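(* If there exist a separable basis $\mathcal{I}\in\mathfrak{G}(\mathbf{L})$ and indices $g\in\mathcal{I}$, $\kappa_1,\kappa_2\in\mathcal{I}^{\mathtt{C}}$ with $\kappa_1\neq\kappa_2$ such that $h(\mathcal{I}^g_{\kappa_1})\cdot h(\mathcal{I}^g_{\kappa_2})\neq0$, then every basis in $\mathfrak{G}(\mathbf{L})$ is separable. In particular, every basis in $\mathfrak{G}(\mathbf{L})$ is separable whenever there exists a basis in $\mathfrak{G}(\mathbf{L})$ that exhibits a non-planar key.
   Context: Notation. $k\le n$ are positive integers, $[n]=\{1,\dots,n\}$, $\wp_k[n]$ is the set of $k$-element subsets of $[n]$, $d\in\mathbb{N}$, $\mathbf{t}=(t_1,\dots,t_d)$, $\mathbf{t}^{\mathbf{e}}=\prod_u t_u^{e_u}$ for $\mathbf{e}\in\mathbb{Z}^d$, $\mathbf{1}=(1,\dots,1)$. $\mathbb{F}$ is the field of ratios of elements of $\mathbb{C}[\mathbf{t},\mathbf{t}^{-1}]=\mathbb{C}[t_1^{\pm1},\dots,t_d^{\pm1}]$. For a $k\times n$ (resp. $n\times k$) matrix $\mathbf{M}$, $\Delta_{\mathbf{M}}(\mathcal{I})$ is the maximal minor on the columns (resp. rows) indexed by $\mathcal{I}\in\wp_k[n]$ in increasing order, and $\mathfrak{G}(\mathbf{M})=\{\mathcal{I}\in\wp_k[n]:\Delta_{\mathbf{M}}(\mathcal{I})\ne0\}$. $\mathcal{I}^{\mathtt{C}}=[n]\setminus\mathcal{I}$, and $\mathcal{I}^{i_1i_2\dots}_{\alpha_1\alpha_2\dots}=(\mathcal{I}\setminus\{i_1,i_2,\dots\})\cup\{\alpha_1,\alpha_2,\dots\}$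 for $i_1,i_2,\dots\in\mathcal{I}$, $\alpha_1,\alpha_2,\dots\in\mathcal{I}^{\mathtt{C}}$. Setting. $\mathbf{L}(\mathbf{t})$ ($k\times n$) and $\mathbf{R}(\mathbf{t})$ ($n\times k$) have entries in a common field of complex functions of $\mathbf{t}$ containing $\mathbb{F}$, with values at $\mathbf{t}=\mathbf{1}$ defined; (non-)vanishing and equalities are as functions of $\mathbf{t}$. Put $h(\mathcal{I}):=\Delta_{\mathbf{L}(\mathbf{t})}(\mathcal{I})\Delta_{\mathbf{R}(\mathbf{t})}(\mathcal{I})$ and $\mathfrak{G}(\mathbf{L}):=\mathfrak{G}(\mathbf{L}(\mathbf{1}))$, whose elements are called bases. Standing assumptions: $\Delta_{\mathbf{L}(\mathbf{t})}(\mathcal{I})$ vanishes identically for $\mathcal{I}\notin\mathfrak{G}(\mathbf{L})$; for each basis $\mathcal{I}$, $h(\mathcal{I})=g_{\mathcal{I}}\mathbf{t}^{\Psi(\mathcal{I})}$ with $g_{\mathcal{I}}\in\mathbb{C}\setminus\{0\}$, $\Psi(\mathcal{I})\in\mathbb{Z}^d$; every element of $[n]$ belongs to at least one basis and none belongs to every basis; for all $\mathcal{I}\in\wp_k[n]$, $\Delta_{\mathbf{R}(\mathbf{t})}(\mathcal{I})\ne0$ at $\mathbf{t}=\mathbf{1}$ and for generic $\mathbf{t}$; $\max\{n-k,k\}\ge5$. Observable sets, keys, separability. For distinct $i,j\in\mathcal{I}$ and distinct $\alpha,\beta\in\mathcal{I}^{\mathtt{C}}$, let $\chi(\mathcal{I}|^{ij}_{\alpha\beta})=\{h(\mathcal{I})h(\mathcal{I}^{ij}_{\alpha\beta}),\,h(\mathcal{I}^i_\alpha)h(\mathcal{I}^j_\beta),\,h(\mathcal{I}^i_\beta)h(\mathcal{I}^j_\alpha)\}$.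 It is observable if it is $\ne\{0\}$; an observable set is separable if all its non-zero elements (monomials $c\,\mathbf{t}^{\mathbf{e}}$) have the same exponent $\mathbf{e}$; a basis $\mathcal{I}$ is separable if all observable sets $\chi(\mathcal{I}|^{ij}_{\alpha\beta})$ are separable. $\mathfrak{c}=\{i,j\}\times\{\alpha,\beta\}$ is a key in $\mathcal{I}$ if $0\notin\chi(\mathcal{I}|^{ij}_{\alpha\beta})$. Let $\mathfrak{c}_r=\{i,j\}$, $\mathfrak{c}_c=\{\alpha,\beta\}$, $\mathcal{N}_{\mathfrak{c}_r}=\{\gamma\in\mathcal{I}^{\mathtt{C}}:h(\mathcal{I}^{s}_\gamma)=0\ \forall s\in\mathfrak{c}_r\}$, $\mathcal{N}^{\mathfrak{c}_c}=\{m\in\mathcal{I}:h(\mathcal{I}^m_\sigma)=0\ \forall\sigma\in\mathfrak{c}_c\}$. The key is planar if both $\mathcal{N}^{\mathfrak{c}_c}=\mathcal{I}\setminus\mathfrak{c}_r$ and $\mathcal{N}_{\mathfrak{c}_r}=\mathcal{I}^{\mathtt{C}}\setminus\mathfrak{c}_c$; otherwise it is non-planar. *)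

(* Defs.v *)
From mathcomp Require Export all_boot all_order all_algebra fraction.
From mathcomp Require Export reals.
From mathcomp.real_closed Require Export complex.
From mathcomp Require Export mpoly.

Set Implicit Arguments.
Unset Strict Implicit.
Unset Printing Implicit Defensive.

Import GRing.Theory.
Local Open Scope ring_scope.

Notation point R d := ('I_d -> complex R).

(* A field of complex functions of t = (t_1, ..., t_d) containing C(t).  Such
   functions are only partially defined on C^d (rational functions have poles,
   algebraic functions have branch cuts), so each element f comes with a set of
   points [ff_def f] where its value [ff_val f] makes sense ([ff_val] is
   junk elsewhere).  The field operations are the pointwise ones wherever these
   make sense, and [ff_ext] makes equality in the field (in particular
   vanishing) equality as functions of t.  The fraction field of
   C[t_1, ..., t_d] is also that of the Laurent polynomials. *)
Record function_field (R : realType) (d : nat) := FunctionField {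
  ff_sort :> fieldType;
  ff_def : ff_sort -> point R d -> Prop;
  ff_val : ff_sort -> point R d -> complex R;
  ff_rat : {rmorphism {fraction {mpoly (complex R)[d]}} -> ff_sort};
  ff_poly : forall (p : {mpoly (complex R)[d]}) (x : point R d),
    ff_def (ff_rat (tofrac p)) x /\ ff_val (ff_rat (tofrac p)) x = p.@[x];
  ff_add : forall (f g : ff_sort) (x : point R d), ff_def f x -> ff_def g x ->
    ff_def (f + g) x /\ ff_val (f + g) x = ff_val f x + ff_val g x;
  ff_mul : forall (f g : ff_sort) (x : point R d), ff_def f x -> ff_def g x ->
    ff_def (f * g) x /\ ff_val (f * g) x = ff_val f x * ff_val g x;
  ff_inv : forall (f : ff_sort) (x : point R d), ff_def f x ->
    ff_val f x != 0 -> ff_def f^-1 x /\ ff_val f^-1 x = (ff_val f x)^-1;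
  ff_ext : forall f g : ff_sort,
    (forall x : point R d, ff_def f x -> ff_def g x ->
       ff_val f x = ff_val g x) ->
    f = g
}.

Definition point1 (R : realType) (d : nat) : point R d := fun=> 1.
Arguments point1 {R d}.

Definition at1 (R : realType) (d : nat) (K : function_field R d) (p q : nat)
    (M : 'M[K]_(p, q)) : 'M[complex R]_(p, q) :=
  map_mx (fun f : K => ff_val f point1) M.

Definition defined_at1 (R : realType) (d : nat) (K : function_field R d)
    (p q : nat) (M : 'M[K]_(p, q)) : Prop :=
  forall i j, ff_def (M i j) point1.

Definition ff_const (R : realType) (d : nat) (K : function_field R d)
    (c : complex R) : K := ff_rat K (tofrac c%:MP).

(* t^e for e in Z^d *)
Definition ff_monom (R : realType) (d : nat) (K : function_field R d)
    (e : 'rV[int]_d) : K :=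
  \prod_(u < d) ff_rat K (tofrac 'X_u) ^ e ord0 u.

(* [enum_val] lists I in increasing order.  The minors get the junk value 0
   on the sets I with #|I| != k. *)
Definition col_minor (F : fieldType) (k n : nat) (M : 'M[F]_(k, n))
    (I : {set 'I_n}) : F :=
  if #|I| =P k is ReflectT e
  then \det (colsub (fun j : 'I_k => enum_val (cast_ord (esym e) j)) M) else 0.

Definition row_minor (F : fieldType) (k n : nat) (M : 'M[F]_(n, k))
    (I : {set 'I_n}) : F :=
  if #|I| =P k is ReflectT e
  then \det (rowsub (fun i : 'I_k => enum_val (cast_ord (esym e) i)) M) else 0.

Definition bases (R : realType) (d : nat) (K : function_field R d) (k n : nat)
    (L : 'M[K]_(k, n)) : {set {set 'I_n}} :=
  [set I : {set 'I_n} | (#|I| == k) && (col_minor (at1 L) I != 0)].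

Definition hfun (F : fieldType) (k n : nat) (L : 'M[F]_(k, n))
    (Rm : 'M[F]_(n, k)) (I : {set 'I_n}) : F :=
  col_minor L I * row_minor Rm I.

Definition exch (T : finType) (I A B : {set T}) : {set T} := (I :\: A) :|: B.

Definition exch1 (T : finType) (I : {set T}) (i a : T) : {set T} :=
  exch I [set i] [set a].

Definition exch2 (T : finType) (I : {set T}) (i j a b : T) : {set T} :=
  exch I [set i; j] [set a; b].

(* chi(I|^{ij}_{ab}), a set of values given by an enumeration *)
Definition chi (F : fieldType) (n : nat) (h : {set 'I_n} -> F)
    (I : {set 'I_n}) (i j a b : 'I_n) : seq F :=
  [:: h I * h (exch2 I i j a b);
      h (exch1 I i a) * h (exch1 I j b);
      h (exch1 I i b) * h (exch1 I j a)].

Definition observable (F : fieldType) (X : seq F) : Prop := ~ (X =i [:: 0]).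

Definition separable_set (R : realType) (d : nat) (K : function_field R d)
    (X : seq K) : Prop :=
  exists e : 'rV[int]_d, forall x : K, x \in X -> x != 0 ->
    exists c : complex R, x = ff_const K c * ff_monom K e.

Definition quad (n : nat) (I : {set 'I_n}) (i j a b : 'I_n) : Prop :=
  [/\ i \in I, j \in I & i != j] /\ [/\ a \in ~: I, b \in ~: I & a != b].

Definition separable_basis (R : realType) (d : nat) (K : function_field R d)
    (n : nat) (h : {set 'I_n} -> K) (I : {set 'I_n}) : Prop :=
  forall i j a b : 'I_n, quad I i j a b ->
    observable (chi h I i j a b) -> separable_set (chi h I i j a b).

Definition key (F : fieldType) (n : nat) (h : {set 'I_n} -> F)
    (I : {set 'I_n}) (i j a b : 'I_n) : Prop :=
  quad I i j a b /\ 0 \notin chi h I i j a b.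

Definition Nrow (F : fieldType) (n : nat) (h : {set 'I_n} -> F)
    (I cr : {set 'I_n}) : {set 'I_n} :=
  [set c in ~: I | [forall s in cr, h (exch1 I s c) == 0]].

Definition Ncol (F : fieldType) (n : nat) (h : {set 'I_n} -> F)
    (I cc : {set 'I_n}) : {set 'I_n} :=
  [set m in I | [forall s in cc, h (exch1 I m s) == 0]].

Definition planar (F : fieldType) (n : nat) (h : {set 'I_n} -> F)
    (I : {set 'I_n}) (i j a b : 'I_n) : Prop :=
  Ncol h I [set a; b] = I :\: [set i; j] /\
  Nrow h I [set i; j] = ~: I :\: [set a; b].

(* Main.v *)
Require Import Defs.
From HB Require Import structures.
From mathcomp Require Import ring zify.
From mathcomp Require Import boolp.

Set Implicit Arguments.
Unset Strict Implicit.
Unset Printing Implicit Defensive.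

Import Order.TTheory GRing.Theory Num.Theory.
Local Open Scope ring_scope.

(** Fix a basis J and write L and R in the coordinates in which their submatrices on J are the
    identity. The other entries form two matrices A and B, with rows indexed by J and columns by
    its complement, and the value of h at the set obtained from J by exchanging s elements is h(J)
    times a minor of order s of A times the corresponding minor of B ([hfun_exch]). Hence the
    minors of B do not vanish, and the product of corresponding minors of A and B is zero or a
    monomial c t^e ([system]). An observable set at J is separable exactly when the cross ratio Y
    = B_ia B_jb / (B_ib B_ja) is constant ([aligned_xratio], [xratio_aligned]). If all these cross
    ratios are constant, then R is a constant matrix up to a rescaling of its rows and a change of
    basis of K^k ([factored]). This no longer refers to J, so that every basis is separable.

    First claim. Separability of J makes Y constant whenever A_ia and A_jb are non-zero. A row of
    A with two non-zero entries ties all the columns together ([fork_cst]). Only one configuration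
    of three rows and four columns is not immediate: two entries u, v of B remain unknown there,
    with u v constant and two affine functions of u, v equal to monomials. This confines the
    monomials to a conic, and comparing degrees makes u and v constant ([conic_cst]).

    Second claim. For a key, Y and the analogous ratio Y' of entries of A have the property that Y
    Y' and (1 - Y)(1 - Y') are monomials. If such a Y lies in C(t), it is constant: its
    discriminant is the form a^2 + b^2 + c^2 - 2ab - 2ac - 2bc in three monomials, and this form
    is a square only if the three exponents agree ([heron_square], [rational_cst]). If Y is not
    constant, this excludes zeros and proportional columns in the two rows of the key, or, after
    transposition, in its two columns. The two coordinate points and five columns (or rows) then
    form seven points on each of two projective lines such that the products of corresponding
    brackets are monomials. Such a configuration has constant cross ratios ([seven_points]), hence
    every key is constant ([key_const]). The heart of that statement is that among five pairs
    (x_c, x_c') for which x_c x_c' and (x_c - x_d)(x_c' - x_d') are always monomials two indices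
    c, d exist for which these monomials all have the same exponent ([five_points]). After a
    specialisation to one variable this follows from an analysis of the multiple roots of the ten
    discriminants, the products of any two of which are squares ([common_shape],
    [five_points_poly]).

    A non-planar key has a further non-zero entry of A in its rows or columns. From it constancy
    spreads, one row at a time, to the cross ratios of all pairs of non-zero entries of A
    ([spread_normalised], [spread]), and the argument of the first claim concludes, since a row of
    the key has two non-zero entries.

    The tool for all relations between monomials is the grading by the degree in one of the
    variables: a vanishing sum vanishes degree by degree ([gradeL]). *)

(** * Monomials and constants *)

(** The structure on which the argument rests: a field into which the polynomials embed, so that
    the monomials t^e with e in Z^d make sense. *)
Record laurent_field (C : numClosedFieldType) (d : nat) := LaurentField {
  lf_sort :> fieldType;
  embed : {rmorphism {mpoly C[d]} -> lf_sort};
  embed_inj : injective embed }.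

Section Monomials.
Variables (C : numClosedFieldType) (d : nat) (K : laurent_field C d).
Implicit Types (x y : K) (e : 'rV[int]_d).
Local Notation embed := (embed K).

Lemma embed_eq0 p : (embed p == 0) = (p == 0).
Proof. by rewrite -(inj_eq (@embed_inj _ _ K)) rmorph0. Qed.

Definition cf : C -> K := fun c => embed c%:MP.
Lemma cf_is_zmod : zmod_morphism cf.
Proof. by move=> a b; rewrite /cf -rmorphB mpolyCB. Qed.
Lemma cf_is_monoid : monoid_morphism cf.
Proof. by split=> [|a b]; rewrite /cf ?mpolyC1 ?rmorph1 // mpolyCM rmorphM. Qed.
HB.instance Definition _ := GRing.isZmodMorphism.Build C K cf cf_is_zmod.
HB.instance Definition _ := GRing.isMonoidMorphism.Build C K cf cf_is_monoid.

Definition monom e : K := \prod_(u < d) embed 'X_u ^ e ord0 u.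

Lemma var_neq0 (u : 'I_d) : embed 'X_u != 0.
Proof. by rewrite embed_eq0 -msupp_eq0 msuppX. Qed.

Lemma monomD e e' : monom (e + e') = monom e * monom e'.
Proof.
rewrite /monom -big_split /=; apply: eq_bigr => u _.
by rewrite mxE expfzDr // var_neq0.
Qed.
Lemma monom0 : monom 0 = 1.
Proof. by rewrite /monom big1 // => u _; rewrite mxE expr0z. Qed.
Lemma monom_neq0 e : monom e != 0.
Proof. by apply/prodf_neq0 => u _; rewrite expfz_neq0 // var_neq0. Qed.
Lemma monomN e : monom (- e) = (monom e)^-1.
Proof.
apply: (@mulIf _ (monom e)); first exact: monom_neq0.
by rewrite -monomD addNr monom0 mulVf // monom_neq0.
Qed.

Definition multi e : 'X_{1..d} := [multinom `|e ord0 u|%N | u < d].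

Lemma monom_multi e : (forall u, 0 <= e ord0 u) -> monom e = embed 'X_[multi e].
Proof.
move=> e0; rewrite /monom mpolyXE_id rmorph_prod; apply: eq_bigr => u _.
by rewrite rmorphXn /= mnmE exprnP gez0_abs.
Qed.

Definition mn c e : K := cf c * monom e.

(** Multiplication by t^E turns finitely many Laurent monomials into polynomials. *)
Lemma shift_exps (s : seq 'rV[int]_d) :
  exists E : 'rV[int]_d, forall e, e \in s -> forall u, 0 <= (e + E) ord0 u.
Proof.
elim: s => [|e s [E HE]]; first by exists 0.
exists (\row_u (`|E ord0 u| + `|e ord0 u|)) => e'.
rewrite inE => /orP[/eqP-> u|/HE He u]; rewrite !mxE; first (set a := e _ _; set b := E _ _; lia).
by move: (He u); rewrite mxE; move: (e' _ _) (E _ _) (e _ _) => a b c; lia.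
Qed.

Lemma multi_inj e e' : (forall u, 0 <= e ord0 u) -> (forall u, 0 <= e' ord0 u) ->
  multi e = multi e' -> e = e'.
Proof.
move=> h h' H; apply/rowP => u.
have := congr1 (fun m : 'X_{1..d} => m u) H; rewrite !mnmE.
by move: (h u) (h' u); rewrite !ord1; move: (e _ _) (e' _ _) => a b; lia.
Qed.

(** Linear independence of monomials with distinct exponents. Exponents may repeat in [s], whence
    the formulation with the part of the sum selected by a condition on the exponents. *)
Lemma mn_free (s : seq (C * 'rV[int]_d)) : \sum_(p <- s) mn p.1 p.2 = 0 ->
  forall P : pred 'rV[int]_d, \sum_(p <- s | P p.2) mn p.1 p.2 = 0.
Proof.
move=> s0 P.
have [E HE] := shift_exps [seq p.2 | p <- s].
pose m (p : C * 'rV[int]_d) := multi (p.2 + E).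
have key (Q : pred 'rV[int]_d) : (\sum_(p <- s | Q p.2) mn p.1 p.2) * monom E
    = embed (\sum_(p <- s | Q p.2) p.1%:MP * 'X_[m p]).
  rewrite mulr_suml rmorph_sum /= big_seq_cond [RHS]big_seq_cond.
  apply: eq_bigr => p /andP[ps _].
  rewrite rmorphM /= /mn -mulrA -monomD monom_multi // => u.
  by apply: HE; apply/mapP; exists p.
have H : \sum_(p <- s) p.1%:MP_[d] * 'X_[m p] = 0.
  by apply/eqP; rewrite -embed_eq0 -(key predT) s0 mul0r.
apply: (mulIf (monom_neq0 E)); rewrite mul0r key.
apply/eqP; rewrite embed_eq0; apply/eqP/mpolyP => m0; rewrite mcoeff0.
have := congr1 (fun q : {mpoly C[d]} => q@_m0) H.
rewrite mcoeff0 !raddf_sum /= => Hm.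
have [/hasP[p0 p0s /andP[/eqP Em Pp0]]|/hasPn no] := boolP (has (fun p => (m p == m0) && P p.2) s).
  rewrite -[RHS]Hm [RHS](bigID (fun p => P p.2)) /= [X in _ = _ + X]big1_seq ?addr0 //.
  move=> p /andP[nP ps]; rewrite mcoeffCM mcoeffX; case: eqP => [e1|]; last by rewrite mulr0.
  move: nP; rewrite -(addrK E p.2); rewrite (@multi_inj (p.2 + E) (p0.2 + E)) ?addrK ?Pp0 //.
  - by move=> u; apply: HE; apply/mapP; exists p.
  - by move=> u; apply: HE; apply/mapP; exists p0.
  - by rewrite -/(m p) e1 -Em.
rewrite big1_seq // => p /andP[Pp ps]; rewrite mcoeffCM mcoeffX.
by have := no p ps; rewrite Pp andbT => /negbTE ->; rewrite mulr0.
Qed.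

Definition cst x := exists c, x = cf c.
Definition mono x := exists c e, c != 0 /\ x = mn c e.

(** Homogeneity of degree z in the variable t_u for Laurent polynomials; 0 has every degree. *)
Definition hom (u : 'I_d) (z : int) x := exists s : seq (C * 'rV[int]_d),
  all (fun p : C * 'rV[int]_d => p.2 ord0 u == z) s /\ x = \sum_(p <- s) mn p.1 p.2.

Lemma mnM c e c' e' : mn c e * mn c' e' = mn (c * c') (e + e').
Proof. by rewrite /mn rmorphM monomD; ring. Qed.

Lemma hom_mn u c e : hom u (e ord0 u) (mn c e).
Proof. by exists [:: (c, e)]; rewrite big_seq1 /= eqxx. Qed.
Lemma homM u z z' x y : hom u z x -> hom u z' y -> hom u (z + z') (x * y).
Proof.
move=> [s [hs ->]] [s' [hs' ->]].
exists [seq (p.1 * q.1, p.2 + q.2) | p <- s, q <- s']; split.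
  apply/allP => _ /allpairsP[[p q] [/= ps qs ->]] /=.
  by rewrite mxE (eqP (allP hs _ ps)) (eqP (allP hs' _ qs)).
rewrite big_allpairs_dep mulr_suml; apply: eq_bigr => p _.
by rewrite mulr_sumr; apply: eq_bigr => q _; rewrite mnM.
Qed.
Lemma cst_hom u x : cst x -> hom u 0 x.
Proof.
move=> [c ->]; exists [:: (c, 0)]; rewrite big_seq1 /= mxE eqxx.
by rewrite /mn monom0 mulr1.
Qed.
Lemma cst0 : cst 0. Proof. by exists 0; rewrite rmorph0. Qed.
Lemma cst1 : cst 1. Proof. by exists 1; rewrite rmorph1. Qed.
Lemma cstD x y : cst x -> cst y -> cst (x + y).
Proof. by move=> [c ->] [c' ->]; exists (c + c'); rewrite rmorphD. Qed.
Lemma cstN x : cst x -> cst (- x).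
Proof. by move=> [c ->]; exists (- c); rewrite rmorphN. Qed.
Lemma cstB x y : cst x -> cst y -> cst (x - y).
Proof. by move=> hx hy; apply: cstD => //; apply: cstN. Qed.
Lemma cstM x y : cst x -> cst y -> cst (x * y).
Proof. by move=> [c ->] [c' ->]; exists (c * c'); rewrite rmorphM. Qed.
Lemma cstV x : cst x -> cst x^-1.
Proof. by move=> [c ->]; exists c^-1; rewrite fmorphV. Qed.
Lemma cst_div x y : cst x -> cst y -> cst (x / y).
Proof. by move=> hx hy; apply: cstM => //; apply: cstV. Qed.
Lemma cstX x n : cst x -> cst (x ^+ n).
Proof. by move=> hx; elim: n => [|n IH]; [exact: cst1|rewrite exprS; apply: cstM]. Qed.
Lemma homN u z x : hom u z x -> hom u z (- x).
Proof.
move=> h; rewrite -mulN1r -[z]add0r; apply: homM => //.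
by apply: cst_hom; apply: cstN; exact: cst1.
Qed.
Lemma homCl u z c x : cst c -> hom u z x -> hom u z (c * x).
Proof. by move=> hc hx; rewrite -[z]add0r; apply: homM => //; apply: cst_hom. Qed.

(** A relation splits into the relations between its terms of equal degree, by [mn_free]. *)
Lemma grade u (s : seq (int * K)) : (forall p, p \in s -> hom u p.1 p.2) ->
  \sum_(p <- s) p.2 = 0 -> forall z, \sum_(p <- s) (if p.1 == z then p.2 else 0) = 0.
Proof.
move=> hs s0 z.
have [t [ht Et]] : exists t : seq (C * 'rV[int]_d), \sum_(p <- s) p.2 = \sum_(q <- t) mn q.1 q.2 /\
   \sum_(p <- s) (if p.1 == z then p.2 else 0) = \sum_(q <- t | q.2 ord0 u == z) mn q.1 q.2.
  elim: s {s0} hs => [|p s IH] hs; first by exists [::]; rewrite !big_nil.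
  have [q qs|t [e1 e2]] := IH; first by apply: hs; rewrite inE qs orbT.
  have [t' [h' e']] : hom u p.1 p.2 by apply: hs; rewrite inE eqxx.
  exists (t' ++ t); rewrite !big_cons !big_cat /= -e1 -e2 e'; split=> //; congr (_ + _).
  case: eqP => [<-|/eqP ne]; rewrite [in RHS]big_seq_cond.
    rewrite [LHS]big_seq; apply: eq_bigl => q; case: (boolP (q \in t')) => //= qt.
    by rewrite (eqP (allP h' _ qt)) eqxx.
  rewrite big1 // => q /andP[qt /eqP Eq]; move: ne.
  by rewrite -Eq (eqP (allP h' _ qt)) eqxx.
rewrite Et; exact: (mn_free (etrans (esym ht) s0) (fun e : 'rV[int]_d => e ord0 u == z)).
Qed.

End Monomials.

Section MonoTheory.
Variables (C : numClosedFieldType) (d : nat) (K : laurent_field C d).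
Implicit Types (x y : K) (e : 'rV[int]_d).

Lemma mono_neq0 x : mono x -> x != 0.
Proof. by move=> [c [e [c0 ->]]]; rewrite /mn mulf_neq0 ?fmorph_eq0 ?monom_neq0. Qed.
Lemma monoM x y : mono x -> mono y -> mono (x * y).
Proof.
move=> [c [e [c0 ->]]] [c' [e' [c0' ->]]]; exists (c * c'), (e + e').
by rewrite mulf_neq0 // mnM.
Qed.
Lemma cst_mono x : cst x -> x != 0 -> mono x.
Proof.
move=> [c ->]; rewrite fmorph_eq0 => c0; exists c, 0; split=> //.
by rewrite /mn monom0 mulr1.
Qed.
Lemma mnV c e : (mn K c e)^-1 = mn K c^-1 (- e).
Proof. by rewrite /mn invfM fmorphV monomN mulrC. Qed.
Lemma monoV x : mono x -> mono x^-1.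
Proof. by move=> [c [e [c0 ->]]]; exists c^-1, (- e); rewrite invr_eq0 c0 mnV. Qed.
Lemma mono_div x y : mono x -> mono y -> mono (x / y).
Proof. by move=> hx hy; apply: monoM => //; apply: monoV. Qed.
Lemma monoN x : mono x -> mono (- x).
Proof.
move=> hx; rewrite -mulN1r; apply: monoM => //; apply: cst_mono.
  by apply: cstN; exact: cst1.
by rewrite oppr_eq0 oner_eq0.
Qed.
Lemma mono_hom u x : mono x -> exists z, hom u z x.
Proof. by move=> [c [e [_ ->]]]; exists (e ord0 u); exact: hom_mn. Qed.

Fixpoint homs (u : 'I_d) (s : seq (int * K)) : Prop :=
  if s is p :: s' then hom u p.1 p.2 /\ homs u s' else True.

(** The form of [grade] for explicit relations: the terms come as a list of pairs of a degree and
    a value, and both sums unfold by computation. *)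
Lemma gradeL u s z : homs u s -> foldr (fun p a => p.2 + a) 0 s = 0 ->
  foldr (fun p a => if p.1 == z then p.2 + a else a) 0 s = 0.
Proof.
move=> hs s0.
have H (p : int * K) : p \in s -> hom u p.1 p.2.
  elim: s hs {s0} => //= q s IH [hq hs]; rewrite inE => /orP[/eqP->//|]; exact: IH.
have E : \sum_(p <- s) p.2 = 0.
  rewrite -[RHS]s0; elim: (s) => [|q t IH]; by rewrite ?big_nil // big_cons IH.
rewrite -[RHS](grade H E z); elim: (s) => [|q t IH]; rewrite ?big_nil // big_cons /= -IH.
by case: ifP => // _; rewrite add0r.
Qed.

Lemma hom_uniq u z z' x : x != 0 -> hom u z x -> hom u z' x -> z = z'.
Proof.
move=> x0 h h'; apply/eqP; apply: contraT => ne.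
have := @gradeL u [:: (z, x); (z', - x)] z.
rewrite /= eqxx eq_sym (negbTE ne) !addr0 subrr => H; case/eqP: x0; apply: H => //.
by split=> //; split=> //; apply: homN.
Qed.

Lemma hom_cast u z z' x : hom u z x -> z = z' -> hom u z' x.
Proof. by move=> h <-. Qed.

Lemma homV u z x : mono x -> hom u z x -> hom u (- z) x^-1.
Proof.
move=> [c [e [c0 ->]]] h.
have <- : e ord0 u = z.
  by apply: hom_uniq (hom_mn K u c e) h; apply: mono_neq0; exists c, e.
by rewrite mnV; apply: hom_cast (hom_mn _ _ _ _) _; rewrite mxE.
Qed.

Lemma cst_homP x : mono x -> (forall u, hom u 0 x) -> cst x.
Proof.
move=> [c [e [c0 ->]]] h; exists c.
suff -> : e = 0 by rewrite /mn monom0 mulr1.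
apply/rowP => u; rewrite mxE; apply: hom_uniq (hom_mn K u c e) (h u).
by apply: mono_neq0; exists c, e.
Qed.

(** C is algebraically closed, so every element of K that is algebraic over C lies in C. *)
Lemma cst_alg x (p : {poly C}) : p != 0 -> root (map_poly (cf K) p) x -> cst x.
Proof.
move=> p0; have [s ->] := closed_field_poly_normal p.
rewrite map_polyZ /= rootZ ?fmorph_eq0 ?lead_coef_eq0 // rmorph_prod /=.
rewrite /root horner_prod prodf_seq_eq0 => /hasP[z _].
by rewrite rmorphB /= map_polyX map_polyC !hornerE /= subr_eq0 => /eqP ->; exists z.
Qed.

Lemma cst_quad x a b c : cst a -> cst b -> cst c ->
  a * x ^+ 2 + b * x + c = 0 -> a != 0 \/ b != 0 \/ c != 0 -> cst x.
Proof.
move=> [a' ->] [b' ->] [c' ->] E H.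
pose p : {poly C} := a' *: 'X^2 + b' *: 'X + c'%:P.
apply: (@cst_alg _ p).
  apply/eqP => p0; case: H => [|[]]; rewrite fmorph_eq0 => /eqP; apply.
  - have := congr1 (fun q : {poly C} => q`_2) p0.
    by rewrite !coefD !coefZ coefXn coefX coefC coef0 /= !mulr0 !addr0 mulr1.
  - have := congr1 (fun q : {poly C} => q`_1) p0.
    by rewrite !coefD !coefZ coefXn coefX coefC coef0 /= mulr0 add0r addr0 mulr1.
  - have := congr1 (fun q : {poly C} => q`_0) p0.
    by rewrite !coefD !coefZ coefXn coefX coefC coef0 /= !mulr0 !add0r.
rewrite /root /p !rmorphD /= !map_polyZ /= map_polyXn map_polyX map_polyC !hornerE /=.
by apply/eqP; rewrite -[RHS]E; ring.
Qed.

(** The degree in t_u of a monomial; the value 0 on elements without a degree is a default. *)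
Definition wt u x : int :=
  if pselect (exists z, hom u z x) is left e then projT1 (cid e) else 0.

Lemma hom_wt u x : mono x -> hom u (wt u x) x.
Proof.
move=> mx; rewrite /wt; case: pselect => [e|[]]; last exact: mono_hom.
exact: (projT2 (cid e)).
Qed.
Lemma wtE u z x : mono x -> hom u z x -> wt u x = z.
Proof. by move=> mx; apply: hom_uniq (mono_neq0 mx) (hom_wt u mx). Qed.
Lemma wtM u x y : mono x -> mono y -> wt u (x * y) = wt u x + wt u y.
Proof. by move=> mx my; apply: wtE (monoM mx my) (homM (hom_wt u mx) (hom_wt u my)). Qed.
Lemma wtV u x : mono x -> wt u x^-1 = - wt u x.
Proof. by move=> mx; apply: wtE (monoV mx) (homV mx (hom_wt u mx)). Qed.
Lemma wtC u x : cst x -> x != 0 -> wt u x = 0.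
Proof. by move=> hx x0; apply: wtE (cst_mono hx x0) (cst_hom u hx). Qed.
Lemma wtZ u c x : cst c -> c != 0 -> mono x -> wt u (c * x) = wt u x.
Proof. by move=> hc c0 mx; rewrite (wtM u (cst_mono hc c0) mx) (wtC u hc c0) add0r. Qed.
Lemma cst_wt x : mono x -> (forall u, wt u x = 0) -> cst x.
Proof. by move=> mx h; apply: cst_homP => // u; rewrite -(h u); apply: hom_wt. Qed.

End MonoTheory.

(** * Heron forms of monomials *)

(** The discriminant of a X^2 - (a + b - c) X + b. Its roots x, x' satisfy x x' = b / a and (1 -
    x)(1 - x') = c / a. *)
Definition heron (A : comRingType) (a b c : A) : A :=
  a ^+ 2 + b ^+ 2 + c ^+ 2 - 2 * a * b - 2 * a * c - 2 * b * c.

Section PolyMonomials.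
Variable C : numClosedFieldType.
Implicit Types (p q f h : {poly C}) (a b c : C) (m n k : nat).

Definition xm c n : {poly C} := c%:P * 'X^n.

Lemma xmM a m b n : xm a m * xm b n = xm (a * b) (m + n).
Proof. by rewrite /xm polyCM exprD; ring. Qed.
Lemma xm_eq0 a n : (xm a n == 0) = (a == 0).
Proof. by rewrite /xm mulf_eq0 polyC_eq0 expf_eq0 polyX_eq0 andbF orbF. Qed.
Lemma coef_xm a n k : (xm a n)`_k = if k == n then a else 0.
Proof. by rewrite /xm coefCM coefXn; case: eqP => _; rewrite ?mulr1 ?mulr0. Qed.

Definition is_xm p := exists c n, c != 0 /\ p = xm c n.

Lemma is_xmM p q : is_xm p -> is_xm q -> is_xm (p * q).
Proof.
move=> [c [n [c0 ->]]] [b [m [b0 ->]]]; exists (c * b), (n + m)%N.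
by rewrite mulf_neq0 ?xmM.
Qed.
(** A divisor of a power of X is a power of X up to a constant. *)
Lemma is_xm_factor p q : is_xm (p * q) -> is_xm p.
Proof.
move=> [c [n [c0 E]]].
have : p %| ('X - 0%:P) ^+ n.
  by rewrite subr0 -(@dvdpZr _ c) // -mul_polyC -/(xm c n) -E dvdp_mulr.
case/dvdp_exp_XsubCP => k _; rewrite subr0 => /eqpf_eq [a a0 ->].
by exists a, k; rewrite /xm mul_polyC.
Qed.

Lemma xm_add3 a b c m n k : a != 0 -> b != 0 -> c != 0 ->
  xm a m + xm b n = xm c k -> m = n /\ n = k.
Proof.
move=> a0 b0 c0 E.
have H i := congr1 (fun p : {poly C} => p`_i) E.
have [e|ne] := eqVneq m n.
  split=> //; apply/eqP; apply: contraT => nk; have := H k.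
  by rewrite coefD !coef_xm e eqxx eq_sym (negbTE nk) addr0 => /esym/eqP; rewrite (negbTE c0).
have := H m; have := H n; rewrite !coefD !coef_xm !eqxx (eq_sym n m) (negbTE ne) addr0 add0r.
case: eqP => [<-|_ /eqP]; last by rewrite (negbTE b0).
by rewrite (negbTE ne) => _ /eqP; rewrite (negbTE a0).
Qed.

(** If the form of A, B, G is q^2, then U, V = (A + B - G -+ q)/2 satisfy U V = A B, and (A - U)(U
    - B) = U G. Divisors of monomials being monomials, U, A - U and U - B are monomials, and
    relations between three monomials force equal exponents. The factor f^2 allows q to be
    rational. *)
Lemma heron_square a b c al be ga f h : a != 0 -> b != 0 -> c != 0 -> f != 0 ->
  heron (xm a al) (xm b be) (xm c ga) * f ^+ 2 = h ^+ 2 -> al = be /\ be = ga.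
Proof.
move=> a0 b0 c0 f0 E.
set A := xm a al in E; set B := xm b be in E; set G := xm c ga in E.
have : f ^+ 2 %| h ^+ 2 by rewrite -E dvdp_mull.
rewrite dvdp_pexp2r // => /dvdpP [q Eh].
have f20 : f ^+ 2 != 0 by rewrite expf_neq0.
have Dq : heron A B G = q ^+ 2 by apply: (mulIf f20); rewrite E Eh exprMn.
pose i2 : {poly C} := (2^-1)%:P.
have h2 : i2 * 2 = 1 by rewrite /i2 -polyC_natr -polyCM mulVf ?pnatr_eq0.
have h4 : i2 * i2 * 4 = 1.
  by have -> : i2 * i2 * 4 = (i2 * 2) ^+ 2; [ring|rewrite h2 expr1n].
pose U := i2 * (A + B - G - q); pose V := i2 * (A + B - G + q).
have UV : U * V = A * B.
  rewrite /U /V -[RHS]mul1r -h4; move: Dq; rewrite /heron => Dq.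
  have -> : i2 * (A + B - G - q) * (i2 * (A + B - G + q))
     = i2 * i2 * ((A + B - G) ^+ 2 - q ^+ 2) by ring.
  by rewrite -Dq; ring.
have UpV : U + V = A + B - G.
  by rewrite /U /V -[RHS]mul1r -h2; ring.
have pA : is_xm A by exists a, al.
have pB : is_xm B by exists b, be.
have pG : is_xm G by exists c, ga.
have pU : is_xm U by apply: (@is_xm_factor _ V); rewrite UV; apply: is_xmM.
have E2 : (A - U) * (U - B) = U * G.
  have -> : G = A + B - (U + V) by rewrite UpV; ring.
  have -> : (A - U) * (U - B) = U * (A + B) - U * U - A * B by ring.
  by rewrite -UV; ring.
have pAU : is_xm (A - U) by apply: (@is_xm_factor _ (U - B)); rewrite E2; apply: is_xmM.
have pUB : is_xm (U - B).
  by apply: (@is_xm_factor _ (A - U)); rewrite mulrC E2; apply: is_xmM.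
case: pU pAU pUB => u [nu [u0 EU]] [w [nw [w0 EW]]] [z [nz [z0 EZ]]].
have [] := @xm_add3 w u a nw nu al w0 u0 a0; first by rewrite -EW -EU; rewrite -/A; ring.
have [] := @xm_add3 z b u nz be nu z0 b0 u0; first by rewrite -EZ -EU; rewrite -/B; ring.
move=> e1 e2 e3 e4.
move: E2; rewrite EW EZ EU /G !xmM => /(congr1 (fun p : {poly C} => p`_(nw + nz))).
rewrite !coef_xm eqxx; case: eqP => [|_ /eqP]; last by rewrite mulf_eq0 (negbTE w0) (negbTE z0).
by lia.
Qed.

End PolyMonomials.

Section Specialization.
Variables (C : numClosedFieldType) (d : nat).
Implicit Types (e : 'rV[int]_d) (w : 'I_d -> nat).

Definition dotw (w : 'I_d -> nat) (e : 'rV[int]_d) : int := \sum_u (w u)%:Z * e ord0 u.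

(** The sums of the e_u y^u are the values at y of non-zero polynomials, which have finitely many
    roots. *)
Lemma generic_weight (s : seq 'rV[int]_d) : (forall e, e \in s -> e != 0) ->
  exists w : 'I_d -> nat, forall e, e \in s -> dotw w e != 0.
Proof.
move=> s0.
pose P (e : 'rV[int]_d) : {poly int} := \sum_(u < d) e ord0 u *: 'X^u.
have P0 e : e \in s -> P e != 0.
  move=> /s0; apply: contra_neq => Pe; apply/rowP => u; rewrite mxE.
  have := congr1 (fun p : {poly int} => p`_u) Pe; rewrite coef0 coef_sum (bigD1 u) //=.
  rewrite coefZ coefXn eqxx mulr1 big1 ?addr0 // => v vu.
  by rewrite coefZ coefXn (_ : (u : nat) == v = false) ?mulr0 //; apply/negbTE; rewrite eq_sym.
have : exists y : nat, forall e, e \in s -> ~~ root (P e) (y%:Z).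
  pose Q := \prod_(e <- s) P e.
  have Q0 : Q != 0 by rewrite /Q prodf_seq_neq0; apply/allP => e /P0.
  have [/allP H|/allPn [y ys Hy]] := boolP (all (root Q) [seq Posz y | y <- iota 0 (size Q)]).
    have := max_poly_roots Q0 _ _; move/(_ [seq Posz y | y <- iota 0 (size Q)]).
    rewrite size_map size_iota ltnn => HH; suff: false by [].
    by apply: HH; [exact/allP|rewrite map_inj_uniq ?iota_uniq // => a b []].
  case/mapP: ys => y' _ Ey.
  exists y' => e es; apply: contra Hy => /eqP; rewrite -Ey /root => Pe.
  by rewrite horner_prod prodf_seq_eq0; apply/hasP; exists e; rewrite //= Pe.
move=> [y Hy]; exists (fun u => y ^ u)%N => e /Hy; apply: contraNN => /eqP E.
rewrite /root /P horner_sum; apply/eqP; rewrite -[RHS]E; apply: eq_bigr => u _.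
by rewrite hornerZ hornerXn mulrC -[Posz y]natz -natrX natz.
Qed.

Definition spec (w : 'I_d -> nat) : {mpoly C[d]} -> {poly C} :=
  mmap (@polyC C) (fun u => 'X^(w u)).
HB.instance Definition _ w := GRing.RMorphism.on (spec w).

Lemma specM w p q : spec w (p * q) = spec w p * spec w q.
Proof. exact: rmorphM. Qed.
Lemma specC w c : spec w c%:MP = c%:P.
Proof. by rewrite /spec mmapC. Qed.
Lemma dotw_abs w e : (forall u, 0 <= e ord0 u) ->
  dotw w e = (\sum_u w u * multi e u)%N.
Proof.
move=> e0; rewrite (big_morph Posz PoszD (erefl _)); apply: eq_bigr => u _.
by rewrite mnmE PoszM gez0_abs.
Qed.
Lemma specX w e : (forall u, 0 <= e ord0 u) -> spec w 'X_[multi e] = 'X^(`|dotw w e|).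
Proof.
move=> e0; rewrite /spec mmapX /mmap1 dotw_abs //.
rewrite (eq_bigr (fun i => ('X : {poly C}) ^+ (w i * multi e i))) => [|i _]; last by rewrite exprM.
by rewrite prodrXr.
Qed.
Lemma dotwB w e e' : dotw w (e - e') = dotw w e - dotw w e'.
Proof. by rewrite /dotw -sumrB; apply: eq_bigr => u _; rewrite !mxE mulrBr. Qed.

Definition mexp (m : 'X_{1..d}) : 'rV[int]_d := \row_u (m u : int).
Lemma mexpK m : multi (mexp m) = m.
Proof. by apply/mnmP => u; rewrite mnmE mxE. Qed.

(** A weight that separates the given exponents together with those of f does not let the terms of
    f cancel. *)
Lemma specialization (s : seq 'rV[int]_d) (f : {mpoly C[d]}) : f != 0 ->
  exists w, spec w f != 0 /\ {in s &, injective (dotw w)}.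
Proof.
move=> f0.
pose t := s ++ [seq mexp m | m <- msupp f].
have [e|w Hw] := @generic_weight [seq e <- [seq x - y | x <- t, y <- t] | e != 0].
  by rewrite mem_filter => /andP[].
have inj : {in t &, injective (dotw w)}.
  move=> x y xt yt /eqP; rewrite -subr_eq0 -dotwB => E; apply/eqP; rewrite -subr_eq0.
  apply: contraT => ne; have := Hw (x - y); rewrite mem_filter ne E; apply.
  by apply/allpairsP; exists (x, y).
exists w; split; last by move=> x y xs ys; apply: inj; rewrite mem_cat ?xs ?ys.
have [m0 m0f] : exists m0, m0 \in msupp f.
  by case E : (msupp f) => [|m l]; [move: f0; rewrite -msupp_eq0 E|exists m; rewrite inE eqxx].
apply/eqP => /(congr1 (fun p : {poly C} => p`_(`|dotw w (mexp m0)|))).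
rewrite coef0 {1}(mpolyE f) raddf_sum coef_sum (bigD1_seq m0) //= ?msupp_uniq //.
rewrite big1_seq ?addr0 => [|m /andP[mm0 mf]].
  rewrite -mul_mpolyC specM specC -{2}[m0]mexpK specX => [|u]; last by rewrite mxE.
  by rewrite coefCM coefXn eqxx mulr1 => /eqP; rewrite mcoeff_eq0 m0f.
rewrite -mul_mpolyC specM specC -{2}[m]mexpK specX => [|u]; last by rewrite mxE.
rewrite coefCM coefXn; case: eqP => [E|_]; last by rewrite mulr0.
case/eqP: mm0; rewrite -[m]mexpK -[m0]mexpK; congr multi; apply: inj.
- by rewrite mem_cat map_f ?orbT.
- by rewrite mem_cat map_f ?orbT.
by move: E; rewrite !dotw_abs /= => [->|u|u] //; rewrite mxE.
Qed.

End Specialization.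

(** * Multiple roots of Heron forms *)

Section DoubleRoots.
Variable C : numClosedFieldType.
Implicit Types (p q f h D F : {poly C}) (a b c z u v x y : C) (m n k : nat).

(** The Euler operator: it multiplies a monomial by its degree, and a multiple non-zero root of p
    is a root of [theta p] of multiplicity one less. *)
Definition theta p : {poly C} := 'X * p^`().
Lemma theta_xm a n : theta (xm a n) = n%:R * xm a n.
Proof.
rewrite /theta /xm derivM derivC mul0r add0r derivXn.
case: n => [|n]; first by rewrite mulr0n !mulr0 mul0r.
by rewrite -mulr_natl exprS; ring.
Qed.

Lemma dvd_theta z k p : ('X - z%:P) ^+ k.+1 %| p -> ('X - z%:P) ^+ k %| theta p.
Proof.
case/dvdpP => q ->; rewrite /theta derivM deriv_exp derivXsubC exprS /=.
set t := _ ^+ k.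
rewrite (_ : 'X * _ = 'X * (q^`() * ('X - z%:P) + q * k.+1%:R) * t).
  exact: dvdp_mull.
by rewrite -(mulr_natr (1 * t)); ring.
Qed.

Lemma dvd_root z p k : ('X - z%:P) ^+ k.+1 %| p -> p.[z] = 0.
Proof.
move=> h; apply/eqP; rewrite -[_ == 0]/(root p z) -dvdp_XsubCl.
by apply: dvdp_trans h; rewrite exprS dvdp_mulr.
Qed.

Lemma dvd_double z p : p.[z] = 0 -> (theta p).[z] = 0 -> z != 0 ->
  ('X - z%:P) ^+ 2 %| p.
Proof.
move=> /eqP h h' z0; have : 'X - z%:P %| p by rewrite dvdp_XsubCl.
case/dvdpP => q E; rewrite E expr2 dvdp_mul2r ?polyXsubC_eq0 // dvdp_XsubCl /root.
have /eqP := h'; rewrite /theta E derivM derivXsubC !hornerE subrr mulr0 add0r.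
by rewrite mulf_eq0 (negbTE z0).
Qed.

Lemma thetaD p q : theta (p + q) = theta p + theta q.
Proof. by rewrite /theta derivD mulrDr. Qed.
Lemma thetaN p : theta (- p) = - theta p.
Proof. by rewrite /theta derivN mulrN. Qed.
Lemma thetaM p q : theta (p * q) = theta p * q + p * theta q.
Proof. by rewrite /theta derivM; ring. Qed.
Lemma thetaC n : theta n%:R = 0.
Proof. by rewrite /theta -polyC_natr derivC mulr0. Qed.

Lemma theta_heronE A B G : theta (heron A B G) =
  2 * (theta A * (A - B - G) + theta B * (B - A - G) + theta G * (G - A - B)).
Proof.
have t2 := thetaC 2.
by rewrite /heron !expr2 !(t2, thetaD, thetaN, thetaM); ring.
Qed.

Lemma theta_heron a b c al be ga :
  let A := xm a al in let B := xm b be in let G := xm c ga in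
  theta (heron A B G) = 2 * (al%:R * A * (A - B - G) + be%:R * B * (B - A - G) + ga%:R * G * (G - A - B)).
Proof. by move=> A B G; rewrite theta_heronE !theta_xm. Qed.

Lemma theta2_heron a b c al be ga :
  let A := xm a al in let B := xm b be in let G := xm c ga in
  theta (theta (heron A B G)) = 4 * al%:R ^+ 2 * A ^+ 2 + 4 * be%:R ^+ 2 * B ^+ 2
    + 4 * ga%:R ^+ 2 * G ^+ 2 - 2 * (al%:R + be%:R) ^+ 2 * A * B
    - 2 * (al%:R + ga%:R) ^+ 2 * A * G - 2 * (be%:R + ga%:R) ^+ 2 * B * G.
Proof.
move=> A B G; rewrite theta_heron -/A -/B -/G.
have := theta_xm a al; have := theta_xm b be; have := theta_xm c ga; rewrite -/A -/B -/G.
have := thetaC al; have := thetaC be; have := thetaC ga; have t2 := thetaC 2.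
move: (al%:R) (be%:R) (ga%:R) A B G => ra rb rc A B G e1 e2 e3 e4 e5 e6.
by rewrite !(t2, thetaD, thetaN, thetaM, e1, e2, e3, e4, e5, e6); ring.
Qed.

(** The form is the product of the four sums x +- y +- z of square roots. *)
Lemma heron_sqrt (u v w : C) : heron u v w = 0 ->
  exists x y z, [/\ u = x ^+ 2, v = y ^+ 2, w = z ^+ 2 & x + y + z = 0].
Proof.
move=> H; set x := sqrtC u; set y := sqrtC v; set z := sqrtC w.
have Ex : u = x ^+ 2 by rewrite sqrtCK.
have Ey : v = y ^+ 2 by rewrite sqrtCK.
have Ez : w = z ^+ 2 by rewrite sqrtCK.
have /eqP : (x + y + z) * (x + y - z) * (x - y + z) * (x - y - z) = 0.
  by rewrite -[RHS]H Ex Ey Ez /heron; ring.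
rewrite !mulf_eq0 -!orbA => /or4P[] /eqP E.
- by exists x, y, z.
- by exists x, y, (- z); rewrite sqrrN.
- by exists x, (- y), z; rewrite sqrrN.
- by exists x, (- y), (- z); rewrite !sqrrN.
Qed.

Section OneForm.
Variables (a b c : C) (al be ga : nat).
Hypotheses (a0 : a != 0) (b0 : b != 0) (c0 : c != 0) (ne : ~ (al = be /\ be = ga)).
Let A := xm a al. Let B := xm b be. Let G := xm c ga.
Let D := heron A B G.
Let ra : C := al%:R. Let rb : C := be%:R. Let rc : C := ga%:R.

Lemma xm_root0 d n z : d != 0 -> z != 0 -> (xm d n).[z] != 0.
Proof. by move=> d0 z0; rewrite /xm hornerM hornerC hornerXn mulf_neq0 ?expf_neq0. Qed.

Lemma heron_horner z : D.[z] = heron A.[z] B.[z] G.[z].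
Proof.
have e2 : (2 : {poly C}).[z] = 2 by rewrite -polyC_natr hornerC.
by rewrite /D /heron !(e2, hornerD, hornerN, hornerM, horner_exp).
Qed.

(** The Euler derivative of the form vanishes too, which reads as a linear relation between the
    same square roots, weighted by the exponents. *)
Lemma double_root z : z != 0 -> ('X - z%:P) ^+ 2 %| D ->
  exists x y w, [/\ x * y * w != 0, [/\ A.[z] = x ^+ 2, B.[z] = y ^+ 2 & G.[z] = w ^+ 2],
    x + y + w = 0 & ra * x + rb * y + rc * w = 0].
Proof.
move=> z0 h2.
have h0 := dvd_root h2.
have h1 := dvd_root (dvd_theta h2).
move: h0; rewrite heron_horner => /heron_sqrt [x [y [w [Ex Ey Ew E0]]]].
have := xm_root0 al a0 z0; have := xm_root0 be b0 z0; have := xm_root0 ga c0 z0.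
rewrite -/A -/B -/G Ex Ey Ew !expf_eq0 /= => w0 y0 x0.
exists x, y, w; split=> //; first by rewrite !mulf_neq0.
have en n : (n%:R : {poly C}).[z] = n%:R by rewrite -polyC_natr hornerC.
move: h1 Ex Ey Ew; rewrite theta_heron -/A -/B -/G; move: A B G => A' B' G'.
rewrite !(en, hornerD, hornerN, hornerM) -/ra -/rb -/rc => h1 Ex Ey Ew; rewrite Ex Ey Ew in h1.
have /eqP : 4 * (x * y * w) * (ra * x + rb * y + rc * w) = 0.
  have Ew' : w = - (x + y) by apply/eqP; rewrite -addr_eq0 addrC -E0; apply/eqP; ring.
  by rewrite -[RHS]h1 Ew'; ring.
by rewrite !mulf_eq0 pnatr_eq0 (negbTE x0) (negbTE y0) (negbTE w0) /= => /eqP.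
Qed.

(** If two of the exponents agreed, but not all three, the two linear relations would make one of
    the square roots vanish. *)
Lemma distinct_exps (x y w : C) : x * y * w != 0 -> x + y + w = 0 -> ra * x + rb * y + rc * w = 0 ->
  [/\ ra != rb, rb != rc & ra != rc].
Proof.
rewrite !mulf_eq0 !negb_or => /andP[/andP[x0 y0] w0] E0 E1.
have H1 : (rb - ra) * y + (rc - ra) * w = 0.
  rewrite -[RHS](subrr (0 : C)) -{1}E1 -{1}(mulr0 ra) -{1}E0; ring.
have H2 : (ra - rb) * x + (rc - rb) * w = 0.
  rewrite -[RHS](subrr (0 : C)) -{1}E1 -{1}(mulr0 rb) -{1}E0; ring.
have key : ~ (ra = rb /\ rb = rc).
  by move=> [/eqP e1 /eqP e2]; apply: ne; move: e1 e2; rewrite !eqr_nat => /eqP-> /eqP->.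
split; apply/eqP => E.
- apply: key; split=> //; move/eqP: H1; rewrite -E subrr mul0r add0r mulf_eq0 (negbTE w0) orbF subr_eq0.
  by rewrite E => /eqP.
- apply: key; split=> //; move/eqP: H2; rewrite -E subrr mul0r addr0 mulf_eq0 (negbTE x0) orbF subr_eq0.
  by move=> /eqP.
- apply: key; move/eqP: H1; rewrite -E subrr mul0r addr0 mulf_eq0 (negbTE y0) orbF subr_eq0.
  by move=> /eqP eb; split; rewrite eb ?E.
Qed.

(** A triple root would yield a third relation, weighted by the squares of the exponents; the
    determinant of the three relations is of Vandermonde type. *)
Lemma no_triple_root z : z != 0 -> ~~ (('X - z%:P) ^+ 3 %| D).
Proof.
move=> z0; apply/negP => h3.
have h2 : ('X - z%:P) ^+ 2 %| D by apply: dvdp_trans h3; rewrite exprS dvdp_mull.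
have [x [y [w [n0 [Ex Ey Ew] E0 E1]]]] := double_root z0 h2.
have [ab bc ac] := distinct_exps n0 E0 E1.
have en n : (n%:R : {poly C}).[z] = n%:R by rewrite -polyC_natr hornerC.
have := dvd_root (dvd_theta (dvd_theta h3)); rewrite theta2_heron -/A -/B -/G.
move: Ex Ey Ew; move: A B G => A' B' G'.
rewrite !(en, hornerD, hornerN, hornerM, horner_exp) -/ra -/rb -/rc => -> -> -> h.
have Ew' : w = - (x + y) by apply/eqP; rewrite -addr_eq0 addrC -E0; apply/eqP; ring.
have S : ra ^+ 2 * x + rb ^+ 2 * y + rc ^+ 2 * w = 0.
  have : 2 * (x * y * w) * (ra ^+ 2 * x + rb ^+ 2 * y + rc ^+ 2 * w)
     - (ra * x + rb * y + rc * w) * 2 * ((rb * y + rc * w - ra * x) * y * w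
       + (ra * x + rc * w - rb * y) * x * w + (ra * x + rb * y - rc * w) * x * y) = 0.
    by rewrite -[RHS]h Ew'; ring.
  rewrite E1 !mul0r subr0 => /eqP.
  by rewrite mulf_eq0 mulf_eq0 pnatr_eq0 (negbTE n0) /= => /eqP.
have : (rb - ra) * (rc - ra) * (rc - rb) * w = 0.
  have -> : (rb - ra) * (rc - ra) * (rc - rb) * w = (rb - ra) * (ra ^+ 2 * x + rb ^+ 2 * y + rc ^+ 2 * w
     - (ra + rb) * (ra * x + rb * y + rc * w) + ra * rb * (x + y + w)) by ring.
  by rewrite S E1 E0; ring.
apply/eqP; move: n0; rewrite mulf_eq0 negb_or => /andP[_ w0].
by rewrite !mulf_neq0 // subr_eq0 eq_sym.
Qed.

End OneForm.
End DoubleRoots.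

(** * The shape of the double roots *)

Section Shapes.
Variable C : numClosedFieldType.
Implicit Types (D F : {poly C}) (a b c z u v x y k : C) (m n p q s g : nat).

(** By [double_root], at a multiple root the three monomials with exponents 0, p, p + q are in the
    proportion 1 : rho : sig. The form below has this multiple root at 1. *)
Definition rho p q : C := ((p + q)%:R / q%:R) ^+ 2.
Definition sig p q : C := (p%:R / q%:R) ^+ 2.
Definition Ebase p q : {poly C} := heron 1 (xm (rho p q) p) (xm (sig p q) (p + q)).

Lemma coef_Ebase p q i : (Ebase p q)`_i =
  (i == 0)%:R + rho p q ^+ 2 * (i == (2 * p))%:R + sig p q ^+ 2 * (i == (2 * (p + q)))%:R
  - 2 * rho p q * (i == p)%:R - 2 * sig p q * (i == (p + q))%:R
  - 2 * rho p q * sig p q * (i == (p + (p + q)))%:R.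
Proof.
have E : Ebase p q = xm 1 0 + xm (rho p q ^+ 2) (2 * p) + xm (sig p q ^+ 2) (2 * (p + q))
   - xm (2 * rho p q) p - xm (2 * sig p q) (p + q) - xm (2 * rho p q * sig p q) (p + (p + q)).
  have x2 (x : C) n : xm (2 * x) n = 2 * xm x n.
    by rewrite /xm polyCM -mulrA; congr (_ * _); exact: polyC_natr.
  have x1 : xm (1 : C) 0 = 1 by rewrite /xm expr0 mulr1.
  rewrite /Ebase /heron !expr2 !mul2n -!addnn; move: (rho p q) (sig p q) => r s.
  by rewrite -[2 * r * s]mulrA !x2 -!xmM x1; ring.
have if01 (x : C) (t : bool) : (if t then x else 0) = x * t%:R by case: t; rewrite ?mulr1 ?mulr0.
by rewrite E !(coefD, coefN) !coef_xm !if01 mul1r.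
Qed.

(** The form and its Euler derivative vanish at 1. *)
Lemma Ebase_factor p q : (0 < p)%N -> (0 < q)%N ->
  exists F, Ebase p q = (1 - 'X) ^+ 2 * F.
Proof.
move=> p0 q0.
have q1 : (q%:R : C) != 0 by rewrite pnatr_eq0 -lt0n.
have h1 d n : (xm d n : {poly C}).[1] = d by rewrite /xm hornerM hornerC hornerXn expr1n mulr1.
have en n : (n%:R : {poly C}).[1] = n%:R by rewrite -polyC_natr hornerC.
have x1 : 1 = xm (1 : C) 0 by rewrite /xm expr0 mulr1.
have /dvdpP [F EF] : ('X - 1%:P) ^+ 2 %| Ebase p q.
  apply: dvd_double; rewrite ?oner_eq0 //.
    rewrite /Ebase x1 heron_horner !h1 /heron /rho /sig natrD; field => //.
  rewrite /Ebase x1 theta_heron.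
  rewrite !(en, h1, hornerD, hornerN, hornerM) /rho /sig !natrD; field => //.
exists F; rewrite EF polyC1; ring.
Qed.

Section Coefs.
Variables (p q : nat) (F : {poly C}).
Hypotheses (p0 : (0 < p)%N) (q0 : (0 < q)%N) (EF : Ebase p q = (1 - 'X) ^+ 2 * F).
Let E i := (Ebase p q)`_i.

(** The equation (1 - X)^2 F = E determines the coefficients of F one after the other. The first
    ones reveal whether p is 1 or 2. *)
Lemma EF_coef i : E i.+2 = F`_i.+2 - 2 * F`_i.+1 + F`_i.
Proof.
rewrite /E EF; have -> : (1 - 'X) ^+ 2 * F = F - ('X * F) *+ 2 + 'X * ('X * F) by ring.
by rewrite !(coefD, coefN, coefMn, coefXM) /=; ring.
Qed.
Lemma EF_coef1 : E 1 = F`_1 - 2 * F`_0.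
Proof.
rewrite /E EF; have -> : (1 - 'X) ^+ 2 * F = F - ('X * F) *+ 2 + 'X * ('X * F) by ring.
by rewrite !(coefD, coefN, coefMn, coefXM) /=; ring.
Qed.
Lemma F0E : F`_0 = 1.
Proof.
have : E 0 = F`_0.
  rewrite /E EF; have -> : (1 - 'X) ^+ 2 * F = F - ('X * F) *+ 2 + 'X * ('X * F) by ring.
  by rewrite !(coefD, coefN, coefMn, coefXM) /=; ring.
move <-; rewrite /E coef_Ebase eqxx.
have -> : (0 == 2 * p)%N = false by lia.
have -> : (0 == 2 * (p + q))%N = false by lia.
have -> : (0 == p)%N = false by lia.
have -> : (0 == p + q)%N = false by lia.
have -> : (0 == p + (p + q))%N = false by lia.
by rewrite /=; ring.
Qed.

Lemma F1E : F`_1 = 2 - 2 * rho p q * (p == 1%N)%:R.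
Proof.
have := EF_coef1; rewrite /E F0E coef_Ebase (eq_sym 1%N p).
have -> : (1 == 2 * p)%N = false by lia.
have -> : (1 == 2 * (p + q))%N = false by lia.
have -> : (1 == p + q)%N = false by lia.
have -> : (1 == p + (p + q))%N = false by lia.
rewrite /= => H; rewrite -[LHS](subrK (2 * 1)) -H; ring.
Qed.

Lemma F2E : (3 <= p + q)%N ->
  F`_2 = 3 + (rho p q ^+ 2 - 4 * rho p q) * (p == 1%N)%:R - 2 * rho p q * (p == 2%N)%:R.
Proof.
move=> s3; have := EF_coef 0; rewrite /E F0E F1E coef_Ebase (eq_sym 2%N p).
have -> : (2 == 2 * p)%N = (p == 1)%N by lia.
have -> : (2 == 2 * (p + q))%N = false by lia.
have -> : (2 == p + q)%N = false by lia.
have -> : (2 == p + (p + q))%N = false by lia.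
rewrite /= => H; apply/eqP; rewrite -subr_eq0; apply/eqP.
transitivity (F`_2 - 2 * (2 - 2 * rho p q * (p == 1)%:R) + 1 - (F`_2 - 2 * (2 - 2 * rho p q * (p == 1)%:R) + 1)).
  by rewrite -{2}H; ring.
by rewrite subrr.
Qed.

Lemma F3E : (p + q = 5)%N -> (p <= 2)%N ->
  F`_3 = 4 + (2 * rho p q ^+ 2 - 6 * rho p q) * (p == 1%N)%:R - 4 * rho p q * (p == 2%N)%:R.
Proof.
move=> s5 p2; have := EF_coef 1; rewrite /E F1E F2E ?s5 // coef_Ebase.
have -> : (3 == 2 * p)%N = false by lia.
have -> : (3 == 2 * (p + q))%N = false by lia.
have -> : (3 == p + q)%N = false by lia.
have -> : (3 == p + (p + q))%N = false by lia.
have -> : (3 == p)%N = false by lia.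
rewrite /= => H; rewrite -[LHS](addrK 0); apply/eqP; rewrite -subr_eq0; apply/eqP.
set f1 := 2 - _ in H; set f2 := 3 + _ - _ in H.
have -> : F`_3 = 2 * f2 - f1.
  by apply/eqP; rewrite -subr_eq0; apply/eqP; move: H; rewrite !mulr0 !subr0 !addr0 => H; rewrite [RHS]H; ring.
by rewrite /f1 /f2; ring.
Qed.

Lemma size_Ebase : size (Ebase p q) = (2 * (p + q)).+1.
Proof.
have sn : sig p q != 0 by rewrite expf_neq0 // mulf_neq0 ?invr_eq0 ?pnatr_eq0 -?lt0n.
apply/eqP; rewrite eqn_leq; apply/andP; split.
  apply/leq_sizeP => j hj; rewrite coef_Ebase.
  have -> : (j == 0)%N = false by lia.
  have -> : (j == 2 * p)%N = false by lia.
  have -> : (j == 2 * (p + q))%N = false by lia.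
  have -> : (j == p)%N = false by lia.
  have -> : (j == p + q)%N = false by lia.
  have -> : (j == p + (p + q))%N = false by lia.
  by rewrite /=; ring.
rewrite ltnNge; apply/negP => /leq_sizeP /(_ _ (leqnn _)); rewrite coef_Ebase eqxx.
have -> : (2 * (p + q) == 0)%N = false by lia.
have -> : (2 * (p + q) == 2 * p)%N = false by lia.
have -> : (2 * (p + q) == p)%N = false by lia.
have -> : (2 * (p + q) == p + q)%N = false by lia.
have -> : (2 * (p + q) == p + (p + q))%N = false by lia.
by rewrite /= !mulr0 !addr0 !subr0 add0r mulr1 => /eqP; rewrite expf_eq0 (negbTE sn).
Qed.

Lemma F_neq0 : F != 0.
Proof. by apply/eqP => F0; have /eqP := F0E; rewrite F0 coef0 eq_sym oner_eq0. Qed.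

Lemma size_F : size F = (2 * (p + q)).-1.
Proof.
have := size_Ebase; rewrite EF.
have -> : (1 - 'X : {poly C}) ^+ 2 = ('X - 1%:P) ^+ 2 by rewrite polyC1; ring.
rewrite size_monicM ?F_neq0 ?monic_exp ?monicXsubC // size_exp_XsubC; lia.
Qed.

Lemma rho1_neq0 : 1 - rho p q != 0.
Proof.
have q1 : (q%:R : C) != 0 by rewrite pnatr_eq0 -lt0n.
have -> : 1 - rho p q = - ((p * (p + q + q))%:R / q%:R ^+ 2).
  by rewrite /rho !(natrD, natrM); field.
by rewrite oppr_eq0 mulf_neq0 ?invr_eq0 ?expf_neq0 // pnatr_eq0; lia.
Qed.

Lemma F1_neq0 : F`_1 != 0.
Proof.
rewrite F1E; case: (p == 1%N) => /=; last by rewrite mulr0n mulr0 subr0 pnatr_eq0.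
rewrite mulr1n mulr1 (_ : 2 - 2 * rho p q = 2 * (1 - rho p q)); last by ring.
by rewrite mulf_neq0 ?pnatr_eq0 ?rho1_neq0.
Qed.
End Coefs.

Lemma coef_dil F u g i : (0 < g)%N -> (F \Po (u *: 'X^g))`_i =
  if (g %| i)%N then F`_(i %/ g) * u ^+ (i %/ g) else 0.
Proof.
move=> g0; rewrite comp_polyE coef_sum.
under eq_bigr do rewrite exprZn -exprM !coefZ coefXn.
case: ifP => [/dvdnP[j ->]|nd].
  rewrite mulnK //; have [hj|hj] := ltnP j (size F).
    rewrite (bigD1 (Ordinal hj)) //= mulnC eqxx mulr1 big1 ?addr0 // => l /eqP ne.
    case: eqP => [E|_]; last by rewrite !mulr0.
    by case: ne; apply/val_inj => /=; apply/eqP; rewrite -(eqn_pmul2l g0) E.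
  rewrite nth_default // mul0r big1 // => l _.
  case: eqP => [E|_]; last by rewrite !mulr0.
  have := ltn_ord l; rewrite ltnNge; case/negP; apply: leq_trans hj _.
  by rewrite -(leq_pmul2l g0) -E mulnC.
rewrite big1 // => l _; case: eqP => [E|_]; last by rewrite !mulr0.
by rewrite E dvdn_mulr in nd.
Qed.

(** The constant terms give c = 1, the linear coefficients do not vanish and give g = g', and the
    degrees give p + q = p' + q'. If p = p' or neither is 1, the linear coefficients also give u =
    u'. If p = 1 < p', the second coefficients leave only p' = 2, q' = 3, which contradicts the
    third ones. *)
Lemma compare_shapes p q p' q' g g' F F' c u u' :
  (0 < p)%N -> (0 < q)%N -> (0 < p')%N -> (0 < q')%N -> (0 < g)%N -> (0 < g')%N ->
  Ebase p q = (1 - 'X) ^+ 2 * F -> Ebase p' q' = (1 - 'X) ^+ 2 * F' -> u != 0 -> u' != 0 ->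
  F \Po (u *: 'X^g) = c *: (F' \Po (u' *: 'X^g')) -> g = g' /\ u = u'.
Proof.
move=> p0 q0 p0' q0' g0 g0' EF EF' u0 u0' H.
have Hi i := congr1 (fun f : {poly C} => f`_i) H.
have c1 : c = 1.
  by have := Hi 0; rewrite coefZ !coef_dil // !dvdn0 !div0n (F0E p0 q0 EF) (F0E p0' q0' EF') !expr0 !mulr1.
have Hc i : (F \Po (u *: 'X^g))`_i = (F' \Po (u' *: 'X^g'))`_i by rewrite H c1 scale1r.
have eg : g = g'.
  wlog lt : p q p' q' g g' F F' u u' p0 q0 p0' q0' g0 g0' EF EF' u0 u0' Hc {H Hi c1} / (g <= g')%N.
    move=> W; case: (leqP g g') => h; first exact: (W p q p' q' g g' F F' u u').
    by symmetry; apply: (W p' q' p q g' g F' F u' u) => //; apply: ltnW.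
  apply/eqP; rewrite eqn_leq lt; apply: contraT; rewrite -ltnNge => lt'.
  have := Hc g; rewrite !coef_dil // dvdnn divnn g0 gtnNdvd // => /eqP.
  by rewrite mulf_eq0 expr1 (negbTE u0) orbF (negbTE (F1_neq0 p0 q0 EF)).
subst g'; split=> //.
have Fc j : F`_j * u ^+ j = F'`_j * u' ^+ j.
  by have := Hc (j * g)%N; rewrite !coef_dil // dvdn_mull // mulnK.
have es : (p + q = p' + q')%N.
  have : size F = size F'.
    apply/eqP; rewrite eqn_leq; apply/andP; split; apply/leq_sizeP => j hj.
      have := Fc j; rewrite (nth_default 0 hj) mul0r => /eqP.
      by rewrite mulf_eq0 expf_eq0 (negbTE u0) andbF orbF => /eqP.
    have := Fc j; rewrite (nth_default 0 hj) mul0r => /esym/eqP.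
    by rewrite mulf_eq0 expf_eq0 (negbTE u0') andbF orbF => /eqP.
  by rewrite (size_F p0 q0 EF) (size_F p0' q0' EF'); lia.
clear H Hi Hc c1.
wlog lep : p q p' q' F F' u u' p0 q0 p0' q0' EF EF' u0 u0' Fc es / (p <= p')%N.
  move=> W; case: (leqP p p') => h; first exact: (W p q p' q' F F' u u').
  by symmetry; apply: (W p' q' p q F' F u' u) => //; apply: ltnW.
have [ep|np] := eqVneq p p'.
  have eq' : q = q' by lia.
  subst p' q'; have := Fc 1%N; rewrite !(F1E p0 q0 EF) !(F1E p0' q0' EF') !expr1.
  by rewrite -(F1E p0 q0 EF); apply: mulfI; exact: (F1_neq0 p0 q0 EF).
have np1 : (p' == 1%N) = false by lia.
have two : (2 : C) != 0 by rewrite pnatr_eq0.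
have [e1|n1] := eqVneq p 1%N; last first.
  have := Fc 1%N; rewrite (F1E p0 q0 EF) (F1E p0' q0' EF') !expr1 np1 (negbTE n1) !mulr0n !mulr0 !subr0.
  exact: mulfI.
exfalso.
have r1 := rho1_neq0 p0 q0.
have s3 : (3 <= p' + q')%N by lia.
have H1 := Fc 1%N; have H2 := Fc 2%N; have H3 := Fc 3%N; move: H1 H2.
rewrite (F1E p0 q0 EF) (F1E p0' q0' EF') (F2E p0 q0 EF) ?es // (F2E p0' q0' EF') //.
rewrite np1 e1 eqxx /= !mulr0n !mulr1n !mulr1 !mulr0 !addr0 !subr0 => H1 H2.
rewrite e1 in r1.
set r := rho 1 q in r1 H1 H2; set r' := rho p' q' in H2.
have Eu : u' = (1 - r) * u by apply: (mulfI two); rewrite -H1; ring.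
have E2 : 3 - r = (3 - 2 * r' * (p' == 2)%:R) * (1 - r).
  apply: (mulIf r1); apply: (mulIf (expf_neq0 2 u0)).
  transitivity ((3 + (r ^+ 2 - 4 * r)) * u ^+ 2); first by ring.
  by rewrite H2 Eu; ring.
have q1 : (q%:R : C) != 0 by rewrite pnatr_eq0 -lt0n.
have r0 : r != 0 by rewrite expf_neq0 // mulf_neq0 ?invr_eq0 // pnatr_eq0.
have [e2|n2] := eqVneq p' 2%N; last first.
  move: E2; rewrite (negbTE n2) mulr0n mulr0 subr0 => E2.
  have /eqP : 2 * r = 0.
    by transitivity (3 - r - 3 * (1 - r)); [ring|rewrite -E2 subrr].
  by rewrite mulf_eq0 (negbTE two) (negbTE r0).
move: E2; rewrite e2 eqxx mulr1n mulr1 => E2.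
have eqq : q = q'.+1 by lia.
have q1' : (q'%:R : C) != 0 by rewrite pnatr_eq0 -lt0n.
have q2' : ((1 + q')%:R : C) != 0 by rewrite pnatr_eq0.
(* the condition on the second coefficients for p = 1, p' = 2 *)
have : (q' ^ 2 = 2 * q' + 3)%N.
  have /eqP : r' * (r - 1) - r = 0.
    apply: (mulfI two); rewrite mulr0.
    by transitivity ((3 - 2 * r') * (1 - r) - (3 - r)); [ring|rewrite -E2 subrr].
  rewrite /r /r' /rho e2 eqq -[q'.+1]add1n addnA.
  have -> : ((2 + q')%:R / q'%:R) ^+ 2 * (((1 + 1 + q')%:R / (1 + q')%:R) ^+ 2 - 1)
      - ((1 + 1 + q')%:R / (1 + q')%:R) ^+ 2 =
      ((2 + q') ^ 2)%:R / (q'%:R * (1 + q')%:R) ^+ 2 * ((2 * q' + 3)%:R - (q' ^ 2)%:R) :> C.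
    rewrite !natrX !(natrD, natrM) in q2' *; field; by rewrite q1' q2'.
  rewrite !mulf_eq0 invr_eq0 expf_eq0 !mulf_eq0 (negbTE q1') (negbTE q2') /= orbF.
  by rewrite pnatr_eq0 expn_eq0 /= subr_eq0 eqr_nat => /eqP.
move=> Eq; have q3 : (q' = 3)%N by nia.
move: H3; rewrite (F3E p0 q0 EF) ?(F3E p0' q0' EF'); try lia.
rewrite np1 e1 e2 eqxx /= !mulr0n !mulr1n !mulr1 !mulr0 !addr0 !subr0 -/r Eu => H3.
have : 4 + (2 * r ^+ 2 - 6 * r) = (4 - 4 * rho 2 q') * (1 - r) ^+ 3.
  by apply: (mulIf (expf_neq0 3 u0)); rewrite H3; ring.
rewrite /r /rho eqq q3 => /eqP; rewrite -subr_eq0.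
rewrite (_ : _ - _ = - (225%:R / 128%:R)); last by field.
by rewrite oppr_eq0 mulf_eq0 invr_eq0 !pnatr_eq0.
Qed.
End Shapes.

(** * Heron forms with square products *)

Section Common.
Variable C : numClosedFieldType.
Implicit Types (D F f v : {poly C}) (a b c z u x y : C) (m n p q s g k : nat).

Definition sqf f := forall z, ~~ (('X - z%:P) ^+ 2 %| f).

Lemma sqf_neq0 f : sqf f -> f != 0.
Proof. by move=> /(_ 0); apply: contraNneq => ->; rewrite dvdp0. Qed.

Lemma sqf_dvd_square f v : sqf f -> f %| v ^+ 2 -> f %| v.
Proof.
move=> sf fv; have f0 := sqf_neq0 sf.
have [s Es] := closed_field_poly_normal f.
have l0 : lead_coef f != 0 by rewrite lead_coef_eq0.
rewrite Es dvdpZl //; apply: uniq_roots_dvdp.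
  apply/allP => z zs; rewrite -dvdp_XsubCl.
  have : 'X - z%:P %| v ^+ 2.
    by apply: dvdp_trans fv; rewrite Es dvdpZr // (big_rem z) //= dvdp_mulr.
  by rewrite !dvdp_XsubCl /root horner_exp expf_eq0.
rewrite uniq_rootsE; apply/negP => /negP /(uniqPn 0) [i [j [ij js Eij]]].
have /negP := sf s`_i; apply; rewrite Es dvdpZr //.
rewrite -[X in \prod_(_ <- X) _](cat_take_drop j s) (drop_nth 0 js) big_cat big_cons /= -Eij.
rewrite (big_rem s`_i) /=; last by rewrite -(nth_take _ ij) mem_nth // size_take js.
set t := _ - _; rewrite expr2 (_ : _ * _ * _ = (\prod_(y <- rem s`_i (take j s)) ('X - y%:P) *
   \prod_(y <- drop j.+1 s) ('X - y%:P)) * (t * t)); last by ring.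
exact: dvdp_mull.
Qed.

Lemma coprime_Xn f n : f.[0] != 0 -> coprimep f 'X^n.
Proof.
move=> f0; apply: coprimep_expr; rewrite -['X]subr0 -polyC0.
by rewrite coprimep_XsubC.
Qed.

Lemma sqf_dvd f f' a k v : sqf f -> f.[0] != 0 -> a != 0 ->
  xm a k * (f * f') = v ^+ 2 -> f %| f'.
Proof.
move=> sf f0 a0 E; have n0 := sqf_neq0 sf.
have : f %| v by apply: sqf_dvd_square => //; rewrite -E mulrCA dvdp_mulr.
case/dvdpP => w Ew.
have : f %| xm a k * f'.
  have -> : xm a k * f' = f * w ^+ 2 by apply: (mulfI n0); rewrite mulrCA E Ew; ring.
  exact: dvdp_mulr.
by rewrite /xm -mulrA mul_polyC dvdpZr // Gauss_dvdpr // coprime_Xn.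
Qed.

(** Each of the two divides the square root, hence the other one. *)
Lemma sqf_assoc f f' a k v : sqf f -> f.[0] != 0 -> sqf f' -> f'.[0] != 0 -> a != 0 ->
  xm a k * (f * f') = v ^+ 2 -> exists2 c, c != 0 & f = c *: f'.
Proof.
move=> sf f0 sf' f0' a0 E.
have h1 := sqf_dvd sf f0 a0 E.
have h2 : f' %| f by apply: (@sqf_dvd _ _ a k v) => //; rewrite (mulrC f').
have /eqpf_eq [c c0 ->] : f %= f' by rewrite /eqp h1 h2.
by exists c.
Qed.

(** Its roots are the double roots of a Heron form, see [shape_sorted]. *)
Definition beta u g : {poly C} := 1 - u *: 'X^g.

(** The two kinds of Heron forms, without and with non-zero double roots. In the second case p, q,
    F tell how the squarefree part arises from [Ebase], which allows to compare two such parts. *)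
Definition plain D f := exists a k, [/\ a != 0, D = xm a k * f, sqf f & f.[0] != 0].
Definition shape D u g f := exists a k p q F, [/\ [/\ a != 0, (0 < p)%N, (0 < q)%N, (0 < g)%N & u != 0],
  Ebase C p q = (1 - 'X) ^+ 2 * F, f = F \Po (u *: 'X^g),
  D = xm a k * (beta u g ^+ 2 * f) & sqf f /\ f.[0] != 0].

Lemma heronC12 (A B G : {poly C}) : heron A B G = heron B A G.
Proof. by rewrite /heron; ring. Qed.
Lemma heronC23 (A B G : {poly C}) : heron A B G = heron A G B.
Proof. by rewrite /heron; ring. Qed.

Section Sorted.
Variables (a b c : C) (al P Q : nat).
Hypotheses (a0 : a != 0) (b0 : b != 0) (c0 : c != 0) (P0 : (0 < P)%N) (Q0 : (0 < Q)%N).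
Let D := heron (xm a al) (xm b (al + P)) (xm c (al + (P + Q))).

Lemma sorted_ne : ~ (al = al + P /\ al + P = al + (P + Q))%N.
Proof. by lia. Qed.

(** The solution of the two linear relations of [double_root], in terms of the exponents. *)
Lemma double_ratio z : z != 0 -> ('X - z%:P) ^+ 2 %| D ->
  b * z ^+ P = rho C P Q * a /\ c * z ^+ (P + Q) = sig C P Q * a.
Proof.
move=> z0 h; have [x [y [w [n0 [EA EB EG] E0 E1]]]] := double_root a0 b0 c0 z0 h.
have q1 : (Q%:R : C) != 0 by rewrite pnatr_eq0 -lt0n.
have ev d n : (xm d n).[z] = d * z ^+ n by rewrite /xm hornerM hornerC hornerXn.
rewrite !ev !exprD in EA EB EG; rewrite !natrD in E1.
have zal : z ^+ al != 0 by rewrite expf_neq0.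
have Ew : w = P%:R / Q%:R * x.
  apply: (mulfI q1); rewrite mulrA mulrCA divff // mulr1.
  apply/eqP; rewrite -subr_eq0; apply/eqP.
  transitivity (al%:R * x + (al%:R + P%:R) * y + (al%:R + (P%:R + Q%:R)) * w - (al%:R + P%:R) * (x + y + w)).
    by ring.
  by rewrite E1 E0 mulr0 subrr.
have Ey : y = - ((P + Q)%:R / Q%:R) * x.
  have -> : y = - x - w by apply/eqP; rewrite -subr_eq0 -E0; apply/eqP; ring.
  by rewrite Ew natrD; field.
split; apply: (mulIf zal).
  transitivity (b * (z ^+ al * z ^+ P)); first by ring.
  by rewrite EB Ey -[rho C P Q * a * _]mulrA EA /rho; ring.
transitivity (c * (z ^+ al * z ^+ (P + Q))); first by ring.
by rewrite exprD EG Ew -[sig C P Q * a * _]mulrA EA /sig; ring.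
Qed.

Lemma pow_gcd z t m n : (0 < m)%N -> z != 0 -> t != 0 -> z ^+ m = t ^+ m -> z ^+ n = t ^+ n ->
  z ^+ gcdn m n = t ^+ gcdn m n.
Proof.
move=> m0 z0 t0 Em En; case: (egcdnP n m0) => i j E _.
have : z ^+ (i * m) = t ^+ (i * m) by rewrite mulnC !exprM Em.
rewrite E !exprD mulnC !exprM En; apply: mulfI.
by rewrite !expf_neq0.
Qed.

(** The substitution of u X^g for X in [Ebase]. *)
Lemma beta_comp p q F u g : Ebase C p q = (1 - 'X) ^+ 2 * F ->
  heron 1 (xm (rho C p q * u ^+ p) (g * p)) (xm (sig C p q * u ^+ (p + q)) (g * (p + q)))
  = beta u g ^+ 2 * (F \Po (u *: 'X^g)).
Proof.
move=> EF.
have xc (d : C) n : xm d n \Po (u *: 'X^g) = xm (d * u ^+ n) (g * n).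
  rewrite /xm comp_polyM comp_polyC comp_Xn_poly exprZn -exprM -mul_polyC polyCM; ring.
rewrite /beta -[1 - _](_ : (1 - 'X) \Po (u *: 'X^g) = _); last first.
  by rewrite comp_polyB comp_polyX (_ : 1 = 1%:P) ?comp_polyC.
have c1 : 1 \Po (u *: 'X^g) = 1 by rewrite (_ : 1 = 1%:P) ?comp_polyC.
have c2 : 2 \Po (u *: 'X^g) = 2 by rewrite -polyC_natr comp_polyC.
have hc (A B G : {poly C}) : heron A B G \Po (u *: 'X^g) =
    heron (A \Po (u *: 'X^g)) (B \Po (u *: 'X^g)) (G \Po (u *: 'X^g)).
  by rewrite /heron !expr2 !(c2, comp_polyB, comp_polyD, comp_polyM).
by rewrite expr2 -!comp_polyM -expr2 -EF /Ebase hc !xc c1.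
Qed.

(** By [double_ratio], z^P and z^Q are the same for all multiple roots z, hence so is z^g for the
    gcd g: the multiple roots are those of beta. A multiple root left in f would be a triple root
    of D. *)
Lemma shape_sorted z : z != 0 -> ('X - z%:P) ^+ 2 %| D -> exists u g f, shape D u g f.
Proof.
move=> z0 h; have [Eb Ec] := double_ratio z0 h.
pose g := gcdn P Q.
have g0 : (0 < g)%N by rewrite gcdn_gt0 P0.
have [EP EQ] : (P = g * (P %/ g) /\ Q = g * (Q %/ g))%N.
  by rewrite ![(g * _)%N]mulnC !divnK // ?dvdn_gcdl ?dvdn_gcdr.
set p := (P %/ g)%N in EP; set q := (Q %/ g)%N in EQ.
have p0 : (0 < p)%N by lia.
have q0 : (0 < q)%N by lia.
have gC : (g%:R : C) != 0 by rewrite pnatr_eq0 -lt0n.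
have qC : (q%:R : C) != 0 by rewrite pnatr_eq0 -lt0n.
have Er : rho C P Q = rho C p q.
  by rewrite /rho EP EQ -mulnDr !natrM; field; rewrite gC qC.
have Es : sig C P Q = sig C p q by rewrite /sig EP EQ !natrM; field; rewrite gC qC.
rewrite Er Es in Eb Ec.
pose u := (z ^+ g)^-1; have zg0 : z ^+ g != 0 by rewrite expf_neq0.
have u0 : u != 0 by rewrite invr_eq0.
have [F EF] := @Ebase_factor C p q p0 q0.
pose f := F \Po (u *: 'X^g).
have Eb' : b = a * (rho C p q * u ^+ p).
  rewrite /u exprVn -exprM -EP; apply: (mulIf (expf_neq0 P z0)); rewrite Eb; field.
  by rewrite expf_neq0.
have Ec' : c = a * (sig C p q * u ^+ (p + q)).
  rewrite /u exprVn -exprM mulnDr -EP -EQ; apply: (mulIf (expf_neq0 (P + Q) z0)); rewrite Ec; field.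
  by rewrite expf_neq0.
have ED : D = xm (a ^+ 2) (2 * al) * (beta u g ^+ 2 * f).
  have x2 : xm (a ^+ 2) (2 * al) = xm a al ^+ 2 by rewrite mul2n -addnn !expr2 -xmM.
  rewrite x2 -(beta_comp u g EF) mulnDr -EP -EQ /D Eb' Ec'.
  move: (_ * u ^+ p) (_ * u ^+ (p + q)) => r s; rewrite -!xmM.
  by rewrite /heron; ring.
have f00 : f.[0] = 1.
  rewrite horner_coef0 /f coef_dil // dvdn0 div0n expr0 mulr1.
  exact: F0E EF.
have f0 : f.[0] != 0 by rewrite f00 oner_eq0.
exists u, g, f, (a ^+ 2), (2 * al)%N, p, q, F; split=> //; first by rewrite expf_neq0.
split=> // t; apply/negP => ht.
have [t0|t0] := eqVneq t 0.
  by have /eqP := dvd_root ht; rewrite t0 (negbTE f0).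
have [Ebt Ect] : b * t ^+ P = rho C P Q * a /\ c * t ^+ (P + Q) = sig C P Q * a.
  apply: double_ratio => //; rewrite ED mulrA; exact: dvdp_mull.
rewrite Er Es -Eb -Ec in Ebt Ect.
have ztP : t ^+ P = z ^+ P by apply: (mulfI b0).
have ztQ : t ^+ Q = z ^+ Q.
  by have := mulfI c0 Ect; rewrite !exprD ztP; apply: mulfI; rewrite expf_neq0.
have Eg : t ^+ g = z ^+ g by apply: pow_gcd.
have : 'X - t%:P %| beta u g.
  by rewrite dvdp_XsubCl /root /beta !hornerE Eg /u mulVf ?subrr.
case/dvdpP => w Ew.
have := no_triple_root a0 b0 c0 sorted_ne t0; rewrite -/D => /negP; apply.
rewrite ED; apply: dvdp_mull; rewrite Ew exprMn -mulrA; apply: dvdp_mull.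
by rewrite (_ : 3 = 2 + 1)%N // exprD; apply: dvdp_mul => //; apply: dvdp_trans ht; rewrite expr2 expr1 dvdp_mulr.
Qed.
End Sorted.

(** A multiple root forces distinct exponents, which can be put in increasing order. Otherwise it
    suffices to remove the power of X. *)
Lemma heron_decomp a b c al be ga : a != 0 -> b != 0 -> c != 0 -> ~ (al = be /\ be = ga) ->
  let D := heron (xm a al) (xm b be) (xm c ga) in
  (exists f, plain D f) \/ exists u g f, shape D u g f.
Proof.
move=> a0 b0 c0 ne D.
have [[z [z0 h]]|no] := EM (exists z, z != 0 /\ ('X - z%:P) ^+ 2 %| D).
  right; have [x [y [w [n0 _ E0 E1]]]] := double_root a0 b0 c0 z0 h.
  have := distinct_exps ne n0 E0 E1; rewrite !eqr_nat => -[ab bc ac].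
  have srt m n k (r s t : C) : r != 0 -> s != 0 -> t != 0 -> (m < n)%N -> (n < k)%N ->
     D = heron (xm r m) (xm s n) (xm t k) -> exists u g f, shape D u g f.
    move=> r0 s0 t0 mn nk ED.
    have [en ek] : (n = m + (n - m) /\ k = m + ((n - m) + (k - n)))%N by lia.
    rewrite ED en ek; apply: (@shape_sorted _ _ _ _ _ _ r0 s0 t0 _ _ z) => //; rewrite ?subn_gt0 //.
    by rewrite -en -ek -ED.
  have [h1|h1] := ltnP al be; have [h2|h2] := ltnP be ga; have [h3|h3] := ltnP al ga; try lia.
  - by apply: (@srt al be ga a b c).
  - by apply: (@srt al ga be a c b) => //; try lia; rewrite /D heronC23.
  - by apply: (@srt ga al be c a b) => //; try lia; rewrite /D heronC23 heronC12.
  - by apply: (@srt be al ga b a c) => //; try lia; rewrite /D heronC12.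
  - by apply: (@srt be ga al b c a) => //; try lia; rewrite /D heronC12 heronC23.
  - by apply: (@srt ga be al c b a) => //; try lia; rewrite /D heronC12 heronC23 heronC12.
left.
have D0 : D != 0.
  apply/eqP => D0; apply: ne; apply: (@heron_square C a b c al be ga 1 0) => //; rewrite ?oner_eq0 //.
  by rewrite -/D D0 mul0r expr0n.
have [m [f nr Ef]] := multiplicity_XsubC D 0.
rewrite D0 /= in nr; rewrite subr0 in Ef.
exists f, 1, m; split; rewrite ?oner_eq0 //.
  by rewrite Ef /xm mul1r mulrC.
move=> z; apply/negP => hz.
have [z0|z0] := eqVneq z 0; first by have /eqP := dvd_root hz; rewrite z0; apply/negP.
by apply: no; exists z; split=> //; rewrite Ef dvdp_mulr.
Qed.

Lemma beta_neq0 u g : (0 < g)%N -> beta u g != 0.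
Proof.
move=> g0; apply/eqP => /(congr1 (fun f : {poly C} => f`_0)) /eqP.
by rewrite /beta coefB coefZ coefXn coef1 coef0 (_ : (0 == g)%N = false) ?mulr0 ?subr0 ?oner_eq0 //; lia.
Qed.

Lemma square_quot f v B : B != 0 -> B ^+ 2 * f = v ^+ 2 -> exists w, f = w ^+ 2.
Proof.
move=> B0 E; have : B ^+ 2 %| v ^+ 2 by rewrite -E dvdp_mulr.
rewrite dvdp_pexp2r // => /dvdpP [w Ew]; exists w.
by apply: (mulfI (expf_neq0 2 B0)); rewrite E Ew; ring.
Qed.

(** The squarefree parts are associated because the products are squares. If double roots are
    present, [compare_shapes] recovers beta from the squarefree part, so that the forms with
    double roots share it. *)
Lemma common_shape (T : Type) (i0 : T) (D : T -> {poly C}) :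
  (forall i, exists a b c al be ga, [/\ a != 0, b != 0, c != 0, ~ (al = be /\ be = ga) &
     D i = heron (xm a al) (xm b be) (xm c ga)]) ->
  (forall i j, exists v, D i * D j = v ^+ 2) ->
  exists u g f, [/\ u != 0, (0 < g)%N, f != 0 &
    forall i, exists (l : bool) a k, a != 0 /\ D i = xm a k * (beta u g ^+ l) ^+ 2 * f].
Proof.
move=> HD Hsq.
have dec i : (exists f, plain (D i) f) \/ exists u g f, shape (D i) u g f.
  by have [a [b [c [al [be [ga [a0 b0 c0 ne ->]]]]]]] := HD i; exact: heron_decomp.
have assoc (i j : T) a k B f a' k' B' f' : a != 0 -> a' != 0 -> B != 0 -> B' != 0 -> sqf f -> f.[0] != 0 -> sqf f' -> f'.[0] != 0 ->
   D i = xm a k * (B ^+ 2 * f) -> D j = xm a' k' * (B' ^+ 2 * f') -> exists2 c, c != 0 & f = c *: f'.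
  move=> a0 a0' B0 B0' sf f0 sf' f0' Ei Ej; have [v Ev] := Hsq i j.
  have [w Ew] : exists w, xm (a * a') (k + k') * (f * f') = w ^+ 2.
    apply: (@square_quot _ v (B * B')); first by rewrite mulf_neq0.
    by rewrite -Ev Ei Ej -xmM; ring.
  by apply: sqf_assoc Ew => //; rewrite mulf_neq0.
have [[i [u [g [f hi]]]]|none] := EM (exists i u g f, shape (D i) u g f).
  have [a [k [p [q [F [[a0 p0 q0 g0 u0] EF Ef EDi [sf f0]]]]]]] := hi.
  exists u, g, f; split=> //; first exact: sqf_neq0.
  move=> j; case: (dec j) => [[f' [a' [k' [a0' EDj sf' f0']]]]|].
    have [c c0 Ec] : exists2 c, c != 0 & f' = c *: f.
      apply: (@assoc j i a' k' 1 f' a k (beta u g) f) => //; rewrite ?oner_eq0 ?beta_neq0 //.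
      by rewrite expr1n mul1r.
    exists false, (a' * c), k'; split; first by rewrite mulf_neq0.
    by rewrite expr0 expr1n mulr1 EDj Ec -mul_polyC /xm polyCM; ring.
  move=> [u' [g' [f' [a' [k' [p' [q' [F' [[a0' p0' q0' g0' u0'] EF' Ef' EDj [sf' f0']]]]]]]]]].
  have [c c0 Ec] : exists2 c, c != 0 & f' = c *: f.
    by apply: (@assoc j i a' k' (beta u' g') f' a k (beta u g) f); rewrite ?beta_neq0.
  have [eg eu] : g' = g /\ u' = u.
    by apply: (compare_shapes (c := c) p0' q0' p0 q0 g0' g0 EF' EF u0' u0); rewrite -Ef' -Ef.
  exists true, (a' * c), k'; split; first by rewrite mulf_neq0.
  by rewrite expr1 EDj Ec eg eu -mul_polyC /xm polyCM; ring.
have pl i : exists f, plain (D i) f.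
  by case: (dec i) => // -[u [g [f h]]]; case: none; exists i, u, g, f.
have [f [a [k [a0 ED0 sf f0]]]] := pl i0.
exists 1, 1%N, f; split=> //; rewrite ?oner_eq0 //; first exact: sqf_neq0.
move=> j; have [f' [a' [k' [a0' EDj sf' f0']]]] := pl j.
have [c c0 Ec] : exists2 c, c != 0 & f' = c *: f.
  by apply: (@assoc j i0 a' k' 1 f' a k 1 f) => //; rewrite ?oner_eq0 // expr1n mul1r.
exists false, (a' * c), k'; split; first by rewrite mulf_neq0.
by rewrite expr0 expr1n mulr1 EDj Ec -mul_polyC /xm polyCM; ring.
Qed.
End Common.

(** * Monomial multiples of powers of a binomial *)

Section BetaMonomials.
Variables (C : numClosedFieldType) (u : C) (g : nat).
Hypotheses (u0 : u != 0) (g0 : (0 < g)%N).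
Implicit Types (a b c d : C) (i j k l : nat).
Local Notation beta := (beta u g).

Lemma coef_xm_beta a i n : (xm a i * beta)`_n = (if n == i then a else 0) - (if n == (i + g)%N then a * u else 0).
Proof.
have -> : xm a i * beta = xm a i - xm (a * u) (i + g).
  by rewrite -xmM /beta /xm -mul_polyC; ring.
by rewrite coefB !coef_xm.
Qed.

Lemma coef_xm_beta2 a i n : (xm a i * beta ^+ 2)`_n = (if n == i then a else 0)
   - (if n == (i + g)%N then 2 * a * u else 0) + (if n == (i + (g + g))%N then a * u ^+ 2 else 0).
Proof.
have -> : xm a i * beta ^+ 2 = xm a i - xm (2 * a * u) (i + g) + xm (a * u ^+ 2) (i + (g + g)).
  have x2 : xm (2 * a * u) (i + g) = 2 * xm (a * u) (i + g).
    by rewrite /xm -mulrA polyCM -mulrA; congr (_ * _); exact: polyC_natr.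
  by rewrite x2 expr2 -!xmM /beta /xm -mul_polyC; ring.
by rewrite !(coefN, coefD) !coef_xm.
Qed.

(** The powers 1, beta, beta^2 have one, two and three terms. Comparing their monomial multiples
    with sums of monomials therefore relates the exponents by multiples of g. *)
Lemma mono_ne_beta a b i j : b != 0 -> xm a i = xm b j * beta -> False.
Proof.
move=> b0 E; have H n := congr1 (fun p : {poly C} => p`_n) E.
have := H j; have := H (j + g)%N; rewrite !coef_xm_beta !coef_xm !eqxx.
rewrite (_ : (j == j + g)%N = false); last lia.
rewrite (_ : (j + g == j)%N = false); last lia.
case: eqP => [e1|_ /eqP]; last by rewrite sub0r eq_sym oppr_eq0 mulf_eq0 (negbTE b0) (negbTE u0).
by rewrite (_ : (j == i)%N = false) ?subr0 => [_ /esym/eqP|]; [rewrite (negbTE b0)|lia].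
Qed.

Lemma mono_beta_inj a b i j (l l' : bool) : a != 0 -> b != 0 ->
  xm a i * beta ^+ l = xm b j * beta ^+ l' -> l = l' /\ i = j.
Proof.
move=> a0 b0; case: l l' => -[]; rewrite ?expr1 ?expr0 ?mulr1 => E.
- split=> //; have := beta_neq0 u g0 => bn; move/(mulIf bn): E => E.
  have := congr1 (fun p : {poly C} => p`_i) E; rewrite /= !coef_xm eqxx.
  by case: eqP => // _ /eqP; rewrite (negbTE a0).
- by case: (@mono_ne_beta b a j i a0); rewrite E.
- by case: (@mono_ne_beta a b i j b0); rewrite E.
- split=> //; have := congr1 (fun p : {poly C} => p`_i) E; rewrite /= !coef_xm eqxx.
  by case: eqP => // _ /eqP; rewrite (negbTE a0).
Qed.

Lemma beta2_ne_two a b c i j k : a != 0 -> xm a i * beta ^+ 2 = xm b j + xm c k -> False.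
Proof.
move=> a0 E; have H n := congr1 (fun p : {poly C} => p`_n) E.
have two : (2 : C) != 0 by rewrite pnatr_eq0.
have := H i; have := H (i + g)%N; have := H (i + (g + g))%N; rewrite !coef_xm_beta2 !coefD !coef_xm !eqxx.
rewrite (_ : (i == i + g)%N = false); last lia.
rewrite (_ : (i + g == i)%N = false); last lia.
rewrite (_ : (i == i + (g + g))%N = false); last lia.
rewrite (_ : (i + (g + g) == i)%N = false); last lia.
rewrite (_ : (i + g == i + (g + g))%N = false); last lia.
rewrite (_ : (i + (g + g) == i + g)%N = false); last lia.
have z1 : a * u ^+ 2 != 0 by rewrite mulf_neq0 ?expf_neq0.
have z2 : 2 * a * u != 0 by rewrite !mulf_neq0.
have nz n (x : C) : x != 0 -> x = (if n == j then b else 0) + (if n == k then c else 0) -> (n = j \/ n = k).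
  move=> x0; case: eqP => [nj _|_]; first by left.
  by case: eqP => [nk _|_]; [right|rewrite addr0 => E'; rewrite E' eqxx in x0].
rewrite !subr0 !addr0 !add0r => h1 h2 h3.
have [] := nz _ _ z1 h1; have [] := nz _ _ a0 h3;
have [] : (i + g = j \/ i + g = k)%N by apply: (nz _ (- (2 * a * u))) => //; rewrite oppr_eq0.
all: lia.
Qed.

Lemma beta_two a b c i j k : a != 0 -> b != 0 -> c != 0 -> xm a i * beta = xm b j + xm c k ->
  (j = i /\ k = i + g \/ j = i + g /\ k = i)%N.
Proof.
move=> a0 b0 c0 E; have H n := congr1 (fun p : {poly C} => p`_n) E.
have := H i; have := H (i + g)%N; rewrite !coef_xm_beta !coefD !coef_xm !eqxx.
rewrite (_ : (i == i + g)%N = false); last lia.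
rewrite (_ : (i + g == i)%N = false); last lia.
have z2 : a * u != 0 by rewrite mulf_neq0.
have nz n (x : C) : x != 0 -> x = (if n == j then b else 0) + (if n == k then c else 0) -> (n = j \/ n = k).
  move=> x0; case: eqP => [nj _|_]; first by left.
  by case: eqP => [nk _|_]; [right|rewrite addr0 => E'; rewrite E' eqxx in x0].
rewrite !subr0 sub0r => h1 h2.
have [] := nz _ _ a0 h2;
have [] : (i + g = j \/ i + g = k)%N by apply: (nz _ (- (a * u))) => //; rewrite oppr_eq0.
all: lia.
Qed.

Lemma beta2_three a b c d i j k l : a != 0 -> xm a i * beta ^+ 2 = xm b j + xm c k + xm d l ->
  [/\ i = j \/ i = k \/ i = l, (i + g = j \/ i + g = k \/ i + g = l)%N &
    (i + (g + g) = j \/ i + (g + g) = k \/ i + (g + g) = l)%N].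
Proof.
move=> a0 E; have H n := congr1 (fun p : {poly C} => p`_n) E.
have two : (2 : C) != 0 by rewrite pnatr_eq0.
have := H i; have := H (i + g)%N; have := H (i + (g + g))%N; rewrite !coef_xm_beta2 !coefD !coef_xm !eqxx.
rewrite (_ : (i == i + g)%N = false); last lia.
rewrite (_ : (i + g == i)%N = false); last lia.
rewrite (_ : (i == i + (g + g))%N = false); last lia.
rewrite (_ : (i + (g + g) == i)%N = false); last lia.
rewrite (_ : (i + g == i + (g + g))%N = false); last lia.
rewrite (_ : (i + (g + g) == i + g)%N = false); last lia.
have z1 : a * u ^+ 2 != 0 by rewrite mulf_neq0 ?expf_neq0.
have z2 : 2 * a * u != 0 by rewrite !mulf_neq0.
have nz n (x : C) : x != 0 -> x = (if n == j then b else 0) + (if n == k then c else 0) + (if n == l then d else 0)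
   -> (n = j \/ n = k \/ n = l).
  move=> x0; case: eqP => [nj _|_]; first by left.
  case: eqP => [nk _|_]; first by right; left.
  by case: eqP => [nl _|_]; [right; right|rewrite !addr0 => E'; rewrite E' eqxx in x0].
rewrite !subr0 !addr0 !add0r => h1 h2 h3; split.
- exact: nz h3.
- by apply: (nz _ (- (2 * a * u))) => //; rewrite oppr_eq0.
- exact: nz h1.
Qed.

Lemma xm_no_lone a b c d i j k l : a != 0 -> xm a i + xm b j + xm c k + xm d l = 0 ->
  i = j \/ i = k \/ i = l.
Proof.
move=> a0 E; have := congr1 (fun p : {poly C} => p`_i) E; rewrite /= !coefD !coef_xm eqxx coef0.
case: eqP => [ij _|_]; first by left.
case: eqP => [ik _|_]; first by right; left.
by case: eqP => [il _|_]; [right; right|rewrite !addr0 => /eqP; rewrite (negbTE a0)].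
Qed.

(** A monomial does not vanish at a root of beta. *)
Lemma beta_root (p : {poly C}) a i : a != 0 -> xm a i = beta * p -> False.
Proof.
move=> a0 E; pose z := g.-root u^-1.
have zg : z ^+ g = u^-1 by rewrite rootCK.
have z0 : z != 0.
  by apply: contraTneq (invr_neq0 u0) => z0; rewrite -zg z0 expr0n eqn0Ngt g0 /= eqxx.
have : (xm a i).[z] = 0.
  by rewrite E hornerM /beta !hornerE zg mulfV // subrr mul0r.
by apply/eqP; apply: xm_root0.
Qed.
End BetaMonomials.

(** * Five pairs over the polynomials *)

(** Each hypothesis says that a value occurs again in a subset of four of the five. *)
Lemma five_equal (x1 x2 x3 x4 x5 : int) :
  (x1 = x2 \/ x1 = x3 \/ x1 = x4) -> (x2 = x1 \/ x2 = x3 \/ x2 = x4) ->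
  (x3 = x1 \/ x3 = x2 \/ x3 = x4) -> (x4 = x1 \/ x4 = x2 \/ x4 = x3) ->
  (x3 = x1 \/ x3 = x2 \/ x3 = x5) -> (x1 = x3 \/ x1 = x4 \/ x1 = x5) ->
  (x2 = x1 \/ x2 = x3 \/ x2 = x5) -> (x1 = x2 \/ x1 = x4 \/ x1 = x5) ->
  (x2 = x1 \/ x2 = x4 \/ x2 = x5) -> (x1 = x2 \/ x1 = x3 \/ x1 = x5) ->
  x1 = x2 /\ x2 = x3.
Proof.
case: (x1 =P x2) => n12; case: (x2 =P x3) => n23 //; case: (x1 =P x3) => n13;
move=> h1 h2 h3 h4 h5 h6 h7 h8 h9 h10;
repeat match goal with H : _ \/ _ |- _ => destruct H; try congruence end.
Qed.

(** The model is a family of pairs (x_c, x_c') indexed by T: n_c stands for x_c x_c', the monomial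
    with coefficient b_cd and exponent mu_cd for (x_c - x_d)(x_c' - x_d'), and t_cd for x_c x_d' +
    x_d x_c'. Then D_cd is the square of s_cd = x_c x_d' - x_d x_c', and gg_cd is, up to sign,
    s_cd times a fixed value of s. Products of two values of s lie in the ground ring although s
    does not; the hypotheses on D and gg are identities between such products. *)
Section FivePoints.
Variables (C : numClosedFieldType) (T : eqType) (o1 o2 : T).
Variables (a : T -> C) (nu : T -> nat) (b : T -> T -> C) (mu : T -> T -> nat) (t : T -> T -> {poly C}).
Let n c := xm (a c) (nu c).
Hypotheses (a0 : forall c, a c != 0) (b0 : forall c d, c != d -> b c d != 0).
Hypothesis tE : forall c d, c != d -> t c d = n c + n d - xm (b c d) (mu c d).
Hypothesis tcc : forall c, t c c = 2 * n c.
Hypothesis ne : forall c d, c != d -> ~ (nu c = nu d /\ nu d = mu c d).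
Let D c d := t c d ^+ 2 - 4 * n c * n d.
Let gg c d := t c o1 * t d o2 - t c o2 * t d o1.
Hypothesis o12 : o1 != o2.
Hypothesis DD : forall c d e f, (t c e * t d f - t c f * t d e) ^+ 2 = D c d * D e f.
Hypothesis P2 : forall c d e, gg c d * t e d + gg d e * t c d + gg e c * t d d = 0.
Hypothesis P3 : forall c d e f, n c * gg d e * gg d f * gg e f - n d * gg c e * gg c f * gg e f
  + n e * gg c d * gg c f * gg d f - n f * gg c d * gg c e * gg d e = 0.
Hypothesis P4 : forall c d e, gg c d ^+ 2 * n e =
  gg d e ^+ 2 * n c + gg e c ^+ 2 * n d + gg d e * gg e c * t c d.

Lemma DE c d : c != d -> D c d = heron (n c) (n d) (xm (b c d) (mu c d)).
Proof. by move=> cd; rewrite /D tE // /heron; ring. Qed.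

Lemma D_not_square c d f h : c != d -> f != 0 -> D c d * f ^+ 2 = h ^+ 2 -> False.
Proof.
move=> cd f0; rewrite DE // => E; apply: (ne cd).
by apply: (heron_square _ _ _ f0 E); rewrite ?a0 ?b0.
Qed.

(** The products of two of the D_cd are squares, so [common_shape] describes all D_cd at once. As
    gg_cd^2 is D_cd times a fixed D, this determines gg_cd up to a monomial and the exponent of
    beta. *)
Lemma five_setup : exists u g, [/\ u != 0, (0 < g)%N &
  exists (l : T -> T -> bool) (w : T -> T -> C) (eta : T -> T -> nat) (H : {poly C}),
   [/\ H != 0, forall c d, c != d -> w c d != 0 &
     forall c d, c != d -> gg c d = H * (xm (w c d) (eta c d) * beta u g ^+ l c d)]].
Proof.
pose I := {p : T * T | p.1 != p.2}.
pose i0 : I := exist _ (o1, o2) o12.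
have [||u [g [f [u0 g0 f0 HD]]]] := @common_shape C I i0 (fun i => D (val i).1 (val i).2).
- move=> [[c d] /= cd]; exists (a c), (a d), (b c d), (nu c), (nu d), (mu c d).
  by split; rewrite ?a0 ?b0 ?DE //; apply: ne.
- by move=> [[c d] /= cd] [[e h] /= eh]; exists (t c e * t d h - t c h * t d e); rewrite DD.
have bn := beta_neq0 u g0.
have [l0 [k0 [m0 [k00 ED0]]]] := HD i0; rewrite /= in ED0.
have W (p : T * T) : exists q : bool * C * nat, p.1 != p.2 ->
   q.1.2 != 0 /\ gg p.1 p.2 = f * beta u g ^+ l0 * (xm q.1.2 q.2 * beta u g ^+ q.1.1).
  case: p => c d /=; have [->|cd] := eqVneq c d; first by exists (true, 0, 0%N).
  have [l [k [m [k1 ED]]]] := HD (exist _ (c, d) cd : I); rewrite /= in ED.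
  pose B := beta u g ^+ l0 * beta u g ^+ l * f.
  have B0 : B != 0 by rewrite !mulf_neq0 ?expf_neq0.
  have E : gg c d ^+ 2 = xm (k * k0) (m + m0) * B ^+ 2.
    by rewrite /gg DD ED ED0 -xmM /B; ring.
  have : B ^+ 2 %| gg c d ^+ 2 by rewrite E dvdp_mull.
  rewrite dvdp_pexp2r // => /dvdpP [h Eh].
  have [k' [m' [k'0 Eh']]] : is_xm h.
    apply: (@is_xm_factor _ h h); exists (k * k0), (m + m0)%N; split; first by rewrite mulf_neq0.
    by apply: (mulIf (expf_neq0 2 B0)); rewrite -E Eh; ring.
  by exists (l, k', m') => _ /=; split=> //; rewrite Eh Eh' /B; ring.
have [q Hq] := choice W.
exists u, g; split=> //; exists (fun c d => (q (c, d)).1.1), (fun c d => (q (c, d)).1.2), (fun c d => (q (c, d)).2),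
  (f * beta u g ^+ l0); split; first by rewrite mulf_neq0 ?expf_neq0.
  by move=> c d cd; have [] := Hq (c, d) cd.
by move=> c d cd; have [] := Hq (c, d) cd.
Qed.

Section Endgame.
Variables (u : C) (g : nat) (l : T -> T -> bool) (w : T -> T -> C) (eta : T -> T -> nat) (H : {poly C}).
Hypotheses (u0 : u != 0) (g0 : (0 < g)%N) (H0 : H != 0) (w0 : forall c d, c != d -> w c d != 0).
Hypothesis gE : forall c d, c != d -> gg c d = H * (xm (w c d) (eta c d) * beta u g ^+ l c d).
Let W c d := xm (w c d) (eta c d).
Let v c d := W c d * beta u g ^+ l c d.
Lemma WN c d : c != d -> l c d = l d c /\ eta c d = eta d c.
Proof.
move=> cd; have dc : d != c by rewrite eq_sym.
have E : gg c d = - gg d c by rewrite /gg; ring.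
rewrite !gE // in E.
apply: (@mono_beta_inj C u g u0 g0 (w c d) (- w d c)); rewrite ?oppr_eq0 ?w0 //.
by apply: (mulfI H0); rewrite E /xm polyCN; ring.
Qed.
Lemma lS c d : c != d -> l c d = l d c. Proof. by move=> /WN[]. Qed.
Lemma etaS c d : c != d -> eta c d = eta d c. Proof. by move=> /WN[]. Qed.

(** The Pluecker relation. *)
Lemma vP c d e f : uniq [:: c; d; e; f] -> v c d * v e f - v c e * v d f + v c f * v d e = 0.
Proof.
rewrite /= !inE !negb_or -!andbA => /and5P[cd ce cf de /and3P[df ef _]].
apply: (mulfI (expf_neq0 2 H0)); rewrite mulr0.
transitivity (gg c d * gg e f - gg c e * gg d f + gg c f * gg d e); last by rewrite /gg; ring.
by rewrite !gE // /v /W; ring.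
Qed.

Lemma vP2 c d e : uniq [:: c; d; e] -> v c d * t e d + v d e * t c d + v e c * (2 * n d) = 0.
Proof.
rewrite /= !inE !negb_or -!andbA => /and4P[cd ce de _].
apply: (mulfI H0); rewrite mulr0 -(P2 c d e) -tcc !gE ?(eq_sym e) // /v /W; ring.
Qed.

Lemma vP3 c d e f : uniq [:: c; d; e; f] ->
  n c * v d e * v d f * v e f - n d * v c e * v c f * v e f + n e * v c d * v c f * v d f - n f * v c d * v c e * v d e = 0.
Proof.
rewrite /= !inE !negb_or -!andbA => /and5P[cd ce cf de /and3P[df ef _]].
by apply: (mulfI (expf_neq0 3 H0)); rewrite mulr0 -(P3 c d e f) !gE // /v /W; ring.
Qed.

Lemma vP4 c d e : uniq [:: c; d; e] ->
  v c d ^+ 2 * n e = v d e ^+ 2 * n c + v e c ^+ 2 * n d + v d e * v e c * t c d.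
Proof.
rewrite /= !inE !negb_or -!andbA => /and4P[cd ce de _].
apply: (mulfI (expf_neq0 2 H0)); have := P4 c d e; rewrite !gE ?(eq_sym e) // => E.
by rewrite /v /W; move: E; move: (beta u g ^+ _) (beta u g ^+ _) (beta u g ^+ _) => A B G E; ring: E.
Qed.

(** In [vP2] two terms are divisible by beta, hence so is the third one, whose other factors are
    monomials. *)
Lemma l_trans c d e : uniq [:: c; d; e] -> l c d -> l d e -> l c e.
Proof.
move=> U; have := vP2 U; move: U; rewrite /= !inE !negb_or -!andbA => /and4P[cd ce de _].
move=> E lcd lde; apply: contraT; rewrite lS // => lec.
move: E; rewrite /v lcd lde (negbTE lec) expr0 mulr1 expr1 => E.
have : xm (w e c * 2 * a d) (eta e c + nu d) != 0.
  by rewrite xm_eq0 !mulf_neq0 ?pnatr_eq0 ?w0 // eq_sym.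
case: (@beta_root C u g u0 g0 (- (W c d * t e d + W d e * t c d)) (w e c * 2 * a d) (eta e c + nu d)).
  by rewrite !mulf_neq0 ?pnatr_eq0 ?w0 // eq_sym.
have -> : xm (w e c * 2 * a d) (eta e c + nu d) = W e c * (2 * n d).
  by rewrite -xmM /W /n /xm polyCM; rewrite (polyC_natr _ 2); ring.
apply/eqP; rewrite -subr_eq0 -E; apply/eqP; rewrite /W; ring.
Qed.

Lemma xmN (x : C) k : xm (- x) k = - xm x k.
Proof. by rewrite /xm polyCN mulNr. Qed.

(** Otherwise [vP] would write beta^2, which has three terms, as a sum of two monomials. *)
Lemma l_pairs c d e f : uniq [:: c; d; e; f] -> l c d -> l e f -> l c e.
Proof.
move=> U lcd lef; have := vP U; move: (U).
rewrite /= !inE !negb_or -!andbA => /and5P[cd ce cf de /and3P[df ef _]].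
move=> E0; apply: contraT => nce; exfalso; move: E0.
have nde : l d e = false.
  apply/negP => h; case/negP: nce; apply: (@l_trans c d e) => //.
  by rewrite /= !inE negb_or cd ce de.
have ncf : l c f = false.
  apply/negP => h; case/negP: nce; apply: (@l_trans c f e); rewrite ?(lS (c := f)) // 1?eq_sym //.
  by rewrite /= !inE negb_or cf ce eq_sym ef.
have ndf : l d f = false.
  apply/negP => h; move/negP: ncf; apply; apply: (@l_trans c d f) => //.
  by rewrite /= !inE negb_or cd cf df.
rewrite /v lcd lef (negbTE nce) ndf ncf nde !expr0 !mulr1 !expr1 => E.
apply: (@beta2_ne_two C u g u0 g0 (w c d * w e f) (w c e * w d f) (- (w c f * w d e)) (eta c d + eta e f)
  (eta c e + eta d f) (eta c f + eta d e)); first by rewrite mulf_neq0 ?w0.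
rewrite xmN -!xmM -/(W _ _) -/(W _ _).
apply/eqP; rewrite -subr_eq0 -E; apply/eqP; rewrite /W; ring.
Qed.

(** Here [vP] writes a multiple of beta as a sum of two monomials. *)
Lemma l_one_pair c d e f : uniq [:: c; d; e; f] -> l c d -> ~~ l c e -> ~~ l c f -> ~~ l e f ->
  (eta c e + eta d f = eta c d + eta e f /\ eta c f + eta d e = eta c d + eta e f + g \/
   eta c e + eta d f = eta c d + eta e f + g /\ eta c f + eta d e = eta c d + eta e f)%N.
Proof.
move=> U lcd nce ncf nef; have E := vP U; move: (U).
rewrite /= !inE !negb_or -!andbA => /and5P[cd ce cf de /and3P[df ef _]].
have nde : l d e = false.
  apply/negP => h; case/negP: nce; apply: (@l_trans c d e) => //.
  by rewrite /= !inE negb_or cd ce de.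
have ndf : l d f = false.
  apply/negP => h; case/negP: ncf; apply: (@l_trans c d f) => //.
  by rewrite /= !inE negb_or cd cf df.
move: E; rewrite /v lcd (negbTE nef) (negbTE nce) ndf (negbTE ncf) nde !expr0 !mulr1 !expr1 => E.
apply: (@beta_two C u g u0 g0 (w c d * w e f) (w c e * w d f) (- (w c f * w d e)) (eta c d + eta e f)
  (eta c e + eta d f) (eta c f + eta d e)); rewrite ?oppr_eq0 ?mulf_neq0 ?w0 //.
rewrite xmN -!xmM.
apply/eqP; rewrite -subr_eq0 -E; apply/eqP; rewrite /W; ring.
Qed.

(** The common power of beta cancels from [vP], leaving three monomials. *)
Lemma eta_quad c d e f (X : {poly C}) : uniq [:: c; d; e; f] -> X != 0 ->
  beta u g ^+ l c d * beta u g ^+ l e f = X -> beta u g ^+ l c e * beta u g ^+ l d f = X ->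
  beta u g ^+ l c f * beta u g ^+ l d e = X ->
  (eta c d + eta e f = eta c e + eta d f /\ eta c e + eta d f = eta c f + eta d e)%N.
Proof.
move=> U X0 E1 E2 E3; have E := vP U; move: (U).
rewrite /= !inE !negb_or -!andbA => /and5P[cd ce cf de /and3P[df ef _]].
have [] := @xm_add3 C (w c d * w e f) (w c f * w d e) (w c e * w d f) (eta c d + eta e f)
  (eta c f + eta d e) (eta c e + eta d f); rewrite ?mulf_neq0 ?w0 //; last by move=> -> ->.
apply: (mulfI X0); apply/eqP; rewrite -subr_eq0; apply/eqP; rewrite -[RHS]E /v /W -!xmM.
by rewrite mulrDr -{1}E1 -{1}E3 -{1}E2; ring.
Qed.

(** The common power of beta cancels from [vP3], leaving four monomials. *)
Lemma lone_free c d e f (X : {poly C}) : uniq [:: c; d; e; f] -> X != 0 ->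
  beta u g ^+ l d e * beta u g ^+ l d f * beta u g ^+ l e f = X ->
  beta u g ^+ l c e * beta u g ^+ l c f * beta u g ^+ l e f = X ->
  beta u g ^+ l c d * beta u g ^+ l c f * beta u g ^+ l d f = X ->
  beta u g ^+ l c d * beta u g ^+ l c e * beta u g ^+ l d e = X ->
  let x := (nu c + (eta d e + eta d f + eta e f))%N in
  [\/ x = (nu d + (eta c e + eta c f + eta e f))%N, x = (nu e + (eta c d + eta c f + eta d f))%N |
     x = (nu f + (eta c d + eta c e + eta d e))%N].
Proof.
move=> U X0 E1 E2 E3 E4; have E := vP3 U; move: (U).
rewrite /= !inE !negb_or -!andbA => /and5P[cd ce cf de /and3P[df ef _]].
have [] := @xm_no_lone C (a c * (w d e * w d f * w e f)) (- (a d * (w c e * w c f * w e f)))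
  (a e * (w c d * w c f * w d f)) (- (a f * (w c d * w c e * w d e)))
  (nu c + (eta d e + eta d f + eta e f)) (nu d + (eta c e + eta c f + eta e f))
  (nu e + (eta c d + eta c f + eta d f)) (nu f + (eta c d + eta c e + eta d e)).
- by rewrite !mulf_neq0 ?w0.
- apply: (mulfI X0); rewrite mulr0 -[RHS]E /v /W !xmN -!xmM -/(n _) -/(n _) !mulrDr.
  by rewrite -{1}E1 !mulrN -{1}E2 -{1}E3 -{1}E4 -/(n e) -/(n f); ring.
- by move=> h; apply: Or31.
- by case=> h; [apply: Or32|apply: Or33].
Qed.

(** By [eta_quad] there are integers A_c with A_c + A_d = 2 eta_cd, and by [lone_free] no value of
    nu - A occurs once in a subset of four points, whence nu - A is constant on three points. Then
    [vP4] is homogeneous and shows that D is a square up to a square. *)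
Lemma all_same (x : bool) (p1 p2 p3 p4 p5 : T) : uniq [:: p1; p2; p3; p4; p5] ->
  (forall c d, c \in [:: p1; p2; p3; p4; p5] -> d \in [:: p1; p2; p3; p4; p5] -> c != d -> l c d = x) -> False.
Proof.
set s := [:: p1; p2; p3; p4; p5] => U Hl.
have [i1 i2 i3 i4 i5] : [/\ p1 \in s, p2 \in s, p3 \in s, p4 \in s & p5 \in s].
  by rewrite /s !inE !eqxx !orbT.
have b0' k : beta u g ^+ k != 0 by rewrite expf_neq0 ?beta_neq0.
have sub4 c d e f : uniq [:: c; d; e; f] -> [&& c \in s, d \in s, e \in s & f \in s] ->
   [/\ l c d = x, l c e = x & l c f = x] /\ [/\ l d e = x, l d f = x & l e f = x].
  move=> V /and4P[hc hd he hf]; move: V.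
  rewrite /= !inE !negb_or -!andbA => /and5P[cd ce cf de /and3P[df ef _]].
  by split; split; apply: Hl.
have Q c d e f : uniq [:: c; d; e; f] -> [&& c \in s, d \in s, e \in s & f \in s] ->
   (eta c d + eta e f = eta c e + eta d f /\ eta c e + eta d f = eta c f + eta d e)%N.
  move=> V is4; have [[e1 e2 e3] [e4 e5 e6]] := sub4 _ _ _ _ V is4.
  by apply: (@eta_quad _ _ _ _ (beta u g ^+ x * beta u g ^+ x)); rewrite ?mulf_neq0 // ?e1 ?e2 ?e3 ?e4 ?e5 ?e6.
have L c d e f : uniq [:: c; d; e; f] -> [&& c \in s, d \in s, e \in s & f \in s] ->
  let x := (nu c + (eta d e + eta d f + eta e f))%N in
  [\/ x = (nu d + (eta c e + eta c f + eta e f))%N, x = (nu e + (eta c d + eta c f + eta d f))%N |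
     x = (nu f + (eta c d + eta c e + eta d e))%N].
  move=> V is4; have [[e1 e2 e3] [e4 e5 e6]] := sub4 _ _ _ _ V is4.
  by apply: (@lone_free _ _ _ _ (beta u g ^+ x * beta u g ^+ x * beta u g ^+ x)); rewrite ?mulf_neq0 // ?e1 ?e2 ?e3 ?e4 ?e5 ?e6.
move: (U); rewrite /= !inE !negb_or -!andbA.
move=> /and5P[n12 n13 n14 n15 /and5P[n23 n24 n25 n34 /and3P[n35 n45 _]]].
have S c d : c != d -> eta c d = eta d c by apply: etaS.
have uq : [/\ uniq [:: p1; p2; p3; p4], uniq [:: p1; p2; p3; p5], uniq [:: p1; p2; p4; p5],
   uniq [:: p1; p3; p4; p5] & uniq [:: p2; p3; p4; p5]].
  by rewrite /= !inE !negb_or n12 n13 n14 n15 n23 n24 n25 n34 n35 n45.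
case: uq => u5 u4 u3 u2 u1.
have [q1 q1'] := Q _ _ _ _ u5 (introT and4P (And4 i1 i2 i3 i4)).
have [q2 q2'] := Q _ _ _ _ u4 (introT and4P (And4 i1 i2 i3 i5)).
have [q3 q3'] := Q _ _ _ _ u3 (introT and4P (And4 i1 i2 i4 i5)).
have [q4 q4'] := Q _ _ _ _ u2 (introT and4P (And4 i1 i3 i4 i5)).
have [q5 q5'] := Q _ _ _ _ u1 (introT and4P (And4 i2 i3 i4 i5)).
have [s12 s13 s14 s15 s23] : [/\ eta p2 p1 = eta p1 p2, eta p3 p1 = eta p1 p3, eta p4 p1 = eta p1 p4,
   eta p5 p1 = eta p1 p5 & eta p3 p2 = eta p2 p3] by split; apply: S; rewrite eq_sym.
have [s24 s25 s34 s35 s45] : [/\ eta p4 p2 = eta p2 p4, eta p5 p2 = eta p2 p5, eta p4 p3 = eta p3 p4,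
   eta p5 p3 = eta p3 p5 & eta p5 p4 = eta p4 p5] by split; apply: S; rewrite eq_sym.
have uqp (r q : seq T) : uniq r -> perm_eq q r -> uniq q by move=> h /perm_uniq ->.
have LL c d e f : uniq [:: c; d; e; f] -> c \in s -> d \in s -> e \in s -> f \in s -> 
  [\/ (nu c + (eta d e + eta d f + eta e f))%N = (nu d + (eta c e + eta c f + eta e f))%N,
      (nu c + (eta d e + eta d f + eta e f))%N = (nu e + (eta c d + eta c f + eta d f))%N |
     (nu c + (eta d e + eta d f + eta e f))%N = (nu f + (eta c d + eta c e + eta d e))%N].
  by move=> V ic id ie if'; apply: (L c d e f V); apply/and4P; split.
have UU c d e f : [&& c != d, c != e, c != f, d != e, d != f & e != f] -> uniq [:: c; d; e; f].
  by move=> /and5P[h1 h2 h3 h4 /andP[h5 h6]]; rewrite /= !inE !negb_or h1 h2 h3 h4 h5 h6.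
have SY (c d : T) : c != d -> (d != c) by rewrite eq_sym.
(* by [eta_quad], eta_cd + eta_ce - eta_de depends on c only *)
pose A1 : int := (eta p1 p2)%:Z + (eta p1 p3)%:Z - (eta p2 p3)%:Z.
pose A2 : int := (eta p1 p2)%:Z + (eta p2 p3)%:Z - (eta p1 p3)%:Z.
pose A3 : int := (eta p1 p3)%:Z + (eta p2 p3)%:Z - (eta p1 p2)%:Z.
pose A4 : int := (eta p1 p4)%:Z + (eta p2 p4)%:Z - (eta p1 p2)%:Z.
pose A5 : int := (eta p1 p5)%:Z + (eta p2 p5)%:Z - (eta p1 p2)%:Z.
pose f1 : int := (nu p1)%:Z - A1.
pose f2 : int := (nu p2)%:Z - A2.
pose f3 : int := (nu p3)%:Z - A3.
pose f4 : int := (nu p4)%:Z - A4.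
pose f5 : int := (nu p5)%:Z - A5.
have h12 : A1 + A2 = 2 * (eta p1 p2)%:Z by move: q1 q1' q2 q2' q3 q3' q4 q4' q5 q5'; rewrite /A1 /A2; clear; lia.
have h13 : A1 + A3 = 2 * (eta p1 p3)%:Z by move: q1 q1' q2 q2' q3 q3' q4 q4' q5 q5'; rewrite /A1 /A3; clear; lia.
have h14 : A1 + A4 = 2 * (eta p1 p4)%:Z by move: q1 q1' q2 q2' q3 q3' q4 q4' q5 q5'; rewrite /A1 /A4; clear; lia.
have h15 : A1 + A5 = 2 * (eta p1 p5)%:Z by move: q1 q1' q2 q2' q3 q3' q4 q4' q5 q5'; rewrite /A1 /A5; clear; lia.
have h23 : A2 + A3 = 2 * (eta p2 p3)%:Z by move: q1 q1' q2 q2' q3 q3' q4 q4' q5 q5'; rewrite /A2 /A3; clear; lia.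
have h24 : A2 + A4 = 2 * (eta p2 p4)%:Z by move: q1 q1' q2 q2' q3 q3' q4 q4' q5 q5'; rewrite /A2 /A4; clear; lia.
have h25 : A2 + A5 = 2 * (eta p2 p5)%:Z by move: q1 q1' q2 q2' q3 q3' q4 q4' q5 q5'; rewrite /A2 /A5; clear; lia.
have h34 : A3 + A4 = 2 * (eta p3 p4)%:Z by move: q1 q1' q2 q2' q3 q3' q4 q4' q5 q5'; rewrite /A3 /A4; clear; lia.
have h35 : A3 + A5 = 2 * (eta p3 p5)%:Z by move: q1 q1' q2 q2' q3 q3' q4 q4' q5 q5'; rewrite /A3 /A5; clear; lia.
have h45 : A4 + A5 = 2 * (eta p4 p5)%:Z by move: q1 q1' q2 q2' q3 q3' q4 q4' q5 q5'; rewrite /A4 /A5; clear; lia.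
have [||||||||||e12 e23] := @five_equal f1 f2 f3 f4 f5.
- have h : uniq [:: p1; p2; p3; p4] by apply: UU; repeat (apply/andP; split); rewrite // eq_sym.
  have := LL p1 p2 p3 p4 h i1 i2 i3 i4; rewrite ?(s12, s13, s14, s15, s23, s24, s25, s34, s35, s45); move: h12 h13 h14 h23 h24 h34.
  by rewrite /f1 /f2 /f3 /f4; move: (A1) (A2) (A3) (A4); clear; do 10 move=> ?; case; lia.
- have h : uniq [:: p2; p1; p3; p4] by apply: UU; repeat (apply/andP; split); rewrite // eq_sym.
  have := LL p2 p1 p3 p4 h i2 i1 i3 i4; rewrite ?(s12, s13, s14, s15, s23, s24, s25, s34, s35, s45); move: h12 h23 h24 h13 h14 h34.
  by rewrite /f2 /f1 /f3 /f4; move: (A2) (A1) (A3) (A4); clear; do 10 move=> ?; case; lia.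
- have h : uniq [:: p3; p1; p2; p4] by apply: UU; repeat (apply/andP; split); rewrite // eq_sym.
  have := LL p3 p1 p2 p4 h i3 i1 i2 i4; rewrite ?(s12, s13, s14, s15, s23, s24, s25, s34, s35, s45); move: h13 h23 h34 h12 h14 h24.
  by rewrite /f3 /f1 /f2 /f4; move: (A3) (A1) (A2) (A4); clear; do 10 move=> ?; case; lia.
- have h : uniq [:: p4; p1; p2; p3] by apply: UU; repeat (apply/andP; split); rewrite // eq_sym.
  have := LL p4 p1 p2 p3 h i4 i1 i2 i3; rewrite ?(s12, s13, s14, s15, s23, s24, s25, s34, s35, s45); move: h14 h24 h34 h12 h13 h23.
  by rewrite /f4 /f1 /f2 /f3; move: (A4) (A1) (A2) (A3); clear; do 10 move=> ?; case; lia.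
- have h : uniq [:: p3; p1; p2; p5] by apply: UU; repeat (apply/andP; split); rewrite // eq_sym.
  have := LL p3 p1 p2 p5 h i3 i1 i2 i5; rewrite ?(s12, s13, s14, s15, s23, s24, s25, s34, s35, s45); move: h13 h23 h35 h12 h15 h25.
  by rewrite /f3 /f1 /f2 /f5; move: (A3) (A1) (A2) (A5); clear; do 10 move=> ?; case; lia.
- have h : uniq [:: p1; p3; p4; p5] by apply: UU; repeat (apply/andP; split); rewrite // eq_sym.
  have := LL p1 p3 p4 p5 h i1 i3 i4 i5; rewrite ?(s12, s13, s14, s15, s23, s24, s25, s34, s35, s45); move: h13 h14 h15 h34 h35 h45.
  by rewrite /f1 /f3 /f4 /f5; move: (A1) (A3) (A4) (A5); clear; do 10 move=> ?; case; lia.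
- have h : uniq [:: p2; p1; p3; p5] by apply: UU; repeat (apply/andP; split); rewrite // eq_sym.
  have := LL p2 p1 p3 p5 h i2 i1 i3 i5; rewrite ?(s12, s13, s14, s15, s23, s24, s25, s34, s35, s45); move: h12 h23 h25 h13 h15 h35.
  by rewrite /f2 /f1 /f3 /f5; move: (A2) (A1) (A3) (A5); clear; do 10 move=> ?; case; lia.
- have h : uniq [:: p1; p2; p4; p5] by apply: UU; repeat (apply/andP; split); rewrite // eq_sym.
  have := LL p1 p2 p4 p5 h i1 i2 i4 i5; rewrite ?(s12, s13, s14, s15, s23, s24, s25, s34, s35, s45); move: h12 h14 h15 h24 h25 h45.
  by rewrite /f1 /f2 /f4 /f5; move: (A1) (A2) (A4) (A5); clear; do 10 move=> ?; case; lia.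
- have h : uniq [:: p2; p1; p4; p5] by apply: UU; repeat (apply/andP; split); rewrite // eq_sym.
  have := LL p2 p1 p4 p5 h i2 i1 i4 i5; rewrite ?(s12, s13, s14, s15, s23, s24, s25, s34, s35, s45); move: h12 h24 h25 h14 h15 h45.
  by rewrite /f2 /f1 /f4 /f5; move: (A2) (A1) (A4) (A5); clear; do 10 move=> ?; case; lia.
- have h : uniq [:: p1; p2; p3; p5] by apply: UU; repeat (apply/andP; split); rewrite // eq_sym.
  have := LL p1 p2 p3 p5 h i1 i2 i3 i5; rewrite ?(s12, s13, s14, s15, s23, s24, s25, s34, s35, s45); move: h12 h13 h15 h23 h25 h35.
  by rewrite /f1 /f2 /f3 /f5; move: (A1) (A2) (A3) (A5); clear; do 10 move=> ?; case; lia.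
have E := @vP4 p1 p2 p3; rewrite /= !inE !negb_or n12 n13 n23 in E; move: (E isT) => {}E.
pose B := beta u g ^+ x.
have vB c d : c \in s -> d \in s -> c != d -> v c d = W c d * B by move=> h1 h2 h3; rewrite /v Hl.
have E' : W p1 p2 ^+ 2 * n p3 = W p2 p3 ^+ 2 * n p1 + W p3 p1 ^+ 2 * n p2 + W p2 p3 * W p3 p1 * t p1 p2.
  apply: (mulfI (expf_neq0 2 (b0' x))); rewrite -/B.
  by move: E; rewrite !vB // 1?eq_sym // => E; ring: E.
pose K := (2 * eta p1 p2 + nu p3)%N.
have sq c d : W c d ^+ 2 = xm (w c d ^+ 2) (2 * eta c d) by rewrite mul2n -addnn /W !expr2 -xmM.
have K1 : (2 * eta p2 p3 + nu p1 = K)%N by move: e12 e23 s13; rewrite /f1 /f2 /f3 /A1 /A2 /A3 /K; clear; lia.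
have K2 : (2 * eta p3 p1 + nu p2 = K)%N by move: e12 e23 s13; rewrite /f1 /f2 /f3 /A1 /A2 /A3 /K; clear; lia.
pose r := w p1 p2 ^+ 2 * a p3 - w p2 p3 ^+ 2 * a p1 - w p3 p1 ^+ 2 * a p2.
have tm (x1 y1 : C) i j : xm (x1 ^+ 2 * y1) (2 * i + j) = xm x1 i ^+ 2 * xm y1 j.
  by rewrite (expr2 (xm _ _)) !xmM; congr (xm _ _); first [ring|lia].
have Er : W p2 p3 * W p3 p1 * t p1 p2 = xm r K.
  have -> : xm r K = W p1 p2 ^+ 2 * n p3 - W p2 p3 ^+ 2 * n p1 - W p3 p1 ^+ 2 * n p2.
    by rewrite /W /n -!tm K1 K2 -/K /r /xm !polyCB; ring.
  by rewrite E'; ring.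
pose q := sqrtC (r ^+ 2 - 4 * (a p1 * a p2 * w p2 p3 ^+ 2 * w p3 p1 ^+ 2)).
apply: (@D_not_square p1 p2 (W p2 p3 * W p3 p1) (xm q K) n12).
  by rewrite mulf_neq0 // xm_eq0 w0 // eq_sym.
have -> : xm q K ^+ 2 = xm r K ^+ 2 - 4 * (n p1 * n p2 * W p2 p3 ^+ 2 * W p3 p1 ^+ 2).
  have -> : n p1 * n p2 * W p2 p3 ^+ 2 * W p3 p1 ^+ 2
      = xm (a p1 * a p2 * w p2 p3 ^+ 2 * w p3 p1 ^+ 2) (K + K).
    rewrite /n /W !expr2 !xmM; congr (xm _ _); first [ring|by move: K1 K2; clear; lia].
  rewrite !(expr2 (xm _ K)) !xmM -(expr2 q) sqrtCK -(expr2 r).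
  by rewrite /xm polyCB (polyCM 4) (polyC_natr _ 4); ring.
by rewrite -Er /D; ring.
Qed.

Lemma uniq4 (c d e f : T) : [&& c != d, c != e, c != f, d != e, d != f & e != f] -> uniq [:: c; d; e; f].
Proof. by move=> /and5P[h1 h2 h3 h4 /andP[h5 h6]]; rewrite /= !inE !negb_or h1 h2 h3 h4 h5 h6. Qed.
Lemma uniq3 (c d e : T) : [&& c != d, c != e & d != e] -> uniq [:: c; d; e].
Proof. by move=> /and3P[h1 h2 h3]; rewrite /= !inE !negb_or h1 h2 h3. Qed.

Lemma l_out c d k : uniq [:: c; d; k] -> l c d -> l d k = l c k.
Proof.
move=> U lcd; move: (U); rewrite /= !inE !negb_or -!andbA => /and4P[cd ck dk _].
apply/idP/idP => h; first exact: l_trans U lcd h.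
by apply: (@l_trans d c k) => //; rewrite ?(lS (c := d)) // 1?eq_sym // uniq3 // eq_sym cd dk ck.
Qed.

(** By [l_one_pair] the differences eta_cx - eta_dx, for x one of the three other points, differ
    pairwise by g in absolute value, but three integers cannot. *)
Lemma class_of_two c d e f k : uniq [:: c; d; e; f; k] -> l c d -> ~~ l c e -> ~~ l c f -> ~~ l c k -> False.
Proof.
rewrite /= !inE !negb_or -!andbA => /and5P[cd ce cf ck /and5P[de df dk ef /and3P[ek fk _]]].
move=> lcd nce ncf nck.
have nn x y : c != x -> c != y -> d != x -> d != y -> x != y -> ~~ l c x -> ~~ l x y.
  move=> cx cy dx dy xy; apply: contra => lxy; apply: (@l_pairs c d x y) => //.
  by apply: uniq4; rewrite cd cx cy dx dy xy.
have U1 : uniq [:: c; d; e; f] by apply: uniq4; rewrite cd ce cf de df ef.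
have U2 : uniq [:: c; d; e; k] by apply: uniq4; rewrite cd ce ck de dk ek.
have U3 : uniq [:: c; d; f; k] by apply: uniq4; rewrite cd cf ck df dk fk.
have := l_one_pair U1 lcd nce ncf (nn e f ce cf de df ef nce).
have := l_one_pair U2 lcd nce nck (nn e k ce ck de dk ek nce).
have := l_one_pair U3 lcd ncf nck (nn f k cf ck df dk fk ncf).
by move: g0; clear; lia.
Qed.

(** The argument of [class_of_two], for the differences eta_xf - eta_xk. *)
Lemma class_of_three c d e f k : uniq [:: c; d; e; f; k] -> l c d -> l c e -> ~~ l c f -> ~~ l c k -> False.
Proof.
rewrite /= !inE !negb_or -!andbA => /and5P[cd ce cf ck /and5P[de df dk ef /and3P[ek fk _]]].
move=> lcd lce ncf nck.
have nfk : ~~ l f k.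
  by apply: contra ncf => lfk; apply: (@l_pairs c d f k) => //; apply: uniq4; rewrite cd cf ck df dk fk.
have lde : l d e by rewrite (@l_out c) // uniq3 // cd ce de.
have ndf : ~~ l d f by rewrite (@l_out c) // uniq3 // cd cf df.
have ndk : ~~ l d k by rewrite (@l_out c) // uniq3 // cd ck dk.
have U1 : uniq [:: c; d; f; k] by apply: uniq4; rewrite cd cf ck df dk fk.
have U2 : uniq [:: c; e; f; k] by apply: uniq4; rewrite ce cf ck ef ek fk.
have U3 : uniq [:: d; e; f; k] by apply: uniq4; rewrite de df dk ef ek fk.
have := l_one_pair U1 lcd ncf nck nfk; have := l_one_pair U2 lce ncf nck nfk.
have := l_one_pair U3 lde ndf ndk nfk.
by move: g0; clear; lia.
Qed.

(** Here [vP3] writes a multiple of beta^2 as a sum of three monomials. *)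
Lemma class_triple c d e k : uniq [:: c; d; e; k] -> l c d -> l c e -> ~~ l c k ->
  let x y := ((nu y)%:Z - 2 * (eta y k)%:Z) in
  (x c - x d = g%:Z \/ x c - x d = - g%:Z \/ x c - x d = 2 * g%:Z \/ x c - x d = - (2 * g%:Z)).
Proof.
move=> U lcd lce nck; have E := vP3 U; move: (U).
rewrite /= !inE !negb_or -!andbA => /and5P[cd ce ck de /and3P[dk ek _]].
have lde : l d e by rewrite (@l_out c) // uniq3 // cd ce de.
have ndk : ~~ l d k by rewrite (@l_out c) // uniq3 // cd ck dk.
have nek : ~~ l e k by rewrite (@l_out c) // uniq3 // ce ck ek.
have b0' := beta_neq0 u g0.
have [] := @eta_quad c d e k (beta u g) U b0'; rewrite ?lcd ?lce ?lde ?(negbTE nck) ?(negbTE ndk) ?(negbTE nek) ?mulr1 ?mul1r //.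
move=> q1 q2.
have [] := @beta2_three C u g u0 g0 (a k * (w c d * w c e * w d e)) (a c * (w d e * w d k * w e k)) (- (a d * (w c e * w c k * w e k)))
  (a e * (w c d * w c k * w d k)) (nu k + (eta c d + eta c e + eta d e))
  (nu c + (eta d e + eta d k + eta e k)) (nu d + (eta c e + eta c k + eta e k))
  (nu e + (eta c d + eta c k + eta d k)).
- by rewrite !mulf_neq0 ?w0.
- apply: (mulfI b0'); apply/eqP; rewrite eq_sym -subr_eq0; apply/eqP; rewrite -[RHS]E /v /W !xmN -!xmM.
  rewrite lcd lce lde (negbTE nck) (negbTE ndk) (negbTE nek) !expr1 !expr0 -!/(n _); rewrite -/(n d) -/(n e) -/(n k); ring.
- move=> h1 h2 h3; move: q1 q2 h1 h2 h3 g0; clear; lia.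
Qed.

(** Four integers cannot differ pairwise by g or 2 g in absolute value. *)
Lemma class_of_four c d e f k : uniq [:: c; d; e; f; k] -> l c d -> l c e -> l c f -> ~~ l c k -> False.
Proof.
rewrite /= !inE !negb_or -!andbA => /and5P[cd ce cf ck /and5P[de df dk ef /and3P[ek fk _]]].
move=> lcd lce lcf nck.
have lde : l d e by rewrite (@l_out c) // uniq3 // cd ce de.
have ldf : l d f by rewrite (@l_out c) // uniq3 // cd cf df.
have ldc : l d c by rewrite lS // eq_sym.
have lec : l e c by rewrite lS // eq_sym.
have lef : l e f by rewrite (@l_out c) // uniq3 // ce cf ef.
have ndk : ~~ l d k by rewrite (@l_out c) // uniq3 // cd ck dk.
have nek : ~~ l e k by rewrite (@l_out c) // uniq3 // ce ck ek.
have h1 := @class_triple c d e k _ lcd lce nck.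
have h2 := @class_triple c e d k _ lce lcd nck.
have h3 := @class_triple c f d k _ lcf lcd nck.
have h4 := @class_triple d e c k _ lde ldc ndk.
have h5 := @class_triple d f c k _ ldf ldc ndk.
have h6 := @class_triple e f c k _ lef lec nek.
move: h1 h2 h3 h4 h5 h6 => /(_ (uniq4 _)) h1 /(_ (uniq4 _)) h2 /(_ (uniq4 _)) h3 /(_ (uniq4 _)) h4 /(_ (uniq4 _)) h5 /(_ (uniq4 _)) h6.
move: h1 h2 h3 h4 h5 h6; rewrite cd ce cf ck de df dk ef ek fk (eq_sym d c) (eq_sym e c) (eq_sym e d) (eq_sym f d) (eq_sym f c) cd ce cf df de.
move=> /(_ isT) h1 /(_ isT) h2 /(_ isT) h3 /(_ isT) h4 /(_ isT) h5 /(_ isT) h6.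
move: h1 h2 h3 h4 h5 h6 g0; clear => /=.
move: ((nu c)%:Z - _) ((nu d)%:Z - _) ((nu e)%:Z - _) ((nu f)%:Z - _) => x1 x2 x3 x4.
by move=> [h1|[h1|[h1|h1]]] [h2|[h2|[h2|h2]]] [h3|[h3|[h3|h3]]]; lia.
Qed.

(** By [l_trans] the pairs on which beta occurs form an equivalence relation, so a pair lies in a
    class of two, three, four or five points. *)
Lemma endgame (p1 p2 p3 p4 p5 : T) : uniq [:: p1; p2; p3; p4; p5] -> False.
Proof.
set s := [:: p1; p2; p3; p4; p5] => U.
have [|nall] := EM (forall c d, c \in s -> d \in s -> c != d -> l c d = false); first exact: all_same U.
have [c [d [cs ds cd lcd]]] : exists c d, [/\ c \in s, d \in s, c != d & l c d].
  apply: contrapT => no; apply: nall => c d cs ds cd; apply/negbTE/negP => lcd; apply: no.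
  by exists c, d.
have P1 : perm_eq s (c :: rem c s) by apply: perm_to_rem.
have dr : d \in rem c s by move: ds; rewrite (perm_mem P1) inE eq_sym (negbTE cd).
have P2' : perm_eq s (c :: d :: rem d (rem c s)).
  by apply: perm_trans P1 _; rewrite perm_cons; apply: perm_to_rem.
have := perm_size P2'; have := perm_uniq P2'; rewrite U.
case: (rem d (rem c s)) => [|e [|f [|k [|? ?]]]] // /esym V _.
have Vp (x y z : T) : perm_eq [:: x; y; z] [:: e; f; k] -> uniq [:: c; d; x; y; z].
  by move=> P; rewrite (@perm_uniq _ _ [:: c; d; e; f; k]) // !perm_cons.
have pp := perm_refl [:: e; f; k].
have p132 : perm_eq [:: e; k; f] [:: e; f; k] by rewrite perm_cons (perm_catC [:: k] [:: f]).
have p213 : perm_eq [:: f; e; k] [:: e; f; k] by rewrite (perm_catCA [:: f] [:: e] [:: k]).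
have p231 : perm_eq [:: f; k; e] [:: e; f; k] by rewrite (perm_catC [:: f; k] [:: e]).
have p312 : perm_eq [:: k; e; f] [:: e; f; k] by rewrite (perm_catC [:: k] [:: e; f]).
have [le|ne'] := boolP (l c e); have [lf|nf] := boolP (l c f); have [lk|nk] := boolP (l c k).
- apply: (@all_same true c d e f k V) => x y.
  have Lc z : z \in [:: c; d; e; f; k] -> z != c -> l c z.
    by rewrite !inE => /or4P[/eqP->|/eqP->|/eqP->|/orP[]/eqP->] //; rewrite eqxx.
  move=> xs ys xy; have [xc|xc] := eqVneq x c; first by subst x; apply: Lc => //; rewrite eq_sym.
  have [yc|yc] := eqVneq y c; first by subst y; rewrite lS //; apply: Lc.
  by rewrite (@l_out c x y) ?Lc // uniq3 // eq_sym xc eq_sym yc xy.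
- exact: (class_of_four V).
- exact: (class_of_four (Vp _ _ _ p132)).
- exact: (class_of_three V).
- exact: (class_of_four (Vp _ _ _ p231)).
- exact: (class_of_three (Vp _ _ _ p213)).
- exact: (class_of_three (Vp _ _ _ p312)).
- exact: (class_of_two V).
Qed.
End Endgame.

(** The contradiction shows that [ne] fails for some pair among five points. *)
Lemma five_points_poly (p1 p2 p3 p4 p5 : T) : uniq [:: p1; p2; p3; p4; p5] -> False.
Proof.
have [u [g [u0 g0 [l [w [eta [H [H0 w0 gE]]]]]]]] := five_setup.
exact: (endgame u0 g0 H0 w0 gE).
Qed.
End FivePoints.

(** * Rational conjugates and five pairs over the function field *)

Section Transfer.
Variables (C : numClosedFieldType) (d : nat) (K : laurent_field C d).
Implicit Types (x y : K) (e : 'rV[int]_d).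
Local Notation nonneg e := (forall u, 0 <= e ord0 u).

Definition pmn (c : C) e : {mpoly C[d]} := c%:MP * 'X_[multi e].
Lemma embed_pmn c e : nonneg e -> embed K (pmn c e) = mn K c e.
Proof. by move=> e0; rewrite /pmn rmorphM /mn monom_multi. Qed.
Lemma spec_pmn w c e : nonneg e -> spec w (pmn c e) = xm c `|dotw w e|.
Proof. by move=> e0; rewrite /pmn specM specC specX. Qed.
Lemma dotw_ge0 w e : nonneg e -> 0 <= dotw w e.
Proof. by move=> e0; rewrite dotw_abs. Qed.
Lemma absz_dotw_inj w (s : seq 'rV[int]_d) : {in s &, injective (dotw w)} -> (forall e, e \in s -> nonneg e) ->
  forall e e', e \in s -> e' \in s -> `|dotw w e|%N = `|dotw w e'|%N -> e = e'.
Proof.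
move=> inj nn e e' es es' E; apply: inj => //.
by rewrite -(gez0_abs (dotw_ge0 w (nn _ es))) -(gez0_abs (dotw_ge0 w (nn _ es'))) E.
Qed.

Lemma specD w (p q : {mpoly C[d]}) : spec w (p + q) = spec w p + spec w q.
Proof. exact: rmorphD. Qed.
Lemma specN w (p : {mpoly C[d]}) : spec w (- p) = - spec w p.
Proof. exact: rmorphN. Qed.
Lemma spec0 w : spec w (0 : {mpoly C[d]}) = 0.
Proof. exact: rmorph0. Qed.
Lemma spec_nat w k : spec w (k%:R : {mpoly C[d]}) = k%:R.
Proof. exact: rmorph_nat. Qed.

(** The discriminant of the equation of x is a Heron form and the square of a fraction. A
    specialisation that keeps distinct exponents distinct and the denominator non-zero leads to
    [heron_square], so that x x' and (1 - x)(1 - x') are constant and x is algebraic over C. *)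
Lemma rational_cst x x' (p q : {mpoly C[d]}) : q != 0 -> x * embed K q = embed K p ->
  mono (x * x') -> mono ((1 - x) * (1 - x')) -> cst x.
Proof.
move=> q0 Ex [cN [eN [cN0 EN]]] [cM [eM [cM0 EM]]].
have [E HE] := shift_exps [:: 0; eN; eM].
have [w [wq winj]] := specialization [:: 0 + E; eN + E; eM + E] q0.
have nn e : e \in [:: 0 + E; eN + E; eM + E] -> nonneg e.
  by rewrite !inE => /or3P[] /eqP -> ; apply: HE; rewrite !inE eqxx ?orbT.
have [n0 n1 n2] : [/\ nonneg (0 + E), nonneg (eN + E) & nonneg (eM + E)].
  by split; apply: nn; rewrite !inE eqxx ?orbT.
pose P0 := pmn 1 (0 + E); pose P1 := pmn cN (eN + E); pose P2 := pmn cM (eM + E).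
have e0 : embed K P0 = monom K E by rewrite embed_pmn // /mn add0r rmorph1 mul1r.
have e1 : embed K P1 = (x * x') * monom K E by rewrite embed_pmn // EN /mn monomD; ring.
have e2 : embed K P2 = ((1 - x) * (1 - x')) * monom K E by rewrite embed_pmn // EM /mn monomD; ring.
have s0 := spec_pmn w 1 n0; have s1 := spec_pmn w cN n1; have s2 := spec_pmn w cM n2.
rewrite -/P0 in s0; rewrite -/P1 in s1; rewrite -/P2 in s2.
clearbody P0 P1 P2.
(* (2 x - (x + x'))^2 is the discriminant, and 2 x = 2 p / q *)
have H : heron P0 P1 P2 * (q * q) = (P0 * p * 2 - (P0 + P1 - P2) * q) * (P0 * p * 2 - (P0 + P1 - P2) * q).
  apply: (@embed_inj _ _ K).
  rewrite /heron !expr2 !(rmorphM, rmorphB, rmorphD) /= -Ex e0 e1 e2 rmorph1; ring.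
have HS : heron (spec w P0) (spec w P1) (spec w P2) * (spec w q) ^+ 2 =
    (spec w P0 * spec w p * 2 - (spec w P0 + spec w P1 - spec w P2) * spec w q) ^+ 2.
  move: (congr1 (spec w) H); rewrite /heron !expr2 !(spec_nat w 2, specM, specN, specD).
  by move=> ->.
rewrite s0 s1 s2 in HS.
have [E1 E2] := heron_square (oner_neq0 _) cN0 cM0 wq HS.
have ai := absz_dotw_inj winj nn.
have h1 : 0 + E = eN + E by apply: ai E1; rewrite !inE eqxx ?orbT.
have h2 : eN + E = eM + E by apply: ai E2; rewrite !inE eqxx ?orbT.
have z1 : eN = 0 by apply: (addIr E).
have z2 : eM = 0 by apply: (addIr E); rewrite -h2 h1.
have c1 : cst (x * x') by exists cN; rewrite EN /mn z1 monom0 mulr1.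
have c2 : cst ((1 - x) * (1 - x')) by exists cM; rewrite EM /mn z2 monom0 mulr1.
apply: (@cst_quad _ _ _ x 1 (- (1 + x * x' - (1 - x) * (1 - x'))) (x * x')) => //.
- exact: cst1.
- by apply: cstN; apply: cstB => //; apply: cstD => //; exact: cst1.
- by ring.
- by left; rewrite oner_eq0.
Qed.

(** A specialisation to one variable that keeps all exponents distinct leads to
    [five_points_poly]. It is applied to polynomial expressions in the monomials only, as x_c and
    x_c' need not be in its domain. *)
Lemma five_points (T : finType) (x x' : T -> K) (p1 p2 p3 p4 p5 : T) :
  uniq [:: p1; p2; p3; p4; p5] -> (forall c, mono (x c * x' c)) ->
  (forall c c', c != c' -> mono ((x c - x c') * (x' c - x' c'))) ->
  exists c c', c != c' /\ (cst (x c * x' c / (x c' * x' c')) /\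
     cst ((x c - x c') * (x' c - x' c') / (x c * x' c))).
Proof.
move=> U mN mM; apply: contrapT => no.
have WN c : exists f : C * 'rV[int]_d, f.1 != 0 /\ x c * x' c = mn K f.1 f.2.
  by have [a [e [a0 ->]]] := mN c; exists (a, e).
have [fN HN] := choice WN.
have WM (p : T * T) : exists f : C * 'rV[int]_d, p.1 != p.2 -> f.1 != 0 /\
    (x p.1 - x p.2) * (x' p.1 - x' p.2) = mn K f.1 f.2.
  case: p => c c' /=; have [->|cc] := eqVneq c c'; first by exists (0, 0).
  by have [a [e [a0 E]]] := mM _ _ cc; exists (a, e) => _.
have [fM HM] := choice WM.
pose s := [seq (fN c).2 | c <- enum T] ++ [seq (fM p).2 | p <- enum {: T * T}].
have [E HE] := shift_exps s.
have sN c : (fN c).2 \in s by rewrite mem_cat (map_f (fun c => (fN c).2)) ?mem_enum.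
have sM p : (fM p).2 \in s by rewrite mem_cat (map_f (fun p => (fM p).2)) ?orbT // mem_enum.
pose s' := [seq e + E | e <- s].
have nn e : e \in s' -> nonneg e by case/mapP => e' /HE h ->.
have [w [_ winj]] := specialization s' (oner_neq0 {mpoly C[d]}).
have ai := absz_dotw_inj winj nn.
have sN' c : (fN c).2 + E \in s' by exact: map_f.
have sM' p : (fM p).2 + E \in s' by exact: map_f.
pose n c := pmn (fN c).1 ((fN c).2 + E).
pose m c c' := if c == c' then 0 else pmn (fM (c, c')).1 ((fM (c, c')).2 + E).
pose t c c' := n c + n c' - m c c'.
pose y c := monom K E * x c.
have en c : embed K (n c) = y c * x' c.
  by rewrite embed_pmn; [have [_] := HN c; rewrite /mn monomD /y -mulrA => ->; rewrite /mn; ring|apply: nn].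
have et c c' : embed K (t c c') = y c * x' c' + x' c * y c'.
  rewrite /t rmorphB rmorphD /= !en /m; case: eqVneq => [->|cc]; first by rewrite rmorph0; ring.
  rewrite embed_pmn; last exact: nn.
  have [_ H] := HM (c, c') cc; rewrite /= in H.
  have -> : mn K (fM (c, c')).1 ((fM (c, c')).2 + E) = monom K E * ((x c - x c') * (x' c - x' c')).
    by rewrite H /mn monomD; ring.
  by rewrite /y; ring.
have tr (p q : {mpoly C[d]}) : embed K p = embed K q -> spec w p = spec w q.
  by move=> h; rewrite (embed_inj h).
have sE := (spec_nat w 2, spec_nat w 4, specM, specN, specD).
have rE := (rmorph_nat (embed K) 2, rmorph_nat (embed K) 4, rmorphM (embed K), rmorphN (embed K), rmorphD (embed K)).
have snE c : spec w (n c) = xm (fN c).1 `|dotw w ((fN c).2 + E)| by apply: spec_pmn; exact: nn.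
have smE p : spec w (pmn (fM p).1 ((fM p).2 + E)) = xm (fM p).1 `|dotw w ((fM p).2 + E)|.
  by apply: spec_pmn; exact: nn.
have stE c c' : spec w (t c c') = spec w (n c) + spec w (n c') - spec w (m c c').
  by rewrite /t (specD w (n c + n c')) (specD w (n c)) (specN w (m c c')).
have smn c c' : c != c' -> spec w (m c c') = xm (fM (c, c')).1 `|dotw w ((fM (c, c')).2 + E)|.
  by rewrite /m => /negbTE ->.
have smm c : spec w (m c c) = 0 by rewrite /m eqxx spec0.
clearbody t; clearbody n m.
have UE := U.
move: U => /=; rewrite inE negb_or -!andbA => /and3P[n12 _ _].
apply: (@five_points_poly C T p1 p2 (fun c => (fN c).1) (fun c => `|dotw w ((fN c).2 + E)|%N)
  (fun c c' => (fM (c, c')).1) (fun c c' => `|dotw w ((fM (c, c')).2 + E)|%N) (fun c c' => spec w (t c c'))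
  _ _ _ _ _ n12 _ _ _ _ p1 p2 p3 p4 p5 UE).
- by move=> c; case: (HN c).
- by move=> c c' cc; case: (HM (c, c') cc).
- move=> c c' cc; by rewrite stE !snE smn.
- by move=> c; rewrite stE smm !snE; ring.
- move=> c c' cc [h1 h2]; apply: no; exists c, c'; split=> //.
  have e1 : (fN c).2 = (fN c').2 by apply: (addIr E); apply: ai h1.
  have e2 : (fN c').2 = (fM (c, c')).2 by apply: (addIr E); apply: ai h2.
  have [a0 EN] := HN c; have [a0' EN'] := HN c'; have [b0 EM] := HM (c, c') cc; rewrite /= in EM.
  have q (a b : C) e : cst (mn K a e / mn K b e).
    by exists (a / b); rewrite /mn -mulf_div divff ?monom_neq0 // mulr1 fmorph_div.
  by split; rewrite ?EN ?EN' ?EM -?e2 ?e1; exact: q.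
- move=> c c' e f; rewrite -!snE.
  rewrite !expr2; rewrite -!sE; apply: tr.
  rewrite !rE !et !en; ring.
- move=> c c' e; rewrite -(spec0 w) -!sE; apply: tr; rewrite !rE !et rmorph0; ring.
- move=> c c' e f; rewrite -!snE.
  rewrite -(spec0 w) -!sE; apply: tr; rewrite !rE !et !en rmorph0; ring.
- move=> c c' e; rewrite -!snE.
  rewrite !expr2 -!sE; apply: tr; rewrite !rE !et !en; ring.
Qed.
End Transfer.

(** * Elements of C(t) and quartets among seven points *)

Section Rational.
Variables (C : numClosedFieldType) (d : nat) (K : laurent_field C d).
Implicit Types (x y z : K).

(** Membership in the image of C(t). *)
Definition rat x := exists p q : {mpoly C[d]}, q != 0 /\ x * embed K q = embed K p.

Lemma cst_rat x : cst x -> rat x.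
Proof. by move=> [c ->]; exists c%:MP, 1; rewrite oner_eq0 rmorph1 mulr1. Qed.
Lemma ratD x y : rat x -> rat y -> rat (x + y).
Proof.
move=> [p [q [q0 E]]] [p' [q' [q0' E']]]; exists (p * q' + p' * q), (q * q').
by rewrite mulf_neq0 // rmorphD !rmorphM /= -E -E'; split=> //; ring.
Qed.
Lemma ratM x y : rat x -> rat y -> rat (x * y).
Proof.
move=> [p [q [q0 E]]] [p' [q' [q0' E']]]; exists (p * p'), (q * q').
by rewrite mulf_neq0 // !rmorphM /= -E -E'; split=> //; ring.
Qed.
Lemma ratN x : rat x -> rat (- x).
Proof. by move=> [p [q [q0 E]]]; exists (- p), q; rewrite rmorphN -E; split=> //; ring. Qed.
Lemma ratB x y : rat x -> rat y -> rat (x - y).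
Proof. by move=> hx hy; apply: ratD => //; apply: ratN. Qed.
Lemma ratV x : rat x -> rat x^-1.
Proof.
have [->|x0] := eqVneq x 0; first by rewrite invr0.
move=> [p [q [q0 E]]]; exists q, p; split; last by rewrite -E mulKf.
by rewrite -(embed_eq0 K) -E mulf_neq0 // embed_eq0.
Qed.
Lemma rat_div x y : rat x -> rat y -> rat (x / y).
Proof. by move=> hx hy; apply: ratM => //; apply: ratV. Qed.
Lemma mono_rat x : mono x -> rat x.
Proof.
move=> [c [e [_ ->]]]; apply: ratM; first by apply: cst_rat; exists c.
rewrite /monom; elim/big_ind: _ => [||u _]; first by apply: cst_rat; exact: cst1.
  exact: ratM.
have rX k : rat (embed K 'X_u ^+ k).
  by exists ('X_u ^+ k), 1; rewrite oner_eq0 rmorph1 mulr1 rmorphXn.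
by case: (e ord0 u) => k; [exact: rX|apply: ratV; exact: rX].
Qed.

Lemma rat_mono_cst x x' : rat x -> mono (x * x') -> mono ((1 - x) * (1 - x')) -> cst x.
Proof. by move=> [p [q [q0 E]]]; apply: rational_cst q0 E. Qed.

(** The quadratic equation of x has constant coefficients. *)
Lemma conj_cst x x' : cst (x * x') -> cst ((1 - x) * (1 - x')) -> cst x.
Proof.
move=> c1 c2; apply: (@cst_quad _ _ _ x 1 (- (1 + x * x' - (1 - x) * (1 - x'))) (x * x')) => //.
- exact: cst1.
- by apply: cstN; apply: cstB => //; apply: cstD => //; exact: cst1.
- by ring.
- by left; rewrite oner_eq0.
Qed.

(** The terms a n, b m, c, - m' cancel degree by degree. As m' has a single degree, two of the
    three other terms have the same degree and cancel. *)
Lemma mover u (a b c n m m' : K) : cst a -> cst b -> cst c -> a != 0 -> b != 0 -> c != 0 ->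
  mono n -> mono m -> mono m' -> a * n + b * m + c = m' -> wt u n != 0 \/ wt u m != 0 ->
  [\/ [/\ wt u n = 0, wt u m != 0 & a * n = - c], [/\ wt u m = 0, wt u n != 0 & b * m = - c] |
     [/\ wt u n = wt u m, wt u n != 0 & a * n = - (b * m)]].
Proof.
move=> ca cb cc a0 b0 c0 mn mm mm' E nz.
have n0 : a * n != 0 := mulf_neq0 a0 (mono_neq0 mn).
have m0 : b * m != 0 := mulf_neq0 b0 (mono_neq0 mm).
have m0' := mono_neq0 mm'.
have H (z : int) := @gradeL _ _ K u [:: (wt u n, a * n); (wt u m, b * m); (0, c); (wt u m', - m')] z.
have hs : homs u [:: (wt u n, a * n); (wt u m, b * m); (0, c); (wt u m', - m')].
  split; [|split; [|split; [|split]]] => //=.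
  - by apply: homCl => //; apply: hom_wt.
  - by apply: homCl => //; apply: hom_wt.
  - exact: cst_hom.
  - by apply: homN; apply: hom_wt.
have S0 : foldr (fun p (y : K) => p.2 + y) 0 [:: (wt u n, a * n); (wt u m, b * m); (0, c); (wt u m', - m')] = 0.
  by rewrite /= -E; ring.
have {}H (z : int) := H z hs S0; move: H nz; rewrite /= {hs S0}.
move: (wt u n) (wt u m) (wt u m') => x y w H nz.
have [x0|x0] := eqVneq x 0.
  have {nz} y0 : y != 0 by case: nz; rewrite ?x0 ?eqxx.
  apply: Or31; split=> //.
  have := H y; rewrite x0 eqxx (eq_sym 0 y) (negbTE y0); case: (w =P y) => [wy|_]; last first.
    by rewrite addr0 => /eqP; rewrite (negbTE m0).
  move=> _; have := H 0; rewrite x0 wy eqxx (negbTE y0) addr0 => /eqP.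
  by rewrite addr_eq0 => /eqP.
have [y0|y0] := eqVneq y 0.
  apply: Or32; split=> //.
  have := H x; rewrite y0 eqxx (eq_sym 0 x) (negbTE x0); case: (w =P x) => [wx|_]; last first.
    by rewrite addr0 => /eqP; rewrite (negbTE n0).
  move=> _; have := H 0; rewrite y0 wx eqxx (negbTE x0) addr0 => /eqP.
  by rewrite addr_eq0 => /eqP.
apply: Or33; have := H 0; rewrite (negbTE x0) (negbTE y0) eqxx; case: (w =P 0) => [w0|_]; last first.
  by rewrite addr0 => /eqP; rewrite (negbTE c0).
move=> _; have := H x; rewrite eqxx w0 (eq_sym 0 x) (negbTE x0); case: (y =P x) => [->|_]; last first.
  by rewrite addr0 => /eqP; rewrite (negbTE n0).
by rewrite addr0 => /eqP; rewrite addr_eq0 => /eqP.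
Qed.
End Rational.

Section Combinatorics.

(** The properties of the quartets with constant cross ratio among seven points in a configuration
    in which not all of them are constant. They are contradictory, see [no_qaxioms]. *)
Record qaxioms (q : seq nat -> Prop) : Prop := QAxioms {
  q_perm : forall s t, perm_eq s t -> q s -> q t;
  q_three : forall a b c d e, uniq [:: a; b; c; d; e] -> all (gtn 7) [:: a; b; c; d; e] ->
    q [:: a; b; c; d] -> q [:: a; b; c; e] -> False;
  q_pairs : forall a b c d e f, uniq [:: a; b; c; d; e; f] -> all (gtn 7) [:: a; b; c; d; e; f] ->
    q [:: a; b; c; d] -> q [:: a; b; e; f] -> q [:: c; d; e; f] -> False;
  q_cover : forall a b, (a < 7)%N -> (b < 7)%N -> a != b -> exists c d,
    [/\ uniq [:: a; b; c; d], (c < 7)%N, (d < 7)%N & q [:: a; b; c; d]] }.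

(** The axioms are invariant under permutations, so that quartets can be put in fixed positions. *)
Lemma q_relabel q s : qaxioms q -> perm_eq s (iota 0 7) ->
  qaxioms (fun t => q [seq nth 0%N s i | i <- t]).
Proof.
move=> ax Ps; have sz : size s = 7 by rewrite (perm_size Ps).
have us : uniq s by rewrite (perm_uniq Ps) iota_uniq.
have lt i : (i < 7)%N -> (nth 0%N s i < 7)%N.
  move=> i7; have : nth 0%N s i \in s by rewrite mem_nth ?sz.
  by rewrite (perm_mem Ps) mem_iota.
have un t : all (gtn 7) t -> uniq t -> uniq [seq nth 0%N s i | i <- t].
  move=> /allP h; rewrite map_inj_in_uniq // => i j it jt /eqP.
  by rewrite nth_uniq ?sz; [move/eqP|exact: h|exact: h|].
have al t : all (gtn 7) t -> all (gtn 7) [seq nth 0%N s i | i <- t].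
  by move=> /allP h; apply/allP => _ /mapP[i /h i7 ->]; exact: lt.
split.
- by move=> t t' P; apply: (q_perm ax); apply: perm_map.
- move=> a b c d e U A; apply: (@q_three q ax (nth 0%N s a) (nth 0%N s b) (nth 0%N s c) (nth 0%N s d) (nth 0%N s e)).
    exact: (un [:: a; b; c; d; e]).
  exact: (al [:: a; b; c; d; e]).
- move=> a b c d e f U A; apply: (@q_pairs q ax (nth 0%N s a) (nth 0%N s b) (nth 0%N s c) (nth 0%N s d) (nth 0%N s e) (nth 0%N s f)).
    exact: (un [:: a; b; c; d; e; f]).
  exact: (al [:: a; b; c; d; e; f]).
- move=> a b a7 b7 ab; have ab' : nth 0%N s a != nth 0%N s b by rewrite nth_uniq ?sz.
  have [c [d [U c7 d7 Q]]] := q_cover ax (lt _ a7) (lt _ b7) ab'.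
  have ix x : (x < 7)%N -> (index x s < 7)%N /\ nth 0%N s (index x s) = x.
    move=> x7; have xs : x \in s by rewrite (perm_mem Ps) mem_iota.
    by split; [move: xs; rewrite -index_mem sz|exact: nth_index].
  have [ic Ec] := ix _ c7; have [id Ed] := ix _ d7.
  exists (index c s), (index d s); split=> //; last by rewrite /= Ec Ed.
  by apply: (@map_uniq _ _ (nth 0%N s)); rewrite /= Ec Ed.
Qed.

(** A form of [q_three] whose conditions are decided by computation. *)
Lemma q_share3 q s t : qaxioms q -> q s -> q t ->
  [&& uniq s, uniq t, size s == 4, size t == 4, all (gtn 7) s, all (gtn 7) t & size (filter (mem t) s) == 3] -> False.
Proof.
move=> ax qs qt /and5P[us ut ss st /and3P[As At s3]].
set c := filter (mem t) s.
have uc : uniq c by rewrite filter_uniq.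
have ct : {subset c <= t} by move=> x; rewrite mem_filter => /andP[].
have Ps : perm_eq s (c ++ filter (predC (mem t)) s) by rewrite perm_sym; apply/permPl/perm_filterC.
have Pt : perm_eq t (c ++ filter (predC (mem c)) t).
  rewrite perm_sym; apply: perm_trans (_ : perm_eq _ (filter (mem c) t ++ filter (predC (mem c)) t)) _.
    rewrite perm_cat2r; apply: uniq_perm; rewrite ?filter_uniq // => x.
    by rewrite mem_filter andb_idr // => /ct.
  by apply/permPl/perm_filterC.
have := perm_size Ps; have := perm_size Pt; rewrite !size_cat (eqP ss) (eqP st) -/c (eqP s3).
move: Ps Pt; case E1 : (filter (predC (mem t)) s) => [|x [|? ?]] // Ps.
case E2 : (filter (predC (mem c)) t) => [|y [|? ?]] // Pt _ _.
have xt : x \notin t by have : x \in filter (predC (mem t)) s; [rewrite E1 inE|rewrite mem_filter => /andP[]].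
have yt : y \in t by rewrite (perm_mem Pt) mem_cat inE eqxx orbT.
move: Ps Pt (s3) uc; rewrite -/c; case: (c) => [|a [|b [|e [|? ?]]]] //= Ps Pt _ _.
apply: (@q_three q ax a b e x y).
- have := perm_uniq Ps; have := perm_uniq Pt; rewrite us ut /= => /esym Ut /esym Us.
  move: Us Ut; rewrite /= !inE !negb_or -!andbA => /and5P[-> -> -> -> /and3P[-> -> _]].
  move=> /and5P[_ _ -> _ /and3P[-> -> _]] /=; rewrite andbT.
  by apply/eqP => xy; rewrite xy yt in xt.
- have := perm_all (gtn 7) Ps; have := perm_all (gtn 7) Pt; rewrite As At /= => /esym /and5P[-> -> -> h _].
  by move=> /esym /and5P[_ _ _ -> _]; rewrite h.
- exact: q_perm Ps qs.
- exact: q_perm Pt qt.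
Qed.

(** The quartet through 6 and 1 is determined, and then none is left through 2 and 5. *)
Lemma q_fan q : qaxioms q -> q [:: 0; 1; 2; 3] -> q [:: 0; 1; 4; 5] -> q [:: 6; 0; 2; 4] -> False.
Proof.
move=> ax h1 h2 h3; have [c [d [U c7 d7 h4]]] := q_cover ax (isT : 6 < 7)%N (isT : 1 < 7)%N isT.
have h5 : q [:: 6; 1; 3; 5].
  move: c7 d7 U h4; case: c => [|[|[|[|[|[|[|c]]]]]]] // _; case: d => [|[|[|[|[|[|[|d]]]]]]] // _ U h4;
    first [ by [] | by case: (q_share3 ax h4 h1) | by case: (q_share3 ax h4 h2) | by case: (q_share3 ax h4 h3)
      | by apply: (q_perm ax) h4
      | by case: (@q_pairs q ax 0 2 1 3 4 6) => //; [apply: (q_perm ax) h1|apply: (q_perm ax) h3|apply: (q_perm ax) h4]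
      | by case: (@q_pairs q ax 0 4 1 5 2 6) => //; [apply: (q_perm ax) h2|apply: (q_perm ax) h3|apply: (q_perm ax) h4] ].
have [c' [d' [U' c7' d7' h6]]] := q_cover ax (isT : 2 < 7)%N (isT : 5 < 7)%N isT.
move: c7' d7' U' h6; case: c' => [|[|[|[|[|[|[|c']]]]]]] // _; case: d' => [|[|[|[|[|[|[|d']]]]]]] // _ U' h6;
    first [ by [] | by case: (q_share3 ax h6 h1) | by case: (q_share3 ax h6 h2) | by case: (q_share3 ax h6 h3)
      | by case: (q_share3 ax h6 h5)
      | by case: (@q_pairs q ax 0 1 2 3 4 5) => //; apply: (q_perm ax) h6
 ].
Qed.

(** A quartet through 6 and 0 leads to [q_fan]. *)
Lemma q_two q : qaxioms q -> q [:: 0; 1; 2; 3] -> q [:: 0; 1; 4; 5] -> False.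
Proof.
move=> ax h1 h2.
have W y z y' z' : perm_eq [:: 0; 1; y; y'; z; z'; 6] (iota 0 7) -> perm_eq [:: 0; 1; 2; 3] [:: 0; 1; y; y'] ->
    perm_eq [:: 0; 1; 4; 5] [:: 0; 1; z; z'] -> q [:: 6; 0; y; z] -> False.
  move=> P P1 P2 h; apply: (q_fan (q_relabel ax P)) => /=; [exact: q_perm h1|exact: q_perm h2|exact: h].
have [c [d [U c7 d7 h]]] := q_cover ax (isT : 6 < 7)%N (isT : 0 < 7)%N isT.
move: c7 d7 U h; case: c => [|[|[|[|[|[|[|c]]]]]]] // _; case: d => [|[|[|[|[|[|[|d]]]]]]] // _ U h;
  first [ by [] | by case: (q_share3 ax h h1) | by case: (q_share3 ax h h2)
   | by apply: (@W 2 4 3 5) => //; apply: (q_perm ax) h | by apply: (@W 2 5 3 4) => //; apply: (q_perm ax) h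
   | by apply: (@W 3 4 2 5) => //; apply: (q_perm ax) h | by apply: (@W 3 5 2 4) => //; apply: (q_perm ax) h ].
Qed.

(** A quartet through 0 and 4 shares two points with each of the two given ones. *)
Lemma q_one q : qaxioms q -> q [:: 0; 1; 2; 3] -> q [:: 3; 4; 5; 6] -> False.
Proof.
move=> ax h1 h2.
have W y y' z z' : perm_eq [:: 0; y; y'; 3; 4; z; z'] (iota 0 7) -> perm_eq [:: 0; 1; 2; 3] [:: 0; y; y'; 3] ->
    q [:: 0; y; 4; z] -> False.
  by move=> P P1 h; apply: (q_two (q_relabel ax P)) => /=; [exact: q_perm h1|exact: h].
have [c [d [U c7 d7 h]]] := q_cover ax (isT : 0 < 7)%N (isT : 4 < 7)%N isT.
move: c7 d7 U h; case: c => [|[|[|[|[|[|[|c]]]]]]] // _; case: d => [|[|[|[|[|[|[|d]]]]]]] // _ U h;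
  first [ by [] | by case: (q_share3 ax h h1) | by case: (q_share3 ax h h2)
   | by apply: (@W 1 2 5 6) => //; apply: (q_perm ax) h | by apply: (@W 1 2 6 5) => //; apply: (q_perm ax) h
   | by apply: (@W 2 1 5 6) => //; apply: (q_perm ax) h | by apply: (@W 2 1 6 5) => //; apply: (q_perm ax) h ].
Qed.

(** A quartet through 4 and 5 shares one or two points with the given one. *)
Lemma q_start q : qaxioms q -> q [:: 0; 1; 2; 3] -> False.
Proof.
move=> ax h1.
have W2 x y z t : perm_eq [:: x; y; z; t; 4; 5; 6] (iota 0 7) -> perm_eq [:: 0; 1; 2; 3] [:: x; y; z; t] ->
    q [:: x; y; 4; 5] -> False.
  by move=> P P1 h; apply: (q_two (q_relabel ax P)) => /=; [exact: q_perm h1|exact: h].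
have W1 x y z t : perm_eq [:: x; y; z; t; 4; 5; 6] (iota 0 7) -> perm_eq [:: 0; 1; 2; 3] [:: x; y; z; t] ->
    q [:: t; 4; 5; 6] -> False.
  by move=> P P1 h; apply: (q_one (q_relabel ax P)) => /=; [exact: q_perm h1|exact: h].
have [c [d [U c7 d7 h]]] := q_cover ax (isT : 4 < 7)%N (isT : 5 < 7)%N isT.
move: c7 d7 U h; case: c => [|[|[|[|[|[|[|c]]]]]]] // _; case: d => [|[|[|[|[|[|[|d]]]]]]] // _ U h;
  first [ by []
   | by apply: (@W2 0 1 2 3) => //; apply: (q_perm ax) h | by apply: (@W2 0 2 1 3) => //; apply: (q_perm ax) h
   | by apply: (@W2 0 3 2 1) => //; apply: (q_perm ax) h | by apply: (@W2 1 2 0 3) => //; apply: (q_perm ax) h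
   | by apply: (@W2 1 3 0 2) => //; apply: (q_perm ax) h | by apply: (@W2 2 3 0 1) => //; apply: (q_perm ax) h
   | by apply: (@W1 1 2 3 0) => //; apply: (q_perm ax) h | by apply: (@W1 0 2 3 1) => //; apply: (q_perm ax) h
   | by apply: (@W1 0 1 3 2) => //; apply: (q_perm ax) h | by apply: (@W1 0 1 2 3) => //; apply: (q_perm ax) h ].
Qed.

Lemma no_qaxioms q : ~ qaxioms q.
Proof.
move=> ax; have [c [d [U c7 d7 h]]] := q_cover ax (isT : 0 < 7)%N (isT : 1 < 7)%N isT.
pose s := [:: 0; 1; c; d] ++ [seq i <- iota 0 7 | i \notin [:: 0; 1; c; d]].
apply: (@q_start _ (q_relabel (s := s) ax _)); last exact: h.
apply: uniq_perm; rewrite ?iota_uniq //.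
  rewrite cat_uniq U filter_uniq ?iota_uniq // andbT; apply/hasPn => x.
  by rewrite mem_filter => /andP[].
move=> x; rewrite mem_cat mem_filter; case: (boolP (x \in [:: 0; 1; c; d])) => //=.
rewrite !inE => /or4P[] /eqP -> //; apply/esym.
- by move: c7; case: c {U h s} => [|[|[|[|[|[|[|c]]]]]]].
- by move: d7; case: d {U h s} => [|[|[|[|[|[|[|d]]]]]]].
Qed.
End Combinatorics.

(** * Cross ratios of seven points *)

Section CrossRatios.
Variables (C : numClosedFieldType) (d : nat) (K : laurent_field C d).

Lemma cst_add u (c m m' : K) : cst c -> mono m -> mono m' -> c + m = m' -> wt u m != 0 -> c = 0.
Proof.
move=> hc mm mm' E w0; apply/eqP; apply: contraT => c0.
have hs : homs u [:: (wt u m, m); (0, c); (wt u m', - m')].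
  by split; [exact: hom_wt|split; [exact: cst_hom|split => //; apply: homN; exact: hom_wt]].
have S0 : foldr (fun p (y : K) => p.2 + y) 0 [:: (wt u m, m); (0, c); (wt u m', - m')] = 0.
  by rewrite /= -E; ring.
have := gradeL 0 hs S0; have := gradeL (wt u m) hs S0; rewrite /= !eqxx (eq_sym 0) (negbTE w0).
case: (wt u m' =P wt u m) => [->|_]; last by rewrite addr0 => m0; case/eqP: (mono_neq0 mm).
by rewrite (negbTE w0) !addr0 => _ c0'; rewrite c0' eqxx in c0.
Qed.

Variable T : eqType.
Variables l0 l1 r0 r1 : T -> K.
(** Brackets of the points (l0 p : l1 p) and (r0 p : r1 p) of two projective lines. *)
Definition lbr p q := l0 p * l1 q - l1 p * l0 q.
Definition rbr p q := r0 p * r1 q - r1 p * r0 q.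
Definition brk p q := lbr p q * rbr p q.
Hypothesis mM : forall p q, p != q -> mono (brk p q).
Local Notation W u p q := (wt u (brk p q)).

(** The three products of brackets that enter the cross ratios of four points have equal degrees.
    By [X_cst] and [X_q4] this means that the cross ratios are constant on both lines. *)
Definition q4 a b c e := forall u, W u a b + W u c e = W u a c + W u b e /\
  W u a c + W u b e = W u a e + W u b c.

Lemma MS p q : brk p q = brk q p. Proof. by rewrite /brk /lbr /rbr; ring. Qed.

Lemma q4S12 a b c e : q4 a b c e -> q4 b a c e.
Proof. by move=> h u; have := h u; rewrite (MS b a); lia. Qed.
Lemma q4S23 a b c e : q4 a b c e -> q4 a c b e.
Proof. by move=> h u; have := h u; rewrite (MS c b); lia. Qed.
Lemma q4S34 a b c e : q4 a b c e -> q4 a b e c.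
Proof. by move=> h u; have := h u; rewrite (MS e c); lia. Qed.

Lemma L_neq0 p q : p != q -> lbr p q != 0.
Proof. by move/mM/mono_neq0; rewrite /brk mulf_eq0 negb_or => /andP[]. Qed.
Lemma R_neq0 p q : p != q -> rbr p q != 0.
Proof. by move/mM/mono_neq0; rewrite /brk mulf_eq0 negb_or => /andP[]. Qed.

Section Base.
Variables a b c : T.
Hypotheses (ab : a != b) (ac : a != c) (bc : b != c).
(** The affine coordinates in which a, b, c are 0, infinity and 1. *)
Definition Xl p := (lbr p a * lbr c b) / (lbr p b * lbr c a).
Definition Xr p := (rbr p a * rbr c b) / (rbr p b * rbr c a).
Let ca : c != a. Proof. by rewrite eq_sym. Qed.
Let cb : c != b. Proof. by rewrite eq_sym. Qed.

Lemma Xa : Xl a = 0 /\ Xr a = 0.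
Proof.
have hL : lbr a a = 0 by rewrite /lbr mulrC subrr.
have hR : rbr a a = 0 by rewrite /rbr mulrC subrr.
by rewrite /Xl /Xr hL hR !mul0r.
Qed.
Lemma Xc : Xl c = 1 /\ Xr c = 1.
Proof.
by rewrite /Xl /Xr ![_ c a * _]mulrC !divff ?mulf_neq0 ?L_neq0 ?R_neq0.
Qed.

Lemma XlB p q : p != b -> q != b ->
  Xl p - Xl q = lbr c b * lbr p q * lbr a b / (lbr c a * lbr p b * lbr q b).
Proof.
move=> pb qb; have h1 := L_neq0 pb; have h2 := L_neq0 qb; have h3 := L_neq0 ca.
have -> : Xl p - Xl q = lbr c b * (lbr p a * lbr q b - lbr q a * lbr p b) / (lbr c a * lbr p b * lbr q b).
  by rewrite /Xl; field; rewrite h1 h2 h3.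
by congr (_ / _); rewrite -mulrA; congr (_ * _); rewrite /lbr; ring.
Qed.
Lemma XrB p q : p != b -> q != b ->
  Xr p - Xr q = rbr c b * rbr p q * rbr a b / (rbr c a * rbr p b * rbr q b).
Proof.
move=> pb qb; have h1 := R_neq0 pb; have h2 := R_neq0 qb; have h3 := R_neq0 ca.
have -> : Xr p - Xr q = rbr c b * (rbr p a * rbr q b - rbr q a * rbr p b) / (rbr c a * rbr p b * rbr q b).
  by rewrite /Xr; field; rewrite h1 h2 h3.
by congr (_ / _); rewrite -mulrA; congr (_ * _); rewrite /rbr; ring.
Qed.

Definition dm p q := (Xl p - Xl q) * (Xr p - Xr q).
Lemma mE p q : p != b -> q != b -> dm p q = brk c b * brk p q * brk a b / (brk c a * brk p b * brk q b).
Proof. by move=> pb qb; rewrite /dm XlB // XrB // mulf_div /brk; congr (_ / _); ring. Qed.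
Lemma m_mono p q : p != q -> p != b -> q != b -> mono (dm p q).
Proof.
move=> pq pb qb; rewrite mE //.
have [h1 h2 h3] : [/\ mono (brk c b), mono (brk p q) & mono (brk a b)] by split; apply: mM.
have [h4 h5 h6] : [/\ mono (brk c a), mono (brk p b) & mono (brk q b)] by split; apply: mM.
exact: mono_div (monoM (monoM h1 h2) h3) (monoM (monoM h4 h5) h6).
Qed.
Lemma m_wt u p q : p != q -> p != b -> q != b ->
  wt u (dm p q) = W u c b + W u p q + W u a b - W u c a - W u p b - W u q b.
Proof.
move=> pq pb qb; have [h1 h2 h3] : [/\ mono (brk c b), mono (brk p q) & mono (brk a b)] by split; apply: mM.
have [h4 h5 h6] : [/\ mono (brk c a), mono (brk p b) & mono (brk q b)] by split; apply: mM.
have h12 := monoM h1 h2; have h45 := monoM h4 h5.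
have h123 := monoM h12 h3; have h456 := monoM h45 h6.
rewrite mE // (wtM u h123 (monoV h456)) (wtV u h456) (wtM u h12 h3) (wtM u h1 h2) (wtM u h45 h6) (wtM u h4 h5).
clear; lia.
Qed.

Lemma X_cst p : p != a -> p != b -> (p == c) || `[< q4 a b c p >] -> cst (Xl p) /\ cst (Xr p).
Proof.
move=> pa pb; have [-> _|pc /asboolP q] := eqVneq p c; first by rewrite !(Xc.1, Xc.2); split; exact: cst1.
have cp : c != p by rewrite eq_sym.
have c1 : cst (dm p a).
  apply: cst_wt => [|u]; first exact: m_mono.
  by rewrite m_wt //; have := q u; rewrite (MS p a) (MS p b) (MS c b) (MS c a); clear; lia.
have c2 : cst (dm c p).
  apply: cst_wt => [|u]; first exact: m_mono.
  by rewrite m_wt //; have := q u; rewrite (MS p b) (MS c b) (MS c a); clear; lia.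
move: c1 c2; rewrite /dm Xa.1 Xa.2 Xc.1 Xc.2 !subr0 => c1 c2; split; first exact: conj_cst c1 c2.
by apply: (@conj_cst _ _ _ _ (Xl p)); rewrite mulrC.
Qed.

Lemma X_q4 p : p != a -> p != b -> p != c -> cst (Xl p) -> cst (Xr p) -> q4 a b c p.
Proof.
move=> pa pb pc cl cr.
have h e : e != b -> e != p -> cst (Xl e) -> cst (Xr e) -> forall u,
    W u c b + W u e p + W u a b - W u c a - W u e b - W u p b = 0.
  move=> eb ep cle cre u; rewrite -m_wt // wtC //; last by apply: mono_neq0; apply: m_mono.
  by apply: cstM; apply: cstB.
move=> u; have := @h a ab _ _ _ u; have := @h c cb _ _ _ u; rewrite Xa.1 Xa.2 Xc.1 Xc.2.
have c1 := cst1 K; have c0 := cst0 K.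
rewrite eq_sym pc (eq_sym a) pa => /(_ isT c1 c1) h1 /(_ isT c0 c0) h2.
by move: h1 h2; rewrite (MS c b) (MS c a) (MS p b); lia.
Qed.

(** Up to factors that depend on single points, brackets are differences of coordinates. *)
Lemma all_q4 : (forall p, p != b -> cst (Xl p) /\ cst (Xr p)) ->
  forall p q r s, uniq [:: p; q; r; s] -> q4 p q r s.
Proof.
move=> H p q r s U.
have HW u e f : e != f -> e != b -> f != b ->
    W u c b + W u e f + W u a b - W u c a - W u e b - W u f b = 0.
  move=> ef eb fb; rewrite -m_wt // wtC //; last by apply: mono_neq0; apply: m_mono.
  by have [h1 h2] := H e eb; have [h3 h4] := H f fb; apply: cstM; apply: cstB.
move: U; rewrite /= !inE !negb_or -!andbA => /and5P[pq pr ps qr /and3P[qs rs _]] u.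
pose k := W u c a - W u c b - W u a b.
have {}HW e f : e != f -> e != b -> f != b -> W u e f = k + W u e b + W u f b.
  by move=> ef eb fb; apply/eqP; rewrite -subr_eq0 -(HW u e f ef eb fb) /k; apply/eqP; ring.
clearbody k.
have [pb|pb] := eqVneq p b.
  subst p; have [qb rb sb] : [/\ q != b, r != b & s != b] by rewrite ![_ == b]eq_sym.
  by rewrite (HW q r) // (HW q s) // (HW r s) // !(MS b); split; ring.
have [qb|qb] := eqVneq q b.
  subst q; have [rb sb] : r != b /\ s != b by rewrite ![_ == b]eq_sym.
  by rewrite (HW p r) // (HW p s) // (HW r s) // !(MS b); split; ring.
have [rb|rb] := eqVneq r b.
  subst r; have sb : s != b by rewrite eq_sym.
  by rewrite (HW p q) // (HW p s) // (HW q s) // !(MS b); split; ring.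
have [sb|sb] := eqVneq s b.
  by subst s; rewrite (HW p q) // (HW p r) // (HW q r) //; split; ring.
by rewrite (HW p q) // (HW p r) // (HW q r) // (HW p s) // (HW q s) // (HW r s) //; split; ring.
Qed.

Lemma mover_wt p : p != a -> p != b -> p != c -> ~ (cst (Xl p) /\ cst (Xr p)) ->
  exists u, wt u (dm p a) != 0 \/ wt u (dm c p) != 0.
Proof.
move=> pa pb pc nc; apply: contrapT => no; apply: nc.
have h u : wt u (dm p a) = 0 /\ wt u (dm c p) = 0.
  by split; apply/eqP; apply: contraT => h; case: no; exists u; [left|right].
have c1 : cst (dm p a) by apply: cst_wt => [|u]; [apply: m_mono|case: (h u)].
have c2 : cst (dm c p) by apply: cst_wt => [|u]; [apply: m_mono => //; rewrite eq_sym|case: (h u)].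
move: c1 c2; rewrite /dm Xa.1 Xa.2 Xc.1 Xc.2 !subr0 => c1 c2; split; first exact: conj_cst c1 c2.
by apply: (@conj_cst _ _ _ _ (Xl p)); rewrite mulrC.
Qed.
End Base.

Hypothesis notall : ~ (forall p q r s, uniq [:: p; q; r; s] -> q4 p q r s).

Section Base2.
Variables a b c : T.
Hypotheses (ab : a != b) (ac : a != c) (bc : b != c).
Let ca : c != a. Proof. by rewrite eq_sym. Qed.
Let cb : c != b. Proof. by rewrite eq_sym. Qed.
Local Notation Xl := (Xl a b c).
Local Notation Xr := (Xr a b c).
Local Notation dm := (dm a b c).
Local Notation Xa := (Xa a b c).
Local Notation Xc := (Xc ac bc).

Lemma X_inj p q : p != b -> q != b -> p != q -> Xl p - Xl q != 0.
Proof.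
by move=> pb qb pq; have /mono_neq0 := m_mono ab ac bc pq pb qb; rewrite /dm mulf_eq0 negb_or => /andP[].
Qed.

(** Otherwise every further point would satisfy a linear equation over C(t), so that its
    coordinates would be rational and therefore constant. *)
Lemma LR e : e != a -> e != b -> e != c -> q4 a b c e -> Xl e = Xr e.
Proof.
move=> ea eb ec q; apply/eqP; apply: contraT => ne; exfalso.
have [cl cr] : cst (Xl e) /\ cst (Xr e).
  by apply: X_cst => //; apply/orP; right; apply/asboolP.
apply: notall; apply: (all_q4 ab ac bc) => p pb.
have [->|pa] := eqVneq p a; first by rewrite Xa.1 Xa.2; split; exact: cst0.
have [->|pc] := eqVneq p c; first by rewrite Xc.1 Xc.2; split; exact: cst1.
have [->|pe] := eqVneq p e; first by [].
have mn := m_mono ab ac bc pa pb ab.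
have mm : mono (dm c p) by apply: m_mono => //; rewrite eq_sym.
have mm' : mono (dm e p) by apply: m_mono => //; rewrite eq_sym.
have ne' : Xr e - Xl e != 0 by rewrite subr_eq0 eq_sym.
have rm := mono_rat mn; have rm1 := mono_rat mm; have rm2 := mono_rat mm'.
have rl := cst_rat cl; have rr := cst_rat cr; have ro := cst_rat (cst1 K).
have sum : Xl p + Xr p = 1 + dm p a - dm c p by rewrite /dm Xa.1 Xa.2 Xc.1 Xc.2; ring.
have rX : rat (Xl p).
  have -> : Xl p = (Xl e * Xr e + dm p a - dm e p - Xl e * (1 + dm p a - dm c p)) / (Xr e - Xl e).
    apply: (mulIf ne'); rewrite divfK // -sum /dm Xa.1 Xa.2; ring.
  by apply: rat_div; do ?[done|apply: ratB|apply: ratD|apply: ratM].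
have rX' : rat (Xr p).
  have -> : Xr p = 1 + dm p a - dm c p - Xl p by rewrite -sum; ring.
  by do ?[done|apply: ratB|apply: ratD|apply: ratM].
move: mn mm; rewrite /dm Xa.1 Xa.2 Xc.1 Xc.2 !subr0 => mn mm.
by split; [exact: rat_mono_cst mn mm|apply: (@rat_mono_cst _ _ _ _ (Xl p)); rewrite // mulrC].
Qed.

(** The quantities [dm] at a, c and e satisfy a linear relation with constant coefficients,
    because e has the same coordinate on both lines. *)
Lemma mover_at e p u : e != a -> e != b -> e != c -> q4 a b c e -> p != a -> p != b -> p != c -> p != e ->
  wt u (dm p a) != 0 \/ wt u (dm c p) != 0 -> let n := dm p a in let m1 := dm c p in let la := Xl e in
  [\/ [/\ wt u n = 0, wt u m1 != 0 & n = la], [/\ wt u m1 = 0, wt u n != 0 & m1 = 1 - la] |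
     [/\ wt u n = wt u m1, wt u n != 0 & (1 - la) * n = - (la * m1)]].
Proof.
move=> ea eb ec q pa pb pc pe nz n m1 la.
have El := LR ea eb ec q.
have [cl _] : cst (Xl e) /\ cst (Xr e).
  by apply: X_cst => //; apply/orP; right; apply/asboolP.
have la0 : la != 0 by have := X_inj eb ab ea; rewrite Xa.1 subr0.
have la1 : 1 - la != 0 by have := X_inj cb eb; rewrite Xc.1 eq_sym; apply.
have mn := m_mono ab ac bc pa pb ab.
have mm : mono (dm c p) by apply: m_mono => //; rewrite eq_sym.
have mm' : mono (dm e p) by apply: m_mono => //; rewrite eq_sym.
have c1 := cst1 K.
have := @mover _ _ K u (1 - la) la (- (la * (1 - la))) n m1 (dm e p) _ cl _ la1 la0 _ mn mm mm' _ nz.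
case=> //.
- exact: cstB.
- by apply: cstN; apply: cstM => //; apply: cstB.
- by rewrite oppr_eq0 mulf_neq0.
- by rewrite /n /m1 /la /dm Xa.1 Xa.2 Xc.1 Xc.2 -El; ring.
- move=> [h1 h2 h3]; apply: Or31; split=> //; apply: (mulfI la1); rewrite h3; ring.
- move=> [h1 h2 h3]; apply: Or32; split=> //; apply: (mulfI la0); rewrite h3; ring.
- by move=> h; apply: Or33.
Qed.

(** A point with non-constant coordinates would satisfy [mover_at] for the two different
    coordinates of e and f, which is impossible. *)
Lemma q4_three e f : uniq [:: a; b; c; e; f] -> q4 a b c e -> q4 a b c f -> False.
Proof.
rewrite /= !inE !negb_or -!andbA => /and5P[_ _ ae af /and5P[_ be bf ce /and3P[cf ef _]]] qe qf.
have [ea eb ec] : [/\ e != a, e != b & e != c] by rewrite ![e == _]eq_sym.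
have [fa fb fc] : [/\ f != a, f != b & f != c] by rewrite ![f == _]eq_sym.
apply: notall; apply: (all_q4 ab ac bc) => p pb.
have [->|pa] := eqVneq p a; first by rewrite Xa.1 Xa.2; split; exact: cst0.
have [->|pc] := eqVneq p c; first by rewrite Xc.1 Xc.2; split; exact: cst1.
have [->|pe] := eqVneq p e; first by apply: X_cst => //; apply/orP; right; apply/asboolP.
have [->|pf] := eqVneq p f; first by apply: X_cst => //; apply/orP; right; apply/asboolP.
apply: contrapT => nc; have [u nz] := mover_wt ab ac bc pa pb pc nc.
have lm : Xl e - Xl f != 0 by apply: X_inj.
have := mover_at ea eb ec qe pa pb pc pe nz; have := mover_at fa fb fc qf pa pb pc pf nz.
have n0 := mono_neq0 (m_mono ab ac bc pa pb ab).
have m0 : dm c p != 0 by apply: mono_neq0; apply: m_mono => //; rewrite eq_sym.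
move=> /= [] [w1 w2 E1] [] [w3 w4 E2]; try by (move: w1 w2 w3 w4; clear; lia).
- by rewrite -E1 -E2 subrr eqxx in lm.
- case/eqP: lm; have -> : Xl e - Xl f = (1 - Xl f) - (1 - Xl e) by ring.
  by rewrite -E1 -E2 subrr.
- case/eqP: lm; apply: (mulIf (mulf_neq0 n0 m0)); rewrite mul0r.
  have e1 : dm p a = Xl f * (dm p a - dm c p).
    have -> : Xl f * (dm p a - dm c p) = Xl f * dm p a + - (Xl f * dm c p) by ring.
    by rewrite -E1; ring.
  have e2 : dm p a = Xl e * (dm p a - dm c p).
    have -> : Xl e * (dm p a - dm c p) = Xl e * dm p a + - (Xl e * dm c p) by ring.
    by rewrite -E2; ring.
  have D0 : dm p a - dm c p != 0 by apply: contra_neq n0 => D0; rewrite e1 D0 mulr0.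
  by apply: (mulIf D0); rewrite mul0r; transitivity (dm c p * dm p a * (Xl e * (dm p a - dm c p) - Xl f * (dm p a - dm c p))); [ring|rewrite -e1 -e2; ring].
Qed.
End Base2.

Lemma Xl_ratio a b c e f : a != b -> a != e -> b != e -> a != c -> b != c -> f != b ->
  Xl a b c f = Xl a b e f * Xl a b c e /\ Xr a b c f = Xr a b e f * Xr a b c e.
Proof.
move=> ab ae be ac bc fb.
have [h1 h2 h3] : [/\ e != b, e != a & c != a] by rewrite ![_ == a]eq_sym eq_sym.
have [l1' l2 l3 l4] : [/\ lbr f b != 0, lbr e b != 0, lbr e a != 0 & lbr c a != 0] by split; apply: L_neq0.
have [k1 k2 k3 k4] : [/\ rbr f b != 0, rbr e b != 0, rbr e a != 0 & rbr c a != 0] by split; apply: R_neq0.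
by split; rewrite /Xl /Xr; field; rewrite ?l1' ?l2 ?l3 ?l4 ?k1 ?k2 ?k3 ?k4.
Qed.

(** In the coordinates at a, b, c the point f is not constant, and the coordinate of g is a
    constant multiple of that of f. The relations of [mover] at e and at g leave three cases each,
    and the third quartet, which compares degrees, excludes their combinations. *)
Lemma q4_pairs a b c e f g : uniq [:: a; b; c; e; f; g] ->
  q4 a b c e -> q4 a b f g -> q4 c e f g -> False.
Proof.
move=> U qe qf qc; have U5 : uniq [:: a; b; c; e; f].
  by move: U; rewrite -[[:: a; b; c; e; f; g]]/([:: a; b; c; e; f] ++ [:: g]) cat_uniq => /andP[].
move: U; rewrite /= !inE !negb_or -!andbA.
move=> /and5P[ab ac ae af /and5P[ag bc be bf /and5P[bg ce cf cg /and4P[ef eg fg _]]]].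
have [ca cb] : c != a /\ c != b by rewrite ![c == _]eq_sym.
have [ea eb ec] : [/\ e != a, e != b & e != c] by rewrite ![e == _]eq_sym.
have [fa fb fc fe] : [/\ f != a, f != b, f != c & f != e] by rewrite ![f == _]eq_sym.
have [ga gb gc ge] : [/\ g != a, g != b, g != c & g != e] by rewrite ![g == _]eq_sym.
have gf : g != f by rewrite eq_sym.
have nf : ~ (cst (Xl a b c f) /\ cst (Xr a b c f)).
  by move=> [h1 h2]; apply: (q4_three ab ac bc U5 qe); apply: X_q4.
have [u nz] := mover_wt ab ac bc fa fb fc nf.
have [Xg Xg'] := @Xl_ratio a b c f g ab af bf ac bc gb.
have kk := LR ab af bf ga gb gf qf.
have [ck _] : cst (Xl a b f g) /\ cst (Xr a b f g).
  by apply: X_cst => //; apply/orP; right; apply/asboolP.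
rewrite -kk in Xg'.
have kap0 : Xl a b f g != 0 by have := X_inj ab af bf gb ab ga; rewrite (Xa a b f).1 subr0.
have kap1 : 1 - Xl a b f g != 0 by have := X_inj ab af bf fb gb fg; rewrite (Xc af bf).1.
have la0 : Xl a b c e != 0 by have := X_inj ab ac bc eb ab ea; rewrite (Xa a b c).1 subr0.
have la1 : 1 - Xl a b c e != 0 by have := X_inj ab ac bc cb eb ce; rewrite (Xc ac bc).1.
have El := LR ab ac bc ea eb ec qe.
have [cl _] : cst (Xl a b c e) /\ cst (Xr a b c e).
  by apply: X_cst => //; apply/orP; right; apply/asboolP.
have := @mover_at a b c ab ac bc e f u ea eb ec qe fa fb fc fe nz.
have mn := m_mono ab ac bc fa fb ab.
have mm := m_mono ab ac bc cf cb fb.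
have mcg := m_mono ab ac bc cg cb gb.
have meg := m_mono ab ac bc eg eb gb.
have mfg := m_mono ab ac bc fg fb gb.
have mce := m_mono ab ac bc ce cb eb.
(* the weights of the last quartet, in the coordinates of the first *)
have wq : wt u (dm a b c c e) + wt u (dm a b c f g) = wt u (dm a b c c f) + wt u (dm a b c e g).
  by rewrite !m_wt //; have [] := qc u; clear; lia.
have one := cst1 K.
have := @mover _ _ K u (- (Xl a b f g * (1 - Xl a b f g))) (Xl a b f g) (1 - Xl a b f g)
   (dm a b c f a) (dm a b c c f) (dm a b c c g) _ ck _ _ kap0 kap1 mn mm mcg _ nz.
move: wq nz mn mm meg mce mfg; rewrite /dm (Xa a b c).1 (Xa a b c).2 (Xc ac bc).1 (Xc ac bc).2 Xg Xg' -El !subr0.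
set x := Xl a b c f; set x' := Xr a b c f; set ka := Xl a b f g in ck kap0 kap1 *; set la := Xl a b c e in cl la0 la1 *.
set n := x * x'; set m1 := (1 - x) * (1 - x').
have -> : (x - ka * x) * (x' - ka * x') = (1 - ka) ^+ 2 * n by rewrite /n; ring.
have -> : (la - ka * x) * (la - ka * x') = (la - ka) * (la - ka * n) + la * ka * m1 by rewrite /n /m1; ring.
move=> wq nz mn mm meg mce mfg HK HL.
have w1 : wt u ((1 - la) * (1 - la)) = 0.
  by apply: wtC; [apply: cstM; apply: cstB|rewrite mulf_neq0].
have w2 : wt u ((1 - ka) ^+ 2 * n) = wt u n.
  by apply: wtZ => //; [apply: cstX; apply: cstB|rewrite expf_neq0].
rewrite w1 w2 add0r in wq.
have {}HK := HK (cstN (cstM ck (cstB one ck))) (cstB one ck).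
have {}HK : [\/ [/\ wt u n = 0, wt u m1 != 0 & ka * n = 1],
   [/\ wt u m1 = 0, wt u n != 0 & ka * m1 = - (1 - ka)] |
   [/\ wt u n = wt u m1, wt u n != 0 & (1 - ka) * n = m1]].
  case: HK.
  - by rewrite oppr_eq0 mulf_neq0.
  - by rewrite /n /m1; ring.
  - by move=> [h1 h2 h3]; apply: Or31; split=> //; apply: (mulfI kap1); rewrite mulr1 -[RHS]opprK -h3; ring.
  - by move=> h; apply: Or32.
  - by move=> [h1 h2 h3]; apply: Or33; split=> //; apply: (mulfI kap0); rewrite -[RHS]opprK -h3; ring.
case: HL HK => [[a1 a2 a3] [[b1 b2 b3]|[b1 b2 b3]|[b1 b2 b3]]|[a1 a2 a3] [[b1 b2 b3]|[b1 b2 b3]|[b1 b2 b3]]|[a1 a2 a3] [[b1 b2 b3]|[b1 b2 b3]|[b1 b2 b3]]];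
  try by (move: a1 a2 b1 b2; clear; lia).
- have kl : ka * la = 1 by rewrite -a3.
  have E : (la - ka) * (la - ka * n) + la * ka * m1 = (la - ka) * (la - 1) + m1.
    by rewrite b3 (mulrC la ka) kl mul1r.
  rewrite E in wq meg.
  have z := cst_add (u := u) (cstM (cstB cl ck) (cstB cl one)) mm meg erefl b2.
  by move: wq a1 a2; rewrite z add0r; clear; lia.
- have kl : ka * la = 1.
    apply/eqP; rewrite -subr_eq0; apply/eqP.
    transitivity (- (ka * (1 - la)) - (1 - ka)); first by ring.
    by rewrite -a3 b3; ring.
  have E : (la - ka) * (la - ka * n) + la * ka * m1 = la * (la - 1) + (ka - la) * ka * n.
    have -> : la * (la - 1) = la ^+ 2 - ka * la + la * ka * (1 - la) by rewrite (mulrC la ka) kl; ring.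
    by rewrite a3; ring.
  rewrite E in wq meg.
  have c1 : cst ((ka - la) * ka) by apply: cstM => //; apply: cstB.
  have [z|nz'] := eqVneq ((ka - la) * ka) 0.
    have w3 : wt u (la * (la - 1)) = 0.
      by apply: wtC; [apply: cstM => //; apply: cstB|rewrite mulf_neq0 // -opprB oppr_eq0].
    by move: wq a2; rewrite z mul0r addr0 a1 w3; clear; lia.
  have z := cst_add (u := u) (cstM cl (cstB cl one)) (monoM (cst_mono c1 nz') mn) meg erefl.
  have wn : wt u ((ka - la) * ka * n) != 0 by rewrite wtZ.
  by have /eqP := z wn; rewrite mulf_eq0 (negbTE la0) -oppr_eq0 opprB (negbTE la1).
- have n0 := mono_neq0 mn.
  have kl : la * ka = 1.
    apply/eqP; rewrite -subr_eq0; apply/eqP; apply: (mulIf n0); rewrite mul0r.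
    transitivity (- ((1 - la) * n) - la * ((1 - ka) * n)); first by ring.
    by rewrite a3 b3; ring.
  have E : (la - ka) * (la - ka * n) + la * ka * m1 = (la ^+ 2 - 1) + ka * (ka - 1) * n.
    rewrite -b3.
    transitivity (la ^+ 2 - la * ka - (la * ka) * n + ka ^+ 2 * n + (la * ka) * ((1 - ka) * n)); first by ring.
    by rewrite kl; ring.
  rewrite E in wq meg.
  have c1 : cst (ka * (ka - 1)) by apply: cstM => //; apply: cstB.
  have c1n : ka * (ka - 1) != 0 by rewrite mulf_neq0 // -opprB oppr_eq0.
  have wn : wt u (ka * (ka - 1) * n) = wt u n by apply: wtZ.
  have z := cst_add (u := u) (cstB (cstX 2 cl) one) (monoM (cst_mono c1 c1n) mn) meg erefl.
  rewrite wn in z; move: wq; rewrite (z a2) add0r wn; by move: a1 a2; clear; lia.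
Qed.
End CrossRatios.

Section SevenPoints.
Variables (C : numClosedFieldType) (d : nat) (K : laurent_field C d).
Variables (T : eqType) (l0 l1 r0 r1 : T -> K).
Local Notation brk := (brk l0 l1 r0 r1).
Local Notation q4 := (q4 l0 l1 r0 r1).
Hypothesis mM : forall p q, p != q -> mono (brk p q).

(** With p and q at 0 and infinity the coordinates of the five other points form pairs as in
    [five_points]. *)
Lemma q4_cover (p q e1 e2 e3 e4 e5 : T) : uniq [:: p; q; e1; e2; e3; e4; e5] ->
  exists a b, [/\ a \in [:: e1; e2; e3; e4; e5], b \in [:: e1; e2; e3; e4; e5], a != b & q4 p q a b].
Proof.
rewrite 2!cons_uniq inE negb_or -andbA => /and4P[pq ps qs U].
set s := [:: e1; e2; e3; e4; e5] in ps qs U *.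
pose f (i : 'I_5) := nth p s i.
have fs i : f i \in s by apply: mem_nth; apply: ltn_ord.
have fp i : f i != p by apply: contraNneq ps => <-.
have fq i : f i != q by apply: contraNneq qs => <-.
have ff i j : i != j -> f i != f j by move=> ij; rewrite nth_uniq.
pose x i := lbr l0 l1 (f i) p / lbr l0 l1 (f i) q; pose x' i := rbr r0 r1 (f i) p / rbr r0 r1 (f i) q.
have N i : x i * x' i = brk (f i) p / brk (f i) q by rewrite /x /x' mulf_div.
have D i j : (x i - x j) * (x' i - x' j) = brk (f i) (f j) * brk p q / (brk (f i) q * brk (f j) q).
  have [h1 h2] : lbr l0 l1 (f i) q != 0 /\ lbr l0 l1 (f j) q != 0 by split; apply: (L_neq0 mM).
  have [h3 h4] : rbr r0 r1 (f i) q != 0 /\ rbr r0 r1 (f j) q != 0 by split; apply: (R_neq0 mM).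
  have -> : x i - x j = lbr l0 l1 (f i) (f j) * lbr l0 l1 p q / (lbr l0 l1 (f i) q * lbr l0 l1 (f j) q).
    transitivity ((lbr l0 l1 (f i) p * lbr l0 l1 (f j) q - lbr l0 l1 (f j) p * lbr l0 l1 (f i) q) / (lbr l0 l1 (f i) q * lbr l0 l1 (f j) q)).
      by rewrite /x; field; rewrite h1 h2.
    by congr (_ / _); rewrite /lbr; ring.
  have -> : x' i - x' j = rbr r0 r1 (f i) (f j) * rbr r0 r1 p q / (rbr r0 r1 (f i) q * rbr r0 r1 (f j) q).
    transitivity ((rbr r0 r1 (f i) p * rbr r0 r1 (f j) q - rbr r0 r1 (f j) p * rbr r0 r1 (f i) q) / (rbr r0 r1 (f i) q * rbr r0 r1 (f j) q)).
      by rewrite /x'; field; rewrite h3 h4.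
    by congr (_ / _); rewrite /rbr; ring.
  by rewrite mulf_div /brk; congr (_ / _); ring.
have mN i : mono (x i * x' i) by rewrite N; apply: mono_div; apply: mM.
have mD i j : i != j -> mono ((x i - x j) * (x' i - x' j)).
  move=> ij; rewrite D; apply: mono_div; apply: monoM; apply: mM => //; exact: ff.
pose o k (h : (k < 5)%N) := Ordinal h.
have U5 : uniq [:: o 0 isT; o 1 isT; o 2 isT; o 3 isT; o 4 isT] by [].
have [i [j [ij [c1 c2]]]] := five_points U5 mN mD.
exists (f i), (f j); split=> //; first exact: ff.
have nz k : x k * x' k != 0 by apply: mono_neq0.
have e1' u : wt u (x i * x' i) = wt u (x j * x' j).
  apply/eqP; rewrite -subr_eq0 -(wtV u (mN j)) -(wtM u (mN i) (monoV (mN j))); apply/eqP; apply: wtC => //.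
  by rewrite mulf_neq0 ?invr_eq0.
have e2' u : wt u ((x i - x j) * (x' i - x' j)) = wt u (x i * x' i).
  apply/eqP; rewrite -subr_eq0 -(wtV u (mN i)) -(wtM u (mD i j ij) (monoV (mN i))); apply/eqP; apply: wtC => //.
  by rewrite mulf_neq0 ?invr_eq0 //; apply: mono_neq0; apply: mD.
move=> u; move: (e1' u) (e2' u); rewrite D !N.
have [m1 m2 m3] : [/\ mono (brk (f i) p), mono (brk (f i) q) & mono (brk (f j) p)] by split; apply: mM.
have [m4 m5 m6] : [/\ mono (brk (f j) q), mono (brk (f i) (f j)) & mono (brk p q)].
  by split; apply: mM => //; apply: ff.
rewrite !(wtM u m1 (monoV m2), wtM u m3 (monoV m4), wtM u (monoM m5 m6) (monoV (monoM m2 m4)), wtM u m5 m6,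
  wtV u (monoM m2 m4), wtM u m2 m4, wtV u m2, wtV u m4).
rewrite !(MS l0 l1 r0 r1 p (f i), MS l0 l1 r0 r1 q (f i), MS l0 l1 r0 r1 p (f j), MS l0 l1 r0 r1 q (f j)).
by clear; lia.
Qed.
End SevenPoints.

(** Adjacent transpositions generate all permutations. *)
Lemma sym4_perm (T : eqType) (q : T -> T -> T -> T -> Prop) :
  (forall a b c e, q a b c e -> q b a c e) -> (forall a b c e, q a b c e -> q a c b e) ->
  (forall a b c e, q a b c e -> q a b e c) -> forall a b c e a' b' c' e',
  perm_eq [:: a; b; c; e] [:: a'; b'; c'; e'] -> q a b c e -> q a' b' c' e'.
Proof.
move=> s12 s23 s34.
have p2 a b c e c' e' : perm_eq [:: c; e] [:: c'; e'] -> q a b c e -> q a b c' e'.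
  move=> P; have : c' \in [:: c; e] by rewrite (perm_mem P) inE eqxx.
  rewrite !inE => /orP[]/eqP E; subst c'.
    by move: P; rewrite perm_cons => /perm_small_eq -/(_ isT) [->].
  by move: P; rewrite (perm_catCA [:: c] [:: e] nil) perm_cons => /perm_small_eq -/(_ isT) [<-] /s34.
have p3 a b c e b' c' e' : perm_eq [:: b; c; e] [:: b'; c'; e'] -> q a b c e -> q a b' c' e'.
  move=> P; have : b' \in [:: b; c; e] by rewrite (perm_mem P) inE eqxx.
  rewrite !inE => /or3P[]/eqP E; subst b'.
  - by move: P; rewrite perm_cons; apply: p2.
  - by move: P; rewrite (perm_catCA [:: b] [:: c] [:: e]) perm_cons => P /s23; apply: p2.
  - by move: P; rewrite (perm_catCA [:: b; c] [:: e] nil) perm_cons => P /s34/s23; apply: p2.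
move=> a b c e a' b' c' e' P; have : a' \in [:: a; b; c; e] by rewrite (perm_mem P) inE eqxx.
rewrite !inE => /or4P[]/eqP E; subst a'.
- by move: P; rewrite perm_cons; apply: p3.
- by move: P; rewrite (perm_catCA [:: a] [:: b] [:: c; e]) perm_cons => P /s12; apply: p3.
- by move: P; rewrite (perm_catCA [:: a; b] [:: c] [:: e]) perm_cons => P /s23/s12; apply: p3.
- by move: P; rewrite (perm_catCA [:: a; b; c] [:: e] nil) perm_cons => P /s34/s23/s12; apply: p3.
Qed.

(** Otherwise the quartets with constant cross ratios satisfy [qaxioms]. *)
Lemma seven_points (C : numClosedFieldType) (d : nat) (K : laurent_field C d) (l0 l1 r0 r1 : 'I_7 -> K) :
  (forall p q, p != q -> mono (brk l0 l1 r0 r1 p q)) ->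
  forall p q r s, uniq [:: p; q; r; s] -> q4 l0 l1 r0 r1 p q r s.
Proof.
move=> mM; apply: contrapT => na.
pose o (k : nat) : 'I_7 := inord k.
pose Q (s : seq nat) := if s is [:: a; b; c; e] then q4 l0 l1 r0 r1 (o a) (o b) (o c) (o e) else False.
have oin a b : (a < 7)%N -> (b < 7)%N -> (o a == o b) = (a == b).
  by move=> ha hb; rewrite -val_eqE /= !inordK.
have oU s : all (gtn 7) s -> uniq s -> uniq [seq o i | i <- s].
  move=> /allP h; rewrite map_inj_in_uniq // => i j /h hi /h hj /eqP.
  by rewrite oin // => /eqP.
apply: (@no_qaxioms Q); split.
- move=> s t P; have := perm_size P; move: P.
  case: s => [|a [|b [|c [|e [|? ?]]]]] //; case: t => [|a' [|b' [|c' [|e' [|? ?]]]]] // P _.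
  move: P; apply: (@sym4_perm _ (fun a b c e => q4 l0 l1 r0 r1 (o a) (o b) (o c) (o e))) => *.
  - exact: q4S12.
  - exact: q4S23.
  - exact: q4S34.
- move=> a b c e f U A h1 h2; have := oU _ A U; rewrite /= => U'.
  have := U'; rewrite /= !inE !negb_or -!andbA => /and5P[ab ac ae af /and5P[bc _ _ _ _]].
  exact: (q4_three mM na ab ac bc U' h1 h2).
- move=> a b c e f g U A h1 h2 h3; have := oU _ A U; rewrite /= => U'.
  exact: (q4_pairs mM na U' h1 h2 h3).
- move=> a b a7 b7 ab.
  pose s := [seq i <- iota 0 7 | i \notin [:: a; b]].
  have Ps : perm_eq ([:: a; b] ++ s) (iota 0 7).
    apply: uniq_perm; rewrite ?iota_uniq //.
      rewrite cat_uniq filter_uniq ?iota_uniq // andbT /= inE ab; apply/hasPn => x.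
      by rewrite mem_filter => /andP[].
    move=> x; rewrite mem_cat mem_filter; have [xab|_] := boolP (x \in [:: a; b]); last by [].
    rewrite orTb mem_iota; apply/esym; rewrite /= add0n.
    by move: xab; rewrite !inE => /orP[]/eqP->.
  have us := perm_uniq Ps; have ss := perm_size Ps; rewrite iota_uniq in us.
  have As : all (gtn 7) s by apply/allP => x; rewrite mem_filter mem_iota => /andP[_].
  case E : s us ss As => [|e1 [|e2 [|e3 [|e4 [|e5 [|? ?]]]]]] // us _ As.
  have U' : uniq [:: o a; o b; o e1; o e2; o e3; o e4; o e5].
    by apply: (oU [:: a; b; e1; e2; e3; e4; e5]) => //=; rewrite a7 b7.
  have [x [y [xs ys xy h]]] := q4_cover mM U'.
  have [x' xs' Ex] : exists2 x', x' \in [:: e1; e2; e3; e4; e5] & x = o x'.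
    by apply/mapP.
  have [y' ys' Ey] : exists2 y', y' \in [:: e1; e2; e3; e4; e5] & y = o y'.
    by apply/mapP.
  have [hx hy] : (x' < 7)%N /\ (y' < 7)%N by split; apply: (allP As).
  exists x', y'; split=> //; last by rewrite /Q -Ex -Ey.
  have xy' : x' != y' by rewrite -oin // -Ex -Ey.
  move: us xs' ys'; rewrite -E 2!cons_uniq inE negb_or -andbA => /and4P[_ as' bs _] xs' ys'.
  rewrite /= !inE !negb_or ab xy' /= !andbT.
  by rewrite ![a == _]eq_sym ![b == _]eq_sym; rewrite -!andbA; apply/and4P; split; [apply: contraNneq as' => <-|apply: contraNneq as' => <-|apply: contraNneq bs => <-|apply: contraNneq bs => <-].
Qed.

(** * Systems of minors and constant keys *)

Section Dets.
Variables (F : comRingType) (I J : Type).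
Implicit Types (A : I -> J -> F).
Definition det2 A i j a b := A i a * A j b - A i b * A j a.
Definition det3 A i j m a b c :=
  A i a * det2 A j m b c - A i b * det2 A j m a c + A i c * det2 A j m a b.
End Dets.

Section System.
Variables (C : numClosedFieldType) (d : nat) (K : laurent_field C d).

(** The situation at a basis: minors of orders one, two and three of B do not vanish, and the
    product of corresponding minors of A and B is zero or a monomial. *)
Record system (I J : finType) (A B : I -> J -> K) : Prop := System {
  sB1 : forall i a, B i a != 0;
  sB2 : forall i j a b, i != j -> a != b -> det2 B i j a b != 0;
  sB3 : forall i j m a b c, uniq [:: i; j; m] -> uniq [:: a; b; c] -> det3 B i j m a b c != 0;
  sA1 : forall i a, A i a != 0 -> mono (A i a * B i a);
  sA2 : forall i j a b, i != j -> a != b -> det2 A i j a b != 0 ->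
    mono (det2 A i j a b * det2 B i j a b);
  sA3 : forall i j m a b c, uniq [:: i; j; m] -> uniq [:: a; b; c] -> det3 A i j m a b c != 0 ->
    mono (det3 A i j m a b c * det3 B i j m a b c);
  s_row : forall i, exists a, A i a != 0;
  s_col : forall a, exists i, A i a != 0 }.

Lemma system_tr (I J : finType) (A B : I -> J -> K) : system A B ->
  system (fun a i => A i a) (fun a i => B i a).
Proof.
have d2 (X : I -> J -> K) a b i j : det2 (fun a i => X i a) a b i j = det2 X i j a b.
  by rewrite /det2; ring.
have d3 (X : I -> J -> K) a b c i j m : det3 (fun a i => X i a) a b c i j m = det3 X i j m a b c.
  by rewrite /det3 /det2; ring.
case=> h1 h2 h3 h4 h5 h6 h7 h8; split => //.
- by move=> a b i j ab ij; rewrite d2; apply: h2.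
- by move=> *; rewrite d3; apply: h3.
- by move=> i a; apply: h4.
- by move=> a b i j ab ij; rewrite !d2; apply: h5.
- by move=> a b c i j m U V; rewrite !d3; apply: h6.
Qed.

(** The cross ratio whose constancy expresses separability. *)
Definition xratio (I J : finType) (B : I -> J -> K) i j a b := (B i a * B j b) / (B i b * B j a).

Section Fixed.
Variables (I J : finType) (A B : I -> J -> K).
Hypothesis S : system A B.
Local Notation Y := (xratio B).

Lemma Y_tr i j a b : xratio (fun a i => B i a) a b i j = Y i j a b.
Proof. by rewrite /xratio; congr (_ / _); rewrite mulrC. Qed.

Lemma Y_sym i j a b : Y j i b a = Y i j a b.
Proof. by rewrite /xratio (mulrC (B j b)) (mulrC (B j a)). Qed.
Lemma Y_inv i j a b : Y i j b a = (Y i j a b)^-1.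
Proof. by rewrite /xratio invf_div. Qed.
Lemma Y_mul i j a b c : Y i j a b * Y i j b c = Y i j a c.
Proof.
have h := sB1 S; rewrite /xratio; field.
by rewrite !h.
Qed.
Lemma Y_neq0 i j a b : Y i j a b != 0.
Proof. by have h := sB1 S; rewrite /xratio !mulf_neq0 ?invr_eq0 ?mulf_neq0 ?h. Qed.

(** When one of the two products in a minor of order two of A vanishes, comparing that minor with
    the entries relates the two products of entries of B. *)
Lemma one_sub_mono i j a b : i != j -> a != b -> A i a != 0 -> A j b != 0 ->
  A i b = 0 \/ A j a = 0 -> exists2 mu, mono mu & B i b * B j a = B i a * B j b * (1 - mu).
Proof.
move=> ij ab ia jb z; have h := sB1 S.
have E : det2 A i j a b = A i a * A j b by rewrite /det2; case: z => ->; ring.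
have m := sA2 S ij ab; rewrite E in m; have {}m := m (mulf_neq0 ia jb).
have mab := monoM (sA1 S ia) (sA1 S jb).
exists ((A i a * A j b * det2 B i j a b) / (A i a * B i a * (A j b * B j b))); first exact: mono_div.
by rewrite /det2; field; rewrite ia jb !h.
Qed.

Lemma one_sub_neq0 i j a b mu : B i b * B j a = B i a * B j b * (1 - mu) -> 1 - mu != 0.
Proof.
move=> E; apply/eqP => z; move/eqP: E; rewrite z mulr0 mulf_eq0.
by rewrite (negbTE (sB1 S _ _)) (negbTE (sB1 S _ _)).
Qed.

(** The keys of a basis, in terms of the entries of A. *)
Definition keyAB i j a b := [/\ i != j, a != b, [/\ A i a != 0, A i b != 0, A j a != 0 & A j b != 0] &
  det2 A i j a b != 0].

Lemma keyAB_swap i j a b : keyAB i j a b -> keyAB i j b a.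
Proof.
move=> [ij ab [h1 h2 h3 h4] dt]; split=> //; first by rewrite eq_sym.
by move: dt; rewrite /det2 -oppr_eq0 opprB.
Qed.
Lemma keyAB_rows i j a b : keyAB i j a b -> keyAB j i a b.
Proof.
move=> [ij ab [h1 h2 h3 h4] dt]; split=> //; first by rewrite eq_sym.
by move: dt; rewrite /det2 -oppr_eq0 opprB (mulrC (A i b)) (mulrC (A i a)).
Qed.

(** For a key the cross ratio of B and that of A satisfy the hypotheses of [rat_mono_cst]. *)
Lemma key_pair i j a b : keyAB i j a b -> exists z, mono (Y i j a b * z) /\ mono ((1 - Y i j a b) * (1 - z)).
Proof.
move=> [ij ab [h1 h2 h3 h4] dt]; have h := sB1 S.
exists ((A i a * A j b) / (A i b * A j a)); split.
  have -> : Y i j a b * ((A i a * A j b) / (A i b * A j a)) =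
     ((A i a * B i a) * (A j b * B j b)) / ((A i b * B i b) * (A j a * B j a)).
    by rewrite /xratio mulf_div; congr (_ / _); ring.
  by apply: mono_div; apply: monoM; apply: (sA1 S).
have -> : (1 - Y i j a b) * (1 - (A i a * A j b) / (A i b * A j a)) =
   (det2 A i j a b * det2 B i j a b) / ((A i b * B i b) * (A j a * B j a)).
  by rewrite /xratio /det2; field; rewrite h2 h3 !h.
by apply: mono_div; [apply: (sA2 S)|apply: monoM; apply: (sA1 S)].
Qed.

Lemma key_rat i j a b : keyAB i j a b -> rat (Y i j a b) -> cst (Y i j a b).
Proof. by move=> /key_pair [z [h1 h2]] r; apply: rat_mono_cst r h1 h2. Qed.

Lemma rat_1B (mu : K) : mono mu -> rat (1 - mu).
Proof. by move=> h; apply: ratB; [apply: cst_rat; exact: cst1|exact: mono_rat]. Qed.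

(** A third column in which a row of the key has a zero expresses the cross ratio rationally in
    monomials, by [one_sub_mono]. Here both rows have a zero there. *)
Lemma column_zero i j a b e m : keyAB i j a b -> A i e = 0 -> A j e = 0 -> A m e != 0 -> rat (Y i j a b).
Proof.
move=> [ij ab [h1 h2 h3 h4] _] ie je me.
have h := sB1 S.
have mi : i != m by apply: contraNneq me => <-; rewrite ie.
have mj : j != m by apply: contraNneq me => <-; rewrite je.
have ae : a != e by apply: contraNneq h1 => ->; rewrite ie.
have be : b != e by apply: contraNneq h2 => ->; rewrite ie.
have [m1 M1 E1] := one_sub_mono mi ae h1 me (or_introl ie).
have [m2 M2 E2] := one_sub_mono mi be h2 me (or_introl ie).
have [m3 M3 E3] := one_sub_mono mj ae h3 me (or_introl je).
have [m4 M4 E4] := one_sub_mono mj be h4 me (or_introl je).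
have [n1 n2 n3 n4] := And4 (one_sub_neq0 E1) (one_sub_neq0 E2) (one_sub_neq0 E3) (one_sub_neq0 E4).
have -> : Y i j a b = (1 - m2) * (1 - m3) / ((1 - m1) * (1 - m4)).
  have e1 : B i a = B i e * B m a / (B m e * (1 - m1)) by rewrite E1; field; rewrite n1 h.
  have e2 : B i b = B i e * B m b / (B m e * (1 - m2)) by rewrite E2; field; rewrite n2 h.
  have e3 : B j a = B j e * B m a / (B m e * (1 - m3)) by rewrite E3; field; rewrite n3 h.
  have e4 : B j b = B j e * B m b / (B m e * (1 - m4)) by rewrite E4; field; rewrite n4 h.
  by rewrite /xratio e1 e2 e3 e4; field; rewrite n1 n2 n3 n4 !h.
by apply: rat_div; apply: ratM; apply: rat_1B.
Qed.

Lemma column_half i j a b e : keyAB i j a b -> A i e != 0 -> A j e = 0 -> rat (Y i j a b).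
Proof.
move=> [ij ab [h1 h2 h3 h4] _] ie je.
have h := sB1 S.
have ae : a != e by apply: contraNneq h3 => ->; rewrite je.
have be : b != e by apply: contraNneq h4 => ->; rewrite je.
have ji : j != i by rewrite eq_sym.
have [m1 M1 E1] := one_sub_mono ji ae h3 ie (or_introl je).
have [m2 M2 E2] := one_sub_mono ji be h4 ie (or_introl je).
have [n1 n2] := conj (one_sub_neq0 E1) (one_sub_neq0 E2).
have -> : Y i j a b = (1 - m1) / (1 - m2).
  have e1 : B i a = B j a * B i e * (1 - m1) / B j e by rewrite -E1; field; rewrite h.
  have e2 : B i b = B j b * B i e * (1 - m2) / B j e by rewrite -E2; field; rewrite h.
  by rewrite /xratio e1 e2; field; rewrite n2 !h.
by apply: rat_div; apply: rat_1B.
Qed.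

(** The relation between the minors of order two of the columns a, b, e is linear in the cross
    ratio and has monomial coefficients. *)
Lemma column_parallel i j a b e : keyAB i j a b -> e != a -> e != b -> A i e != 0 -> A j e != 0 ->
  det2 A i j a e = 0 -> rat (Y i j a b).
Proof.
move=> [ij ab [h1 h2 h3 h4] dt] ea eb ie je par.
have h := sB1 S.
pose r := A i e / A i a.
have r0 : r != 0 by rewrite mulf_neq0 ?invr_eq0.
have Ei : A i e = r * A i a by rewrite /r divfK.
have Ej : A j e = r * A j a.
  apply: (mulfI h1); apply/eqP; rewrite -subr_eq0; apply/eqP; rewrite -[RHS]par /det2 Ei; ring.
have dE : det2 A i j e b = r * det2 A i j a b by rewrite /det2 Ei Ej; ring.
have m3 : mono (det2 A i j e b * det2 B i j e b) by apply: (sA2 S) => //; rewrite dE mulf_neq0.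
pose n1 := (A i e * B i e) / (A i a * B i a).
pose n2 := (A j e * B j e) / (A j a * B j a).
pose n3 := (det2 A i j e b * det2 B i j e b) / (det2 A i j a b * det2 B i j a b).
have [M1 M2 M3] : [/\ mono n1, mono n2 & mono n3].
  by split; apply: mono_div; try exact: (sA1 S); [|apply: (sA2 S)].
have db : det2 B i j a b != 0 by apply: (sB2 S).
have R1 : B i e = n1 * B i a / r by rewrite /n1 Ei; field; rewrite r0 h1 h.
have R2 : B j e = n2 * B j a / r by rewrite /n2 Ej; field; rewrite r0 h3 h.
have R3 : det2 B i j e b = n3 * det2 B i j a b / r by rewrite /n3 dE; field; rewrite r0 dt db.
have E : n1 * (B i a * B j b) - n2 * (B i b * B j a) = n3 * (B i a * B j b - B i b * B j a).
  rewrite -/(det2 B i j a b); transitivity (r * det2 B i j e b); last by rewrite R3; field.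
  by rewrite /det2 R1 R2; field.
have E2 : (n1 - n3) * Y i j a b = n2 - n3.
  rewrite /xratio mulrA; apply: (mulIf (mulf_neq0 (sB1 S i b) (sB1 S j a))); rewrite divfK ?mulf_neq0 ?h //.
  apply/eqP; rewrite -subr_eq0; apply/eqP.
  transitivity (n1 * (B i a * B j b) - n2 * (B i b * B j a) - n3 * (B i a * B j b - B i b * B j a)); first by ring.
  by rewrite E subrr.
have [e13|n13] := eqVneq n1 n3.
  have e23 : n2 = n3 by apply/eqP; rewrite -subr_eq0 -E2 e13 subrr mul0r.
  have : det2 B i j a e != 0 by apply: (sB2 S); rewrite // eq_sym.
  by rewrite /det2 R1 R2 e13 e23 => /eqP []; ring.
have -> : Y i j a b = (n2 - n3) / (n1 - n3) by rewrite -E2 mulrC mulKf // subr_eq0.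
by apply: rat_div; apply: ratB; apply: mono_rat.
Qed.

(** By the preceding lemmas, the rows of a non-constant key have non-zero entries in all columns,
    and no two columns are proportional. The two coordinate points and five columns are then seven
    points in general position. *)
Lemma key_const_cols i j a b : (5 <= #|J|)%N -> keyAB i j a b -> cst (Y i j a b).
Proof.
move=> J5 kab; apply: contrapT => nc.
have [ij ab [h1 h2 h3 h4] dt] := kab.
have full e : A i e != 0 /\ A j e != 0.
  have [ie|ie] := eqVneq (A i e) 0; have [je|je] := eqVneq (A j e) 0 => //; case: nc; apply: key_rat => //.
  - by have [m me] := s_col S e; apply: column_zero ie je me.
  - by rewrite -Y_sym Y_inv; apply: ratV; apply: (column_half (e := e)) => //; apply: keyAB_rows.
  - exact: column_half ie je.
have par0 x y e : keyAB i j x y -> ~ cst (Y i j x y) -> e != x -> e != y -> det2 A i j x e != 0.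
  move=> kxy ncxy ex ey; apply/eqP => z; apply: ncxy; apply: key_rat => //.
  by have [ie je] := full e; apply: column_parallel z.
have par1 e : e != a -> e != b -> det2 A i j a e != 0 /\ det2 A i j b e != 0.
  move=> ea eb; split; first exact: par0 kab nc ea eb.
  by apply: par0 (keyAB_swap kab) _ eb ea; rewrite Y_inv => h; apply: nc; rewrite -[Y _ _ _ _]invrK; apply: cstV.
have mk x y : x != y -> det2 A i j x y != 0 -> keyAB i j x y.
  by move=> xy dxy; have [? ?] := full x; have [? ?] := full y.
have gen x y : x != y -> det2 A i j x y != 0.
  move=> xy; have yx : y != x by rewrite eq_sym.
  have dS e f : det2 A i j e f != 0 -> det2 A i j f e != 0.
    by rewrite /det2 -oppr_eq0 opprB.
  have [ea|xa] := eqVneq x a.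
    by have [eb|yb] := eqVneq y b; [rewrite ea eb|rewrite ea; apply: (par1 y _ _).1; rewrite -?ea].
  have [eb|xb] := eqVneq x b.
    have [ea|ya] := eqVneq y a; first by rewrite eb ea; apply: dS.
    by rewrite eb; apply: (par1 y _ _).2; rewrite -?eb.
  have [pa pb] := par1 x xa xb.
  have [ea|ya] := eqVneq y a; first by rewrite ea; apply: dS.
  have [eb|yb] := eqVneq y b; first by rewrite eb; apply: dS.
  have [c1|n1] := EM (cst (Y i j x a)).
    apply: par0 (mk x b xb (dS _ _ pb)) _ yx yb => c2; apply: nc; rewrite -(Y_mul i j a x b) Y_inv.
    by apply: cstM => //; apply: cstV.
  by apply: par0 (mk x a xa (dS _ _ pa)) n1 yx ya.
have [c [e [f U]]] : exists c e f, uniq [:: a; b; c; e; f].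
  pose s := [seq x <- enum J | x \notin [:: a; b]].
  have Ps : perm_eq ([:: a; b] ++ s) (enum J).
    apply: uniq_perm; rewrite ?enum_uniq //.
      rewrite cat_uniq filter_uniq ?enum_uniq // andbT /= inE ab; apply/hasPn => x.
      by rewrite mem_filter => /andP[].
    by move=> x; rewrite mem_cat mem_filter mem_enum andbT orbN.
  have := perm_uniq Ps; have := perm_size Ps; rewrite enum_uniq -cardE => ss us.
  case: s ss us {Ps} => [|c [|e [|f s]]] ss us; try by rewrite -ss in J5.
  exists c, e, f; move: us; rewrite (_ : [:: a; b] ++ [:: c, e, f & s] = [:: a; b; c; e; f] ++ s) //.
  by rewrite cat_uniq => /andP[].
pose s := [:: a; b; c; e; f].
(* points 0 and 1 are the coordinate points, the others are the five columns *)
pose pt (X : I -> J -> K) (t : bool) (k : 'I_7) : K := 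
  if k == 0%N :> nat then (if t then 1 else 0) else if k == 1%N :> nat then (if t then 0 else 1)
  else X (if t then j else i) (nth a s (k - 2)%N).
have H : forall p q : 'I_7, p != q -> mono (brk (pt A false) (pt A true) (pt B false) (pt B true) p q).
  have sl (p q : 'I_7) : (p < q)%N -> mono (brk (pt A false) (pt A true) (pt B false) (pt B true) p q).
    move=> pq; rewrite /brk /lbr /rbr /pt.
    have q0 : (q == 0%N :> nat) = false by lia.
    rewrite q0; have [p0|p0] := eqVneq (p : nat) 0%N.
      have [q1|q1] := eqVneq (q : nat) 1%N.
        by rewrite !mul0r !mul1r !sub0r mulrNN mul1r; apply: cst_mono; [exact: cst1|rewrite oner_eq0].
      by rewrite !mul0r !mul1r !sub0r mulrNN; apply: (sA1 S); case: (full (nth a s (q - 2))).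
    have q1 : (q == 1%N :> nat) = false by lia.
    rewrite q1; have [p1|p1] := eqVneq (p : nat) 1%N.
      by rewrite !mul0r !mul1r !subr0; apply: (sA1 S); case: (full (nth a s (q - 2))).
    have := ltn_ord q => q7.
    have ne : nth a s (p - 2) != nth a s (q - 2) by rewrite nth_uniq //=; lia.
    have -> (X : I -> J -> K) : X i (nth a s (p - 2)) * X j (nth a s (q - 2)) - X j (nth a s (p - 2)) * X i (nth a s (q - 2))
       = det2 X i j (nth a s (p - 2)) (nth a s (q - 2)) by rewrite /det2; ring.
    rewrite -/(det2 B _ _ _ _) -/(det2 A _ _ _ _).
    rewrite (_ : B i (nth a s (p - 2)) * B j (nth a s (q - 2)) - B j (nth a s (p - 2)) * B i (nth a s (q - 2))
       = det2 B i j (nth a s (p - 2)) (nth a s (q - 2))); last by rewrite /det2; ring.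
    by apply: (sA2 S) => //; apply: gen.
  move=> p q; rewrite -val_eqE /= neq_ltn => /orP[|] h; first exact: sl.
  by rewrite MS; apply: sl.
pose o k (h : (k < 7)%N) : 'I_7 := Ordinal h.
have := seven_points H (isT : uniq [:: o 0 isT; o 1 isT; o 2 isT; o 3 isT]).
rewrite /q4 /brk /lbr /rbr /pt /= => q.
have [m1 m2 m3 m4 m5] : [/\ mono (A i a * B i a), mono (A i b * B i b), mono (A j a * B j a), mono (A j b * B j b) &
   mono (det2 A i j a b * det2 B i j a b)] by split; try exact: (sA1 S); apply: (sA2 S).
pose z := (A i a * A j b) / (A i b * A j a).
have h := sB1 S.
have E1 : Y i j a b * z = ((A i a * B i a) * (A j b * B j b)) / ((A i b * B i b) * (A j a * B j a)).
  by rewrite /xratio mulf_div; congr (_ / _); ring.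
have E2 : (1 - Y i j a b) * (1 - z) = (det2 A i j a b * det2 B i j a b) / ((A i b * B i b) * (A j a * B j a)).
  by rewrite /xratio /z /det2; field; rewrite h2 h3 !h.
have w1 u : wt u (1 : K) = 0 by apply: wtC; [exact: cst1|rewrite oner_eq0].
have Q u : wt u (det2 A i j a b * det2 B i j a b) = wt u (A i a * B i a) + wt u (A j b * B j b) /\
   wt u (A i a * B i a) + wt u (A j b * B j b) = wt u (A i b * B i b) + wt u (A j a * B j a).
  have := q u; rewrite !(mul0r, mul1r, mulr0, mulr1, sub0r, subr0, mulrNN) w1 add0r /det2.
  by rewrite (mulrC (A j a) (A i b)) (mulrC (B j a) (B i b)).
apply: nc; apply: (@conj_cst _ _ _ _ z).
  rewrite E1; apply: cst_wt => [|u]; first by apply: mono_div; apply: monoM.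
  rewrite (wtM u (monoM m1 m4) (monoV (monoM m2 m3))) (wtV u (monoM m2 m3)) (wtM u m1 m4) (wtM u m2 m3).
  by case: (Q u) => _ ->; rewrite subrr.
rewrite E2; apply: cst_wt => [|u]; first by apply: mono_div => //; apply: monoM.
rewrite (wtM u m5 (monoV (monoM m2 m3))) (wtV u (monoM m2 m3)) (wtM u m2 m3).
by case: (Q u) => -> ->; rewrite subrr.
Qed.
End Fixed.

Lemma key_const (I J : finType) (A B : I -> J -> K) i j a b : system A B -> (5 <= maxn #|I| #|J|)%N ->
  keyAB A i j a b -> cst (xratio B i j a b).
Proof.
move=> S; rewrite leq_max => /orP[h|h] k; last first.
  by apply: (key_const_cols S).
rewrite -Y_tr; apply: (key_const_cols (system_tr S) h).
case: k => ij ab [h1 h2 h3 h4] dt; split=> //.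
by rewrite /det2 (mulrC (A j a)).
Qed.
End System.

(** * Linear relations between monomials *)

Section Relations.
Variables (C : numClosedFieldType) (d : nat) (K : laurent_field C d).
Implicit Types (x y c mu nu : K).

Lemma cst_or_wt x : mono x -> cst x \/ exists u, wt u x != 0.
Proof.
move=> mx; have [h|h] := EM (exists u, wt u x != 0); [by right|left; apply: cst_wt => // u].
by apply/eqP; apply: contraT => hu; case: h; exists u.
Qed.

(** If x had a non-zero degree, c would be alone in degree 0. *)
Lemma cst_add_mono c x y : cst c -> c != 0 -> mono x -> mono y -> c + x = y -> cst x.
Proof.
move=> hc c0 mx my E; have [//|[u hu]] := cst_or_wt mx.
by have := cst_add hc mx my E hu => c00; rewrite c00 eqxx in c0.
Qed.

Lemma one_sub_mono_cst mu nu : mono mu -> mono nu -> 1 - mu = nu -> cst mu.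
Proof.
move=> m1 m2 E; rewrite -[mu]opprK; apply: cstN.
by apply: (cst_add_mono (cst1 K) (oner_neq0 K) (monoN m1) m2).
Qed.

Lemma one_sub_ratio_cst c mu nu : cst c -> c != 1 -> mono mu -> mono nu -> 1 - mu = c * (1 - nu) -> cst mu.
Proof.
move=> hc c1 m1 m2 E; have [c0|c0] := eqVneq c 0.
  by move: E; rewrite c0 mul0r => /eqP; rewrite subr_eq0 => /eqP <-; exact: cst1.
apply: (@cst_add_mono (c - 1) _ (c * nu)) => //.
- by apply: cstB => //; exact: cst1.
- by rewrite subr_eq0.
- by apply: monoM => //; apply: cst_mono.
- by transitivity (c * 1 - (1 - mu)); [ring|rewrite E; ring].
Qed.

(** Otherwise the k-th term would be a whole component of the sum. *)
Lemma no_lone u (s : seq (int * K)) k : homs u s -> foldr (fun p (a : K) => p.2 + a) 0 s = 0 ->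
  (k < size s)%N -> (nth (0, 0) s k).2 != 0 ->
  has (fun q => q.1 == (nth (0, 0) s k).1) (take k s ++ drop k.+1 s).
Proof.
move=> hs s0 ks; apply: contraNT => /hasPn no.
have := gradeL (nth (0, 0) s k).1 hs s0.
set z := (nth _ _ _).1 in no *.
have F (t t' : seq (int * K)) : (forall q, q \in t -> q.1 != z) ->
   foldr (fun p (a : K) => if p.1 == z then p.2 + a else a) 0 (t ++ t') =
   foldr (fun p (a : K) => if p.1 == z then p.2 + a else a) 0 t'.
  elim: t => //= q t IH H; rewrite (negbTE (H q _)) ?inE ?eqxx //; apply: IH => r rt.
  by apply: H; rewrite inE rt orbT.
rewrite -{1}(cat_take_drop k s) F => [|q qt]; last by apply: no; rewrite mem_cat qt.
rewrite (drop_nth (0, 0) ks) /= eqxx -[drop k.+1 s]cats0 F => [|q qt]; last by apply: no; rewrite mem_cat qt orbT.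
by rewrite /= addr0 => ->.
Qed.

Section QCore.
Variables (ka t : K).
Hypothesis mt : mono t.

(** The result of eliminating ka from two relations ka (m - 1) = d t m - b: a sum of six
    monomials. *)
Definition six (d1 d2 b1 b2 m1 m2 : K) := (d1 - d2) * (m1 * m2 * t) + (- d1 * (m1 * t)) + d2 * (m2 * t)
   + (- b1 * m2) + b2 * m1 + (b1 - b2) = 0.

Lemma six_rel d1 d2 b1 b2 m1 m2 : m1 != 1 -> m2 != 1 ->
  ka * (m1 - 1) = d1 * t * m1 - b1 -> ka * (m2 - 1) = d2 * t * m2 - b2 -> six d1 d2 b1 b2 m1 m2.
Proof.
move=> n1 n2 E1 E2; rewrite /six.
transitivity ((d1 * t * m1 - b1) * (m2 - 1) - (d2 * t * m2 - b2) * (m1 - 1)); first by ring.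
by rewrite -E1 -E2; ring.
Qed.

Section Pair.
Variables (u : 'I_d) (d1 d2 b1 b2 m1 m2 : K).
Hypotheses (cd1 : cst d1) (cd2 : cst d2) (cb1 : cst b1) (cb2 : cst b2) (mm1 : mono m1) (mm2 : mono m2).
Hypotheses (d1n : d1 != 0) (d2n : d2 != 0) (d12 : d1 != d2) (b1n : b1 != 0) (b2n : b2 != 0) (b12 : b1 != b2).
Hypothesis E : six d1 d2 b1 b2 m1 m2.
Let T := wt u t. Let x := wt u m1. Let y := wt u m2.
Let s := [:: (x + y + T, (d1 - d2) * (m1 * m2 * t)); (x + T, - d1 * (m1 * t)); (y + T, d2 * (m2 * t));
  (y, - b1 * m2); (x, b2 * m1); (0, b1 - b2)].

Lemma six_homs : homs u s.
Proof.
have [h h1 h2] : [/\ hom u T t, hom u x m1 & hom u y m2] by split; apply: hom_wt.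
rewrite /s; do ![split] => //=; try (apply: homCl; [by do ?[apply: cstB|apply: cstN]|]) => //.
- by apply: homM => //; apply: homM.
- exact: homM.
- exact: homM.
- by apply: cst_hom; apply: cstB.
Qed.

Lemma six_sum : foldr (fun p (a : K) => p.2 + a) 0 s = 0.
Proof. by rewrite /= -[RHS]E; ring. Qed.

Definition six_grade z := gradeL z six_homs six_sum.

(** The degrees for which none of the six monomials is alone in its degree. *)
Lemma six_patterns : T != 0 -> [\/ [\/ x = 0 /\ y = 0, x = - T /\ y = - T | x = y /\ x + x = - T],
   x = 0 /\ y = T \/ x = T /\ y = 0 | x = - T /\ y = - (T + T) \/ x = - (T + T) /\ y = - T].
Proof.
move=> T0.
have L k := no_lone (k := k) six_homs six_sum.
have [n1 n2 n3] : [/\ m1 != 0, m2 != 0 & t != 0] by split; apply: mono_neq0.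
have l0 := L 0%N isT; have l1 := L 1%N isT; have l2 := L 2%N isT; have l3 := L 3%N isT; have l4 := L 4%N isT; have l5 := L 5%N isT.
move: l0 l1 l2 l3 l4 l5; rewrite /= !mulf_neq0 ?oppr_eq0 ?subr_eq0 ?d12 ?b12 //.
move=> /(_ isT) l0 /(_ isT) l1 /(_ isT) l2 /(_ isT) l3 /(_ isT) l4 /(_ isT) l5.
move: T0 l0 l1 l2 l3 l4 l5; rewrite !orbF; move: (T) (x) (y); clear => T x y T0.
have [x0|x0] := eqVneq x 0.
  move=> _ _ _ l3 _ _; have : y = 0 \/ y = T by move: l3 T0; rewrite x0; clear; lia.
  by case=> ->; [apply: Or31; apply: Or31|apply: Or32; left].
have [y0|y0] := eqVneq y 0.
  move=> _ _ _ _ l4 _; have : x = T by move: l4 T0 x0; rewrite y0; clear; lia.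
  by move=> ->; apply: Or32; right.
have [x1|x1] := eqVneq x (- T).
  move=> _ _ _ _ l4 _; have : y = - T \/ y = - (T + T) by move: l4 T0; rewrite x1; clear; lia.
  by case=> ->; [apply: Or31; apply: Or32|apply: Or33; left].
have [y1|y1] := eqVneq y (- T).
  move=> _ _ _ l3 _ _; have : x = - (T + T) by move: l3 T0 x1; rewrite y1; clear; lia.
  by move=> ->; apply: Or33; right.
move=> _ _ _ _ l4 l5; apply: Or31; apply: Or33.
by move: l4 l5 x0 y0 x1 y1 T0; clear; lia.
Qed.

Lemma six_zero : T != 0 -> x = 0 -> y = 0 -> b1 * (1 - m2) = b2 * (1 - m1).
Proof.
move=> T0 x0 y0; have := six_grade 0; rewrite /s /= x0 y0 !addr0 add0r (negbTE T0) eqxx => h.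
apply/eqP; rewrite -subr_eq0; apply/eqP; rewrite -[RHS]h; ring.
Qed.

Lemma six_negT : T != 0 -> x = - T -> y = - T -> d1 * t * m1 - b1 = d2 * t * m2 - b2.
Proof.
move=> T0 x0 y0; have := six_grade 0; rewrite /s /=.
have -> : (x + y + T == 0) = false by move: T0 x0 y0; clear; lia.
have -> : (x + T == 0) = true by move: T0 x0; clear; lia.
have -> : (y + T == 0) = true by move: T0 y0; clear; lia.
have -> : (y == 0) = false by move: T0 y0; clear; lia.
have -> : (x == 0) = false by move: T0 x0; clear; lia.
rewrite addr0 => h.
apply/eqP; rewrite -subr_eq0; apply/eqP; rewrite -[RHS]oppr0 -[in RHS]h; ring.
Qed.

Lemma six_half : T != 0 -> x = y -> x + x = - T -> b2 * m1 = b1 * m2.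
Proof.
move=> T0 xy xT; have := six_grade x; rewrite /s /= -xy eqxx.
have -> : (x + x + T == x) = false by move: T0 xT; clear; lia.
have -> : (x + T == x) = false by move: T0 xT; clear; lia.
have -> : (0 == x) = false by move: T0 xT; clear; lia.
rewrite addr0 => h.
apply/eqP; rewrite -subr_eq0; apply/eqP; rewrite -[RHS]h; ring.
Qed.

Lemma six_T0 : T = 0 -> x = 0 -> y != 0 -> (b2 - d1 * t) * m1 = b2 - b1.
Proof.
move=> T0 x0 y0; have := six_grade 0; rewrite /s /= x0 T0 !addr0 add0r (negbTE y0) eqxx => h.
apply/eqP; rewrite -subr_eq0; apply/eqP; rewrite -[RHS]h; ring.
Qed.

Lemma six_T0_opp : T = 0 -> x != 0 -> y != 0 -> x + y = 0.
Proof.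
move=> T0 x0 y0; have := no_lone (k := 5) six_homs six_sum isT; rewrite /= subr_eq0 => /(_ b12).
by rewrite T0 !addr0 orbF (negbTE x0) (negbTE y0) !orbF => /eqP.
Qed.
End Pair.

(** If t has a degree T <> 0, then [six_patterns] for the three pairs leaves only the case in
    which all m_e have degree - T / 2, and [six_half] makes the m_e proportional to the b_e,
    against the determinant condition. So t is constant. If then m_1 has degree 0, so have the
    others by [six_T0]; and three non-zero degrees cannot be pairwise opposite. *)
Lemma three_columns_linear (d1 d2 d3 b1 b2 b3 m1 m2 m3 : K) :
  [/\ cst d1, cst d2 & cst d3] -> [/\ cst b1, cst b2 & cst b3] -> [/\ mono m1, mono m2 & mono m3] ->
  [/\ d1 != 0, d2 != 0 & d3 != 0] -> [/\ b1 != 0, b2 != 0 & b3 != 0] ->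
  [/\ d1 != d2, d1 != d3 & d2 != d3] -> [/\ b1 != b2, b1 != b3 & b2 != b3] ->
  [/\ m1 != 1, m2 != 1 & m3 != 1] -> [/\ m1 != m2, m1 != m3 & m2 != m3] ->
  [/\ b1 * (1 - m2) != b2 * (1 - m1), b1 * (1 - m3) != b3 * (1 - m1) & b2 * (1 - m3) != b3 * (1 - m2)] ->
  ka != 0 -> [/\ ka != b1, ka != b2 & ka != b3] ->
  b1 * m2 - b2 * m1 + b3 * m1 - b1 * m3 + b2 * m3 - b3 * m2 != 0 ->
  ka * (m1 - 1) = d1 * t * m1 - b1 -> ka * (m2 - 1) = d2 * t * m2 - b2 -> ka * (m3 - 1) = d3 * t * m3 - b3 ->
  [/\ cst ka, cst m1, cst m2 & cst m3].
Proof.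
move=> [cd1 cd2 cd3] [cb1 cb2 cb3] [mm1 mm2 mm3] [d1n d2n d3n] [b1n b2n b3n] [d12 d13 d23] [b12 b13 b23].
move=> [m11 m21 m31] [m12 m13 m23] [y12 y13 y23] ka0 [k1 k2 k3] dt E1 E2 E3.
have S12 := six_rel m11 m21 E1 E2; have S13 := six_rel m11 m31 E1 E3; have S23 := six_rel m21 m31 E2 E3.
have ct : cst t.
  have [//|[u T0]] := cst_or_wt mt; exfalso.
  have P12 := six_patterns cd1 cd2 cb1 cb2 mm1 mm2 d1n d2n d12 b1n b2n b12 S12 T0.
  have P13 := six_patterns cd1 cd3 cb1 cb3 mm1 mm3 d1n d3n d13 b1n b3n b13 S13 T0.
  have P23 := six_patterns cd2 cd3 cb2 cb3 mm2 mm3 d2n d3n d23 b2n b3n b23 S23 T0.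
  have N (a a' b b' m m' : K) : ka * (m - 1) = a * t * m - b -> ka * (m' - 1) = a' * t * m' - b' ->
      m != m' -> a * t * m - b = a' * t * m' - b' -> False.
    by move=> F F' ne e; case/eqP: ne; move: e; rewrite -F -F' => /(mulfI ka0)/addIr.
  have {}P12 : [\/ wt u m1 = wt u m2 /\ wt u m1 + wt u m1 = - wt u t, wt u m1 = 0 /\ wt u m2 = wt u t
      \/ wt u m1 = wt u t /\ wt u m2 = 0 | wt u m1 = - wt u t /\ wt u m2 = - (wt u t + wt u t) \/
      wt u m1 = - (wt u t + wt u t) /\ wt u m2 = - wt u t].
    case: P12 => [[[p q]|[p q]|pq]|pq|pq]; [| |by apply: Or31|by apply: Or32|by apply: Or33].
      by case/eqP: y12; apply: (six_zero cd1 cd2 cb1 cb2 mm1 mm2 S12 T0 p q).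
    by case: (N _ _ _ _ _ _ E1 E2 m12 (six_negT cd1 cd2 cb1 cb2 mm1 mm2 S12 T0 p q)).
  have {}P13 : [\/ wt u m1 = wt u m3 /\ wt u m1 + wt u m1 = - wt u t, wt u m1 = 0 /\ wt u m3 = wt u t
      \/ wt u m1 = wt u t /\ wt u m3 = 0 | wt u m1 = - wt u t /\ wt u m3 = - (wt u t + wt u t) \/
      wt u m1 = - (wt u t + wt u t) /\ wt u m3 = - wt u t].
    case: P13 => [[[p q]|[p q]|pq]|pq|pq]; [| |by apply: Or31|by apply: Or32|by apply: Or33].
      by case/eqP: y13; apply: (six_zero cd1 cd3 cb1 cb3 mm1 mm3 S13 T0 p q).
    by case: (N _ _ _ _ _ _ E1 E3 m13 (six_negT cd1 cd3 cb1 cb3 mm1 mm3 S13 T0 p q)).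
  have {}P23 : [\/ wt u m2 = wt u m3 /\ wt u m2 + wt u m2 = - wt u t, wt u m2 = 0 /\ wt u m3 = wt u t
      \/ wt u m2 = wt u t /\ wt u m3 = 0 | wt u m2 = - wt u t /\ wt u m3 = - (wt u t + wt u t) \/
      wt u m2 = - (wt u t + wt u t) /\ wt u m3 = - wt u t].
    case: P23 => [[[p q]|[p q]|pq]|pq|pq]; [| |by apply: Or31|by apply: Or32|by apply: Or33].
      by case/eqP: y23; apply: (six_zero cd2 cd3 cb2 cb3 mm2 mm3 S23 T0 p q).
    by case: (N _ _ _ _ _ _ E2 E3 m23 (six_negT cd2 cd3 cb2 cb3 mm2 mm3 S23 T0 p q)).
  have [e1 e2 e3] : [/\ wt u m1 = wt u m2, wt u m1 = wt u m3 & wt u m1 + wt u m1 = - wt u t].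
    move: T0 P12 P13 P23; move: (wt u m1) (wt u m2) (wt u m3) (wt u t); clear => w1 w2 w3 T T0.
    by case=> [[]|[[]|[]]|[[]|[]]] h1 h2; case=> [[]|[[]|[]]|[[]|[]]] h3 h4;
      case=> [[]|[[]|[]]|[[]|[]]] h5 h6; split; lia.
  have h12 := six_half cd1 cd2 cb1 cb2 mm1 mm2 S12 T0 e1 e3.
  have h13 := six_half cd1 cd3 cb1 cb3 mm1 mm3 S13 T0 e2 e3.
  have h23 : b3 * m2 = b2 * m3.
    by apply: (six_half cd2 cd3 cb2 cb3 mm2 mm3 S23 T0); rewrite -?e1.
  by move/eqP: dt; apply; rewrite -h12 -h13 -h23; ring.
have T0 u : wt u t = 0 by apply: wtC => //; apply: mono_neq0.
have kaE (a b m : K) : cst a -> cst b -> cst m -> m != 1 -> ka * (m - 1) = a * t * m - b -> cst ka.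
  move=> ca cb cm m1' F; have m0 : m - 1 != 0 by rewrite subr_eq0.
  have -> : ka = (a * t * m - b) / (m - 1) by rewrite -F mulfK.
  apply: cst_div; apply: cstB => //; [|exact: cst1].
  by apply: cstM => //; apply: cstM.
have zz u (a a' b b' m m' : K) : [/\ cst a, cst a', cst b & cst b'] -> mono m -> mono m' ->
    b' != b -> m != 1 -> m' != 1 -> ka != b' -> ka * (m - 1) = a * t * m - b -> ka * (m' - 1) = a' * t * m' - b' ->
    wt u m = 0 -> wt u m' = 0.
  move=> [ca ca' cb cb'] mm mm' bb m1' m1'' kb F F' w0; apply/eqP; apply: contraT => w1.
  have H : (b' - a * t) * m = b' - b.
    by apply: (six_T0 (m2 := m') ca ca' cb cb' mm mm' (six_rel m1' m1'' F F') (T0 u) w0 w1).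
  have z : b' - a * t != 0.
    by apply: contraNneq bb => z; move: H; rewrite z mul0r => /esym/eqP; rewrite subr_eq0.
  have cm : cst m.
    have -> : m = (b' - b) / (b' - a * t) by rewrite -H mulrC mulKf.
    by apply: cst_div; apply: cstB => //; apply: cstM.
  have cka := kaE a b m ca cb cm m1' F.
  have F2 : (ka - a' * t) * m' = ka - b'.
    apply/eqP; rewrite -subr_eq0; apply/eqP.
    transitivity (ka * (m' - 1) - (a' * t * m' - b')); [ring|by rewrite F' subrr].
  have z' : ka - a' * t != 0.
    by apply: contraNneq kb => z'; move: F2; rewrite z' mul0r => /esym/eqP; rewrite subr_eq0.
  have cm' : cst m'.
    have -> : m' = (ka - b') / (ka - a' * t) by rewrite -F2 mulrC mulKf.
    by apply: cst_div; apply: cstB => //; apply: cstM.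
  by rewrite wtC ?eqxx // mono_neq0 in w1.
have [c12 c13 c23] : [/\ [/\ cst d1, cst d2, cst b1 & cst b2], [/\ cst d1, cst d3, cst b1 & cst b3] &
  [/\ cst d2, cst d3, cst b2 & cst b3]] by [].
have [c21 c31 c32] : [/\ [/\ cst d2, cst d1, cst b2 & cst b1], [/\ cst d3, cst d1, cst b3 & cst b1] &
  [/\ cst d3, cst d2, cst b3 & cst b2]] by [].
have [b21 b31 b32] : [/\ b2 != b1, b3 != b1 & b3 != b2] by split; rewrite eq_sym.
have W u : [/\ wt u m1 = 0, wt u m2 = 0 & wt u m3 = 0].
  have [p|p] := eqVneq (wt u m1) 0.
    split=> //; first exact: (zz u _ _ _ _ _ _ c12 mm1 mm2 b21 m11 m21 k2 E1 E2 p).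
    exact: (zz u _ _ _ _ _ _ c13 mm1 mm3 b31 m11 m31 k3 E1 E3 p).
  have [q|q] := eqVneq (wt u m2) 0.
    by rewrite (zz u _ _ _ _ _ _ c21 mm2 mm1 b12 m21 m11 k1 E2 E1 q) eqxx in p.
  have [r|r] := eqVneq (wt u m3) 0.
    by rewrite (zz u _ _ _ _ _ _ c31 mm3 mm1 b13 m31 m11 k1 E3 E1 r) eqxx in p.
  have h1 := six_T0_opp cd1 cd2 cb1 cb2 mm1 mm2 b12 S12 (T0 u) p q.
  have h2 := six_T0_opp cd1 cd3 cb1 cb3 mm1 mm3 b13 S13 (T0 u) p r.
  have h3 := six_T0_opp cd2 cd3 cb2 cb3 mm2 mm3 b23 S23 (T0 u) q r.
  by move: h1 h2 h3 p; clear; lia.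
have cm1 : cst m1 by apply: cst_wt => // u; case: (W u).
have cm2 : cst m2 by apply: cst_wt => // u; case: (W u).
have cm3 : cst m3 by apply: cst_wt => // u; case: (W u).
by split=> //; apply: (kaE d1 b1 m1).
Qed.
End QCore.
End Relations.

(** * Three columns, two unknowns, one unknown *)

Section Elements.
Variables (C : numClosedFieldType) (d : nat) (K : laurent_field C d).

Lemma cst_sum_ratio (t r s : K) : mono t -> mono r -> mono s -> t + r = s -> cst (s / t).
Proof.
move=> mt mr ms E; have t0 := mono_neq0 mt.
have -> : s / t = 1 + r / t by rewrite -E; field.
apply: cstD; first exact: cst1.
apply: (cst_add_mono (cst1 K) (oner_neq0 K) (mono_div mr mt) (mono_div ms mt)).
by rewrite -E; field.
Qed.

(** Three columns with entries (1, b_e, 1 - m_e) in three rows, and a fourth one with entries (1,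
    ka, 1). By the conditions on minors, enough of the tau_e and of their differences are
    monomials to make the ratios of the tau_e constant, and ka (m_e - 1) = tau_e m_e - b_e is a
    relation as in [three_columns_linear]. *)
Lemma three_columns (ka b1 b2 b3 m1 m2 m3 n1 n2 : K) :
  [/\ cst b1, cst b2 & cst b3] -> [/\ mono m1, mono m2 & mono m3] ->
  [/\ b1 != 0, b2 != 0 & b3 != 0] -> [/\ b1 != b2, b1 != b3 & b2 != b3] ->
  [/\ m1 != 1, m2 != 1 & m3 != 1] -> [/\ m1 != m2, m1 != m3 & m2 != m3] ->
  [/\ b1 * (1 - m2) != b2 * (1 - m1), b1 * (1 - m3) != b3 * (1 - m1) & b2 * (1 - m3) != b3 * (1 - m2)] ->
  ka != 0 -> [/\ ka != b1, ka != b2 & ka != b3] ->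
  [/\ ka * (1 - m1) != b1, ka * (1 - m2) != b2 & ka * (1 - m3) != b3] ->
  b1 * m2 - b2 * m1 + b3 * m1 - b1 * m3 + b2 * m3 - b3 * m2 != 0 ->
  mono n1 -> mono n2 -> ka * (1 - m1) = b1 * (1 - n1) -> ka * (1 - m2) = b2 * (1 - n2) ->
  mono ((b2 - ka) * m1 - (b1 - ka) * m2) -> mono ((b3 - ka) * m1 - (b1 - ka) * m3) ->
  (b3 - ka) * m2 - (b2 - ka) * m3 != 0 ->
  (exists2 n3, mono n3 & ka * (1 - m3) = b3 * (1 - n3)) \/ mono ((b3 - ka) * m2 - (b2 - ka) * m3) ->
  [/\ cst ka, cst m1, cst m2 & cst m3].
Proof.
move=> cb mm bn bb m1' mn yy ka0 kb [k1 k2 k3] dt mn1 mn2 E1 E2 D12 D13 D23 alt.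
have [mm1 mm2 mm3] := mm; have [b1n b2n b3n] := bn; have [cb1 cb2 cb3] := cb.
have [z1 z2 z3] : [/\ m1 != 0, m2 != 0 & m3 != 0] by split; apply: mono_neq0.
pose tau (b m : K) := ka + (b - ka) / m.
have tE b m : m != 0 -> m * tau b m = b - ka * (1 - m).
  by move=> m0; rewrite /tau; field.
have tM b m n : cst b -> b != 0 -> m != 0 -> mono m -> mono n -> ka * (1 - m) = b * (1 - n) -> mono (tau b m).
  move=> hb b0 m0 hm hn E.
  have -> : tau b m = b * n / m by apply: (mulfI m0); rewrite tE // E; field.
  by apply: mono_div => //; apply: monoM => //; apply: cst_mono.
have t0 b m : m != 0 -> ka * (1 - m) != b -> tau b m != 0.
  by move=> m0 ne; apply: contraNneq ne => h; have := tE b m m0; rewrite h mulr0 => /esym/eqP; rewrite subr_eq0 eq_sym.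
have tD b m b' m' : m != 0 -> m' != 0 -> tau b' m' - tau b m = ((b' - ka) * m - (b - ka) * m') / (m * m').
  by move=> h h'; rewrite /tau; field; rewrite h h'.
have mt1 := tM b1 m1 n1 cb1 b1n z1 mm1 mn1 E1; have mt2 := tM b2 m2 n2 cb2 b2n z2 mm2 mn2 E2.
have r12 : mono (tau b2 m2 - tau b1 m1) by rewrite tD //; apply: mono_div => //; apply: monoM.
have r13 : mono (tau b3 m3 - tau b1 m1) by rewrite tD //; apply: mono_div => //; apply: monoM.
have c2 : cst (tau b2 m2 / tau b1 m1) by apply: (cst_sum_ratio mt1 r12 mt2); ring.
have t1n := mono_neq0 mt1.
have c3 : cst (tau b3 m3 / tau b1 m1).
  case: alt => [[n3 mn3 E3]|D23'].
    by apply: (cst_sum_ratio mt1 r13 (tM b3 m3 n3 cb3 b3n z3 mm3 mn3 E3)); ring.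
  have r23 : mono (tau b3 m3 - tau b2 m2) by rewrite tD //; apply: mono_div => //; apply: monoM.
  have r12n := mono_neq0 r12.
  have h : cst ((tau b3 m3 - tau b1 m1) / (tau b2 m2 - tau b1 m1)) by apply: (cst_sum_ratio r12 r23 r13); ring.
  have -> : tau b3 m3 / tau b1 m1 = 1 + (tau b3 m3 - tau b1 m1) / (tau b2 m2 - tau b1 m1) * (tau b2 m2 / tau b1 m1 - 1).
    by field; rewrite t1n r12n.
  by apply: cstD; [exact: cst1|apply: cstM => //; apply: cstB => //; exact: cst1].
have eq b m : m != 0 -> ka * (m - 1) = tau b m / tau b1 m1 * tau b1 m1 * m - b.
  by move=> m0; rewrite divfK // (mulrC _ m) tE //; ring.
have dne b m b' m' : m != 0 -> m' != 0 -> (b' - ka) * m - (b - ka) * m' != 0 -> tau b m / tau b1 m1 != tau b' m' / tau b1 m1.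
  move=> h h' ne; apply/eqP => /(mulIf (invr_neq0 t1n)) e; case/eqP: ne.
  have := tD b m b' m' h h'; rewrite e subrr => /esym/eqP.
  by rewrite mulf_eq0 invr_eq0 mulf_eq0 (negbTE h) (negbTE h') /= orbF => /eqP.
apply: (@three_columns_linear _ _ K ka (tau b1 m1) mt1 (tau b1 m1 / tau b1 m1) (tau b2 m2 / tau b1 m1) (tau b3 m3 / tau b1 m1) b1 b2 b3) => //.
- by rewrite divff //; split=> //; exact: cst1.
- by split; rewrite mulf_neq0 ?invr_eq0 ?t0.
- by split; apply: dne => //; apply: mono_neq0.
- exact: eq.
- exact: eq.
- exact: eq.
Qed.

Section TwoUnknowns.
Variables (y1 y2 y3 z1 z2 z3 c2 c4 P Q M0 : K).
Hypotheses (cy : [/\ cst y1, cst y2 & cst y3]) (cz : [/\ cst z1, cst z2 & cst z3]) (cc2 : cst c2) (cc4 : cst c4).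
Let M y z := M0 + y * P + z * Q.
Let e12 := y1 * z2 - y2 * z1. Let e13 := y1 * z3 - y3 * z1. Let e23 := y2 * z3 - y3 * z2.
Let e0 := e23 - e13 + e12.
Hypotheses (y1n : y1 != 0) (z1n : z1 != 0) (e12n : e12 != 0) (e13n : e13 != 0) (e23n : e23 != 0).
Hypotheses (y23 : y2 != y3) (z23 : z2 != z3).
Hypotheses (mM0 : mono M0) (mM1 : mono (M y1 z1)) (mM2 : mono (M y2 z2)) (mM3 : mono (M y3 z3)).
Hypothesis E : M0 + P * Q + c2 * P + c4 * Q = 0.

Lemma cst_e : [/\ cst e12, cst e13, cst e23 & cst e0].
Proof.
have [h1 h2 h3] := cy; have [k1 k2 k3] := cz.
have a12 : cst e12 by apply: cstB; apply: cstM.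
have a13 : cst e13 by apply: cstB; apply: cstM.
have a23 : cst e23 by apply: cstB; apply: cstM.
by split=> //; apply: cstD => //; apply: cstB.
Qed.

Lemma affine_rel : e23 * M y1 z1 + (- e13 * M y2 z2) + e12 * M y3 z3 + (- e0 * M0) = 0.
Proof. by rewrite /e0 /M /e12 /e13 /e23; ring. Qed.

(** If the four monomials had two degrees, each shared by two of them, then P and Q would be
    linear in two monomials X, T of different degrees. The quadratic relation splits into degrees,
    which makes coefficients vanish that cannot vanish together. *)
Lemma pairs_absurd u : wt u M0 = wt u (M y1 z1) -> wt u (M y2 z2) = wt u (M y3 z3) ->
  wt u M0 != wt u (M y2 z2) -> False.
Proof.
have [ce12 ce13 ce23 ce0] := cst_e; have [h1 h2 h3] := cy; have [k1 k2 k3] := cz.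
move=> w01 w23 xy.
have hs : homs u [:: (wt u M0, e23 * M y1 z1); (wt u (M y2 z2), - e13 * M y2 z2);
     (wt u (M y2 z2), e12 * M y3 z3); (wt u M0, - e0 * M0)].
  split; [|split; [|split; [|split]]] => //=; apply: homCl => //; try (by apply: cstN); try exact: hom_wt.
    by rewrite w01; apply: hom_wt.
  by rewrite w23; apply: hom_wt.
have s0 : foldr (fun p (a : K) => p.2 + a) 0 [:: (wt u M0, e23 * M y1 z1); (wt u (M y2 z2), - e13 * M y2 z2);
     (wt u (M y2 z2), e12 * M y3 z3); (wt u M0, - e0 * M0)] = 0.
  by rewrite /= -[RHS]affine_rel; ring.
have g1 := gradeL (wt u M0) hs s0.
rewrite /= eqxx eq_sym (negbTE xy) addr0 in g1.
have EM1 : M y1 z1 = e0 / e23 * M0.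
  by apply: (mulfI e23n); rewrite mulrA mulrCA divff // mulr1; apply/eqP; rewrite -subr_eq0 -g1; apply/eqP; ring.
pose f := e0 / e23; have cf' : cst f by apply: cst_div.
pose X := M0; pose T := M y2 z2.
pose a := ((f - 1) * z2 + z1) / e12; pose b := - z1 / e12.
pose a' := - (y1 + y2 * (f - 1)) / e12; pose b' := y1 / e12.
have one := cst1 K.
have [ca cb ca' cb'] : [/\ cst a, cst b, cst a' & cst b'].
  split; apply: cst_div => //.
  - by apply: cstD => //; apply: cstM => //; apply: cstB.
  - exact: cstN.
  - by apply: cstN; apply: cstD => //; apply: cstM => //; apply: cstB.
have EP : P = a * X + b * T.
  rewrite /a /b; apply: (mulfI e12n).
  transitivity ((M y1 z1 - M0) * z2 - (M y2 z2 - M0) * z1); first by rewrite /M /e12; ring.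
  by rewrite EM1 -/f /X /T; field.
have EQ : Q = a' * X + b' * T.
  rewrite /a' /b'; apply: (mulfI e12n).
  transitivity (y1 * (M y2 z2 - M0) - y2 * (M y1 z1 - M0)); first by rewrite /M /e12; ring.
  by rewrite EM1 -/f /X /T; field.
have bn : b != 0 by rewrite mulf_neq0 ?oppr_eq0 ?invr_eq0.
have bn' : b' != 0 by rewrite mulf_neq0 ?invr_eq0.
have I2 : 1 + a * y2 + a' * z2 = 0 by rewrite /a /a' /e12; field.
have I3 : 1 + a * y3 + a' * z3 = 0.
  by rewrite /a /a' /f /e0; rewrite /e12 /e13 /e23; field; rewrite -/e12 -/e23 e12n e23n.
have [mX mT] : mono X /\ mono T by [].
have [Xn Tn] := conj (mono_neq0 mX) (mono_neq0 mT).
pose x := wt u X; pose y := wt u T.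
have [hX hT] : hom u x X /\ hom u y T by split; apply: hom_wt.
pose s := [:: (x + x, a * a' * (X * X)); (x + y, (a * b' + a' * b) * (X * T)); (y + y, b * b' * (T * T));
   (x, (1 + c2 * a + c4 * a') * X); (y, (c2 * b + c4 * b') * T)].
have hs2 : homs u s.
  split; [|split; [|split; [|split; [|split]]]] => //=; apply: homCl; try (by apply: homM); try exact: hT; try exact: hX.
  - exact: cstM.
  - by apply: cstD; apply: cstM.
  - exact: cstM.
  - by apply: cstD; [apply: cstD => //|]; apply: cstM.
  - by apply: cstD; apply: cstM.
have s02 : foldr (fun p (a : K) => p.2 + a) 0 s = 0.
  by rewrite /= -[RHS]E EP EQ -/X; ring.
have xy' : x != y by [].
have ln := no_lone (k := 2) hs2 s02 isT (mulf_neq0 (mulf_neq0 bn bn') (mulf_neq0 Tn Tn)); rewrite /= in ln.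
have g2 := gradeL (x + x) hs2 s02; have g11 := gradeL (x + y) hs2 s02.
rewrite /= eqxx in g2 g11.
have [y0|y0] := eqVneq y 0.
  move: g2; have -> : (x + y == x + x) = false by move: xy'; clear; lia.
  have -> : (y + y == x + x) = false by move: xy'; clear; lia.
  have -> : (x == x + x) = false by move: xy'; rewrite y0; clear; lia.
  have -> : (y == x + x) = false by move: xy'; rewrite y0; clear; lia.
  rewrite addr0 => /eqP; rewrite mulf_eq0 (mulf_eq0 X) (negbTE Xn) /= orbF mulf_eq0 => /orP[/eqP a0|/eqP a0].
    move: I2 I3; rewrite a0 !mul0r !addr0 => I2 I3.
    case/eqP: z23; have a'n : a' != 0.
      by apply/eqP => z; move: I2; rewrite z mul0r addr0 => /eqP; rewrite oner_eq0.
    by apply: (mulfI a'n); apply: (addrI 1); rewrite I2 I3.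
  move: I2 I3; rewrite a0 !mul0r !addr0 => I2 I3.
  case/eqP: y23; have a'n : a != 0.
    by apply/eqP => z; move: I2; rewrite z mul0r addr0 => /eqP; rewrite oner_eq0.
  by apply: (mulfI a'n); apply: (addrI 1); rewrite I2 I3.
have x2 : x = y + y by move: ln xy' y0; clear; lia.
move: g2 g11.
have -> : (x + y == x + x) = false by move: xy'; clear; lia.
have -> : (x + x == x + y) = false by move: xy'; clear; lia.
have -> : (y + y == x + x) = false by move: y0; rewrite x2; clear; lia.
have -> : (x == x + x) = false by move: y0; rewrite x2; clear; lia.
have -> : (y == x + x) = false by move: y0; rewrite x2; clear; lia.
have -> : (y + y == x + y) = false by move: y0; rewrite x2; clear; lia.
have -> : (x == x + y) = false by move: y0; rewrite x2; clear; lia.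
have -> : (y == x + y) = false by move: y0; rewrite x2; clear; lia.
rewrite !addr0 => /eqP; rewrite mulf_eq0 (mulf_eq0 X) (negbTE Xn) /= orbF mulf_eq0 => aa /eqP.
rewrite eqxx mulf_eq0 (mulf_eq0 X) (negbTE Xn) (negbTE Tn) /= orbF => /eqP ab.
have [a0 a0'] : a = 0 /\ a' = 0.
  case/orP: aa => /eqP h; split=> //.
    by move/eqP: ab; rewrite h mul0r add0r mulf_eq0 (negbTE bn) orbF => /eqP.
  by move/eqP: ab; rewrite h mul0r addr0 mulf_eq0 (negbTE bn') orbF => /eqP.
by move/eqP: I2; rewrite a0 a0' !mul0r !addr0 oner_eq0.
Qed.
End TwoUnknowns.

(** Three columns of constant entries and two unknowns: by [affine_rel] no monomial is alone in
    its degree, and by [pairs_absurd] there are no two pairs. So all degrees agree, P / M0 and Q /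
    M0 are constant, and the quadratic relation gives M0. *)
Lemma two_unknowns (y1 y2 y3 z1 z2 z3 c2 c4 P Q M0 : K) :
  [/\ cst y1, cst y2 & cst y3] -> [/\ cst z1, cst z2 & cst z3] -> cst c2 -> cst c4 ->
  [/\ y1 != 0, y2 != 0 & y3 != 0] -> [/\ z1 != 0, z2 != 0 & z3 != 0] ->
  [/\ y1 * z2 - y2 * z1 != 0, y1 * z3 - y3 * z1 != 0 & y2 * z3 - y3 * z2 != 0] ->
  y2 * z3 - y3 * z2 - (y1 * z3 - y3 * z1) + (y1 * z2 - y2 * z1) != 0 ->
  [/\ y1 != y2, y1 != y3 & y2 != y3] -> [/\ z1 != z2, z1 != z3 & z2 != z3] ->
  P != 0 -> Q != 0 ->
  mono M0 -> mono (M0 + y1 * P + z1 * Q) -> mono (M0 + y2 * P + z2 * Q) -> mono (M0 + y3 * P + z3 * Q) ->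
  M0 + P * Q + c2 * P + c4 * Q = 0 -> cst P /\ cst Q.
Proof.
move=> cy cz cc2 cc4 [y1n y2n y3n] [z1n z2n z3n] [e12 e13 e23] e0 [y12 y13 y23] [z12 z13 z23] Pn Qn m0 m1 m2 m3 E.
have [h1 h2 h3] := cy; have [k1 k2 k3] := cz.
have swp (a b c e : K) : a * b - c * e != 0 -> c * e - a * b != 0 by rewrite -oppr_eq0 opprB.
have eqw u : wt u (M0 + y1 * P + z1 * Q) = wt u M0 /\ wt u (M0 + y2 * P + z2 * Q) = wt u M0.
  have [ce12 ce13 ce23 ce0] := cst_e cy cz.
  have := affine_rel y1 y2 y3 z1 z2 z3 P Q M0.
  set N1 := M0 + y1 * P + z1 * Q in m1 *; set N2 := M0 + y2 * P + z2 * Q in m2 *; set N3 := M0 + y3 * P + z3 * Q in m3 *.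
  move=> R.
  have A1 := @pairs_absurd y1 y2 y3 z1 z2 z3 c2 c4 P Q M0 cy cz cc2 cc4 y1n z1n e12 e23 y23 z23 m0 m1 m2 m3 E u.
  have A2 := @pairs_absurd y2 y1 y3 z2 z1 z3 c2 c4 P Q M0 _ _ cc2 cc4 y2n z2n (swp _ _ _ _ e12) e13 y13 z13 m0 m2 m1 m3 E u.
  have A3 := @pairs_absurd y3 y1 y2 z3 z1 z2 c2 c4 P Q M0 _ _ cc2 cc4 y3n z3n (swp _ _ _ _ e13) e12 y12 z12 m0 m3 m1 m2 E u.
  have {}A2 := A2 (And3 h2 h1 h3) (And3 k2 k1 k3).
  have {}A3 := A3 (And3 h3 h1 h2) (And3 k3 k1 k2).
  rewrite -/N1 -/N2 -/N3 in A1 A2 A3.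
  pose s := [:: (wt u N1, (y2 * z3 - y3 * z2) * N1); (wt u N2, - (y1 * z3 - y3 * z1) * N2);
     (wt u N3, (y1 * z2 - y2 * z1) * N3); (wt u M0, - (y2 * z3 - y3 * z2 - (y1 * z3 - y3 * z1) + (y1 * z2 - y2 * z1)) * M0)].
  have hs : homs u s.
    split; [|split; [|split; [|split]]] => //=; apply: homCl => //; try (by apply: cstN); exact: hom_wt.
  have s0 : foldr (fun p (a : K) => p.2 + a) 0 s = 0 by rewrite /= -[RHS]R; ring.
  have [n0 n1 n2 n3] := And4 (mono_neq0 m0) (mono_neq0 m1) (mono_neq0 m2) (mono_neq0 m3).
  have L0 := no_lone (k := 3) hs s0 isT; have L1 := no_lone (k := 0) hs s0 isT.
  have L2 := no_lone (k := 1) hs s0 isT; have L3 := no_lone (k := 2) hs s0 isT.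
  move: L0 L1 L2 L3; rewrite /= !mulf_neq0 ?oppr_eq0 // => /(_ isT) L0 /(_ isT) L1 /(_ isT) L2 /(_ isT) L3.
  move: L0 L1 L2 L3 A1 A2 A3; move: (wt u N1) (wt u N2) (wt u N3) (wt u M0); clear => w1 w2 w3 w0 L0 L1 L2 L3 A1 A2 A3.
  have {}A1 : ~ [/\ w0 = w1, w2 = w3 & w0 != w2] by case.
  have {}A2 : ~ [/\ w0 = w2, w1 = w3 & w0 != w1] by case.
  have {}A3 : ~ [/\ w0 = w3, w1 = w2 & w0 != w1] by case.
  have [e1|n1] := eqVneq w0 w1.
    split=> //; apply/eqP; apply: contraT => n2; case: A1; split=> //; last by rewrite eq_sym.
    by move: L2 e1 n2; clear; lia.
  exfalso; have [e2|n2] := eqVneq w0 w2; first by apply: A2; split=> //; move: L1 e2 n1; clear; lia.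
  by apply: A3; split=> //; move: L0 L1 n1 n2; clear; lia.
have n0 := mono_neq0 m0.
have ratio N : mono N -> (forall u, wt u N = wt u M0) -> cst (N / M0).
  move=> mN h; apply: cst_wt => [|u]; first exact: mono_div.
  by rewrite (wtM u mN (monoV m0)) (wtV u m0) h subrr.
have r1 := ratio _ m1 (fun u => (eqw u).1); have r2 := ratio _ m2 (fun u => (eqw u).2).
have one := cst1 K.
have pE : cst (P / M0).
  have -> : P / M0 = (((M0 + y1 * P + z1 * Q) / M0 - 1) * z2 - ((M0 + y2 * P + z2 * Q) / M0 - 1) * z1) / (y1 * z2 - y2 * z1).
    by field; rewrite n0 e12.
  by apply: cst_div; apply: cstB; apply: cstM => //; apply: cstB.
have qE : cst (Q / M0).
  have -> : Q / M0 = (y1 * ((M0 + y2 * P + z2 * Q) / M0 - 1) - y2 * ((M0 + y1 * P + z1 * Q) / M0 - 1)) / (y1 * z2 - y2 * z1).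
    by field; rewrite n0 e12.
  by apply: cst_div; apply: cstB; apply: cstM => //; apply: cstB.
have c0 : cst M0.
  have -> : M0 = - (1 + c2 * (P / M0) + c4 * (Q / M0)) / ((P / M0) * (Q / M0)).
    apply/eqP; rewrite -subr_eq0; apply/eqP.
    transitivity (M0 * (M0 + P * Q + c2 * P + c4 * Q) / (P * Q)); last by rewrite E mulr0 mul0r.
    by field; rewrite n0 Pn Qn.
  apply: cst_div; last exact: cstM.
  by apply: cstN; apply: cstD; [apply: cstD => //|]; apply: cstM.
by split; [rewrite -(divfK n0 P)|rewrite -(divfK n0 Q)]; apply: cstM.
Qed.

Section LemmaU.
Variables (I J : finType) (A B : I -> J -> K).
Hypothesis S : system A B.

(** Developed along its unknown entry, the determinant is a non-zero constant plus a constant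
    multiple of mu, and [cst_add_mono] applies. *)
Lemma one_unknown (r1 r2 r3 : I) (s1 s2 s3 : J) mu : uniq [:: r1; r2; r3] -> uniq [:: s1; s2; s3] ->
  [/\ cst (B r1 s1), cst (B r1 s2) & cst (B r1 s3)] -> [/\ cst (B r2 s1), cst (B r2 s2) & cst (B r2 s3)] ->
  cst (B r3 s2) -> cst (B r3 s3) -> mono mu -> B r3 s1 * B r1 s2 = B r1 s1 * B r3 s2 * (1 - mu) ->
  mono (det3 B r1 r2 r3 s1 s2 s3) -> cst (B r3 s1).
Proof.
move=> U V [c11 c12 c13] [c21 c22 c23] c32 c33 mmu E mD; have h := sB1 S.
move: U V; rewrite /= !inE !negb_or -!andbA => /and4P[r12 r13 r23 _] /and4P[s12 s13 s23 _].
pose la := B r3 s2 / B r1 s2.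
have cla : cst la by apply: cst_div.
have Ex : B r3 s1 = la * B r1 s1 * (1 - mu).
  apply: (mulIf (h r1 s2)); rewrite E /la; field; exact: h.
have E32 : B r3 s2 = la * B r1 s2 by rewrite /la divfK.
have d1 : det2 B r1 r2 s1 s2 != 0 by apply: (sB2 S).
have d2 : det2 B r1 r2 s2 s3 != 0 by apply: (sB2 S).
have d3 : B r3 s3 - la * B r1 s3 != 0.
  have := sB2 S r13 s23; rewrite /det2 E32; apply: contraNneq => z.
  by apply/eqP; transitivity (B r1 s2 * (B r3 s3 - la * B r1 s3)); [ring|rewrite z mulr0].
have ED : det3 B r1 r2 r3 s1 s2 s3 = (B r3 s3 - la * B r1 s3) * det2 B r1 r2 s1 s2
    + (- (la * B r1 s1 * det2 B r1 r2 s2 s3)) * mu.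
  by rewrite /det3 /det2 Ex E32; ring.
have cd3 : cst (B r3 s3 - la * B r1 s3) by apply: cstB => //; apply: cstM.
have cd1 : cst (det2 B r1 r2 s1 s2) by apply: cstB; apply: cstM.
have cd2 : cst (det2 B r1 r2 s2 s3) by apply: cstB; apply: cstM.
have ce : cst (- (la * B r1 s1 * det2 B r1 r2 s2 s3)) by apply: cstN; apply: cstM => //; apply: cstM.
have en : - (la * B r1 s1 * det2 B r1 r2 s2 s3) != 0.
  by rewrite oppr_eq0 !mulf_neq0 ?invr_eq0 ?h.
have cm : cst (- (la * B r1 s1 * det2 B r1 r2 s2 s3) * mu).
  apply: (cst_add_mono (cstM cd3 cd1) (mulf_neq0 d3 d1) (monoM (cst_mono ce en) mmu) mD).
  by rewrite ED.
have cmu : cst mu by rewrite -(mulKf en mu); apply: cstM => //; apply: cstV.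
by rewrite Ex; apply: cstM; [apply: cstM|apply: cstB => //; exact: cst1].
Qed.
End LemmaU.
End Elements.

(** * Rows around a key *)

(** The rows i, j and the columns al, be form a key, and row i has a third non-zero entry, in
    column ga. Rows and columns are scaled so that B is 1 on row i and on column al. The live
    columns are those met by row i or row j. *)
Section Spread.
Variables (C : numClosedFieldType) (d : nat) (K : laurent_field C d).
Variables (I J : finType) (A B : I -> J -> K) (i j : I) (al be ga : J).
Hypothesis S : system A B.
Hypothesis kc : forall i j a b, keyAB A i j a b -> cst (xratio B i j a b).
Hypotheses (Bi : forall e, B i e = 1) (Ba : forall m, B m al = 1).
Hypothesis K0 : keyAB A i j al be.
Hypotheses (gaa : ga != al) (gab : ga != be) (ig : A i ga != 0).

Let h := sB1 S.
Let ij : i != j. Proof. by case: K0. Qed.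
Let ji : j != i. Proof. by rewrite eq_sym. Qed.
Let ab : al != be. Proof. by case: K0. Qed.
Let ba : be != al. Proof. by rewrite eq_sym. Qed.
Let edges : [/\ A i al != 0, A i be != 0, A j al != 0 & A j be != 0]. Proof. by case: K0. Qed.
Let ia : A i al != 0. Proof. by case: edges. Qed.
Let ib : A i be != 0. Proof. by case: edges. Qed.
Let ja : A j al != 0. Proof. by case: edges. Qed.
Let jb : A j be != 0. Proof. by case: edges. Qed.
Let dt : det2 A i j al be != 0. Proof. by case: K0. Qed.
Let one : cst (1 : K) := cst1 K.

Definition live e := (A i e != 0) || (A j e != 0).

Let Gal : live al. Proof. by rewrite /live ia. Qed.
Let Gbe : live be. Proof. by rewrite /live ib. Qed.
Let Gga : live ga. Proof. by rewrite /live ig. Qed.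
Let cBi e : cst (B i e). Proof. by rewrite Bi. Qed.
Let cBa m : cst (B m al). Proof. by rewrite Ba. Qed.

Let rat_ne a m e f : a != m -> e != f -> B a e * B m f / (B a f * B m e) != 1.
Proof.
move=> am ef; have := sB2 S am ef; apply: contraNneq => E.
by rewrite /det2 subr_eq0 -[X in _ == X]mul1r -E divfK // mulf_neq0 ?h.
Qed.

Let mA m e : A m e != 0 -> cst (B m e) -> mono (A m e).
Proof.
move=> ne c; have := mono_div (sA1 S ne) (cst_mono c (h m e)).
by rewrite mulfK ?h.
Qed.

Let mdet2 a m e f : a != m -> e != f -> det2 A a m e f != 0 -> cst (B a e) -> cst (B a f) ->
  cst (B m e) -> cst (B m f) -> mono (det2 A a m e f).
Proof.
move=> am ef ne c1 c2 c3 c4; have db := sB2 S am ef.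
have := mono_div (sA2 S am ef ne) (cst_mono (cstB (cstM c1 c4) (cstM c2 c3)) db).
by rewrite mulfK.
Qed.

Let mdet3 r1 r2 r3 s1 s2 s3 : uniq [:: r1; r2; r3] -> uniq [:: s1; s2; s3] ->
  mono (det3 A r1 r2 r3 s1 s2 s3) -> mono (det3 B r1 r2 r3 s1 s2 s3).
Proof.
move=> U V m; have ne := mono_neq0 m; have := mono_div (sA3 S U V ne) m.
by rewrite mulrAC divff // mul1r.
Qed.

(** If row i or j has a zero in column e, the relations [one_sub_mono] with both columns of the
    key apply; otherwise column e forms a key with one of them. *)
Lemma entries_j e : live e -> cst (B j e).
Proof.
have [->|ea] := eqVneq e al; first by [].
have xj f : xratio B i j al f = B j f by rewrite /xratio !Bi Ba !mul1r divr1.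
have cb : cst (B j be) by rewrite -xj; apply: kc.
have [->|eb] := eqVneq e be; first by [].
have [ae be'] : al != e /\ be != e by rewrite ![_ == e]eq_sym.
have bn : B j be != 1.
  by have := rat_ne ij ba; rewrite !Bi Ba !mul1r invr_eq1.
rewrite /live; have [ie|ie] := eqVneq (A i e) 0; have [je|je] := eqVneq (A j e) 0 => //= _.
- have [m1 M1 E1] := one_sub_mono S ij ae ia je (or_introl ie).
  have [m2 M2 E2] := one_sub_mono S ij be' ib je (or_introl ie).
  rewrite !Bi Ba !mul1r in E1 E2.
  have cm : cst m2.
    by apply: (one_sub_ratio_cst cb bn M2 M1); rewrite {1}E2 mulrAC -E1 mul1r.
  have z := one_sub_neq0 S (i := i) (j := j) (a := be) (b := e) (mu := m2).
  rewrite !Bi !mul1r in z; have {}z := z E2.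
  have -> : B j e = B j be / (1 - m2) by rewrite E2 mulfK.
  by apply: cst_div => //; apply: cstB.
- have [m1 M1 E1] := one_sub_mono S ji ae ja ie (or_introl je).
  have [m2 M2 E2] := one_sub_mono S ji be' jb ie (or_introl je).
  rewrite !Bi !mulr1 Ba mul1r in E1 E2.
  have cm : cst m1 by apply: (one_sub_ratio_cst cb bn M1 M2); rewrite -E1.
  by rewrite E1; apply: cstB.
have [de|de] := eqVneq (det2 A i j al e) 0; last by rewrite -xj; apply: kc.
have de2 : det2 A i j be e != 0.
  apply: contraNneq dt => z; apply/eqP; apply: (mulIf ie); rewrite mul0r.
  transitivity (A i be * det2 A i j al e - A i al * det2 A i j be e); first by rewrite /det2; ring.
  by rewrite de z !mulr0 subrr.
have := kc (And4 ij be' (And4 ib ie jb je) de2).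
rewrite /xratio !Bi !mul1r => c; rewrite -(divfK (h j be) (B j e)); exact: cstM.
Qed.

Let cG a e : (a == i) || (a == j) -> live e -> cst (B a e).
Proof. by case/orP => /eqP -> //; apply: entries_j. Qed.

(** The two columns form a key, or are proportional, or one of the four entries vanishes. *)
Lemma row_info a m e k : a != m -> e != k -> A a k != 0 -> A m e != 0 -> cst (B a e) -> cst (B a k) ->
  [\/ cst (B m k / B m e), exists2 mu, mono mu & B m k / B m e = B a k / B a e * (1 - mu) |
    [/\ A m k != 0, det2 A a m e k = 0 & mono (B m k / B m e)]].
Proof.
move=> am ek ak me ce ck; have ke : k != e by rewrite eq_sym.
have [z|[mk ae]] : (A a e = 0 \/ A m k = 0) \/ (A m k != 0 /\ A a e != 0).
  by have [z|z] := eqVneq (A a e) 0; [left; left|have [z'|z'] := eqVneq (A m k) 0; [left; right|right]].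
  have [mu M E] := one_sub_mono S am ke ak me z; apply: Or32; exists mu => //.
  apply: (mulfI (mulf_neq0 (h a e) (h m e))).
  transitivity (B a e * B m k); first by field; rewrite h.
  by rewrite E; field; rewrite h.
have [de|de] := eqVneq (det2 A a m e k) 0.
  apply: Or33; split=> //.
  have -> : B m k / B m e = ((A m k * B m k) / (A m e * B m e)) * ((A a e * B a e) / (A a k * B a k)) * (B a k / B a e).
    have E : A a e * A m k = A a k * A m e by apply/eqP; rewrite -subr_eq0 -de.
    transitivity ((A a e * A m k) / (A a k * A m e) * (B m k / B m e)).
      by rewrite E divff ?mul1r // mulf_neq0.
    by field; rewrite ak me !h.
  apply: monoM; first by apply: monoM; apply: mono_div; apply: (sA1 S).
  by apply: mono_div; apply: cst_mono; rewrite ?h.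
apply: Or31; have := kc (And4 am ek (And4 ae ak me mk) de) => c.
have -> : B m k / B m e = xratio B a m e k * (B a k / B a e) by rewrite /xratio; field; rewrite !h.
by apply: cstM => //; apply: cst_div.
Qed.

(** The cases of [row_info] for rows i and j contradict each other or give constancy, except if
    the two columns are proportional in both pairs of rows. *)
Lemma rel_full m e k : m != i -> m != j -> live e -> A m e != 0 -> k != e -> A i k != 0 -> A j k != 0 ->
  cst (B m k / B m e) \/ [/\ A m k != 0, det2 A i m e k = 0 & det2 A j m e k = 0].
Proof.
move=> mi mj Ge me ke ik jk; have Gk : live k by rewrite /live ik.
have [im jm] : i != m /\ j != m by rewrite ![_ == m]eq_sym.
have ek : e != k by rewrite eq_sym.
have ce := entries_j Ge; have ck := entries_j Gk.
have cr : cst (B j k / B j e) by apply: cst_div.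
have r0 : B j k / B j e != 0 by rewrite mulf_neq0 ?invr_eq0 ?h.
have r1 : B j k / B j e != 1 by have := rat_ne ij ek; rewrite !Bi !mul1r.
case: (row_info im ek ik me (cBi e) (cBi k)) => [c|[mu M E]|[mk d1 M1]]; first by left.
  rewrite !Bi divr1 mul1r in E.
  case: (row_info jm ek jk me ce ck) => [c|[nu N E']|[mk d2 M2]]; first by left.
    left; rewrite E; apply: cstB => //; apply: (one_sub_ratio_cst cr r1 M N).
    by rewrite -E E'.
  by left; rewrite E; apply: cstB => //; apply: (one_sub_mono_cst M M2).
case: (row_info jm ek jk me ce ck) => [c|[nu N E']|[_ d2 M2]]; first by left.
  left; rewrite E'; apply: cstM => //; apply: cstB => //.
  apply: (one_sub_mono_cst N (mono_div M1 (cst_mono cr r0))).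
  by rewrite E' mulrAC divff // mul1r.
by right.
Qed.

Section Row.
Variable m : I.
Hypotheses (mi : m != i) (mj : m != j).
Let im : i != m. Proof. by rewrite eq_sym. Qed.
Let jm : j != m. Proof. by rewrite eq_sym. Qed.
Let Uijm : uniq [:: i; j; m]. Proof. by rewrite /= !inE negb_or ij im jm. Qed.

Let par e k := [/\ A m k != 0, det2 A i m e k = 0 & det2 A j m e k = 0].

Let par2 e : A m e != 0 -> par e al -> par e be -> False.
Proof.
move=> me [_ a1 a2] [_ b1 b2]; case/eqP: dt; apply: (mulIf (mulf_neq0 me me)); rewrite mul0r.
have e1 : A i al * A m e = A i e * A m al by apply/eqP; rewrite eq_sym -subr_eq0; apply/eqP.
have e2 : A j al * A m e = A j e * A m al by apply/eqP; rewrite eq_sym -subr_eq0; apply/eqP.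
have e3 : A i be * A m e = A i e * A m be by apply/eqP; rewrite eq_sym -subr_eq0; apply/eqP.
have e4 : A j be * A m e = A j e * A m be by apply/eqP; rewrite eq_sym -subr_eq0; apply/eqP.
transitivity ((A i al * A m e) * (A j be * A m e) - (A i be * A m e) * (A j al * A m e)).
  by rewrite /det2; ring.
by rewrite e1 e2 e3 e4; ring.
Qed.

Let par_ab : A m al != 0 -> ~ par al be.
Proof.
move=> ma [_ b1 b2]; case/eqP: dt; apply: (mulIf ma); rewrite mul0r.
transitivity (A j al * det2 A i m al be - A i al * det2 A j m al be); first by rewrite /det2; ring.
by rewrite b1 b2 !mulr0 subrr.
Qed.
Let par_ba : A m be != 0 -> ~ par be al.
Proof.
move=> ma [_ b1 b2]; case/eqP: dt; apply: (mulIf ma); rewrite mul0r.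
transitivity (A i be * det2 A j m be al - A j be * det2 A i m be al); first by rewrite /det2; ring.
by rewrite b1 b2 !mulr0 subrr.
Qed.

Let cdivl e k : cst (B m k / B m e) -> cst (B m e) -> cst (B m k).
Proof. by move=> c ce; rewrite -(divfK (h m e) (B m k)); apply: cstM. Qed.
Let cdivr e k : cst (B m k / B m e) -> cst (B m k) -> cst (B m e).
Proof.
move=> c ck; have -> : B m e = B m k / (B m k / B m e) by field; rewrite !h.
exact: cst_div.
Qed.

Let from_al : A m al != 0 -> cst (B m be).
Proof.
move=> ma; case: (rel_full mi mj Gal ma ba ib jb) => [c|p]; last by case: (par_ab ma p).
exact: cdivl c (cBa m).
Qed.
Let from_be : A m be != 0 -> cst (B m be).
Proof.
move=> ma; case: (rel_full mi mj Gbe ma ab ia ja) => [c|p]; last by case: (par_ba ma p).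
exact: cdivr c (cBa m).
Qed.

(** Rows i, j are independent on the columns al, be, so that column e cannot be proportional to
    both of these in the sense of [rel_full]. *)
Lemma edge_live e : live e -> A m e != 0 -> cst (B m e) /\ cst (B m be).
Proof.
move=> Ge me.
have [E|ea] := eqVneq e al; first by rewrite E in me *; split=> //; apply: from_al.
have [E|eb] := eqVneq e be; first by rewrite E in me *; split; apply: from_be.
have [ae be'] : al != e /\ be != e by rewrite ![_ == e]eq_sym.
case: (rel_full mi mj Ge me ae ia ja) => [c|p].
  have ce := cdivr c (cBa m); split=> //.
  case: (rel_full mi mj Ge me be' ib jb) => [c'|[mb _ _]]; first exact: cdivl c' ce.
  exact: from_be.
case: (rel_full mi mj Ge me be' ib jb) => [c'|p']; last by case: (par2 me p p').
by case: p => ma _ _; have cb := from_al ma; split=> //; apply: cdivr c' cb.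
Qed.

Let other e : exists2 f, f != e & [/\ live f, A i f != 0 & A j f != 0].
Proof.
by have [->|ne] := eqVneq e al; [exists be|exists al; rewrite // eq_sym].
Qed.

(** Two non-zero entries of row m give two relations [one_sub_mono] for the same unknown; a single
    one leads to [one_unknown]. *)
Lemma half_column a a' e k : (a == i) && (a' == j) || (a == j) && (a' == i) -> live e -> A m e != 0 -> A m k = 0 ->
  A a k != 0 -> A a' k = 0 -> cst (B m k).
Proof.
move=> aa Ge me mk ak ak'.
have ra : (a == i) || (a == j) by case/orP: aa => /andP[-> _]; rewrite ?orbT.
have ra' : (a' == i) || (a' == j) by case/orP: aa => /andP[_ ->]; rewrite ?orbT.
have am : a != m by case/orP: ra => /eqP ->.
have am' : a' != m by case/orP: ra' => /eqP ->.
have aa' : a != a' by case/orP: aa => /andP[/eqP -> /eqP ->].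
have Gk : live k by rewrite /live; case/orP: ra => /eqP <-; rewrite ak ?orbT.
have ke : k != e by apply: contraNneq me => <-; rewrite mk.
have [ce cb] := edge_live Ge me.
have [cae cak] := conj (cG ra Ge) (cG ra Gk).
have [mu M E] := one_sub_mono S am ke ak me (or_intror mk).
have [f fe [Gf if' jf]] := other e.
have af : A a f != 0 by case/orP: ra => /eqP ->.
have af' : A a' f != 0 by case/orP: ra' => /eqP ->.
have kf : k != f by apply: contraNneq af' => <-; rewrite ak'.
have cf' : cst (B a f) := cG ra Gf.
have [mf|mf] := eqVneq (A m f) 0; last first.
  have [cmf _] := edge_live Gf mf.
  have [nu N E'] := one_sub_mono S am kf ak mf (or_intror mk).
  have cmu : cst mu.
    apply: (@one_sub_ratio_cst _ _ _ (B a e * B m f / (B a f * B m e)) mu nu) => //.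
    - by apply: cst_div; apply: cstM.
    - by apply: rat_ne => //; rewrite eq_sym.
    - apply: (mulfI (mulf_neq0 (h a k) (h m e))); rewrite -E.
      transitivity (B a e / B a f * (B a f * B m k)); first by field; rewrite h.
      by rewrite E'; field; rewrite !h.
  have -> : B m k = B a k * B m e * (1 - mu) / B a e by rewrite -E; field; rewrite h.
  by apply: cst_div => //; apply: cstM; [apply: cstM|apply: cstB].
have U : uniq [:: a; a'; m] by rewrite /= !inE negb_or aa' am am'.
have V : uniq [:: k; e; f] by rewrite /= !inE negb_or ke kf eq_sym fe.
have cmf : cst (B m f).
  have [->|fa] := eqVneq f al; first by [].
  have [->|fb] := eqVneq f be; first by [].
  case: (rel_full mi mj Ge me fe if' jf) => [c|[]]; first exact: cdivl c ce.
  by rewrite mf eqxx.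
apply: (one_unknown S U V (And3 cak cae cf') (And3 (cG ra' Gk) (cG ra' Ge) (cG ra' Gf)) ce cmf M).
  by rewrite mulrC E.
apply: mdet3 => //.
have -> : det3 A a a' m k e f = - (A a k * A a' f * A m e) by rewrite /det3 /det2 mk mf ak'; ring.
apply: monoN; apply: monoM; last exact: mA.
by apply: monoM; apply: mA => //; exact: cG.
Qed.

Lemma row_live e : live e -> A m e != 0 -> forall k, live k -> cst (B m k).
Proof.
move=> Ge me k Gk; have [mk|mk] := eqVneq (A m k) 0; last by case: (edge_live Gk mk).
have [ce _] := edge_live Ge me.
have ke : k != e by apply: contraNneq me => <-; rewrite mk.
have [ik|ik] := eqVneq (A i k) 0; have [jk|jk] := eqVneq (A j k) 0.
- by move: Gk; rewrite /live ik jk eqxx.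
- by apply: (@half_column j i e k) => //; rewrite !eqxx orbT.
- by apply: (@half_column i j e k) => //; rewrite !eqxx.
case: (rel_full mi mj Ge me ke ik jk) => [c|[]]; first exact: cdivl c ce.
by rewrite mk eqxx.
Qed.

(** The relations [one_sub_mono] of row m with row i, and with row j, on both columns of the key. *)
Lemma column_out e : (forall k, live k -> cst (B m k)) -> ~~ live e -> A m e != 0 -> cst (B m e) /\ cst (B j e).
Proof.
move=> cm; rewrite /live negb_or !negbK => /andP[/eqP ie /eqP je] me.
have ae : al != e by apply: contraNneq ia => ->; rewrite ie.
have be' : be != e by apply: contraNneq ib => ->; rewrite ie.
have [m1 M1 E1] := one_sub_mono S im ae ia me (or_introl ie).
have [m2 M2 E2] := one_sub_mono S im be' ib me (or_introl ie).
have [n1 N1 F1] := one_sub_mono S jm ae ja me (or_introl je).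
have [n2 N2 F2] := one_sub_mono S jm be' jb me (or_introl je).
have cb := cm _ Gbe; have cjb := entries_j Gbe.
rewrite !(Bi, Ba, mul1r, mulr1) in E1 E2 F1 F2.
have c1 : cst m1.
  apply: (@one_sub_ratio_cst _ _ _ (B m be)^-1 m1 m2) => //; first exact: cstV.
    by have := rat_ne im ba; rewrite !Bi Ba !mul1r.
  by apply: (mulfI (h m e)); rewrite -E1 mulrCA -E2 mulVf ?h.
have z1 : 1 - m1 != 0 by apply: contra_eq_neq E1 => ->; rewrite mulr0 oner_neq0.
have ce : cst (B m e).
  have -> : B m e = (1 - m1)^-1 by apply: (mulIf z1); rewrite -E1 mulVf.
  by apply: cstV; apply: cstB.
split=> //.
have c2 : cst n1.
  apply: (@one_sub_ratio_cst _ _ _ (B j be / B m be) n1 n2) => //; first exact: cst_div.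
    by have := rat_ne jm ba; rewrite !Ba mul1r mulr1.
  apply: (mulfI (h m e)); rewrite -F1.
  transitivity (B j e * B m be / B m be); first by rewrite mulfK ?h.
  by rewrite F2; field; rewrite h.
by rewrite F1; apply: cstM => //; apply: cstB.
Qed.

(** A row all of whose non-zero entries lie outside the live columns. *)
Section FarRow.
Variable e : J.
Hypotheses (me : A m e != 0) (far : forall k, live k -> A m k = 0).
Let nG : ~~ live e. Proof. by apply/negP => Ge; move: me; rewrite (far Ge) eqxx. Qed.
Let ie : A i e = 0. Proof. by move: nG; rewrite /live negb_or negbK => /andP[/eqP]. Qed.
Let je : A j e = 0. Proof. by move: nG; rewrite /live negb_or !negbK => /andP[_ /eqP]. Qed.
Let Ge_ne k : live k -> k != e. Proof. by apply: contraTneq => ->; exact: nG. Qed.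

Let D (x y : K) (bx by' : K) := (by' - B j e) * x - (bx - B j e) * y.

Let D_mono f f' x y : live f -> live f' -> f != f' -> det2 A i j f f' != 0 ->
  B m f = B m e * (1 - x) -> B m f' = B m e * (1 - y) -> mono (D x y (B j f) (B j f')).
Proof.
move=> Gf Gf' ff dd Ex Ey.
have V : uniq [:: f; f'; e] by rewrite /= !inE negb_or ff !Ge_ne.
have EA : det3 A i j m f f' e = det2 A i j f f' * A m e.
  by rewrite /det3 /det2 (far Gf) (far Gf') ie je; ring.
have EB : det3 B i j m f f' e = D x y (B j f) (B j f') * B m e.
  by rewrite /det3 /det2 !Bi Ex Ey /D; ring.
have m2 : mono (det2 A i j f f') by apply: mdet2 => //; apply: entries_j.
have ne : det3 A i j m f f' e != 0 by rewrite EA mulf_neq0 // mono_neq0.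
have := mono_div (sA3 S Uijm V ne) (monoM m2 (sA1 S me)).
rewrite EA EB (_ : _ / _ = D x y (B j f) (B j f')) //.
by field; rewrite h me mono_neq0.
Qed.

Let D_neq0 f f' x y : live f -> live f' -> f != f' ->
  B m f = B m e * (1 - x) -> B m f' = B m e * (1 - y) -> D x y (B j f) (B j f') != 0.
Proof.
move=> Gf Gf' ff Ex Ey.
have V : uniq [:: f; f'; e] by rewrite /= !inE negb_or ff !Ge_ne.
have := sB3 S Uijm V; apply: contraNneq => z.
have -> : det3 B i j m f f' e = D x y (B j f) (B j f') * B m e.
  by rewrite /det3 /det2 !Bi Ex Ey /D; ring.
by rewrite z mul0r.
Qed.

Let muf f : live f -> A i f != 0 -> exists2 mu, mono mu & B m f = B m e * (1 - mu).
Proof.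
move=> Gf af; have [mu M E] := one_sub_mono S im (Ge_ne Gf) af me (or_introl ie).
by exists mu => //; move: E; rewrite !Bi !mul1r.
Qed.
Let nuf f : live f -> A j f != 0 -> exists2 nu, mono nu & B j e * B m f = B j f * B m e * (1 - nu).
Proof. by move=> Gf af; apply: (one_sub_mono S jm (Ge_ne Gf) af me (or_introl je)). Qed.

Let far_core f1 f2 : f1 != f2 -> [/\ A i f1 != 0, A i f2 != 0, A j f1 != 0 & A j f2 != 0] ->
  det2 A i j f1 f2 != 0 -> ga != f1 -> ga != f2 -> det2 A i j f1 ga != 0 ->
  [/\ cst (B j e), cst (B m f1 / B m e) & cst (B m f2 / B m e)].
Proof.
move=> f12 [i1 i2 j1 j2] d12 g1 g2 d13.
have [G1 G2] : live f1 /\ live f2 by rewrite /live i1 i2.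
have [m1 M1 E1] := muf G1 i1; have [m2 M2 E2] := muf G2 i2; have [m3 M3 E3] := muf Gga ig.
have [n1 N1 F1] := nuf G1 j1; have [n2 N2 F2] := nuf G2 j2.
have f13 : f1 != ga by rewrite eq_sym.
have f23 : f2 != ga by rewrite eq_sym.
have w0 := h m e.
have F f x n : B m f = B m e * (1 - x) -> B j e * B m f = B j f * B m e * (1 - n) -> B j e * (1 - x) = B j f * (1 - n).
  by move=> Ex En; apply: (mulfI w0); rewrite mulrCA -Ex En; ring.
have x1 f x : B m f = B m e * (1 - x) -> x != 1.
  by move=> Ex; apply: contraNneq (h m f) => x1; rewrite Ex x1 subrr mulr0.
have xx f f' x y : f != f' -> B m f = B m e * (1 - x) -> B m f' = B m e * (1 - y) -> x != y.
  move=> ff Ex Ey; have := sB2 S im ff; rewrite /det2 !Bi !mul1r.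
  by apply: contraNneq => xy; rewrite Ex Ey xy subrr.
have bb f f' : f != f' -> B j f != B j f'.
  move=> ff; have := sB2 S ij ff; rewrite /det2 !Bi !mul1r; apply: contraNneq => ->.
  by rewrite subrr.
have yy f f' x y : f != f' -> B m f = B m e * (1 - x) -> B m f' = B m e * (1 - y) -> B j f * (1 - y) != B j f' * (1 - x).
  move=> ff Ex Ey; have := sB2 S jm ff; apply: contraNneq => xy.
  by rewrite /det2 Ex Ey mulrCA xy; apply/eqP; ring.
have ky f x : live f -> B m f = B m e * (1 - x) -> B j e * (1 - x) != B j f.
  move=> Gf Ex; have := sB2 S jm (Ge_ne Gf); apply: contraNneq => xy.
  by rewrite /det2 Ex mulrCA xy; apply/eqP; ring.
have kb f : live f -> B j e != B j f by move=> /Ge_ne; rewrite eq_sym; apply: bb.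
have U3 : uniq [:: f1; f2; ga] by rewrite /= !inE negb_or f12 f13 f23.
have [//|||||c0 c1 c2 _] := @three_columns _ _ K (B j e) (B j f1) (B j f2) (B j ga) m1 m2 m3 n1 n2
   (And3 (entries_j G1) (entries_j G2) (entries_j Gga)) (And3 M1 M2 M3) (And3 (h _ _) (h _ _) (h _ _))
   (And3 (bb _ _ f12) (bb _ _ f13) (bb _ _ f23)) (And3 (x1 _ _ E1) (x1 _ _ E2) (x1 _ _ E3))
   (And3 (xx _ _ _ _ f12 E1 E2) (xx _ _ _ _ f13 E1 E3) (xx _ _ _ _ f23 E2 E3))
   (And3 (yy _ _ _ _ f12 E1 E2) (yy _ _ _ _ f13 E1 E3) (yy _ _ _ _ f23 E2 E3)) (h j e)
   (And3 (kb _ G1) (kb _ G2) (kb _ Gga)) (And3 (ky _ _ G1 E1) (ky _ _ G2 E2) (ky _ _ Gga E3)) _ N1 N2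
   (F _ _ _ E1 F1) (F _ _ _ E2 F2).
- have := sB3 S Uijm U3; apply: contraNneq => z.
  rewrite /det3 /det2 !Bi E1 E2 E3; apply/eqP.
  transitivity (- (B m e) * (B j f1 * m2 - B j f2 * m1 + B j ga * m1 - B j f1 * m3 + B j f2 * m3 - B j ga * m2)); first by ring.
  by rewrite z mulr0.
- exact: D_mono G1 G2 f12 d12 E1 E2.
- exact: D_mono G1 Gga f13 d13 E1 E3.
- exact: D_neq0 G2 Gga f23 E2 E3.
- have [jg|jg] := eqVneq (A j ga) 0; [right|left].
    apply: D_mono Gga f23 _ E2 E3 => //.
    by rewrite /det2 jg mulr0 sub0r oppr_eq0 mulf_neq0.
  have [n3 N3 F3] := nuf Gga jg; exists n3 => //; exact: F E3 F3.
have q x f : cst x -> B m f = B m e * (1 - x) -> cst (B m f / B m e).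
  by move=> cx ->; rewrite mulrAC divff // mul1r; apply: cstB.
by split=> //; [exact: q c1 E1|exact: q c2 E2].
Qed.

(** The columns al, be, ga and e are in the position of [three_columns]; if column ga is
    proportional to al in the rows i, j, then al and be change roles. *)
Lemma far_base : [/\ cst (B j e), cst (B m e) & cst (B m be)].
Proof.
have inv1 : cst (B m al / B m e) -> cst (B m e) by rewrite Ba div1r => /cstV; rewrite invrK.
have fin : cst (B j e) -> cst (B m al / B m e) -> cst (B m be / B m e) -> [/\ cst (B j e), cst (B m e) & cst (B m be)].
  by move=> c0 c1 c2; have ce := inv1 c1; split=> //; rewrite -(divfK (h m e) (B m be)); apply: cstM.
have [z|z] := eqVneq (det2 A i j al ga) 0; last by have [] := far_core ab edges dt gaa gab z.
have dt' : det2 A i j be al != 0.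
  have -> : det2 A i j be al = - det2 A i j al be by rewrite /det2; ring.
  by rewrite oppr_eq0.
have z' : det2 A i j be ga != 0.
  apply: contraNneq dt => z'; apply/eqP; apply: (mulIf ig); rewrite mul0r.
  transitivity (A i be * det2 A i j al ga - A i al * det2 A i j be ga); first by rewrite /det2; ring.
  by rewrite z z' !mulr0 subrr.
have [c0 c2 c1] := far_core ba (And4 ib ia jb ja) dt' gab gaa z'.
exact: fin.
Qed.

(** A column of the key that is not proportional to k in the rows i, j gives a linear relation
    with one new monomial. *)
Lemma far_row k : live k -> cst (B m k).
Proof.
have [cj ce cb] := far_base.
have [->|ka] := eqVneq k al; first by [].
have [->|kb] := eqVneq k be; first by [].
move=> Gk.
have [f [Gf fi fk dd cf]] : exists f, [/\ live f, A i f != 0, f != k, det2 A i j f k != 0 & cst (B m f)].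
  have [z|z] := eqVneq (det2 A i j al k) 0; last by exists al; split; rewrite // eq_sym.
  exists be; split=> //; first by rewrite eq_sym.
  apply: contraTneq Gk => z'; rewrite /live negb_or !negbK.
  have e1 : A i k * det2 A i j al be = 0.
    transitivity (A i be * det2 A i j al k - A i al * det2 A i j be k); first by rewrite /det2; ring.
    by rewrite z z' !mulr0 subrr.
  have e2 : A j k * det2 A i j al be = 0.
    transitivity (A j be * det2 A i j al k - A j al * det2 A i j be k); first by rewrite /det2; ring.
    by rewrite z z' !mulr0 subrr.
  by move/eqP: e1 e2; rewrite mulf_eq0 (negbTE dt) orbF => -> /eqP; rewrite mulf_eq0 (negbTE dt) orbF.
have [x X Ex] := muf Gf fi.
have w0 := h m e.
have cx : cst x.
  have -> : x = 1 - B m f / B m e by rewrite Ex; field.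
  by apply: cstB => //; apply: cst_div.
have cjk := entries_j Gk; have cjf := entries_j Gf.
have kf : B j f - B j e != 0.
  by have := sB2 S ij (Ge_ne Gf); rewrite /det2 !Bi !mul1r -oppr_eq0 opprB.
have kk : B j k - B j e != 0.
  by have := sB2 S ij (Ge_ne Gk); rewrite /det2 !Bi !mul1r -oppr_eq0 opprB.
have [ik|ik] := eqVneq (A i k) 0.
  have jk : A j k != 0 by move: Gk; rewrite /live ik eqxx.
  have [nu N F] := nuf Gk jk.
  (* only row j meets column k: the relation is rewritten in terms of nu *)
  pose y := 1 - B j k * (1 - nu) / B j e.
  have Ey : B m k = B m e * (1 - y).
    apply: (mulfI (h j e)); rewrite F /y; field; exact: h.
  have M := D_mono Gf Gk fk dd Ex Ey.
  pose c := (B j k - B j e) * ((B j e * x + B j f - B j e) / B j e).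
  pose c' := - ((B j f - B j e) * B j k / B j e).
  have cc : cst c.
    apply: cstM; first exact: cstB.
    by apply: cst_div => //; apply: cstB => //; apply: cstD => //; apply: cstM.
  have cc' : cst c' by apply: cstN; apply: cst_div => //; apply: cstM => //; apply: cstB.
  have c0 : c != 0.
    rewrite mulf_neq0 // mulf_neq0 ?invr_eq0 ?h //.
    have := sB2 S jm (Ge_ne Gf); apply: contraNneq => z; rewrite /det2 Ex; apply/eqP.
    transitivity (B m e * (B j e * x + B j f - B j e)); first by ring.
    by rewrite z mulr0.
  have c0' : c' != 0 by rewrite oppr_eq0 !mulf_neq0 ?invr_eq0 ?h.
  have cm : cst (c' * nu).
    apply: (cst_add_mono cc c0 (monoM (cst_mono cc' c0') N) M).
    by rewrite /D /y /c /c'; field; exact: h.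
  have cn : cst nu by rewrite -(mulKf c0' nu); apply: cstM => //; apply: cstV.
  have -> : B m k = B j k * B m e * (1 - nu) / B j e by rewrite -F; field; exact: h.
  by apply: cst_div => //; apply: cstM; [apply: cstM|apply: cstB].
have [y N Ey] := muf Gk ik.
have M := D_mono Gf Gk fk dd Ex Ey.
have x0 := mono_neq0 X.
have cc : cst ((B j k - B j e) * x) by apply: cstM => //; apply: cstB.
have cc' : cst (- (B j f - B j e)) by apply: cstN; apply: cstB.
have c0' : - (B j f - B j e) != 0 by rewrite oppr_eq0.
have cm : cst (- (B j f - B j e) * y).
  apply: (cst_add_mono cc (mulf_neq0 kk x0) (monoM (cst_mono cc' c0') N) M).
  by rewrite /D; ring.
have cn : cst y by rewrite -(mulKf c0' y); apply: cstM => //; apply: cstV.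
by rewrite Ey; apply: cstM => //; apply: cstB.
Qed.
End FarRow.
End Row.

(** Either row m meets a live column, or all its non-zero entries are far from them. *)
Lemma row_cst m : (forall k, live k -> cst (B m k)) /\ (forall e, A m e != 0 -> cst (B m e) /\ cst (B j e)).
Proof.
have [->|mi] := eqVneq m i.
  by split=> // e ie; split=> //; apply: entries_j; rewrite /live ie.
have [->|mj] := eqVneq m j.
  by split=> [k|e je]; [exact: entries_j|split; apply: entries_j; rewrite /live je orbT].
have [[e [Ge me]]|no] := EM (exists e, live e /\ A m e != 0).
  have cm := row_live mi mj Ge me; split=> // f mf.
  have [Gf|nf] := boolP (live f); last exact: column_out.
  by split; [exact: cm|exact: entries_j].
have far k : live k -> A m k = 0 by move=> Gk; apply/eqP; apply: contraT => mk; case: no; exists k.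
split=> [k Gk|e me]; last by have [] := far_base mi mj me far.
by have [e me] := s_row S m; apply: (far_row mi mj me far).
Qed.

(** Only one entry of B in rows m, m' and columns e, e' is unknown; with a row of the key and a
    suitable live column it is the unknown of [one_unknown]. *)
Lemma spread_unknown m m' e e' : m != m' -> e != e' -> A m e != 0 -> A m' e' != 0 -> m' != i -> m' != j ->
  ~~ live e -> A m' e = 0 -> cst (B m e') -> cst (B m' e).
Proof.
move=> mm ee me me' mi' mj' nG z c.
have [ie je] : A i e = 0 /\ A j e = 0 by move: nG; rewrite /live negb_or !negbK => /andP[/eqP -> /eqP ->].
have mi : m != i by apply: contraNneq me => ->; rewrite ie.
have mj : m != j by apply: contraNneq me => ->; rewrite je.
have Ge f : live f -> f != e by apply: contraTneq => ->.
have [cm cme] := row_cst m; have [cm' cme'] := row_cst m'.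
have [c1 c2] := cme e me; have [c3 c4] := cme' e' me'.
have [a [f [ra fe [Gf dd]]]] : exists a f, [/\ (a == i) || (a == j), f != e' & live f /\ det2 A a m' e' f != 0].
  apply: contrapT => no.
  have nn a f : (a == i) || (a == j) -> live f -> f != e' -> det2 A a m' e' f = 0.
    by move=> ra Gf fe; apply/eqP; apply: contraT => dd; case: no; exists a, f.
  have par f : live f -> A i f * A m' e' = A i e' * A m' f /\ A j f * A m' e' = A j e' * A m' f.
    move=> Gf; have [->|fe] := eqVneq f e'; first by [].
    have h1 := nn i f; have h2 := nn j f; rewrite !eqxx orbT in h1 h2.
    have {}h1 := h1 isT Gf fe; have {}h2 := h2 isT Gf fe.
    by split; apply/eqP; rewrite eq_sym -subr_eq0; apply/eqP.
  have [p1 p2] := par _ Gal; have [p3 p4] := par _ Gbe.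
  case/eqP: dt; apply: (mulIf (mulf_neq0 me' me')); rewrite mul0r.
  transitivity ((A i al * A m' e') * (A j be * A m' e') - (A i be * A m' e') * (A j al * A m' e')).
    by rewrite /det2; ring.
  by rewrite p1 p2 p3 p4; ring.
have am : m != a by case/orP: ra => /eqP ->.
have am' : a != m' by case/orP: ra => /eqP ->; rewrite eq_sym.
have U : uniq [:: m; a; m'] by rewrite /= !inE negb_or am mm am'.
have ef : e' != f by rewrite eq_sym.
have V : uniq [:: e; e'; f] by rewrite /= !inE negb_or ee ef eq_sym Ge.
have cae : cst (B a e) by case/orP: ra => /eqP ->.
have cae' : cst (B a e') by case/orP: ra => /eqP ->.
have [mu M E] := one_sub_mono S mm ee me me' (or_intror z).
apply: (one_unknown S U V (And3 c1 c (cm _ Gf)) (And3 cae cae' (cG ra Gf)) c3 (cm' _ Gf) M).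
  by rewrite mulrC E.
apply: mdet3 => //.
have ae : A a e = 0 by case/orP: ra => /eqP ->.
have -> : det3 A m a m' e e' f = A m e * det2 A a m' e' f by rewrite /det3 /det2 ae z; ring.
apply: monoM; first exact: mA.
by apply: mdet2 => //; [exact: cG|exact: cm'].
Qed.

(** Both entries opposite to the two non-zero ones are unknown: with row i and the columns al, be,
    ga they are the unknowns of [two_unknowns]. *)
Lemma spread_two m m' e e' : m != m' -> e != e' -> A m e != 0 -> A m' e' != 0 ->
  [/\ m != i, m != j, m' != i & m' != j] -> ~~ live e -> ~~ live e' -> A m' e = 0 -> A m e' = 0 ->
  cst (B m' e) /\ cst (B m e').
Proof.
move=> mm ee me me' [mi mj mi' mj'] nG nG' z z'.
have [ie je] : A i e = 0 /\ A j e = 0 by move: nG; rewrite /live negb_or !negbK => /andP[/eqP -> /eqP ->].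
have [ie' je'] : A i e' = 0 /\ A j e' = 0 by move: nG'; rewrite /live negb_or !negbK => /andP[/eqP -> /eqP ->].
have Ge f : live f -> f != e by apply: contraTneq => ->.
have Ge' f : live f -> f != e' by apply: contraTneq => ->.
have [cm cme] := row_cst m; have [cm' cme'] := row_cst m'.
have [c1 c2] := cme e me; have [c3 c4] := cme' e' me'.
have [im im'] : i != m /\ i != m' by rewrite ![i == _]eq_sym.
pose P := B m' e - B m' e'; pose Q := B m e' - B m e; pose M0 := det2 B m m' e e'.
have M0E : M0 = B m e * B m' e' - B m' e * B m e' by rewrite /M0 /det2; ring.
have mM0 : mono M0.
  have E : det2 A m m' e e' = A m e * A m' e' by rewrite /det2 z z'; ring.
  have mE : mono (A m e * A m' e') by apply: monoM; apply: mA.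
  have ne : det2 A m m' e e' != 0 by rewrite E; apply: mono_neq0.
  have := mono_div (sA2 S mm ee ne) mE.
  by rewrite E mulrAC divff ?mul1r // mono_neq0.
have U : uniq [:: i; m; m'] by rewrite /= !inE negb_or im im' mm.
have MM f : live f -> A i f != 0 -> mono (M0 + B m f * P + B m' f * Q).
  move=> Gf fi; have V : uniq [:: f; e; e'] by rewrite /= !inE negb_or ee Ge ?Ge'.
  have -> : M0 + B m f * P + B m' f * Q = det3 B i m m' f e e'.
    by rewrite M0E /P /Q /det3 /det2 !Bi; ring.
  apply: mdet3 => //.
  have -> : det3 A i m m' f e e' = A i f * (A m e * A m' e') by rewrite /det3 /det2 ie ie' z z'; ring.
  by apply: monoM; [apply: mA|apply: monoM; apply: mA].
have [ag bg] : al != ga /\ be != ga by rewrite ![_ == ga]eq_sym.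
have U3 : uniq [:: al; be; ga] by rewrite /= !inE negb_or ab ag bg.
have d2 f f' : f != f' -> B m f * B m' f' - B m f' * B m' f != 0 by move=> ff; apply: (sB2 S mm ff).
have dm f f' : f != f' -> B m f != B m f'.
  by move=> ff; have := sB2 S im ff; rewrite /det2 !Bi !mul1r; apply: contraNneq => ->; rewrite subrr.
have dm' f f' : f != f' -> B m' f != B m' f'.
  by move=> ff; have := sB2 S im' ff; rewrite /det2 !Bi !mul1r; apply: contraNneq => ->; rewrite subrr.
have [||||cP cQ] := @two_unknowns _ _ K (B m al) (B m be) (B m ga) (B m' al) (B m' be) (B m' ga) (B m e) (B m' e') P Q M0
  (And3 (cm _ Gal) (cm _ Gbe) (cm _ Gga)) (And3 (cm' _ Gal) (cm' _ Gbe) (cm' _ Gga)) c1 c3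
  (And3 (h _ _) (h _ _) (h _ _)) (And3 (h _ _) (h _ _) (h _ _)) (And3 (d2 _ _ ab) (d2 _ _ ag) (d2 _ _ bg)) _
  (And3 (dm _ _ ab) (dm _ _ ag) (dm _ _ bg)) (And3 (dm' _ _ ab) (dm' _ _ ag) (dm' _ _ bg)) _ _
  mM0 (MM _ Gal ia) (MM _ Gbe ib) (MM _ Gga ig).
- have := sB3 S U U3; rewrite /det3 /det2 !Bi; apply: contraNneq => z0; apply/eqP; rewrite -[RHS]z0; ring.
- by rewrite /P subr_eq0; apply: dm'.
- by rewrite /Q subr_eq0; apply: dm; rewrite eq_sym.
- by rewrite M0E /P /Q; ring.
split.
  have -> : B m' e = P + B m' e' by rewrite /P; ring.
  exact: cstD.
have -> : B m e' = Q + B m e by rewrite /Q; ring.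
exact: cstD.
Qed.

Lemma spread_normalised m m' e e' : m != m' -> e != e' -> A m e != 0 -> A m' e' != 0 ->
  cst (xratio B m m' e e').
Proof.
move=> mm ee me me'.
have [cm cme] := row_cst m; have [cm' cme'] := row_cst m'.
have [c1 c2] := cme e me; have [c3 c4] := cme' e' me'.
have mm' : m' != m by rewrite eq_sym.
have ee' : e' != e by rewrite eq_sym.
suff [k1 k2] : cst (B m e') /\ cst (B m' e) by apply: cst_div; apply: cstM.
have known n f : (n == i) || (n == j) -> cst (B j f) -> cst (B n f) by case/orP => /eqP ->.
have side n f : cst (B j f) -> cst (B n f) \/ [/\ A n f = 0, ~~ live f, n != i & n != j].
  move=> cj; have [Gf|nf] := boolP (live f); first by left; apply: (row_cst n).1.
  have [nz|nz] := eqVneq (A n f) 0; last by left; case: ((row_cst n).2 f nz).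
  have [ni|ni] := eqVneq n i; first by left; apply: known; rewrite ?ni ?eqxx.
  have [nj|nj] := eqVneq n j; first by left; apply: known; rewrite ?nj ?eqxx ?orbT.
  by right.
have [k1|[z1 g1 i1 j1]] := side m e' c4; have [k2|[z2 g2 i2 j2]] := side m' e c2.
- by split.
- by split=> //; apply: (@spread_unknown m m' e e').
- by split=> //; apply: (@spread_unknown m' m e' e).
- by have [] := @spread_two m m' e e' mm ee me me' (And4 i1 j1 i2 j2) g2 g1 z2 z1.
Qed.
End Spread.

(** * Scaling and non-planar keys *)

Section Scaling.
Variables (C : numClosedFieldType) (d : nat) (K : laurent_field C d).
Variables (I J : finType) (A B : I -> J -> K) (s : I -> K) (t : J -> K).
Hypotheses (S : system A B) (s0 : forall i, s i != 0) (t0 : forall a, t a != 0).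

Definition scaleA i a := A i a * (s i * t a).
Definition scaleB i a := B i a / (s i * t a).

Lemma det2_scaleA i j a b : det2 scaleA i j a b = det2 A i j a b * (s i * s j * t a * t b).
Proof. by rewrite /det2 /scaleA; ring. Qed.
Lemma det2_scaleB i j a b : det2 scaleB i j a b = det2 B i j a b / (s i * s j * t a * t b).
Proof. by rewrite /det2 /scaleB; field; rewrite !s0 !t0. Qed.
Let u2 i j a b : s i * s j * t a * t b != 0.
Proof. by apply: mulf_neq0 => //; apply: mulf_neq0 => //; apply: mulf_neq0. Qed.
Let u3 i j m a b c : s i * s j * s m * t a * t b * t c != 0.
Proof. by do 4![apply: mulf_neq0 => //]; apply: mulf_neq0. Qed.
Let u1 i a : s i * t a != 0. Proof. exact: mulf_neq0. Qed.

(** Inverse scalings of A and B do not change the products of corresponding minors. *)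
Lemma system_scale : system scaleA scaleB.
Proof.
have d3A i j m a b c : det3 scaleA i j m a b c = det3 A i j m a b c * (s i * s j * s m * t a * t b * t c).
  by rewrite /det3 !det2_scaleA /scaleA; ring.
have d3B i j m a b c : det3 scaleB i j m a b c = det3 B i j m a b c / (s i * s j * s m * t a * t b * t c).
  by rewrite /det3 !det2_scaleB /scaleB; field; rewrite !s0 !t0.
have cc (x y z : K) : z != 0 -> x * z * (y / z) = x * y by move=> z0; rewrite mulrACA divff // mulr1.
have ne (x z : K) : z != 0 -> x * z != 0 -> x != 0 by move=> z0; apply: contraNneq => ->; rewrite mul0r.
split.
- by move=> i a; apply: mulf_neq0; rewrite ?invr_eq0 ?(sB1 S).
- by move=> i j a b ij ab; rewrite det2_scaleB; apply: mulf_neq0; rewrite ?invr_eq0 ?(sB2 S).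
- by move=> i j m a b c U V; rewrite d3B; apply: mulf_neq0; rewrite ?invr_eq0 ?(sB3 S).
- by move=> i a h; rewrite /scaleA /scaleB cc //; apply: (sA1 S); apply: ne (u1 i a) h.
- by move=> i j a b ij ab; rewrite det2_scaleA det2_scaleB cc // => h; apply: (sA2 S); rewrite ?(ne _ _ _ h).
- by move=> i j m a b c U V; rewrite d3A d3B cc // => h; apply: (sA3 S); rewrite ?(ne _ _ _ h).
- by move=> i; have [a h] := s_row S i; exists a; apply: mulf_neq0.
- by move=> a; have [i h] := s_col S a; exists i; apply: mulf_neq0.
Qed.

Lemma xratio_scale i j a b : xratio scaleB i j a b = xratio B i j a b.
Proof. by rewrite /xratio /scaleB; field; rewrite !s0 !t0 !(sB1 S). Qed.

Lemma keyAB_scale i j a b : keyAB A i j a b <-> keyAB scaleA i j a b.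
Proof.
have z x y : (scaleA x y != 0) = (A x y != 0).
  by rewrite /scaleA mulf_eq0 negb_or u1 andbT.
have z2 : (det2 scaleA i j a b != 0) = (det2 A i j a b != 0).
  by rewrite det2_scaleA mulf_eq0 negb_or u2 andbT.
by rewrite /keyAB !z z2.
Qed.
End Scaling.

Section Spread.
Variables (C : numClosedFieldType) (d : nat) (K : laurent_field C d).

Definition disjoint_cst (I J : finType) (A B : I -> J -> K) := forall i j a b, i != j -> a != b ->
  A i a != 0 -> A j b != 0 -> cst (xratio B i j a b).

(** A scaling makes B equal to 1 on row i and on column a. *)
Lemma spread_col (I J : finType) (A B : I -> J -> K) i j a b c : system A B -> (5 <= maxn #|I| #|J|)%N ->
  keyAB A i j a b -> c != a -> c != b -> A i c != 0 -> disjoint_cst A B.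
Proof.
move=> S ge5 k ca cb ic m m' e e' mm ee me me'; have h := sB1 S.
pose s m := B m a / B i a; pose t e := B i e.
have s0 x : s x != 0 by rewrite /s; apply: mulf_neq0; rewrite ?invr_eq0.
have t0 x : t x != 0 by exact: h.
have z x y : A x y != 0 -> scaleA A s t x y != 0 by move=> ?; do 2?[apply: mulf_neq0 => //].
rewrite -(xratio_scale S s0 t0).
apply: (@spread_normalised _ _ _ _ _ (scaleA A s t) (scaleB B s t) i j a b c) => //; try exact: z.
- exact: system_scale.
- move=> i' j' a' b' /(keyAB_scale A s0 t0) k'.
  by rewrite (xratio_scale S s0 t0); apply: key_const k'.
- by move=> x; rewrite /scaleB /s /t; field; rewrite !h.
- by move=> x; rewrite /scaleB /s /t; field; rewrite !h.
- exact: (keyAB_scale A s0 t0 i j a b).1.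
Qed.

(** The two rows play the same role, and a third row is a third column of the transposed system. *)
Lemma spread (I J : finType) (A B : I -> J -> K) i j a b : system A B -> (5 <= maxn #|I| #|J|)%N ->
  keyAB A i j a b ->
  (exists c, [/\ c != a, c != b & (A i c != 0) || (A j c != 0)]) \/
  (exists m, [/\ m != i, m != j & (A m a != 0) || (A m b != 0)]) -> disjoint_cst A B.
Proof.
move=> S ge5 k [[c [ca cb /orP[ic|jc]]]|[m [mi mj e]]].
- exact: spread_col k ca cb ic.
- exact: spread_col (keyAB_rows k) ca cb jc.
have kt : keyAB (fun a i => A i a) a b i j.
  case: k => ij ab [h1 h2 h3 h4] dt; split=> //.
  by move: dt; rewrite /det2 (mulrC (A i b)).
have ge5' : (5 <= maxn #|J| #|I|)%N by rewrite maxnC.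
have D : disjoint_cst (fun a i => A i a) (fun a i => B i a).
  case/orP: e => [e|e]; first exact: (spread_col (system_tr S) ge5' kt mi mj e).
  exact: (spread_col (system_tr S) ge5' (keyAB_rows kt) mi mj e).
move=> i' j' a' b' ij ab h h'; have := D a' b' i' j' ab ij h h'.
by rewrite Y_tr.
Qed.

(** The unknowns are affine in the monomials M, N, and u v = const becomes a conic in M, N whose
    leading form is a multiple of (N - c1 M)(N - c3 M). By the grading M and N are constant or lie
    on one of the two asymptotic directions, on which u or v is constant. *)
Lemma conic_cst (u v c1 c3 a b : K) : u != 0 -> v != 0 -> cst (u * v) ->
  [/\ cst c1, cst c3, cst a & cst b] -> [/\ c1 != 0, c3 != 0 & c1 != c3] ->
  mono (u + v + a) -> mono (c3 * u + c1 * v + b) -> cst u /\ cst v.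
Proof.
move=> u0 v0 cuv [h1 h3 ha hb] [n1 n3 n13].
set M := u + v + a; set N := c3 * u + c1 * v + b => mM mN.
have other1 : cst u -> cst u /\ cst v.
  by move=> cu; split=> //; rewrite -(mulKf u0 v) mulrC; apply: cst_div.
have other2 : cst v -> cst u /\ cst v.
  by move=> cv; split=> //; rewrite -(mulfK v0 u); apply: cst_div.
have d13 : c1 - c3 != 0 by rewrite subr_eq0.
pose p := c1 * a - b; pose q := c3 * a - b.
have [cp cq] : cst p /\ cst q by split; apply: cstB => //; apply: cstM.
have U : u = (c1 * M - N - p) / (c1 - c3) by rewrite /M /N /p; field.
have V : v = (N - c3 * M + q) / (c1 - c3) by rewrite /M /N /q; field.
have onU : N = c1 * M -> cst u /\ cst v.
  move=> E; apply: other1; rewrite U E; apply: cst_div; last exact: cstB.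
  by rewrite subrr sub0r; apply: cstN.
have onV : N = c3 * M -> cst u /\ cst v.
  move=> E; apply: other2; rewrite V E; apply: cst_div; last exact: cstB.
  by rewrite subrr add0r.
have [h|[w hw]] : (forall w, wt w M = 0 /\ wt w N = 0) \/ exists w, ~ (wt w M = 0 /\ wt w N = 0).
  have [h|h] := EM (forall w, wt w M = 0 /\ wt w N = 0); [by left|right].
  by apply: contrapT => no; apply: h => w; apply: contrapT => hw; apply: no; exists w.
  have cM : cst M by apply: cst_wt => // w; case: (h w).
  have cN : cst N by apply: cst_wt => // w; case: (h w).
  by apply: other1; rewrite U; apply: cst_div; [apply: cstB => //; apply: cstB => //; apply: cstM|apply: cstB].
have [hM hN] := conj (hom_wt w mM) (hom_wt w mN).
move: hw hM hN; set x := wt w M; set y := wt w N => hw hM hN.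
pose e1 := - (c1 * q + c3 * p); pose e0 := p * q + (c1 - c3) ^+ 2 * (u * v).
pose s := [:: (x + x, c1 * c3 * (M * M)); (x + y, - (c1 + c3) * (M * N)); (y + y, N * N);
  (x, e1 * M); (y, (p + q) * N); (0, e0)].
have ce1 : cst e1 by apply: cstN; apply: cstD; apply: cstM.
have ce0 : cst e0.
  by apply: cstD; apply: cstM => //; apply: cstX; apply: cstB.
have hs : homs w s.
  split; [|split; [|split; [|split; [|split; [|split]]]]] => //=; last exact: cst_hom.
  - by apply: homCl; [exact: cstM|exact: homM].
  - by apply: homCl; [apply: cstN; exact: cstD|exact: homM].
  - exact: homM.
  - exact: homCl.
  - by apply: homCl => //; exact: cstD.
have z0 : foldr (fun p (a : K) => p.2 + a) 0 s = 0.
  rewrite /= /e0 /e1 U V; field; exact: d13.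
have L0 := no_lone (k := 0) hs z0 isT; have L2 := no_lone (k := 2) hs z0 isT.
have [Mn Nn] := conj (mono_neq0 mM) (mono_neq0 mN).
rewrite /= in L0 L2.
have {}L0 := L0 (mulf_neq0 (mulf_neq0 n1 n3) (mulf_neq0 Mn Mn)).
have {}L2 := L2 (mulf_neq0 Nn Nn).
have xy : x = y by move: L0 L2; clear; lia.
have x0 : x != 0.
  by apply/eqP => x0; apply: hw; rewrite -xy x0.
have := gradeL (x + x) hs z0; rewrite /= -xy eqxx.
have -> : (x == x + x) = false by move: x0; clear; lia.
have -> : (0 == x + x) = false by move: x0; clear; lia.
rewrite !addr0 => E.
have : (N - c1 * M) * (N - c3 * M) = 0 by rewrite -[RHS]E; ring.
move/eqP; rewrite mulf_eq0 !subr_eq0 => /orP[/eqP|/eqP]; [exact: onU|exact: onV].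
Qed.
End Spread.

(** * Rows with two non-zero entries *)

Section Fork.
Variables (C : numClosedFieldType) (d : nat) (K : laurent_field C d).

Section Normalised.
Variables (I J : finType) (A B : I -> J -> K) (g : I) (k1 k2 : J).
Hypotheses (S : system A B) (D : disjoint_cst A B).
Hypotheses (Bg : forall e, B g e = 1) (Bk : forall m, B m k1 = 1).
Hypotheses (k12 : k1 != k2) (g1 : A g k1 != 0) (g2 : A g k2 != 0).

Let h := sB1 S.

(** A row i has a non-zero entry, to which the entries of row g are compared. *)
Lemma near_cst i e : (A g e != 0) || (A i e != 0) -> cst (B i e).
Proof.
have [->|gi] := eqVneq i g; first by rewrite Bg => _; exact: cst1.
rewrite eq_sym in gi.
have edge f : A i f != 0 -> cst (B i f).
  move=> fi; have [->|k1f] := eqVneq f k1; first by rewrite Bk; exact: cst1.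
  rewrite eq_sym in k1f; have := D gi k1f g1 fi.
  by rewrite /xratio !Bg Bk !mul1r divr1.
have [de di] := s_row S i; have cd := edge de di.
case/orP => [ge|]; last exact: edge.
have [->|ed] := eqVneq e de; first by [].
have := D gi ed ge di; rewrite /xratio !Bg !mul1r => c.
have -> : B i e = B i de / (B i de / B i e) by field; rewrite !h.
exact: cst_div.
Qed.

(** Let column c miss the rows g and i, let row j meet c and let row i meet column de. Then B_ic
    B_jde is constant, and a non-zero entry of A at g, de or in row j at k1, k2 or de makes B_jde
    constant. Without one, [conic_cst] applies to the minors of order three on k1, de, c and on
    k2, de, c. *)
Lemma fork_normalised i c : cst (B i c).
Proof.
have [near|] := boolP ((A g c != 0) || (A i c != 0)); first exact: near_cst.
rewrite negb_or !negbK => /andP[/eqP gc /eqP ic].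
have [j jc] := s_col S c; have [de di] := s_row S i.
have gj : g != j by apply: contraNneq jc => <-; rewrite gc.
have ij : i != j by apply: contraNneq jc => <-; rewrite ic.
have dc : de != c by apply: contraNneq di => ->; rewrite ic.
have cid : cst (B i de) by apply: near_cst; rewrite di orbT.
have cjc : cst (B j c) by apply: near_cst; rewrite jc orbT.
have cuv : cst (B i c * B j de).
  have -> : B i c * B j de = B i de * B j c / xratio B i j de c by rewrite /xratio; field; rewrite !h.
  by apply: cst_div; [exact: cstM|exact: D].
have fin : cst (B j de) -> cst (B i c).
  by move=> cd; rewrite -(mulfK (h j de) (B i c)); apply: cst_div.
have [near|] := boolP ((A g de != 0) || (A j de != 0)); first by apply: fin; exact: near_cst.
rewrite negb_or !negbK => /andP[/eqP gd /eqP jd].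
have gi : g != i by apply: contraNneq di => <-; rewrite gd.
have [kd1 kd2] : k1 != de /\ k2 != de.
  by split; [apply: contraNneq g1|apply: contraNneq g2] => ->; rewrite gd.
have [kc1 kc2] : k1 != c /\ k2 != c.
  by split; [apply: contraNneq g1|apply: contraNneq g2] => ->; rewrite gc.
have far k : A g k != 0 -> k != de -> A j k != 0 -> cst (B i c).
  move=> gk kd jk; apply: fin.
  have -> : B j de = B i de * B j k / (B i k * xratio B i j de k) by rewrite /xratio; field; rewrite !h.
  have ck x : cst (B x k) by apply: near_cst; rewrite gk.
  by apply: cst_div; apply: cstM => //; apply: D; rewrite // eq_sym.
have [jk1|jk1] := eqVneq (A j k1) 0; last exact: far jk1.
have [jk2|jk2] := eqVneq (A j k2) 0; last exact: far jk2.
have ck x k : A g k != 0 -> cst (B x k) by move=> gk; apply: near_cst; rewrite gk.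
have mA x k : A x k != 0 -> cst (B x k) -> mono (A x k).
  by move=> ne cB; have := mono_div (sA1 S ne) (cst_mono cB (h x k)); rewrite mulfK.
have U : uniq [:: g; i; j] by rewrite /= !inE negb_or gi gj ij.
have M k : A g k != 0 -> k != de -> k != c -> mono (det3 B g i j k de c).
  move=> gk kd kc.
  have V : uniq [:: k; de; c] by rewrite /= !inE negb_or kd kc dc.
  have E : det3 A g i j k de c = A g k * (A i de * A j c) by rewrite /det3 /det2 gd gc ic; ring.
  have m : mono (det3 A g i j k de c).
    by rewrite E; apply: monoM; [apply: mA => //; exact: ck|apply: monoM; exact: mA].
  by have := mono_div (sA3 S U V (mono_neq0 m)) m; rewrite mulrAC divff ?mul1r ?mono_neq0.
have b1 x : g != x -> B x k2 != 1.
  move=> gx; have := sB2 S gx k12; rewrite /det2 !Bg Bk !mul1r.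
  by apply: contraNneq => ->; rewrite subrr.
have b2 : B i k2 != B j k2.
  have := sB2 S ij k12; rewrite /det2 !Bk mul1r mulr1.
  by apply: contraNneq => ->; rewrite subrr.
have [ci2 cj2] := conj (ck i k2 g2) (ck j k2 g2).
pose a1 := B i de * B j c - B i c * B j de - B j c - B i de.
pose a2 := B i de * B j c - B i c * B j de - B i k2 * B j c - B i de * B j k2.
have [ca1 ca2] : cst a1 /\ cst a2.
  split; first by do 3?[apply: cstB => //]; apply: cstM.
  by apply: cstB; [apply: cstB; [apply: cstB => //|]|]; apply: cstM.
have m1 : mono (B i c + B j de + a1).
  have := M k1 g1 kd1 kc1; congr mono; rewrite /det3 /det2 !Bg !Bk /a1; ring.
have m2 : mono (B j k2 * B i c + B i k2 * B j de + a2).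
  have := M k2 g2 kd2 kc2; congr mono; rewrite /det3 /det2 !Bg /a2; ring.
have [] // := @conic_cst _ _ _ (B i c) (B j de) (B i k2) (B j k2) a1 a2 (h i c) (h j de) cuv
  (And4 ci2 cj2 ca1 ca2) (And3 (h i k2) (h j k2) b2) m1 m2.
Qed.
End Normalised.

(** The scaling with B equal to 1 on row g and column k1 reduces the claim to the constancy of all
    entries. *)
Lemma fork_cst (I J : finType) (A B : I -> J -> K) g k1 k2 : system A B -> disjoint_cst A B ->
  k1 != k2 -> A g k1 != 0 -> A g k2 != 0 -> forall i j a b, cst (xratio B i j a b).
Proof.
move=> S D k12 g1 g2 i j a b; have h := sB1 S.
pose s m := B m k1 / B g k1; pose t e := B g e.
have s0 x : s x != 0 by rewrite /s; apply: mulf_neq0; rewrite ?invr_eq0.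
have t0 x : t x != 0 by exact: h.
have z x y : (scaleA A s t x y != 0) = (A x y != 0).
  by rewrite /scaleA mulf_eq0 negb_or mulf_neq0 ?andbT.
rewrite -(xratio_scale S s0 t0).
have cB x y : cst (scaleB B s t x y).
  apply: (@fork_normalised _ _ (scaleA A s t) _ g k1 k2) => //; rewrite ?z //.
  - exact: system_scale.
  - by move=> i' j' a' b' ij ab; rewrite !z (xratio_scale S s0 t0); apply: D.
  - by move=> e; rewrite /scaleB /s /t; field; rewrite !h.
  - by move=> e; rewrite /scaleB /s /t; field; rewrite !h.
by rewrite /xratio; apply: cst_div; apply: cstM.
Qed.
End Fork.

(** * Determinants of exchanges *)

Section Dets.
Variable F : fieldType.

(** Both sides are the determinant of the block matrix [M]. *)
Lemma det_1DmulC k m (U : 'M[F]_(k, m)) (V : 'M_(m, k)) : \det (1%:M + U *m V) = \det (1%:M + V *m U).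
Proof.
pose M := block_mx 1%:M (- U) V 1%:M.
have E1 : M = block_mx 1%:M (- U) 0 1%:M *m block_mx (1%:M + U *m V) 0 V 1%:M.
  by rewrite mulmx_block !mul1mx !mulmx1 !mul0mx !mulNmx !add0r addrK.
have E2 : M = block_mx 1%:M 0 V 1%:M *m block_mx 1%:M (- U) 0 (1%:M + V *m U).
  by rewrite mulmx_block !mul1mx !mulmx1 !mul0mx !mulmxN !addr0 addrCA addNr addr0.
have := congr1 determinant E1; rewrite {}E2 !det_mulmx !det_ublock !det_lblock !det1.
by rewrite !mul1r mulr1 => ->.
Qed.

(** P selects coordinates; replacing the corresponding columns and rows of the identity by V and W
    is a product of two matrices of the form 1 + U V. *)
Lemma det_exchange k m (P V : 'M[F]_(k, m)) (W : 'M_(m, k)) : P^T *m P = 1%:M ->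
  \det (1%:M - P *m P^T + V *m W) = \det (P^T *m V) * \det (W *m P).
Proof.
move=> PP.
have -> : 1%:M - P *m P^T + V *m W = (1%:M + (V - P) *m P^T) *m (1%:M + P *m (W - P^T)).
  rewrite mulmxDl mul1mx (mulmxDr (_ *m P^T)) mulmx1 -mulmxA (mulmxA P^T) PP mul1mx.
  rewrite !mulmxBl !mulmxBr; apply/matrixP => i j; rewrite !mxE; ring.
rewrite det_mulmx (det_1DmulC (V - P)) (det_1DmulC P) mulmxBr mulmxBl PP.
by rewrite !(addrC 1%:M) !subrK.
Qed.

Lemma det_mx22 (M : 'M[F]_2) : \det M = M 0 0 * M 1 1 - M 0 1 * M 1 0.
Proof.
rewrite (expand_det_row _ ord0) !big_ord_recl big_ord0 /cofactor !det_mx11 !mxE /=.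
have e1 : lift ord0 ord0 = 1 :> 'I_2 by apply: val_inj.
have e2 : lift 1 ord0 = 0 :> 'I_2 by apply: val_inj.
rewrite !e1 e2 /bump /= !(expr0, expr1); ring.
Qed.

Variables (I J : Type) (A : I -> J -> F).

Definition submx (i0 : I) (a0 : J) (s : seq I) (t : seq J) : 'M[F]_(size s) :=
  \matrix_(i, j) A (nth i0 s i) (nth a0 t j).

Lemma det_submx1 i a : \det (submx i a [:: i] [:: a]) = A i a.
Proof. by rewrite det_mx11 mxE. Qed.
Lemma det_submx2 i j a b : \det (submx i a [:: i; j] [:: a; b]) = det2 A i j a b.
Proof. by rewrite det_mx22 !mxE. Qed.
Lemma det_submx3 i j m a b c : \det (submx i a [:: i; j; m] [:: a; b; c]) = det3 A i j m a b c.
Proof.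
rewrite (expand_det_row _ ord0) !big_ord_recl big_ord0 /cofactor !det_mx22 !mxE /=.
rewrite /det3 /det2 /bump /=; ring.
Qed.
End Dets.

Section Gram.
Variables (F : fieldType) (k n : nat).
Implicit Types (L : 'M[F]_(k, n)) (Rm : 'M[F]_(n, k)) (I : {set 'I_n}).

(** Its determinant is the product of the maximal minors on I by [hfun_gram], and it depends on I
    as a set, without reference to an enumeration. *)
Definition gram L Rm I : 'M[F]_k := \matrix_(i, j) \sum_(y in I) L i y * Rm y j.

Definition frame I (cI : #|I| = k) (x : 'I_k) : 'I_n := enum_val (cast_ord (esym cI) x).

Lemma frame_inj I (cI : #|I| = k) : injective (frame cI).
Proof. by move=> x y /enum_val_inj /cast_ord_inj. Qed.
Lemma frame_in I (cI : #|I| = k) x : frame cI x \in I.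
Proof. exact: enum_valP. Qed.
Lemma frame_surj I (cI : #|I| = k) y : y \in I -> exists x, frame cI x = y.
Proof.
move=> yI; exists (cast_ord cI (enum_rank_in yI y)).
by rewrite /frame cast_ordK enum_rankK_in.
Qed.
Lemma big_frame (I : {set 'I_n}) (cI : #|I| = k) (G : 'I_n -> F) : \sum_(y in I) G y = \sum_x G (frame cI x).
Proof.
rewrite big_enum_val (reindex (cast_ord (esym cI))) //=.
by apply: onW_bij; exists (cast_ord cI); [exact: cast_ordKV|exact: cast_ordK].
Qed.

Lemma col_minorE L I (cI : #|I| = k) : col_minor L I = \det (colsub (frame cI) L).
Proof. by rewrite /col_minor; case: eqP => // e; rewrite (eq_irrelevance e cI). Qed.
Lemma row_minorE Rm I (cI : #|I| = k) : row_minor Rm I = \det (rowsub (frame cI) Rm).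
Proof. by rewrite /row_minor; case: eqP => // e; rewrite (eq_irrelevance e cI). Qed.

Lemma gram_frame L Rm I (cI : #|I| = k) : gram L Rm I = colsub (frame cI) L *m rowsub (frame cI) Rm.
Proof.
apply/matrixP => i j; rewrite !mxE (big_frame cI).
by apply: eq_bigr => x _; rewrite !mxE.
Qed.

Lemma hfun_gram L Rm I : #|I| = k -> hfun L Rm I = \det (gram L Rm I).
Proof. by move=> cI; rewrite /hfun (col_minorE _ cI) (row_minorE _ cI) -det_mulmx -gram_frame. Qed.

Lemma gramE L Rm I : gram L Rm I = L *m diag_mx (\row_y (y \in I)%:R) *m Rm.
Proof.
apply/matrixP => i j; rewrite !mxE big_mkcond; apply: eq_bigr => y _.
by rewrite mul_mx_diag !mxE; case: (y \in I); rewrite ?mulr1 ?mulr0 ?mul0r.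
Qed.

Lemma gram_mul (X Y : 'M_k) L Rm I : gram (X *m L) (Rm *m Y) I = X *m gram L Rm I *m Y.
Proof. by rewrite !gramE !mulmxA. Qed.
End Gram.

Section Exchange.
Variables (F : fieldType) (k n : nat) (J : {set 'I_n}) (cJ : #|J| = k).
Local Notation e := (frame cJ).

Definition outside := {y : 'I_n | y \notin J}.

Lemma card_outside : #|{: outside}| = (n - k)%N.
Proof.
rewrite card_sig; have := cardC J; rewrite card_ord cJ => E.
rewrite (_ : #|_| = #|[predC J]|); last by apply: eq_card => y; rewrite !inE.
by move: E; lia.
Qed.

Definition exchange m (s : 'I_m -> 'I_k) (t : 'I_m -> outside) : {set 'I_n} :=
  exch J [set e (s i) | i in 'I_m] [set val (t i) | i in 'I_m].

Section Fixed.
Variables (m : nat) (s : 'I_m -> 'I_k) (t : 'I_m -> outside).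
Hypotheses (sinj : injective s) (tinj : injective t).

Let S := [set e (s i) | i in 'I_m].
Let T := [set val (t i) | i in 'I_m].
Let ies : injective (e \o s). Proof. by apply: inj_comp => //; exact: frame_inj. Qed.
Let ivt : injective (val \o t). Proof. by apply: inj_comp => //; exact: val_inj. Qed.
Let SJ : S \subset J. Proof. by apply/subsetP => _ /imsetP[i _ ->]; exact: frame_in. Qed.
Let TJ : [disjoint J :\: S & T].
Proof.
rewrite -setI_eq0; apply/eqP/setP => y; rewrite !inE; apply/andP => -[/andP[_ yJ]] /imsetP[i _ E].
by move: (valP (t i)); rewrite -E yJ.
Qed.

Lemma card_exchange : #|exchange s t| = k.
Proof.
rewrite /exchange /exch -/S -/T cardsU (_ : (J :\: S) :&: T = set0) ?cards0 ?subn0; last first.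
  by apply/eqP; rewrite setI_eq0.
rewrite cardsD (setIidPr SJ) /S /T (card_imset _ ies) (card_imset _ ivt).
by rewrite subnK // -(card_imset _ ies) -/S; exact: subset_leq_card.
Qed.

(** The Gram matrix of J is the identity; an exchange removes the projection P P^T onto the
    removed coordinates and adds the new columns times the new rows. *)
Lemma gram_exchange (a : 'M[F]_(k, n)) (b : 'M_(n, k)) : colsub e a = 1%:M -> rowsub e b = 1%:M ->
  \det (gram a b (exchange s t)) = \det (\matrix_(i, j) a (s i) (val (t j))) * \det (\matrix_(i, j) b (val (t j)) (s i)).
Proof.
move=> ea eb.
have Ea x z : a x (e z) = (x == z)%:R by have := congr1 (fun M : 'M_k => M x z) ea; rewrite !mxE.
have Eb x z : b (e z) x = (z == x)%:R by have := congr1 (fun M : 'M_k => M z x) eb; rewrite !mxE.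
pose P : 'M[F]_(k, m) := \matrix_(x, i) (x == s i)%:R.
have PP : P^T *m P = 1%:M.
  apply/matrixP => i j; rewrite !mxE (bigD1 (s i)) //= big1 ?addr0.
    by rewrite !mxE eqxx mul1r (inj_eq sinj).
  by move=> x /negbTE ne; rewrite !mxE ne mul0r.
have -> : gram a b (exchange s t) = 1%:M - P *m P^T + (\matrix_(x, i) a x (val (t i))) *m (\matrix_(i, x) b (val (t i)) x).
  apply/matrixP => x y; rewrite !mxE.
  pose f z := a x z * b z y.
  have -> : \sum_(z in exchange s t) f z = \sum_(z in J) f z - \sum_(z in S) f z + \sum_(z in T) f z.
    have -> : \sum_(z in J) f z = \sum_(z in S) f z + \sum_(z in J :\: S) f z.
      by rewrite (big_setID S) /= (setIidPr SJ).
    rewrite [X in X - _]addrC addrK -bigU //=.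
    by apply: eq_bigl => z; rewrite !inE.
  rewrite (big_frame cJ) /S /T (big_imset _ (in2W ies)) (big_imset _ (in2W ivt)) /=; congr (_ - _ + _).
  - rewrite (bigD1 x) //= big1 => [|z /negbTE ne]; rewrite /f Ea Eb.
      by rewrite eqxx mul1r addr0.
    by rewrite eq_sym ne mul0r.
  - by apply: eq_bigr => i _; rewrite /f Ea Eb !mxE (eq_sym y).
  - by apply: eq_bigr => i _; rewrite /f !mxE.
rewrite det_exchange //; congr (_ * _).
  congr determinant; apply/matrixP => i j; rewrite !mxE (bigD1 (s i)) //= big1 ?addr0.
    by rewrite !mxE eqxx mul1r.
  by move=> x /negbTE ne; rewrite !mxE ne mul0r.
rewrite -[RHS]det_tr; congr determinant; apply/matrixP => i j; rewrite !mxE (bigD1 (s j)) //= big1 ?addr0.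
  by rewrite !mxE eqxx mulr1.
by move=> x /negbTE ne; rewrite !mxE ne mulr0.
Qed.
End Fixed.
End Exchange.

(** * Coordinates at a basis *)

Section Chart.
Variables (F : fieldType) (k n : nat) (J : {set 'I_n}) (cJ : #|J| = k).
Implicit Types (L : 'M[F]_(k, n)) (Rm : 'M[F]_(n, k)) (I : {set 'I_n}).
Local Notation e := (frame cJ).
Local Notation outside := (outside J).

(** The entries of L and of R outside J in the coordinates given by J. Those of R are transposed,
    so that A and B have the same index types. *)
Definition chartA L (x : 'I_k) (y : outside) : F := (invmx (colsub e L) *m L) x (val y).
Definition chartB Rm (x : 'I_k) (y : outside) : F := (Rm *m invmx (rowsub e Rm)) (val y) x.

Lemma colsub_frame L : col_minor L J != 0 ->
  colsub e (invmx (colsub e L) *m L) = 1%:M /\ L = colsub e L *m (invmx (colsub e L) *m L).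
Proof.
rewrite (col_minorE _ cJ) => u; have U : colsub e L \in unitmx by rewrite unitmxE unitfE.
split; last by rewrite mulKVmx.
by rewrite -(mulVmx U); apply/matrixP => i j; rewrite !mxE; apply: eq_bigr => z _; rewrite !mxE.
Qed.
Lemma rowsub_frame Rm : row_minor Rm J != 0 ->
  rowsub e (Rm *m invmx (rowsub e Rm)) = 1%:M /\ Rm = (Rm *m invmx (rowsub e Rm)) *m rowsub e Rm.
Proof.
rewrite (row_minorE _ cJ) => u; have U : rowsub e Rm \in unitmx by rewrite unitmxE unitfE.
split; last by rewrite mulmxKV.
by rewrite -(mulmxV U); apply/matrixP => i j; rewrite !mxE; apply: eq_bigr => z _; rewrite !mxE.
Qed.

Lemma hfun_exchange L Rm m (s : 'I_m -> 'I_k) (t : 'I_m -> outside) : injective s -> injective t ->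
  col_minor L J != 0 -> row_minor Rm J != 0 ->
  hfun L Rm (exchange cJ s t) = hfun L Rm J * \det (\matrix_(i, j) chartA L (s i) (t j)) *
    \det (\matrix_(i, j) chartB Rm (s i) (t j)).
Proof.
move=> si ti hL hR; have [a1 aL] := colsub_frame hL; have [b1 bR] := rowsub_frame hR.
rewrite (hfun_gram _ _ (card_exchange cJ si ti)) [in LHS]aL [in LHS]bR gram_mul !det_mulmx (gram_exchange si ti a1 b1).
rewrite /hfun (col_minorE _ cJ) (row_minorE _ cJ) /chartA /chartB.
by move: (\det _) (\det _) (\det _) (\det _) => *; ring.
Qed.

Lemma col_minor_tr Rm I : col_minor Rm^T I = row_minor Rm I.
Proof.
rewrite /col_minor /row_minor; case: eqP => // cI.
by rewrite -det_tr; congr determinant; apply/matrixP => i j; rewrite !mxE.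
Qed.

(** With the transpose of R in place of L, [hfun_exchange] computes the square of a minor of R. *)
Lemma chartB_minor Rm m (s : 'I_m -> 'I_k) (t : 'I_m -> outside) : injective s -> injective t ->
  row_minor Rm J != 0 -> row_minor Rm (exchange cJ s t) != 0 -> \det (\matrix_(i, j) chartB Rm (s i) (t j)) != 0.
Proof.
move=> si ti hR hE; have hL : col_minor Rm^T J != 0 by rewrite col_minor_tr.
have := hfun_exchange si ti hL hR; rewrite /hfun !col_minor_tr => E.
have := mulf_neq0 hE hE; rewrite E; apply: contraNneq => ->; by rewrite mulr0.
Qed.

Lemma chart_minor L I (cI : #|I| = k) : col_minor L J != 0 -> col_minor L I != 0 ->
  \det (colsub (frame cI) (invmx (colsub e L) *m L)) != 0.
Proof.
rewrite (col_minorE _ cJ) (col_minorE _ cI) => hJ hI.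
have -> : colsub (frame cI) (invmx (colsub e L) *m L) = invmx (colsub e L) *m colsub (frame cI) L.
  by apply/matrixP => i j; rewrite !mxE; apply: eq_bigr => z _; rewrite !mxE.
by rewrite det_mulmx det_inv mulf_neq0 ?invr_eq0.
Qed.

(** A zero row of A would make all maximal minors avoiding e x vanish. *)
Lemma chart_row L I x : #|I| = k -> col_minor L J != 0 -> col_minor L I != 0 -> e x \notin I ->
  exists y, chartA L x y != 0.
Proof.
move=> cI hJ hI xI; apply: contrapT => no.
have := chart_minor cI hJ hI; rewrite (expand_det_row _ x) big1 ?eqxx // => z _.
rewrite mxE; set y := frame cI z; have yI : y \in I by exact: frame_in.
have [yJ|yJ] := boolP (y \in J).
  have [w Ew] := frame_surj cJ yJ; have [a1 _] := colsub_frame hJ.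
  have := congr1 (fun M : 'M_k => M x w) a1; rewrite !mxE Ew => ->.
  have -> : (x == w) = false by apply/eqP => xw; move: xI; rewrite xw Ew yI.
  by rewrite mul0r.
have [z0|nz] := eqVneq (chartA L x (exist _ y yJ)) 0; last by case: no; exists (exist _ y yJ).
by move: z0; rewrite /chartA /= => ->; rewrite mul0r.
Qed.

(** A zero column of A is a zero column of L. *)
Lemma chart_col L I (y : outside) : #|I| = k -> col_minor L J != 0 -> col_minor L I != 0 -> val y \in I ->
  exists x, chartA L x y != 0.
Proof.
move=> cI hJ hI yI; apply: contrapT => no.
have [w Ew] := frame_surj cI yI.
have := chart_minor cI hJ hI; rewrite (expand_det_col _ w) big1 ?eqxx // => x _.
have [z0|nz] := eqVneq (chartA L x y) 0; last by case: no; exists x.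
by move: z0; rewrite /chartA -Ew !mxE => ->; rewrite mul0r.
Qed.

Lemma nth_set (T U : finType) (f : T -> U) (x0 : T) (s : seq T) m : size s = m ->
  (fun i : 'I_m => f (nth x0 s i)) @: 'I_m = [set z in map f s].
Proof.
move=> <-; apply/setP => z; rewrite inE; apply/imsetP/mapP => [[i _ ->]|[x /(nthP x0)[i si <-] ->]].
  by exists (nth x0 s i) => //; exact: mem_nth.
by exists (Ordinal si).
Qed.

Lemma exchange_nth (x0 : 'I_k) (y0 : outside) s t : size s = size t ->
  exchange cJ (fun i : 'I_(size s) => nth x0 s i) (fun i => nth y0 t i) =
  exch J [set z in map e s] [set z in map val t].
Proof. by move=> st; rewrite /exchange !nth_set. Qed.

Lemma nth_inj (T : eqType) (x0 : T) (s : seq T) m : (m <= size s)%N -> uniq s -> injective (fun i : 'I_m => nth x0 s i).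
Proof.
move=> ms us i j /eqP; rewrite nth_uniq => // [/eqP/val_inj //||]; exact: leq_trans (ltn_ord _) ms.
Qed.

Section Seq.
Variables (x0 : 'I_k) (y0 : outside) (s : seq 'I_k) (t : seq outside).
Hypotheses (st : size s = size t) (us : uniq s) (ut : uniq t).

(** The formula that turns the hypotheses on h into conditions on small minors of A and B. *)
Lemma hfun_exch L Rm : col_minor L J != 0 -> row_minor Rm J != 0 ->
  hfun L Rm (exch J [set z in map e s] [set z in map val t]) =
  hfun L Rm J * (\det (submx (chartA L) x0 y0 s t) * \det (submx (chartB Rm) x0 y0 s t)).
Proof.
move=> hL hR; rewrite -(exchange_nth x0 y0 st) (hfun_exchange _ _ hL hR) ?mulrA //; apply: nth_inj => //.
by rewrite st.
Qed.

Lemma chartB_exch Rm : row_minor Rm J != 0 -> row_minor Rm (exch J [set z in map e s] [set z in map val t]) != 0 ->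
  \det (submx (chartB Rm) x0 y0 s t) != 0.
Proof.
rewrite -(exchange_nth x0 y0 st); apply: chartB_minor; apply: nth_inj => //.
by rewrite st.
Qed.

Lemma card_exch : #|exch J [set z in map e s] [set z in map val t]| = k.
Proof.
rewrite -(exchange_nth x0 y0 st); apply: card_exchange; apply: nth_inj => //.
by rewrite st.
Qed.
End Seq.
End Chart.

(** * Separable sets and factored matrices *)

Section Aligned.
Variables (C : numClosedFieldType) (d : nat) (K : laurent_field C d).
Implicit Types (X : seq K) (x y : K).

(** The counterpart of [separable_set] for a [laurent_field]. *)
Definition aligned X := exists e : 'rV[int]_d, forall x : K, x \in X -> x != 0 ->
  exists c : C, x = cf K c * monom K e.

Lemma cst_aligned X x : mono x -> (forall y, y \in X -> exists2 c, cst c & y = c * x) -> aligned X.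
Proof.
move=> [c0 [e [c0n ->]]] h; exists e => y /h [_ [c ->] ->] _; exists (c * c0).
by rewrite /mn rmorphM mulrA.
Qed.

Lemma aligned_div X x y : aligned X -> x \in X -> y \in X -> x != 0 -> y != 0 -> cst (x / y).
Proof.
move=> [e h] /h hx /h hy x0 y0; have [c ->] := hx x0; have [c' ->] := hy y0.
exists (c / c'); rewrite rmorphM fmorphV /= invfM mulrACA divff ?mulr1 //.
exact: monom_neq0.
Qed.

Section FourMinors.
Variables (I J : finType) (A B : I -> J -> K).
Hypothesis S : system A B.
Let h := sB1 S.
Local Notation Y := (xratio B).

(** The set chi of a basis, up to the square of the value of h there. *)
Definition products i j a b := [:: det2 A i j a b * det2 B i j a b;
  (A i a * B i a) * (A j b * B j b); (A i b * B i b) * (A j a * B j a)].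

(** The identities of [key_pair], for entries that need not form a key. *)
Lemma products_xratio i j a b (z := A i a * A j b / (A i b * A j a)) : A i b != 0 -> A j a != 0 ->
  Y i j a b * z = (A i a * B i a) * (A j b * B j b) / ((A i b * B i b) * (A j a * B j a)) /\
  (1 - Y i j a b) * (1 - z) = det2 A i j a b * det2 B i j a b / ((A i b * B i b) * (A j a * B j a)).
Proof.
move=> ib ja; rewrite /z /xratio /det2; split; field; by rewrite ib ja !h.
Qed.

(** If all entries of A are non-zero, the cross ratio and its counterpart z satisfy [conj_cst];
    otherwise the minor of A is a product of two entries and determines the cross ratio. *)
Lemma aligned_xratio u i j a b : u != 0 -> A i a != 0 -> A j b != 0 ->
  aligned (map ( *%R u) (products i j a b)) -> cst (Y i j a b).
Proof.
move=> u0 ia jb al.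
pose P := (A i a * B i a) * (A j b * B j b); pose Q := (A i b * B i b) * (A j a * B j a).
pose H := det2 A i j a b * det2 B i j a b.
have P0 : P != 0 by apply: mulf_neq0; apply: mulf_neq0.
have div x y : x \in products i j a b -> y \in products i j a b -> y != 0 -> cst (x / y).
  move=> xX yX y0; have [->|x0] := eqVneq x 0; first by rewrite mul0r; exact: cst0.
  have -> : x / y = (u * x) / (u * y) by field; rewrite u0 y0.
  by apply: (aligned_div al); rewrite ?map_f //; exact: mulf_neq0.
have [HX PX QX] : [/\ H \in products i j a b, P \in products i j a b & Q \in products i j a b].
  by rewrite !inE !eqxx !orbT.
have [z|[ib ja]] : A i b * A j a = 0 \/ A i b != 0 /\ A j a != 0.
  have [ib|ib] := eqVneq (A i b) 0; first by left; rewrite ib mul0r.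
  by have [ja|ja] := eqVneq (A j a) 0; [left; rewrite ja mulr0|right].
  have -> : Y i j a b = (1 - H / P)^-1.
    rewrite -[LHS]invrK; congr _^-1; rewrite -Y_inv //.
    by rewrite /xratio /H /P /det2 z subr0; field; rewrite ia jb !h.
  by apply: cstV; apply: cstB; [exact: cst1|exact: div].
have [E1 E2] := products_xratio ib ja.
have Q0 : Q != 0 by apply: mulf_neq0; apply: mulf_neq0.
by apply: (conj_cst (x := Y i j a b) (x' := A i a * A j b / (A i b * A j a))); rewrite ?E1 ?E2; apply: div.
Qed.

(** A non-zero product serves as unit of measure for the others. If both products are non-zero, z
    is a monomial and so is 1 - z unless it vanishes, whence z is constant. *)
Lemma xratio_aligned u i j a b : mono u -> i != j -> a != b -> cst (Y i j a b) ->
  observable (map ( *%R u) (products i j a b)) -> aligned (map ( *%R u) (products i j a b)).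
Proof.
move=> mu ij ab c obs.
pose P := (A i a * B i a) * (A j b * B j b); pose Q := (A i b * B i b) * (A j a * B j a).
pose H := det2 A i j a b * det2 B i j a b.
have fin x : mono x -> (exists2 c, cst c & H = c * x) -> (exists2 c, cst c & P = c * x) ->
    (exists2 c, cst c & Q = c * x) -> aligned (map ( *%R u) (products i j a b)).
  move=> mx h1 h2 h3; apply: (cst_aligned (monoM mu mx)) => _ /mapP[y yX ->].
  suff [c' cc' ->] : exists2 c, cst c & y = c * x by exists c'; rewrite // mulrCA.
  by move: yX; rewrite !inE => /or3P[] /eqP ->.
have c0 : cst (0 : K) := cst0 K; have c1 : cst (1 : K) := cst1 K.
have Y0 := Y_neq0 S i j a b.
have [P0|Pn] := eqVneq (A i a * A j b) 0; have [Q0|Qn] := eqVneq (A i b * A j a) 0.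
- case: obs => y; rewrite /products /det2 P0 Q0 /= !inE.
  have -> : A i a * B i a * (A j b * B j b) = 0 by rewrite mulrACA P0 mul0r.
  have -> : A i b * B i b * (A j a * B j a) = 0 by rewrite mulrACA Q0 mul0r.
  by rewrite subr0 mul0r mulr0 !orbb.
- move: Qn; rewrite mulf_eq0 negb_or => /andP[ib ja].
  apply: (fin Q).
  + by apply: monoM; apply: (sA1 S).
  + exists (1 - Y i j a b); first exact: cstB.
    by rewrite /H /Q /det2 P0 /xratio; field; rewrite !h.
  + by exists 0; rewrite // mul0r /P mulrACA P0 mul0r.
  + by exists 1; rewrite // mul1r.
- move: Pn; rewrite mulf_eq0 negb_or => /andP[ia jb].
  apply: (fin P).
  + by apply: monoM; apply: (sA1 S).
  + exists (1 - (Y i j a b)^-1); first by apply: cstB => //; exact: cstV.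
    by rewrite /H /P /det2 Q0 /xratio; field; rewrite !h.
  + by exists 1; rewrite // mul1r.
  + by exists 0; rewrite // mul0r /Q mulrACA Q0 mul0r.
move: Pn Qn; rewrite !mulf_eq0 !negb_or => /andP[ia jb] /andP[ib ja].
have [mP mQ] : mono P /\ mono Q by split; apply: monoM; apply: (sA1 S).
have [E1 E2] := products_xratio ib ja; rewrite -/P -/Q -/H in E1 E2.
have Qn := mono_neq0 mQ.
have Y1 : 1 - Y i j a b != 0.
  have := sB2 S ij ab; apply: contraNneq => z; rewrite /det2; apply/eqP.
  transitivity (- (1 - Y i j a b) * (B i b * B j a)); last by rewrite z oppr0 mul0r.
  by rewrite /xratio; field; rewrite !h.
set z := _ / _ in E1 E2.
have mz : mono z.
  have -> : z = P / Q / Y i j a b by rewrite -E1 mulrC mulKf.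
  by apply: mono_div; [exact: mono_div|exact: cst_mono].
have cz : cst z.
  have [D0|Dn] := eqVneq (det2 A i j a b) 0.
    suff -> : z = 1 by [].
    apply/eqP; rewrite eq_sym -subr_eq0; apply/eqP; apply: (mulfI Y1).
    by rewrite mulr0 E2 /H D0 !mul0r.
  apply: (one_sub_mono_cst mz (nu := H / Q / (1 - Y i j a b))).
    by apply: mono_div; [apply: mono_div => //; exact: (sA2 S)|apply: cst_mono => //; exact: cstB].
  by rewrite -E2 mulrC mulKf.
apply: (fin Q) => //.
- by exists ((1 - Y i j a b) * (1 - z)); [apply: cstM; apply: cstB|rewrite E2 divfK].
- by exists (Y i j a b * z); [apply: cstM|rewrite E1 divfK].
- by exists 1; rewrite // mul1r.
Qed.
End FourMinors.
End Aligned.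

Section Factored.
Variables (C : numClosedFieldType) (d : nat) (K : laurent_field C d) (k n : nat).

(** The property of R that expresses constant cross ratios without reference to a basis. *)
Definition factored (Rm : 'M[K]_(n, k)) := exists (u : 'rV[K]_n) (M : 'M[C]_(n, k)) (N : 'M[K]_k),
  [/\ forall z, u 0 z != 0, N \in unitmx & Rm = diag_mx u *m map_mx (cf K) M *m N].

(** The coordinates of the constant factor at J are constant, up to the row scalings. *)
Lemma factored_xratio Rm (J : {set 'I_n}) (cJ : #|J| = k) : factored Rm -> row_minor Rm J != 0 ->
  (forall x y, chartB cJ Rm x y != 0) -> forall x x' y y', cst (xratio (chartB cJ Rm) x x' y y').
Proof.
move=> [u [M [N [u0 uN E]]]]; rewrite (row_minorE _ cJ) => hJ B0 x x' y y'.
have uR : rowsub (frame cJ) Rm \in unitmx by rewrite unitmxE unitfE.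
pose M' := rowsub (frame cJ) M; pose v : 'rV[K]_k := \row_x u 0 (frame cJ x).
have ER : rowsub (frame cJ) Rm = diag_mx v *m map_mx (cf K) M' *m N.
  apply/matrixP => i j; rewrite E !mxE; apply: eq_bigr => z _.
  by rewrite !mul_diag_mx !mxE.
have uM : M' \in unitmx.
  rewrite -(map_unitmx (cf K)) unitmxE unitfE; apply: contraNneq hJ => z.
  by rewrite ER !det_mulmx z mulr0 mul0r.
pose w : 'rV[K]_k := \row_x (v 0 x)^-1.
have wv : diag_mx w *m diag_mx v = 1%:M.
  rewrite mul_diag_mx; apply/matrixP => i j; rewrite !mxE.
  by case: eqP => [->|]; rewrite ?mulr0n ?mulr0 // mulr1n mulVf.
have EG : Rm = diag_mx u *m map_mx (cf K) (M *m invmx M') *m diag_mx w *m rowsub (frame cJ) Rm.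
  rewrite ER !mulmxA -(mulmxA _ (diag_mx w)) wv mulmx1 -(mulmxA _ (map_mx _ _) (map_mx _ _)) -map_mxM /=.
  by rewrite mulmxKV.
have G : Rm *m invmx (rowsub (frame cJ) Rm) = diag_mx u *m map_mx (cf K) (M *m invmx M') *m diag_mx w.
  by rewrite {1}EG mulmxK.
have Ex a c : chartB cJ Rm a c = u 0 (val c) * cf K ((M *m invmx M') (val c) a) * w 0 a.
  by rewrite /chartB G mul_mx_diag mxE mul_diag_mx !mxE.
have w0 a : w 0 a != 0 by rewrite !mxE invr_eq0.
have q0 a (c : outside J) : cf K ((M *m invmx M') (val c) a) != 0.
  by have := B0 a c; rewrite Ex; apply: contraNneq => ->; rewrite mulr0 mul0r.
pose q a (c : outside J) := cf K ((M *m invmx M') (val c) a).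
have -> : xratio (chartB cJ Rm) x x' y y' = q x y * q x' y' / (q x y' * q x' y).
  by rewrite /xratio !Ex /q; field; rewrite !q0 !u0 !w0.
by apply: cst_div; apply: cstM; eexists.
Qed.

(** The entry of B at x, y is the product of the entries at x0, y and x, y0 and of a constant
    cross ratio, divided by the entry at x0, y0. *)
Lemma xratio_factored Rm (J : {set 'I_n}) (cJ : #|J| = k) (x0 : 'I_k) (y0 : outside J) : row_minor Rm J != 0 ->
  (forall x y, chartB cJ Rm x y != 0) -> (forall x x' y y', cst (xratio (chartB cJ Rm) x x' y y')) -> factored Rm.
Proof.
move=> hJ B0 c; have [b1 bR] := rowsub_frame cJ hJ.
set b := Rm *m _ in b1 bR.
pose B := chartB cJ Rm; pose D x := B x y0 / B x0 y0.
have D0 x : D x != 0 by apply: mulf_neq0; rewrite ?invr_eq0 B0.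
pose u : 'rV[K]_n := \row_z (if [pick x | frame cJ x == z] is Some x then (D x)^-1 else b z x0).
have ue x : u 0 (frame cJ x) = (D x)^-1.
  by rewrite mxE; case: pickP => [x' /eqP/frame_inj -> //|/(_ x)]; rewrite eqxx.
have uo (y : outside J) : u 0 (val y) = B x0 y.
  by rewrite mxE; case: pickP => // x' /eqP E; move: (valP y); rewrite -E frame_in.
have bc z x : exists m, b z x = u 0 z * cf K m * D x.
  have [zJ|zJ] := boolP (z \in J).
    have [x' <-] := frame_surj cJ zJ; rewrite ue.
    have -> : b (frame cJ x') x = (x' == x)%:R.
      by have := congr1 (fun M : 'M_k => M x' x) b1; rewrite !mxE => <-.
    exists (x' == x)%:R; rewrite rmorph_nat; case: eqP => [->|_]; last by rewrite mulr0 mul0r.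
    by rewrite mulr1 mulVf.
  pose y : outside J := exist _ z zJ; have [m Em] := c x x0 y y0; exists m.
  have -> : b z x = B x y by [].
  rewrite -Em (uo y) /D /xratio -/B; field; by rewrite !B0.
pose M : 'M[C]_(n, k) := \matrix_(z, x) projT1 (cid (bc z x)).
have EM z x : b z x = u 0 z * cf K (M z x) * D x.
  by rewrite [M z x]mxE; exact: (projT2 (cid (bc z x))).
exists u, M, (diag_mx (\row_x D x) *m rowsub (frame cJ) Rm); split.
- move=> z; have [zJ|zJ] := boolP (z \in J).
    by have [x' <-] := frame_surj cJ zJ; rewrite ue invr_eq0.
  by rewrite -[z]/(val (exist _ z zJ : outside J)) uo B0.
- rewrite unitmxE unitfE det_mulmx -(row_minorE _ cJ) mulf_neq0 // det_diag.
  by apply/prodf_neq0 => x _; rewrite mxE.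
rewrite {1}bR mulmxA; congr (_ *m _); apply/matrixP => z x.
rewrite EM mul_mx_diag mul_diag_mx; clearbody M u.
by rewrite !mxE.
Qed.
End Factored.

(** * The bases of a pair of matrices *)

Section Pair.
Variables (C : numClosedFieldType) (d : nat) (K : laurent_field C d) (k n : nat).
Variables (L : 'M[K]_(k, n)) (Rm : 'M[K]_(n, k)).
Local Notation h := (hfun L Rm).

Definition is_basis (J : {set 'I_n}) := #|J| = k /\ col_minor L J != 0.
Definition separable_at (J : {set 'I_n}) := forall i j a b : 'I_n, quad J i j a b ->
  observable (chi h J i j a b) -> aligned (chi h J i j a b).

Hypothesis h_mono : forall J, is_basis J -> mono (h J).
Hypothesis R_gen : forall J : {set 'I_n}, #|J| = k -> row_minor Rm J != 0.
Hypothesis loop : forall a, exists2 J, is_basis J & a \in J.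
Hypothesis coloop : forall a, exists2 J, is_basis J & a \notin J.

Section AtBasis.
Variables (J : {set 'I_n}) (cJ : #|J| = k) (hJ : col_minor L J != 0).
Local Notation e := (frame cJ).
Local Notation A := (chartA cJ L).
Local Notation B := (chartB cJ Rm).
Let bJ : is_basis J. Proof. by []. Qed.
Let hR : row_minor Rm J != 0. Proof. exact: R_gen. Qed.
Let h0 : h J != 0. Proof. exact: mono_neq0 (h_mono bJ). Qed.

Let minorB x0 y0 s t : size s = size t -> uniq s -> uniq t -> \det (submx B x0 y0 s t) != 0.
Proof. by move=> st us ut; apply: chartB_exch => //; apply: R_gen; apply: (card_exch cJ x0 y0). Qed.

Let minorA x0 y0 s t : size s = size t -> uniq s -> uniq t -> \det (submx A x0 y0 s t) != 0 ->
  mono (\det (submx A x0 y0 s t) * \det (submx B x0 y0 s t)).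
Proof.
move=> st us ut dA; have E := hfun_exch cJ x0 y0 st us ut hJ hR.
have n0 : h (exch J [set z in map e s] [set z in map val t]) != 0.
  by rewrite E; apply: mulf_neq0 => //; apply: mulf_neq0 => //; exact: minorB.
have bE : is_basis (exch J [set z in map e s] [set z in map val t]).
  by split; [exact: (card_exch cJ x0 y0)|apply: contraNneq n0 => z; rewrite /hfun z mul0r].
have := mono_div (h_mono bE) (h_mono bJ); rewrite E [h J * _]mulrC mulfK //.
Qed.

Lemma chart_system : system A B.
Proof.
split.
- by move=> x y; rewrite -(det_submx1 B); apply: minorB.
- by move=> x x' y y' xx yy; rewrite -(det_submx2 B); apply: minorB => //=; rewrite inE ?xx ?yy.
- by move=> x x' x2 y y' y2 U V; rewrite -(det_submx3 B); apply: minorB.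
- by move=> x y; rewrite -(det_submx1 A) -(det_submx1 B); apply: minorA.
- by move=> x x' y y' xx yy; rewrite -(det_submx2 A) -(det_submx2 B); apply: minorA => //=; rewrite inE ?xx ?yy.
- by move=> x x' x2 y y' y2 U V; rewrite -(det_submx3 A) -(det_submx3 B); apply: minorA.
- by move=> x; have [I [cI hI] xI] := coloop (e x); apply: chart_row cI hJ hI xI.
- by move=> y; have [I [cI hI] yI] := loop (val y); apply: chart_col cI hJ hI yI.
Qed.

Let set_1 (T : finType) (z : T) : [set w in [:: z]] = [set z].
Proof. by apply/setP => w; rewrite !inE. Qed.
Let set_2 (T : finType) (z z' : T) : [set w in [:: z; z']] = [set z; z'].
Proof. by apply/setP => w; rewrite !inE. Qed.

Lemma h_exch1 x y : h (exch1 J (e x) (val y)) = h J * (A x y * B x y).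
Proof.
have := hfun_exch cJ x y (erefl : size [:: x] = size [:: y]) isT isT hJ hR.
by rewrite /= !set_1 !det_submx1.
Qed.

Lemma h_exch1_eq0 x y : (h (exch1 J (e x) (val y)) == 0) = (A x y == 0).
Proof.
by rewrite h_exch1 (mulf_eq0 (h J)) (mulf_eq0 (A x y)) (negbTE h0) (negbTE (sB1 chart_system x y)) orbF.
Qed.

Lemma h_exch2 x x' y y' : x != x' -> y != y' ->
  h (exch2 J (e x) (e x') (val y) (val y')) = h J * (det2 A x x' y y' * det2 B x x' y y').
Proof.
move=> xx yy; have ux : uniq [:: x; x'] by rewrite /= inE xx.
have uy : uniq [:: y; y'] by rewrite /= inE yy.
have := hfun_exch cJ x y (erefl : size [:: x; x'] = size [:: y; y']) ux uy hJ hR.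
by rewrite /= !set_2 !det_submx2.
Qed.

(** The exchange formula for one and two elements. *)
Lemma chi_products x x' y y' : x != x' -> y != y' ->
  chi h J (e x) (e x') (val y) (val y') = map ( *%R (h J * h J)) (products A B x x' y y').
Proof.
move=> xx yy; rewrite /chi /products h_exch2 // !h_exch1 /=; congr [:: _; _; _]; ring.
Qed.

Lemma in_frame i : i \in J -> exists x, i = e x.
Proof. by move=> iJ; have [x <-] := frame_surj cJ iJ; exists x. Qed.
Lemma in_outside a : a \in ~: J -> exists y : outside J, a = val y.
Proof. by rewrite inE => aJ; exists (exist _ a aJ). Qed.

Lemma quadP i j a b : quad J i j a b -> exists x x' (y y' : outside J),
  [/\ i = e x, j = e x', a = val y & b = val y'] /\ (x != x' /\ y != y').
Proof.
move=> [[/in_frame[x ->] /in_frame[x' ->] xx] [/in_outside[y ->] /in_outside[y' ->] yy]].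
by exists x, x', y, y'; split=> //; split; [apply: contraNneq xx|apply: contraNneq yy] => ->.
Qed.

Lemma quad_frame x x' (y y' : outside J) : x != x' -> y != y' -> quad J (e x) (e x') (val y) (val y').
Proof.
move=> xx yy; split; split; rewrite ?frame_in ?(inj_eq (@frame_inj _ _ _ cJ)) ?(inj_eq val_inj) //.
  by rewrite inE (valP y).
by rewrite inE (valP y').
Qed.

Lemma separable_disjoint : separable_at J -> disjoint_cst A B.
Proof.
move=> sep x x' y y' xx yy xy xy'.
have h2 : h J * h J != 0 by apply: mulf_neq0.
have := sep _ _ _ _ (quad_frame xx yy); rewrite chi_products // => al.
apply: (aligned_xratio chart_system h2 xy xy'); apply: al => E.
have B0 := sB1 chart_system.
have := E (h J * h J * (A x y * B x y * (A x' y' * B x' y'))); rewrite !inE eqxx orbT.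
by rewrite mulf_eq0 (negbTE h2) /= !mulf_eq0 (negbTE xy) (negbTE xy') !(negbTE (B0 _ _)).
Qed.

Lemma xratio_separable : (forall x x' y y', cst (xratio B x x' y y')) -> separable_at J.
Proof.
move=> c i j a b /quadP[x [x' [y [y' [[-> -> -> ->] [xx yy]]]]]]; rewrite chi_products // => obs.
by apply: (xratio_aligned chart_system) => //; apply: monoM; exact: h_mono.
Qed.

Lemma keyP x x' (y y' : outside J) : x != x' -> y != y' -> 0 \notin chi h J (e x) (e x') (val y) (val y') -> keyAB A x x' y y'.
Proof.
move=> xx yy; rewrite chi_products // !inE !negb_or ![0 == _]eq_sym => /and3P[k1 k2 k3].
have ne (u v : K) : u * v != 0 -> u != 0 /\ v != 0 by rewrite mulf_eq0 negb_or => /andP.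
have [[_ /ne[dA _]] [_ /ne[/ne[a1 _] /ne[a2 _]]] [_ /ne[/ne[a3 _] /ne[a4 _]]]] := And3 (ne _ _ k1) (ne _ _ k2) (ne _ _ k3).
by split.
Qed.

(** The entries of the key itself are non-zero, so only a third row or column can make planarity
    fail. *)
Lemma nonplanar x x' y y' : keyAB A x x' y y' -> ~ planar h J (e x) (e x') (val y) (val y') ->
  (exists c, [/\ c != y, c != y' & (A x c != 0) || (A x' c != 0)]) \/
  (exists m, [/\ m != x, m != x' & (A m y != 0) || (A m y' != 0)]).
Proof.
move=> [xx yy [a1 a2 a3 a4] _] np; apply: contrapT => no; apply: np.
have no1 c : c != y -> c != y' -> A x c = 0 /\ A x' c = 0.
  move=> cy cy'; have [z|z] := boolP ((A x c != 0) || (A x' c != 0)); first by case: no; left; exists c.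
  by move: z; rewrite negb_or !negbK => /andP[/eqP -> /eqP ->].
have no2 m : m != x -> m != x' -> A m y = 0 /\ A m y' = 0.
  move=> mx mx'; have [z|z] := boolP ((A m y != 0) || (A m y' != 0)); first by case: no; right; exists m.
  by move: z; rewrite negb_or !negbK => /andP[/eqP -> /eqP ->].
split; apply/setP => w; rewrite !inE.
  have [wJ|] := boolP (w \in J); last by rewrite andbF.
  rewrite andbT; have [m ->] := in_frame wJ; rewrite !(inj_eq (@frame_inj _ _ _ cJ)).
  apply/'forall_implyP/norP => [z|[mx mx'] s].
    have := z (val y); have := z (val y'); rewrite !inE !eqxx orbT !h_exch1_eq0 => /(_ isT) z1 /(_ isT) z2.
    by split; [apply: contraNneq a1|apply: contraNneq a3] => <-.
  by have [z1 z2] := no2 m mx mx'; rewrite !inE => /orP[] /eqP ->; rewrite h_exch1_eq0 ?z1 ?z2.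
have [wJ|] := boolP (w \in J); first by rewrite andbF.
rewrite -in_setC andbT => /in_outside[c ->]; rewrite !(inj_eq val_inj).
apply/'forall_implyP/norP => [z|[cy cy'] s].
  have := z (e x); have := z (e x'); rewrite !inE !eqxx orbT !h_exch1_eq0 => /(_ isT) z1 /(_ isT) z2.
  by split; [apply: contraNneq a1|apply: contraNneq a2] => <-.
by have [z1 z2] := no1 c cy cy'; rewrite !inE => /orP[] /eqP ->; rewrite h_exch1_eq0 ?z1 ?z2.
Qed.

(** Constancy of all cross ratios at one basis is a property of R. *)
Lemma fork_all g k1 k2 : disjoint_cst A B -> k1 != k2 -> A g k1 != 0 -> A g k2 != 0 ->
  factored Rm.
Proof.
move=> D k12 g1 g2; have c := fork_cst chart_system D k12 g1 g2.
exact: (xratio_factored g k1 hR (sB1 chart_system) c).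
Qed.
End AtBasis.

Lemma factored_separable J : factored Rm -> is_basis J -> separable_at J.
Proof.
move=> f [cJ hJ]; apply: (xratio_separable (cJ := cJ) hJ) => x x' y y'.
by apply: factored_xratio f (R_gen cJ) (sB1 (chart_system cJ hJ)) _ _ _ _.
Qed.

Theorem separable_fork I s c1 c2 : is_basis I -> separable_at I ->
  [/\ s \in I, c1 \in ~: I, c2 \in ~: I & c1 != c2] -> h (exch1 I s c1) * h (exch1 I s c2) != 0 ->
  forall J, is_basis J -> separable_at J.
Proof.
move=> [cI hI] sep [sI]; have [x ->] := in_frame cI sI.
move=> /in_outside[y1 ->] /in_outside[y2 ->] y12; rewrite mulf_eq0 negb_or !h_exch1_eq0 // => /andP[g1 g2] J bJ.
have yy : y1 != y2 by apply: contraNneq y12 => ->.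
by apply: factored_separable => //; apply: fork_all (separable_disjoint hI sep) yy g1 g2.
Qed.

Theorem nonplanar_key I i j a b : (5 <= maxn (n - k) k)%N -> is_basis I -> key h I i j a b ->
  ~ planar h I i j a b -> forall J, is_basis J -> separable_at J.
Proof.
move=> ge5 [cI hI] [/(quadP cI)[x [x' [y [y' [[-> -> -> ->] [xx yy]]]]]] k0] np J bJ.
have ke := keyP hI xx yy k0; have S := chart_system cI hI.
have ge5' : (5 <= maxn #|{: 'I_k}| #|{: outside I}|)%N by rewrite card_ord (card_outside cI) maxnC.
have D := spread S ge5' ke (nonplanar hI ke np).
by case: ke => _ _ [g1 g2 _ _] _; apply: factored_separable => //; apply: fork_all D yy g1 g2.
Qed.
End Pair.

(** * Functions of t *)

Section Instance.
Variables (R : realType) (d : nat) (K : function_field R d).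

Definition poly_embedding : {rmorphism {mpoly (complex R)[d]} -> K} :=
  ff_rat K \o @tofrac {mpoly (complex R)[d]}.

Lemma poly_embedding_inj : injective poly_embedding.
Proof.
apply: inj_comp; first exact: fmorph_inj.
by move=> p q /eqP; rewrite tofrac_eq => /eqP.
Qed.

Definition function_laurent : laurent_field (complex R) d := LaurentField poly_embedding_inj.
End Instance.

Theorem theorem27 (R : realType) (d k n : nat) (K : function_field R d)
  (L : 'M[K]_(k, n)) (Rm : 'M[K]_(n, k))
  (g : {set 'I_n} -> complex R) (Psi : {set 'I_n} -> 'rV[int]_d)
  (k_gt0 : (0 < k)%N) (k_le_n : (k <= n)%N)
  (L_def1 : defined_at1 L) (R_def1 : defined_at1 Rm)
  (L_nonbasis : forall I : {set 'I_n}, #|I| = k -> I \notin bases L ->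
     col_minor L I = 0)
  (g_neq0 : forall I : {set 'I_n}, I \in bases L -> g I != 0)
  (h_monom : forall I : {set 'I_n}, I \in bases L ->
     hfun L Rm I = ff_const K (g I) * ff_monom K (Psi I))
  (no_loop : forall a : 'I_n, exists2 I : {set 'I_n}, I \in bases L & a \in I)
  (no_coloop : forall a : 'I_n,
     exists2 I : {set 'I_n}, I \in bases L & a \notin I)
  (R_minor1 : forall I : {set 'I_n}, #|I| = k -> row_minor (at1 Rm) I != 0)
  (R_minor : forall I : {set 'I_n}, #|I| = k -> row_minor Rm I != 0)
  (dim_ge5 : (5 <= maxn (n - k) k)%N) :
  ((exists (I : {set 'I_n}) (s c1 c2 : 'I_n),
      [/\ I \in bases L, separable_basis (hfun L Rm) I &
          [/\ s \in I, c1 \in ~: I, c2 \in ~: I, c1 != c2 &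
              hfun L Rm (exch1 I s c1) * hfun L Rm (exch1 I s c2) != 0]]) ->
   forall J : {set 'I_n}, J \in bases L -> separable_basis (hfun L Rm) J)
  /\
  ((exists (I : {set 'I_n}) (i j a b : 'I_n),
      [/\ I \in bases L, key (hfun L Rm) I i j a b &
          ~ planar (hfun L Rm) I i j a b]) ->
   forall J : {set 'I_n}, J \in bases L -> separable_basis (hfun L Rm) J).
Proof.
pose K' := function_laurent K.
pose L' : 'M[K']_(k, n) := L; pose R' : 'M[K']_(n, k) := Rm.
have h0 I : I \in bases L -> mono (hfun L' R' I).
  by move=> bI; exists (g I), (Psi I); rewrite g_neq0 //; split=> //; exact: h_monom.
have basisP I : is_basis L' I <-> I \in bases L.
  split=> [[cI hI]|bI].
    by apply: contraT => nb; rewrite /L' L_nonbasis ?eqxx in hI.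
  split; first by move: bI; rewrite inE => /andP[/eqP].
  by have := mono_neq0 (h0 I bI); apply: contraNneq => z; rewrite /hfun z mul0r.
have hm I : is_basis L' I -> mono (hfun L' R' I) by move/basisP/h0.
have lp a : exists2 J, is_basis L' J & a \in J.
  by have [J /basisP bJ aJ] := no_loop a; exists J.
have cl a : exists2 J, is_basis L' J & a \notin J.
  by have [J /basisP bJ aJ] := no_coloop a; exists J.
split=> [[I [s [c1 [c2 [bI sep [sI c1I c2I c12 hh]]]]]]|[I [i [j [a [b [bI kI npI]]]]]]] J /basisP bJ.
  exact: (separable_fork hm R_minor lp cl (iffRL (basisP I) bI) sep (And4 sI c1I c2I c12) hh bJ).
exact: (nonplanar_key hm R_minor lp cl dim_ge5 (iffRL (basisP I) bI) kI npI bJ).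
Qed.
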